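(* Let $\varrho(x)=(1+|x|^2)^{-\alpha}$ for some $\alpha\ge0$. Let $\varphi\in\mathbb{L}_2^{loc}(\mathbb{R}^d)$, $h\in\mathbb{L}_2^{loc}(Q_T)\cap C(Q_T)$ with $\varphi(x)\ge h(T,x)$ for all $x\in\mathbb{R}^d$, and let $f:[0,T]\times\mathbb{R}^d\times\mathbb{R}\times\mathbb{R}^d\to\mathbb{R}$ be measurable such that for some $L>0$, $M>0$ and $g\in\mathbb{L}_2^{loc}(Q_T)$: $|f(t,x,y_1,z_1)-f(t,x,y_2,z_2)|\le L(|y_1-y_2|+|z_1-z_2|)$ and $|f(t,x,y,z)|\le g(t,x)+M(|y|+|z|)$ for all arguments. If $(u,\mu)$ is a solution of OP$(\varphi,f,h)$ such that $u\in W^{0,1}_{2,\varrho}(Q_T)\cap C(\breve Q_T)$, then $u$ is a weak solution of OP$(\varphi,f,h)$ in the variational sense. If, in addition, $u\in\mathcal{W}_\varrho$, then $u$ is a strong solution of OP$(\varphi,f,h)$ in the variational sense.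
   Context: Fix $T>0$, $d\ge1$. $Q_T=[0,T]\times\mathbb{R}^d$, $\breve Q_T=(0,T)\times\mathbb{R}^d$. $a:Q_T\to\mathbb{R}^d\otimes\mathbb{R}^d$ is a measurable symmetric matrix-valued function with $\lambda|\xi|^2\le\sum_{i,j}a_{ij}(t,x)\xi_i\xi_j\le\Lambda|\xi|^2$ for all $\xi\in\mathbb{R}^d$, where $0<\lambda\le\Lambda$; $\sigma$ is a measurable matrix-valued function with $\sigma\sigma^*=a$; $A_t=\frac12\sum_{i,j}\partial_{x_i}(a_{ij}\partial_{x_j})$. $\nabla$ is the gradient in $x$; $f_u(t,x)=f(t,x,u(t,x),\sigma\nabla u(t,x))$; $\langle\cdot,\cdot\rangle_2$ is the inner product of $\mathbb{L}_2(\mathbb{R}^d)$ (also used as a pairing when one factor is only locally square integrable and the other has compact support). Spaces. $\mathbb{L}_2^{loc}$ (on $\mathbb{R}^d$ or $Q_T$): functions square integrable on every compact subset. $\mathbb{L}_{2,\varrho}$: functions $u$ with $u\varrho\in\mathbb{L}_2$ (on $\mathbb{R}^d$ or $Q_T$), $\|u\|_{2,\varrho}=\|u\varrho\|_2$, $\langle u,v\rangle_{2,\varrho}=\int_{\mathbb{R}^d}uv\varrho^2dx$. $W^1_{2,\varrho}(\mathbb{R}^d)$: $u\in\mathbb{L}_{2,\varrho}(\mathbb{R}^d)$ with $\partial u/\partial x_i\in\mathbb{L}_{2,\varrho}(\mathbb{R}^d)$; $W^{-1}_{2,\varrho}(\mathbb{R}^d)$: its dual (pivot space $\mathbb{L}_{2,\varrho}(\mathbb{R}^d)$),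 with duality pairing $\langle\cdot,\cdot\rangle$. $W^{0,1}_{2,\varrho}(Q_T)$: $u\in\mathbb{L}_{2,\varrho}(Q_T)$ with $\partial u/\partial x_i\in\mathbb{L}_{2,\varrho}(Q_T)$; $W^{1,1}_{2,\varrho}(Q_T)$: additionally $\partial u/\partial t\in\mathbb{L}_{2,\varrho}(Q_T)$. $W^{0,1}_{2,loc}(Q_T)$: local version. $W^{1,1}_{2,0}(Q_T)$: elements of $W^{1,1}_2(Q_T)$ ($\varrho\equiv1$) with compact support in $Q_T$. $\mathcal{W}_\varrho=\{u\in\mathbb{L}_2([0,T],W^1_{2,\varrho}(\mathbb{R}^d)):\frac{\partial u}{\partial t}\in\mathbb{L}_2([0,T],W^{-1}_{2,\varrho}(\mathbb{R}^d))\}$. $C_0^+(Q_T)$: nonnegative continuous functions with compact support on $Q_T$. Obstacle problem. $(u,\mu)$, with $\mu$ a Radon measure on $Q_T$ and $u:Q_T\to\mathbb{R}$ measurable (defined up to sets of $\mu$-measure zero), is a solution of OP$(\varphi,f,h)$ if: (a) $u\in W^{0,1}_{2,loc}(Q_T)\cap C([0,T],\mathbb{L}_2^{loc}(\mathbb{R}^d))$ and for every $\eta\in W^{1,1}_{2,0}(Q_T)$, $t\in[0,T]$, $$\int_t^T\langle u,\tfrac{\partial\eta}{\partial s}\rangle_2ds+\frac12\int_t^T\langle a\nabla u,\nabla\eta\rangle_2ds=\int_t^T\langle f_u,\eta\rangle_2ds+\int_t^T\!\!\int_{\mathbb{R}^d}\eta\,d\mu+\langle\varphi,\eta(T)\rangle_2-\langle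 u(t),\eta(t)\rangle_2;$$ (b) $u\ge h$ on $Q_T$; (c) $\int_{Q_T}(u-h)\xi\,d\mu=0$ for all $\xi\in C_0^+(Q_T)$; (d) $\mu(\{t\}\times\mathbb{R}^d)=0$ for every $t\in[0,T]$. (In (a), $\eta$ is taken in its version defined up to sets of zero capacity, the capacity of a compact $E\subset\breve Q_T$ being $\inf\{\int_{\breve Q_T}(|\partial_t\eta|^2+|\nabla\eta|^2):\eta\in C_0^\infty(\breve Q_T),\eta\ge\mathbf1_E\}$, extended as an external capacity; (a) forces $\mu|_{\breve Q_T}$ to vanish on sets of zero capacity.) Weak solution in the variational sense: $u\in W^{0,1}_{2,\varrho}(Q_T)$ and for any $v\in W^{1,1}_{2,\varrho}(Q_T)$ with $v\ge h$, $$\int_0^T\langle\tfrac{\partial v}{\partial t}(t),(v-u)(t)\rangle_{2,\varrho}dt+\int_0^T\langle A_tu(t),(v-u)(t)\rangle_{2,\varrho}dt+\int_0^T\langle f_u(t),(v-u)(t)\rangle_{2,\varrho}dt\le\frac12\|\varphi-v(T)\|^2_{2,\varrho},$$ where $\langle A_tu(t),(v-u)(t)\rangle_{2,\varrho}=-\frac12\langle a(t)\nabla u(t),\nabla((v-u)(t)\varrho^2)\rangle_2$. Strong solution in the variational sense: $u\in\mathcal{W}_\varrho$, $u(T)=\varphi$ and for any $v\in W^{0,1}_{2,\varrho}(Q_T)$ with $v\ge h$, $$\int_0^T\langle\tfrac{\partial u}{\partial t}(t),(v-u)(t)\rangle dt+\int_0^T\langle A_tu(t),(v-u)(t)\rangle_{2,\varrho}dt+\int_0^T\langle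 f_u(t),(v-u)(t)\rangle_{2,\varrho}dt\le0.$$ *)

(* Defs.v *)
From HB Require Import structures.
From mathcomp Require Import all_boot all_order all_algebra.
From mathcomp Require Import all_classical all_reals all_analysis.

Set Implicit Arguments.
Unset Strict Implicit.
Unset Printing Implicit Defensive.

Import Order.TTheory GRing.Theory Num.Theory.
Import numFieldNormedType.Exports.

Local Open Scope classical_set_scope.
Local Open Scope ring_scope.

Definition measure_mx_display : measure_display -> measure_display.
Proof. exact. Qed.

Section measurable_matrix.
Context {R : realType} (m n : nat).

(* The sigma-algebra generated by the entries; as R is second countable it is
   the Borel sigma-algebra of the normed topology of 'M[R]_(m, n). *)
Definition mx_sigma : set (set 'M[R]_(m, n)) :=
  <<s \bigcup_(i in [set: 'I_m * 'I_n])
        preimage_set_system setT (fun A : 'M[R]_(m, n) => A i.1 i.2)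
          measurable >>.

Let mx_sigma0 : mx_sigma set0.
Proof. exact: sigma_algebra0. Qed.

Let mx_sigmaC A : mx_sigma A -> mx_sigma (~` A).
Proof. exact: sigma_algebraC. Qed.

Let mx_sigma_bigcup (F : (set _)^nat) :
  (forall i, mx_sigma (F i)) -> mx_sigma (\bigcup_i F i).
Proof. exact: sigma_algebra_bigcup. Qed.

HB.instance Definition _ := @isMeasurable.Build
  (measure_mx_display default_measure_display)
  'M[R]_(m, n) mx_sigma mx_sigma0 mx_sigmaC mx_sigma_bigcup.

Lemma measurable_mx_entry (i : 'I_m) (j : 'I_n) :
  measurable_fun setT (fun A : 'M[R]_(m, n) => A i j).
Proof.
move=> _ Y mY; rewrite setTI; apply: sub_sigma_algebra.
by exists (i, j) => //=; exists Y => //; rewrite setTI.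
Qed.

Lemma measurable_fun_mxP d (T : measurableType d) (D : set T)
    (f : T -> 'M[R]_(m, n)) :
  measurable_fun D f <-> forall i j, measurable_fun D (fun x => f x i j).
Proof.
split=> [mf i j|mf mD].
  have := measurableT_comp (measurable_mx_entry i j) mf; exact.
suff H : mx_sigma `<=` [set A | measurable (D `&` f @^-1` A)] by move=> A /H.
apply: smallest_sub.
  split; first by rewrite /= preimage_set0 setI0.
    move=> A /= mA; rewrite setTD.
    rewrite (_ : _ `&` _ = D `\` (D `&` f @^-1` A)); first exact: measurableD.
    by rewrite setDIr setDv set0U.
  move=> F mF /=; rewrite preimage_bigcup setI_bigcupr.
  exact: bigcupT_measurable.
by move=> A [[i j] _ [Y mY <-]] /=; rewrite setTI; exact: (mf i j).
Qed.

End measurable_matrix.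

Section lebesgue_rV.
Context {R : realType}.

Definition rV_cons d (p : R * 'rV[R]_d) : 'rV[R]_d.+1 :=
  row_mx (p.1%:M : 'rV[R]_1) p.2.

Definition rV_uncons d (x : 'rV[R]_d.+1) : R * 'rV[R]_d :=
  (x 0 0, rsubmx (x : 'rV[R]_(1 + d))).

Lemma rV_consK d : cancel (@rV_cons d) (@rV_uncons d).
Proof.
move=> [a x]; rewrite /rV_cons/rV_uncons; congr pair; last by rewrite row_mxKr.
rewrite (_ : 0 = lshift d (0 : 'I_1)); last exact/val_inj.
by rewrite (row_mxEl (a%:M : 'rV_1)) mxE.
Qed.

Lemma measurable_rV_cons d : measurable_fun setT (@rV_cons d).
Proof.
apply/measurable_fun_mxP => i j; rewrite -(splitK (j : 'I_(1 + d))).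
case: (fintype.split _) => k /=.
  under eq_fun do rewrite (row_mxEl (_.1%:M : 'rV_1)) !ord1 mxE eqxx mulr1n.
  exact: measurable_fst.
under eq_fun do rewrite (row_mxEr (_.1%:M : 'rV_1)).
exact: measurableT_comp (measurable_mx_entry _ _) measurable_snd.
Qed.

Lemma measurable_rV_uncons d : measurable_fun setT (@rV_uncons d).
Proof.
apply: measurable_fun_pair; first exact: measurable_mx_entry.
apply/measurable_fun_mxP => i j; under eq_fun do rewrite mxE.
exact: measurable_mx_entry.
Qed.

(* Lebesgue measure on R, carried by the type R itself, which (unlike the
   alias measurableTypeR R) also bears the topology. *)
Definition leb1 : set R -> \bar R := @lebesgue_measure R.

Let leb1_semi_sigma_additive : semi_sigma_additive leb1.
Proof. exact: (@measure_semi_sigma_additive _ _ _ (@lebesgue_measure R)). Qed.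

HB.instance Definition _ := isMeasure.Build _ R R leb1
  (@measure0 _ _ _ (@lebesgue_measure R))
  (@measure_ge0 _ _ _ (@lebesgue_measure R)) leb1_semi_sigma_additive.

Let leb1_sigma_finite : sigma_finite setT leb1.
Proof. exact: (@sigma_finiteT _ _ _ (@lebesgue_measure R)). Qed.

HB.instance Definition _ :=
  Measure_isSigmaFinite.Build _ _ _ leb1 leb1_sigma_finite.

(* The library declares the sigma-finite instance of a product measure for
   pairs of subprobabilities only. *)
Lemma product_sigma_finite d1 d2 (T1 : measurableType d1)
    (T2 : measurableType d2) (m1 : {sigma_finite_measure set T1 -> \bar R})
    (m2 : {sigma_finite_measure set T2 -> \bar R}) :
  sigma_finite setT (m1 \x m2)%E.
Proof.
have /sigma_finiteP[F [TF ndF Foo]] := sigma_finiteT m1.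
have /sigma_finiteP[G [TG ndG Goo]] := sigma_finiteT m2.
exists (fun n => F n `*` G n).
  rewrite -setXTT TF TG predeqE => -[x y]; split.
    move=> [/= [n _ Fnx] [k _ Gky]]; exists (maxn n k) => //; split.
    - by move: x Fnx; exact/subsetPset/ndF/leq_maxl.
    - by move: y Gky; exact/subsetPset/ndG/leq_maxr.
  by move=> [n _ []/= ? ?]; split; exists n.
move=> k; have [? ?] := Foo k; have [? ?] := Goo k.
split; first exact: measurableX.
by rewrite product_measure1E// lte_mul_pinfty// ge0_fin_numE.
Qed.

Section step.
Context d (m : {sigma_finite_measure set 'rV[R]_d -> \bar R}).

Definition leb_cons : set 'rV[R]_d.+1 -> \bar R :=
  pushforward (leb1 \x m)%E (@rV_cons d).

Let pushm := measure_function_pushforward__canonical__measure_function_Measure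
  (leb1 \x m)%E (@measurable_rV_cons d).

HB.instance Definition _ := isMeasure.Build _ _ _ leb_cons
  (@measure0 _ _ _ pushm) (@measure_ge0 _ _ _ pushm)
  (@measure_semi_sigma_additive _ _ _ pushm).

Let leb_cons_sigma_finite : sigma_finite setT leb_cons.
Proof.
have [F TF Foo] := product_sigma_finite leb1 m.
exists (fun k => @rV_uncons d @^-1` F k).
  by rewrite -preimage_bigcup -TF preimage_setT.
move=> k; have [mF Fk] := Foo k; split.
  by rewrite -[X in measurable X]setTI; exact: measurable_rV_uncons.
rewrite /leb_cons /pushforward -comp_preimage.
by rewrite (_ : _ \o _ = id) //; apply/funext => p /=; rewrite rV_consK.
Qed.

HB.instance Definition _ :=
  Measure_isSigmaFinite.Build _ _ _ leb_cons leb_cons_sigma_finite.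

End step.

Fixpoint leb d : {sigma_finite_measure set 'rV[R]_d -> \bar R} :=
  match d with
  | 0 => \d_(0 : 'rV[R]_0)
  | d'.+1 => leb_cons (leb d')
  end.

Definition lebQ d : set (R * 'rV[R]_d) -> \bar R := (leb1 \x leb d)%E.

HB.instance Definition _ d := Measure.on (@lebQ d).

HB.instance Definition _ d := Measure_isSigmaFinite.Build _ _ _ (@lebQ d)
  (product_sigma_finite leb1 (leb d)).

End lebesgue_rV.


(* R^d is 'rV[R]_d; a matrix A acts on a row vector x by x *m A^T. *)

Definition dot {R : realType} {d} (x y : 'rV[R]_d) : R :=
  \sum_i x 0 i * y 0 i.

(* The norm `|x| of the library is the sup norm. *)
Definition enorm {R : realType} {d} (x : 'rV[R]_d) : R := Num.sqrt (dot x x).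

Definition varrho {R : realType} {d} (alpha : R) (x : 'rV[R]_d) : R :=
  (1 + enorm x ^+ 2) `^ (- alpha).

Definition iter_derive {R : realType} {V : normedModType R}
    (vs : seq V) (f : V -> R) : V -> R :=
  foldr (fun v g => fun x => 'D_v g x) f vs.

Definition smooth {R : realType} {V : normedModType R} (f : V -> R) : Prop :=
  forall vs : seq V, continuous (iter_derive vs f) /\
    forall x v, derivable (iter_derive vs f) x v.

Definition compact_supp {R : realType} {V : normedModType R} (D : set V)
    (f : V -> R) : Prop :=
  exists K : set V, [/\ compact K, K `<=` D & forall x, ~ K x -> f x = 0].

Definition test_fun {R : realType} {V : normedModType R} (D : set V)
    (f : V -> R) : Prop := smooth f /\ compact_supp D f.

Definition L2 {R : realType} {dT} {X : measurableType dT}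
    (m : {measure set X -> \bar R}) (D : set X) (f : X -> R) : Prop :=
  measurable_fun D f /\ (\int[m]_(x in D) ((f x) ^+ 2)%:E < +oo)%E.

Section space.
Context {R : realType} {d : nat}.
Implicit Types (r w : 'rV[R]_d -> R).

Definition L2loc_Rd w : Prop :=
  forall K, compact K -> L2 (leb d) K w.

Definition is_wderivx (v : 'rV[R]_d) w w' : Prop :=
  [/\ measurable_fun setT w',
      forall K, compact K -> (leb d).-integrable K (EFin \o w') &
      forall psi, test_fun setT psi ->
        \int[leb d]_x (w x * 'D_v psi x) = - \int[leb d]_x (w' x * psi x)].

Definition has_wderivx v w : Prop := exists w', is_wderivx v w w'.

(* A chosen representative, unique almost everywhere; zero if there is none. *)
Definition wderivx v w : 'rV[R]_d -> R := xget (cst 0) [set w' | is_wderivx v w w'].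

Definition L2rho r w : Prop := L2 (leb d) setT (fun x => w x * r x).

Definition sqnorm r w : \bar R := (\int[leb d]_x ((w x * r x) ^+ 2)%:E)%E.

Definition W1 r w : Prop := L2rho r w /\
  forall i, has_wderivx (delta_mx 0 i) w /\ L2rho r (wderivx (delta_mx 0 i) w).

Definition W1sqnorm r w : \bar R :=
  (sqnorm r w + \sum_(i < d) sqnorm r (wderivx (delta_mx 0 i)%R w))%E.

(* A functional is applied to representatives; boundedness for the W1 norm makes
   its values on W1 independent of the representative. Its values off W1 are
   irrelevant. *)
Definition dual_norm r (l : ('rV[R]_d -> R) -> R) : \bar R :=
  ereal_sup [set (`|l w|)%:E | w in [set w | W1 r w /\ (W1sqnorm r w <= 1)%E]].

Definition W1dual r (l : ('rV[R]_d -> R) -> R) : Prop :=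
  (forall (c : R) w1 w2, W1 r w1 -> W1 r w2 ->
     l (fun x => c * w1 x + w2 x) = c * l w1 + l w2) /\
  (dual_norm r l < +oo)%E.

End space.

Section spacetime.
Context {R : realType} {d : nat}.
Local Notation E := (R * 'rV[R]_d)%type.
Implicit Types (T : R) (r : 'rV[R]_d -> R) (u : E -> R).

(* Functions on [0, T] x R^d are total functions on E; their values elsewhere are
   irrelevant. Space-time integrals are with respect to dt dx. *)

Definition strip (t T : R) : set E := `[t, T]%classic `*` setT.

Definition QT T : set E := strip 0 T.

Definition oQT T : set E := `]0, T[%classic `*` setT.

Definition dirt : E := (1, 0).
Definition dirx (i : 'I_d) : E := (0, delta_mx 0 i).

Definition L2loc_QT T u : Prop :=
  forall K, compact K -> K `<=` QT T -> L2 (@lebQ R d) K u.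

Definition L2rho_QT T r u : Prop := L2 (@lebQ R d) (QT T) (fun z => u z * r z.2).

(* Weak derivatives are taken in the sense of distributions on oQT T. *)
Definition is_wderiv T (v : E) u u' : Prop :=
  [/\ measurable_fun (QT T) u',
      forall K, compact K -> K `<=` oQT T ->
        (@lebQ R d).-integrable K (EFin \o u') &
      forall psi, test_fun (oQT T) psi ->
        \int[@lebQ R d]_(z in oQT T) (u z * 'D_v psi z) =
        - \int[@lebQ R d]_(z in oQT T) (u' z * psi z)].

Definition has_wderiv T v u : Prop := exists u', is_wderiv T v u u'.

Definition wderiv T v u : E -> R := xget (cst 0) [set u' | is_wderiv T v u u'].

Definition dt T u : E -> R := wderiv T dirt u.

Definition grad T u (z : E) : 'rV[R]_d := \row_i wderiv T (dirx i) u z.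

Definition W01 T r u : Prop := L2rho_QT T r u /\
  forall i, has_wderiv T (dirx i) u /\ L2rho_QT T r (wderiv T (dirx i) u).

Definition W11 T r u : Prop :=
  [/\ W01 T r u, has_wderiv T dirt u & L2rho_QT T r (dt T u)].

Definition W01loc T u : Prop := L2loc_QT T u /\
  forall i, has_wderiv T (dirx i) u /\ L2loc_QT T (wderiv T (dirx i) u).

Definition W11_0 T u : Prop := W11 T (cst 1) u /\
  exists K : set E, [/\ compact K, K `<=` QT T &
    {ae @lebQ R d, forall z, QT T z -> ~ K z -> u z = 0}].

(* ub is a representative of u by a family of slices, u being a class of
   functions: ub t is the value u(t) once ub is continuous in t. *)
Definition slice_version T u (ub : R -> 'rV[R]_d -> R) : Prop :=
  {ae @leb1 R, forall t, t \in `[0, T] ->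
    {ae leb d, forall x, u (t, x) = ub t x}}.

Definition L2continuous T (S : set 'rV[R]_d) r (ub : R -> 'rV[R]_d -> R) :
    Prop :=
  forall t, t \in `[0, T] -> L2 (leb d) S (fun x => ub t x * r x) /\
    (\int[leb d]_(x in S) (((ub s x - ub t x) * r x) ^+ 2)%:E)%E
      @[s --> within `[0, T]%classic (nbhs t)] --> 0%E.

(* ub is the version of u in C([0, T], L_{2, r}) *)
Definition C_version T r u ub : Prop :=
  slice_version T u ub /\ L2continuous T setT r ub.

(* ub is the version of u in C([0, T], L_2^loc) *)
Definition Cloc_version T u ub : Prop :=
  slice_version T u ub /\ forall K, compact K -> L2continuous T K (cst 1) ub.

Definition energy T (eta : E -> R) : \bar R :=
  (\int[@lebQ R d]_(z in oQT T)
     (('D_dirt eta z) ^+ 2 + \sum_i ('D_(dirx i) eta z) ^+ 2)%:E)%E.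

Definition cap_compact T (K : set E) : \bar R :=
  ereal_inf [set energy T eta | eta in
    [set eta | test_fun (oQT T) eta /\ forall z, \1_K z <= eta z]].

Definition cap_open T (G : set E) : \bar R :=
  ereal_sup [set cap_compact T K | K in [set K | compact K /\ K `<=` G]].

(* The external capacity, for A included in oQT T. *)
Definition capacity T (A : set E) : \bar R :=
  ereal_inf [set cap_open T G | G in
    [set G | [/\ open G, A `<=` G & G `<=` oQT T]]].

Definition quasi_continuous T (eta : E -> R) : Prop :=
  forall eps : R, 0 < eps -> exists G : set E,
    [/\ open G, G `<=` oQT T, (capacity T G < eps%:E)%E &
        {within oQT T `\` G, continuous eta}].

(* etaq is the version of eta defined up to sets of zero capacity. *)
Definition qc_version T (eta etaq : E -> R) : Prop :=
  [/\ measurable_fun (QT T) etaq, quasi_continuous T etaq &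
      {ae @lebQ R d, forall z, QT T z -> eta z = etaq z}].

Definition C0_plus T (xi : E -> R) : Prop :=
  [/\ {within QT T, continuous xi}, forall z, QT T z -> 0 <= xi z &
      exists K : set E, [/\ compact K, K `<=` QT T &
        forall z, QT T z -> ~ K z -> xi z = 0]].

Definition radon T (mu : {measure set E -> \bar R}) : Prop :=
  forall K, compact K -> K `<=` QT T -> (mu K < +oo)%E.

End spacetime.

Section obstacle.
Context {R : realType} {d : nat}.
Local Notation E := (R * 'rV[R]_d)%type.
Variables (T : R) (a sigma : E -> 'M[R]_d).
Variables (phi : 'rV[R]_d -> R) (f : E -> R -> 'rV[R]_d -> R) (h : E -> R).

Definition fu (u : E -> R) (z : E) : R :=
  f z (u z) (grad T u z *m (sigma z)^T).

(* Only the restriction of mu to QT T matters. The quasi-continuous version etaq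
   of eta is universally quantified: this is where mu is forced to charge no set
   of zero capacity in the open strip. *)
Record OP_solution (u : E -> R) (mu : {measure set E -> \bar R}) : Prop := {
  OP_radon : radon T mu ;
  OP_measurable : measurable_fun (QT T) u ;
  OP_W01loc : W01loc T u ;
  OP_equation : exists ub, Cloc_version T u ub /\
    forall eta etab etaq t, W11_0 T eta ->
      C_version T (cst 1) eta etab -> qc_version T eta etaq ->
      t \in `[0, T] ->
      mu.-integrable (QT T) (EFin \o etaq) /\
      \int[@lebQ R d]_(z in strip t T) (u z * dt T eta z)
      + 2^-1 * \int[@lebQ R d]_(z in strip t T)
                 dot (grad T u z *m (a z)^T) (grad T eta z)
      = \int[@lebQ R d]_(z in strip t T) (fu u z * eta z)
        + \int[mu]_(z in strip t T) etaq z
        + \int[leb d]_x (phi x * etab T x)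
        - \int[leb d]_x (ub t x * etab t x) ;
  OP_obstacle : forall z, QT T z -> h z <= u z ;
  OP_minimality : forall xi, C0_plus T xi ->
    (\int[mu]_(z in QT T) ((u z - h z) * xi z)%:E = 0)%E ;
  OP_slices : forall t, t \in `[0, T] -> mu ([set t] `*` setT) = 0%E }.

Variable r : 'rV[R]_d -> R.

(* the integral over [0, T] of <A_t u(t), w(t)>_{2, r} *)
Definition A_pairing (u w : E -> R) : R :=
  - 2^-1 * \int[@lebQ R d]_(z in QT T)
     dot (grad T u z *m (a z)^T) (grad T (fun z => w z * r z.2 ^+ 2) z).

(* The integral over [0, T] of <f_u(t), w(t)>_{2, r}. As f_u w r^2 need not be
   integrable, it is an extended real; when neither the positive nor the negative
   part is integrable it has no meaning, and is -oo by convention. *)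
Definition f_pairing (u w : E -> R) : \bar R :=
  (\int[@lebQ R d]_(z in QT T) (fu u z * w z * r z.2 ^+ 2)%:E)%E.

Definition above_obstacle (v : E -> R) : Prop :=
  {ae @lebQ R d, forall z, QT T z -> h z <= v z}.

Definition weak_variational (u : E -> R) : Prop :=
  W01 T r u /\
  forall v vb, W11 T r v -> above_obstacle v -> C_version T r v vb ->
    ((\int[@lebQ R d]_(z in QT T) (dt T v z * (v z - u z) * r z.2 ^+ 2))%:E
     + (A_pairing u (v \- u)%R)%:E + f_pairing u (v \- u)%R
     <= (2^-1)%:E * sqnorm r (phi \- vb T)%R)%E.

(* u in L_2([0, T], W^1_{2, r}) *)
Definition L2_W1 (u : E -> R) : Prop :=
  [/\ measurable_fun (QT T) u,
      {ae @leb1 R, forall t, t \in `[0, T] -> W1 r (fun x => u (t, x))} &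
      (\int[@leb1 R]_(t in `[0%R, T]%classic)
         W1sqnorm r (fun x => u (t, x)) < +oo)%E].

(* Lam in L_2([0, T], W^{-1}_{2, r}) is the distributional derivative of u in
   time, with pivot space L_{2, r}. *)
Definition dual_dt (u : E -> R) (Lam : R -> ('rV[R]_d -> R) -> R) : Prop :=
  [/\ forall t, t \in `[0, T] -> W1dual r (Lam t),
      forall w, W1 r w -> measurable_fun `[0, T]%classic (fun t => Lam t w),
      (\int[@leb1 R]_(t in `[0%R, T]%classic) (dual_norm r (Lam t) ^+ 2) < +oo)%E &
      forall (psi : R -> R) w, test_fun `]0, T[%classic psi -> W1 r w ->
        \int[@leb1 R]_(t in `[0, T]%classic)
          ('D_1 psi t * \int[leb d]_x (u (t, x) * w x * r x ^+ 2))
        = - \int[@leb1 R]_(t in `[0, T]%classic) (psi t * Lam t w)].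

Definition calW (u : E -> R) : Prop := L2_W1 u /\ exists Lam, dual_dt u Lam.

Definition strong_variational (u : E -> R) : Prop :=
  [/\ calW u,
      exists ub, C_version T r u ub /\ {ae leb d, forall x, ub T x = phi x} &
      forall Lam v, dual_dt u Lam -> W01 T r v -> above_obstacle v ->
        ((\int[@leb1 R]_(t in `[0, T]%classic)
            Lam t (fun x => v (t, x) - u (t, x)))%R%:E
         + (A_pairing u (v \- u)%R)%:E + f_pairing u (v \- u)%R <= 0)%E].

End obstacle.

(* Main.v *)
Require Import Defs.
From mathcomp Require Import all_boot all_order all_algebra.
From mathcomp Require Import all_classical all_reals all_analysis.
From mathcomp Require Import measurable_realfun ring lra.

Set Implicit Arguments.
Unset Strict Implicit.
Unset Printing Implicit Defensive.

Import Order.TTheory GRing.Theory Num.Theory.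
Import numFieldNormedType.Exports.

Local Open Scope classical_set_scope.
Local Open Scope ring_scope.

(** The inequalities for a competitor [v] come from testing the equation with the
    difference [w = v - u], localised by a cutoff [zeta] with compact support in
    the open strip.

    As [w] has no time derivative, the test functions are [J n (zeta * J n w)],
    where [J n] averages against an even smooth kernel. They are smooth, so that
    they are their own versions outside sets of zero capacity. Since [J n] is
    self-adjoint, the term with the time derivative equals [- zeta * v_t * w - D_t
    zeta * w^2 / 2] in the limit ([mol_time]). The measure term is bounded below
    ([mol_mu]): almost everywhere [w >= h - u], which is continuous, so the test
    function is at least [(h - u - del) * J n zeta], and the integral of [(u - h)
    * J n zeta] is 0 because the measure only acts where [u] touches the
    obstacle. The limit is the inequality [core_ineq].

    For weak solutions [zeta] is a time cutoff times a space cutoff times [rho^2].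
    When the time cutoff tends to 1, its derivative concentrates at the end
    points; the contribution of time 0 has a sign, and that of time [T] is half
    the squared norm of [phi - v(T)], as the equation at the final time forces
    [u(T) = phi] ([OP_final]). Then the space cutoff tends to 1. Only the term
    with [f_u] may have no finite integral; [cutoff_limit] takes care of it.

    For strong solutions the time derivative of [u] is a family [Lam t] of
    functionals, and [ell e] integrates [Lam t (e t)] over time. The square of the
    dual norm of [Lam t] has a finite integral but is not known to be a measurable
    function of [t]. Still [ell] is continuous on the energy space ([envelope],
    [ell_cvg]), and continuity extends the identity [\int u * D_t eta = - ell (eta
    / rho^2)] from tensor products, for which it is the definition of the
    derivative, to averages ([mollified_identity]) and to the limits of the test
    functions ([ell_mol]). This replaces [mol_time]; no boundary term appears.
    That [u] is continuous in time with values in the weighted space follows from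
    its continuity on balls and from the smallness of the tails uniformly in time,
    which the energy identity for cutoffs yields ([trace_tail]). *)

(** * Integrals that ignore null sets *)

Section ae_integral.
Context d (X : measurableType d) (R : realType).
Variable m : {measure set X -> \bar R}.
Local Open Scope ereal_scope.
Import HBNNSimple.

Let nnint (f : X -> \bar R) :=
  ereal_sup [set sintegral m (h : {nnsfun X >-> R}) | h in
    [set h : {nnsfun X >-> R} | forall x, (h x)%:E <= f x]].

(** The integral of a nonnegative function, measurable or not, is a supremum over
    the simple functions below it, and these can be set to 0 on a null set. So
    almost everywhere equality may be used under integrals of functions that are
    not known to be measurable. *)
Lemma nnint_le_ae (f g : X -> \bar R) : (forall x, 0 <= g x) ->
  {ae m, forall x, f x = g x} -> nnint f <= nnint g.
Proof.
move=> g0 [N [mN N0 fg]]; apply: ub_ereal_sup => _ [h /= hf <-].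
pose h' := proj_nnsfun h (measurableC mN).
have h'E x : ~ N x -> h' x = h x.
  by move=> Nx; rewrite /h' -mrestrict patchE mem_set.
have -> : sintegral m h = sintegral m h'.
  have -> : sintegral m h = sintegral m (h \_ setT) by congr (sintegral m _); apply/funext => x; rewrite patchE in_setT.
  have -> : sintegral m h' = sintegral m (h' \_ setT) by congr (sintegral m _); apply/funext => x; rewrite patchE in_setT.
  rewrite -!integral_nnsfun//; apply: ae_eq_integral => //.
  - exact/measurable_EFinP.
  - exact/measurable_EFinP.
  - exists N; split => // x /= /not_implyP[_ hx]; apply: contrapT => Nx.
    by apply: hx; have := h'E x Nx; rewrite /h'/= => ->.
apply: ereal_sup_ubound; exists h' => // x.
have [Nx|Nx] := pselect (N x).
  by rewrite /h' -mrestrict patchE ifF ?g0//; apply/negP; rewrite inE.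
rewrite h'E//; suff <- : f x = g x by exact: hf.
by apply: contrapT => nfg; apply/Nx/fg.
Qed.

Lemma integral_ae_ext (D : set X) (f g : X -> \bar R) :
  {ae m, forall x, D x -> f x = g x} ->
  \int[m]_(x in D) f x = \int[m]_(x in D) g x.
Proof.
move=> fg; rewrite /integral -/nnint.
have E : {ae m, forall x, (f \_ D) x = (g \_ D) x}.
  case: fg => N [mN N0 fg]; exists N; split => // x /= fgx; apply: fg => Dx.
  apply: fgx; rewrite !patchE; case: ifPn => //; rewrite inE; exact: Dx.
have P (a b : X -> \bar R) : {ae m, forall x, a x = b x} ->
    nnint a^\+ = nnint b^\+ /\ nnint a^\- = nnint b^\-.
  move=> [N [mN N0 ab]]; split; apply/eqP; rewrite eq_le; apply/andP; split;
    apply: nnint_le_ae => //; exists N; split => // x /= h; apply: ab => abx;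
    by apply: h; rewrite ?funeposE ?funenegE abx.
by have [] := P _ _ E; rewrite /nnint => -> ->.
Qed.

Lemma Rintegral_ae_ext (D : set X) (f g : X -> R) :
  {ae m, forall x, D x -> f x = g x} ->
  (\int[m]_(x in D) f x = \int[m]_(x in D) g x)%R.
Proof.
move=> fg; rewrite /Rintegral; congr fine; apply: integral_ae_ext.
by case: fg => N [mN N0 fg]; exists N; split => // x /= h; apply: fg => fgx;
  apply: h => Dx; rewrite fgx.
Qed.

Lemma ge0_le_integral_nomeas (D : set X) (f g : X -> \bar R) :
  (forall x, D x -> 0 <= f x) -> (forall x, D x -> f x <= g x) ->
  \int[m]_(x in D) f x <= \int[m]_(x in D) g x.
Proof.
move=> f0 fg.
have g0 x : D x -> 0 <= g x by move=> Dx; exact: le_trans (f0 _ Dx) (fg _ Dx).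
rewrite integral_mkcond [leRHS]integral_mkcond !ge0_integralTE//; last 2 first.
- exact: erestrict_ge0.
- exact: erestrict_ge0.
apply: le_ereal_sup => _ [h hf <-]; exists h => //= x.
apply: le_trans (hf x) _; rewrite !patchE; case: ifPn => // /set_mem Dx.
exact: fg.
Qed.

End ae_integral.

Lemma sqrD_le (R : realDomainType) (a b : R) :
  (a + b) ^+ 2 <= 2 * a ^+ 2 + 2 * b ^+ 2.
Proof. by have := sqr_ge0 (a - b); nra. Qed.

(** * Square integrable functions *)

Section L2_kit.
Context d (X : measurableType d) (R : realType).
Variable m : {measure set X -> \bar R}.
Implicit Types f g : X -> R.
Implicit Types fs gs : nat -> X -> R.

Local Notation L2T := (L2 m setT).
Local Notation int1 f := (m.-integrable setT (EFin \o f)).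

Lemma sqr_integrable f : L2T f -> int1 (fun x => f x ^+ 2).
Proof.
move=> [mf f2]; apply/integrableP; split.
  by apply/measurable_EFinP; exact: measurable_funX.
rewrite (eq_integral (fun x => (f x ^+ 2)%:E))// => x _ /=.
by rewrite ger0_norm// sqr_ge0.
Qed.

Lemma le_integrableT f g : measurable_fun setT f -> int1 g ->
  (forall x, `|f x| <= g x) -> int1 f.
Proof.
move=> mf ig fg; apply: (le_integrable _ _ _ ig) => //.
  exact/measurable_EFinP.
move=> x _ /=; rewrite lee_fin; apply: le_trans (fg x) _.
exact: ler_norm.
Qed.

Lemma int1_measurable f : int1 f -> measurable_fun setT f.
Proof. by move/measurable_int/measurable_EFinP. Qed.

Lemma int1D f g : int1 f -> int1 g -> int1 (fun x => f x + g x).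
Proof. by move=> if1 ig; exact: (integrableD measurableT if1 ig). Qed.

Lemma int1B f g : int1 f -> int1 g -> int1 (fun x => f x - g x).
Proof. by move=> if1 ig; exact: (integrableB measurableT if1 ig). Qed.

Lemma int1Z c f : int1 f -> int1 (fun x => c * f x).
Proof. by move=> if1; exact: (integrableZl measurableT c if1). Qed.

Lemma int1N f : int1 f -> int1 (fun x => - f x).
Proof.
by move=> /(int1Z (-1)); congr (integrable m setT _); apply/funext => x /=;
  rewrite mulN1r.
Qed.

Lemma int1_norm f : int1 f -> int1 (fun x => `|f x|).
Proof. exact: integrable_norm. Qed.

Lemma int1_bounded f g (C : R) : int1 f -> measurable_fun setT g ->
  (forall x, `|g x| <= C) -> int1 (fun x => g x * f x).
Proof.
move=> if1 mg gC; apply: (@le_integrableT _ (fun x => C * `|f x|)).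
- by apply: measurable_funM => //; exact: int1_measurable.
- exact/int1Z/int1_norm.
- by move=> x; rewrite normrM ler_wpM2r.
Qed.

Lemma indic_int1 (A : set X) : measurable A -> (m A < +oo)%E -> int1 (\1_A : X -> R).
Proof.
move=> mA Aoo; apply/integrableP; split; first exact/measurable_EFinP.
rewrite (eq_integral (fun z => (\1_A z)%:E)) ?integral_indic ?setIT// => z _ /=.
by rewrite ger0_norm// indicE ler0n.
Qed.

Lemma int1_sum (I : finType) (f : I -> X -> R) : (forall i, int1 (f i)) ->
  int1 (fun x => \sum_i f i x).
Proof.
move=> if1; rewrite (_ : _ \o _ = fun x => (\sum_i (f i x)%:E)%E).
  by apply: integrable_sum => // i _; exact: if1.
by apply/funext => x /=; rewrite sumEFin.
Qed.

Lemma Rint_sum (I : finType) (f : I -> X -> R) : (forall i, int1 (f i)) ->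
  \int[m]_x (\sum_i f i x) = \sum_i \int[m]_x f i x.
Proof.
move=> if1; rewrite /Rintegral.
under eq_integral do rewrite -sumEFin.
rewrite (integral_sum measurableT)//.
by rewrite -sum_fine// => i _; exact: (integrable_fin_num _ (if1 i)).
Qed.

Lemma L2_le f g : measurable_fun setT f -> L2T g ->
  (forall x, `|f x| <= `|g x|) -> L2T f.
Proof.
move=> mf [mg g2] fg; split=> //; apply: le_lt_trans g2.
apply: ge0_le_integral => //.
- by move=> x _; rewrite lee_fin sqr_ge0.
- by apply/measurable_EFinP; exact: measurable_funX.
- by apply/measurable_EFinP; exact: measurable_funX.
by move=> x _; rewrite lee_fin -[f x ^+ 2]real_normK ?num_real//
  -[g x ^+ 2]real_normK ?num_real// lerXn2r// ?nnegrE.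
Qed.

Lemma L2_of_sq f : measurable_fun setT f -> int1 (fun x => f x ^+ 2) -> L2T f.
Proof.
move=> mf /integrableP[_ f2]; split=> //.
by rewrite (eq_integral (fun x => `|(f x ^+ 2)%:E|)%E)// => x _ /=;
  rewrite ger0_norm// sqr_ge0.
Qed.

Lemma L2_indic (A : set X) : measurable A -> (m A < +oo)%E -> L2T (\1_A : X -> R).
Proof.
move=> mA fA; apply: L2_of_sq; first exact: measurable_indic.
rewrite (_ : (fun _ => _) = \1_A); first exact: indic_int1.
by apply/funext => x; rewrite indicE; case: (x \in A); rewrite ?expr1n ?expr0n.
Qed.

Lemma L2D f g : L2T f -> L2T g -> L2T (fun x => f x + g x).
Proof.
move=> Lf Lg; apply: L2_of_sq.
  by apply: measurable_funD; [case: Lf|case: Lg].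
apply: (@le_integrableT _ (fun x => 2 * f x ^+ 2 + 2 * g x ^+ 2)).
- by apply: measurable_funX; apply: measurable_funD; [case: Lf|case: Lg].
- by apply: int1D; apply: int1Z; exact: sqr_integrable.
- by move=> x; rewrite ger0_norm ?sqr_ge0// sqrD_le.
Qed.

Lemma L2M f g (C : R) : L2T f -> measurable_fun setT g -> (forall x, `|g x| <= C) ->
  L2T (fun x => g x * f x).
Proof.
move=> Lf mg gC; apply: L2_of_sq.
  by apply: measurable_funM => //; case: Lf.
apply: (@le_integrableT _ (fun x => C ^+ 2 * f x ^+ 2)).
- by apply: measurable_funX; apply: measurable_funM => //; case: Lf.
- by apply: int1Z; exact: sqr_integrable.
move=> x; rewrite ger0_norm ?sqr_ge0// exprMn ler_wpM2r ?sqr_ge0//.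
by rewrite -[g x ^+ 2]real_normK ?num_real// lerXn2r// ?nnegrE//;
  exact: le_trans (gC x).
Qed.

Lemma L2Z c f : L2T f -> L2T (fun x => c * f x).
Proof. by move=> Lf; apply: (@L2M _ (cst c) `|c|) => //. Qed.

Lemma L2N f : L2T f -> L2T (fun x => - f x).
Proof.
by move=> /(L2Z (-1)); congr (L2 m setT _); apply/funext => x; rewrite mulN1r.
Qed.

Lemma L2B f g : L2T f -> L2T g -> L2T (fun x => f x - g x).
Proof. by move=> Lf Lg; apply: L2D => //; exact: L2N. Qed.

Lemma L2_0 : L2T (fun=> 0).
Proof.
split=> //; rewrite (eq_integral (cst 0%E)) ?integral0//.
by move=> x _; rewrite expr0n.
Qed.

Lemma L2_sum_seq (I : Type) (s : seq I) (f : I -> X -> R) :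
  (forall i, L2T (f i)) -> L2T (fun x => \sum_(i <- s) f i x).
Proof.
move=> Lf; elim: s => [|i s ih].
  by under eq_fun do rewrite big_nil; exact: L2_0.
by under eq_fun do rewrite big_cons; exact: L2D.
Qed.

Lemma mul_integrable f g : L2T f -> L2T g -> int1 (fun x => f x * g x).
Proof.
move=> Lf Lg.
apply: (@le_integrableT _ (fun x => f x ^+ 2 + g x ^+ 2)).
- by apply: measurable_funM; [case: Lf|case: Lg].
- by apply: int1D; exact: sqr_integrable.
move=> x; rewrite ler_norml; apply/andP; split; nra.
Qed.

(** The real-valued integral is 0 when the true one is infinite: this is the
    squared norm only on square integrable functions. *)
Definition N2 f : R := \int[m]_x (f x ^+ 2).

Lemma N2_ge0 f : 0 <= N2 f.
Proof. by apply: Rintegral_ge0 => x _; exact: sqr_ge0. Qed.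

Lemma RintD f g : int1 f -> int1 g ->
  \int[m]_x (f x + g x) = \int[m]_x f x + \int[m]_x g x.
Proof. exact: RintegralD. Qed.

Lemma RintB f g : int1 f -> int1 g ->
  \int[m]_x (f x - g x) = \int[m]_x f x - \int[m]_x g x.
Proof. exact: RintegralB. Qed.

Lemma RintZ c f : int1 f -> \int[m]_x (c * f x) = c * \int[m]_x f x.
Proof. exact: RintegralZl. Qed.

Lemma RintN f : int1 f -> \int[m]_x (- f x) = - \int[m]_x f x.
Proof.
move=> if1; rewrite -mulN1r -RintZ//; apply: eq_Rintegral => x _.
by rewrite mulN1r.
Qed.

Lemma le_Rint f g : int1 f -> int1 g -> (forall x, f x <= g x) ->
  \int[m]_x f x <= \int[m]_x g x.
Proof. by move=> ? ? fg; apply: le_Rintegral. Qed.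

Lemma le_Rint_norm f g : int1 f -> int1 g -> (forall x, `|f x| <= g x) ->
  `|\int[m]_x f x| <= \int[m]_x g x.
Proof.
move=> if1 ig fg; apply: le_trans (le_normr_Rintegral measurableT if1) _.
by apply: le_Rint => //; exact: int1_norm.
Qed.

Lemma N2_le f g : measurable_fun setT f -> L2T g ->
  (forall x, `|f x| <= `|g x|) -> N2 f <= N2 g.
Proof.
move=> mf Lg fg; apply: le_Rint.
- by apply: sqr_integrable; exact: L2_le Lg fg.
- exact: sqr_integrable.
by move=> x; rewrite -[f x ^+ 2]real_normK ?num_real//
  -[g x ^+ 2]real_normK ?num_real// lerXn2r// ?nnegrE.
Qed.

Lemma N2D f g : L2T f -> L2T g ->
  N2 (fun x => f x + g x) <= 2 * N2 f + 2 * N2 g.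
Proof.
move=> Lf Lg; rewrite /N2 -!RintZ ?sqr_integrable// -RintD//; last 2 first.
- exact/int1Z/sqr_integrable.
- exact/int1Z/sqr_integrable.
apply: le_Rint.
- by apply: sqr_integrable; exact: L2D.
- by apply: int1D; apply: int1Z; exact: sqr_integrable.
by move=> x; exact: sqrD_le.
Qed.

Lemma N2M f g (C : R) : L2T f -> measurable_fun setT g -> (forall x, `|g x| <= C) ->
  N2 (fun x => g x * f x) <= C ^+ 2 * N2 f.
Proof.
move=> Lf mg gC; rewrite /N2 -RintZ ?sqr_integrable//; apply: le_Rint.
- by apply: sqr_integrable; exact: L2M Lf mg gC.
- exact/int1Z/sqr_integrable.
move=> x; rewrite exprMn ler_wpM2r ?sqr_ge0//.
by rewrite -[g x ^+ 2]real_normK ?num_real// lerXn2r// ?nnegrE//;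
  exact: le_trans (gC x).
Qed.

Lemma N2N f : N2 (fun x => - f x) = N2 f.
Proof. by apply: eq_Rintegral => x _; rewrite sqrrN. Qed.

(** The weighted arithmetic-geometric inequality replaces the Cauchy-Schwarz
    inequality throughout: it needs no square root. *)
Lemma int_mul_le (e : R) f g : 0 < e -> L2T f -> L2T g ->
  `|\int[m]_x (f x * g x)| <= e * N2 f + e^-1 * N2 g.
Proof.
move=> e0 Lf Lg; rewrite /N2 -!RintZ ?sqr_integrable// -RintD//; last 2 first.
- exact/int1Z/sqr_integrable.
- exact/int1Z/sqr_integrable.
apply: le_Rint_norm.
- exact: mul_integrable.
- by apply: int1D; apply: int1Z; exact: sqr_integrable.
move=> x.
have : 0 <= (e * `|f x| - `|g x|) ^+ 2 / e by rewrite divr_ge0 ?sqr_ge0// ltW.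
rewrite (_ : _ / e = e * `|f x| ^+ 2 + e^-1 * `|g x| ^+ 2 - 2 * (`|f x| * `|g x|)).
  rewrite !real_normK ?num_real// normrM => h.
  have := mulr_ge0 (normr_ge0 (f x)) (normr_ge0 (g x)); lra.
by field; rewrite gt_eqF.
Qed.

Definition L2cv (fs : nat -> X -> R) f : Prop :=
  [/\ forall n, L2T (fs n), L2T f &
      N2 (fun x => fs n x - f x) @[n --> \oo] --> 0].

Lemma L2cv_cst f : L2T f -> L2cv (fun=> f) f.
Proof.
move=> Lf; split=> //; apply: cvg_near_cst; near=> n.
rewrite /N2 (@eq_Rintegral _ _ _ _ _ (cst 0)) ?Rintegral_cst ?mul0r//.
by move=> x _; rewrite subrr expr0n.
Unshelve. all: by end_near. Qed.

Lemma L2cv_le (fs : nat -> X -> R) f (e : nat -> R) :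
  (forall n, L2T (fs n)) -> L2T f ->
  (forall n, N2 (fun x => fs n x - f x) <= e n) -> e @ \oo --> 0 -> L2cv fs f.
Proof.
move=> Lfs Lf fe e0; split => //.
by apply: (@squeeze_cvgr _ _ _ _ (cst 0) e) => //;
  [apply: nearW => n; rewrite N2_ge0 fe|exact: cvg_cst].
Qed.

Lemma L2cvD fs gs f g : L2cv fs f -> L2cv gs g ->
  L2cv (fun n x => fs n x + gs n x) (fun x => f x + g x).
Proof.
move=> [Lfs Lf cf] [Lgs Lg cg].
apply: (@L2cv_le _ _ (fun n => 2 * N2 (fun x => fs n x - f x) +
                               2 * N2 (fun x => gs n x - g x))).
- by move=> n; exact: L2D.
- exact: L2D.
- move=> n; apply: le_trans (N2D _ _); [|exact: L2B|exact: L2B].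
  rewrite le_eqVlt; apply/orP; left; apply/eqP; apply: eq_Rintegral => x _.
  by congr (_ ^+ 2); ring.
- rewrite [X in _ --> X](_ : _ = 2 * 0 + 2 * 0); last by rewrite !mulr0 addr0.
  by apply: cvgD; apply: cvgM; [exact: cvg_cst|exact: cf|exact: cvg_cst|exact: cg].
Qed.

Lemma L2cvM fs f g (C : R) : L2cv fs f -> measurable_fun setT g ->
  (forall x, `|g x| <= C) -> L2cv (fun n x => g x * fs n x) (fun x => g x * f x).
Proof.
move=> [Lfs Lf cf] mg gC.
apply: (@L2cv_le _ _ (fun n => C ^+ 2 * N2 (fun x => fs n x - f x))).
- by move=> n; exact: L2M (Lfs n) mg gC.
- exact: L2M Lf mg gC.
- move=> n; apply: le_trans (N2M _ mg gC); last exact: L2B.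
  rewrite le_eqVlt; apply/orP; left; apply/eqP; apply: eq_Rintegral => x _.
  by rewrite mulrBr.
- rewrite [X in _ --> X](_ : _ = C ^+ 2 * 0); last by rewrite mulr0.
  by apply: cvgM; [exact: cvg_cst|exact: cf].
Qed.

Lemma cvg0_by_eps (a : nat -> R) :
  (forall e, 0 < e -> \forall n \near \oo, `|a n| <= e) -> a @ \oo --> 0.
Proof.
move=> h; apply/cvgr0Pnorm_le => e e0; exact: h.
Qed.

Lemma L2cv_int fs gs f g : L2cv fs f -> L2cv gs g ->
  \int[m]_x (fs n x * gs n x) @[n --> \oo] --> \int[m]_x (f x * g x).
Proof.
move=> [Lfs Lf cf] [Lgs Lg cg]; apply/subr_cvg0; apply: cvg0_by_eps => e e0.
set F := fun n => N2 (fun x => fs n x - f x).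
set G := fun n => N2 (fun x => gs n x - g x).
have E n : `|\int[m]_x (fs n x * gs n x) - \int[m]_x (f x * g x)| <=
    F n + G n + (e^-1 * (4 * (N2 g + 1)) * F n + e / (4 * (N2 g + 1)) * N2 g)
    + (e^-1 * (4 * (N2 f + 1)) * G n + e / (4 * (N2 f + 1)) * N2 f).
  have -> : \int[m]_x (fs n x * gs n x) - \int[m]_x (f x * g x) =
      \int[m]_x ((fs n x - f x) * (gs n x - g x))
      + \int[m]_x ((fs n x - f x) * g x) + \int[m]_x ((gs n x - g x) * f x).
    have L1 := L2B (Lfs n) Lf; have L3 := L2B (Lgs n) Lg.
    rewrite -RintB; [|exact: mul_integrable..].
    rewrite -RintD; [|exact: mul_integrable..].
    rewrite -RintD; last 2 first.
    - by apply: int1D; exact: mul_integrable.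
    - exact: mul_integrable.
    by apply: eq_Rintegral => x _; ring.
  have P (h : X -> R) : 0 < 4 * (N2 h + 1) by have := N2_ge0 h; lra.
  have := int_mul_le ltr01 (L2B (Lfs n) Lf) (L2B (Lgs n) Lg).
  rewrite invr1 !mul1r => h1.
  have h2 := int_mul_le (mulr_gt0 (eqbRL (invr_gt0 e) e0) (P g)) (L2B (Lfs n) Lf) Lg.
  have h3 := int_mul_le (mulr_gt0 (eqbRL (invr_gt0 e) e0) (P f)) (L2B (Lgs n) Lg) Lf.
  rewrite invfM invrK in h2; rewrite invfM invrK in h3.
  apply: le_trans (ler_normD _ _) _; apply: lerD; last exact: h3.
  by apply: le_trans (ler_normD _ _) _; apply: lerD; [exact: h1|exact: h2].
have B (h : X -> R) : e / (4 * (N2 h + 1)) * N2 h <= e / 4.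
  have N0 := N2_ge0 h; rewrite invfM mulrA -[leRHS]mulr1 -mulrA ler_wpM2l//.
    by rewrite divr_ge0// ltW.
  by rewrite mulrC ler_pdivrMr ?mul1r ?lerDl// ltr_wpDl.
pose A := 1 + e^-1 * (4 * (N2 g + 1)) + e^-1 * (4 * (N2 f + 1)).
have A0 : 0 < A.
  have := N2_ge0 g; have := N2_ge0 f => f0 g0.
  by rewrite /A ltr_wpDr// ?ltr_wpDr// ?mulr_ge0// ?invr_ge0 ?ltW//; lra.
have cF : \forall n \near \oo, F n <= e / 4 / A.
  have : 0 < e / 4 / A by rewrite !divr_gt0.
  by move/(cvgr_le _ cf).
have cG : \forall n \near \oo, G n <= e / 4 / A.
  have : 0 < e / 4 / A by rewrite !divr_gt0.
  by move/(cvgr_le _ cg).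
near=> n.
apply: le_trans (E n) _.
have Fn : F n <= e / 4 / A by near: n.
have Gn : G n <= e / 4 / A by near: n.
have F0 : 0 <= F n := N2_ge0 _; have G0 : 0 <= G n := N2_ge0 _.
have := B f; have := B g => Bg Bf.
have AF : A * F n <= e / 4 by rewrite mulrC -ler_pdivlMr.
have AG : A * G n <= e / 4 by rewrite mulrC -ler_pdivlMr.
have Ag : 0 <= e^-1 * (4 * (N2 g + 1)).
  by have := N2_ge0 g => ?; rewrite mulr_ge0 ?invr_ge0 ?ltW//; lra.
have Af : 0 <= e^-1 * (4 * (N2 f + 1)).
  by have := N2_ge0 f => ?; rewrite mulr_ge0 ?invr_ge0 ?ltW//; lra.
move: AF AG; rewrite /A.
set p := e^-1 * _ in Ag *; set q := e^-1 * _ in Af *.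
have pG := mulr_ge0 Ag G0; have qF := mulr_ge0 Af F0.
nra.
Unshelve. all: by end_near. Qed.

Lemma Rint_dominated (fs : nat -> X -> R) f G :
  (forall n, measurable_fun setT (fs n)) -> measurable_fun setT f -> int1 G ->
  (forall n x, `|fs n x| <= G x) ->
  {ae m, forall x, fs n x @[n --> \oo] --> f x} ->
  int1 f /\ \int[m]_x fs n x @[n --> \oo] --> \int[m]_x f x.
Proof.
move=> mfs mf iG fG fcv.
have [] := @dominated_convergence _ _ _ m setT measurableT
  (fun n => EFin \o fs n) (EFin \o f) (EFin \o G).
- by move=> n; exact/measurable_EFinP.
- exact/measurable_EFinP.
- case: fcv => N [mN N0 sN]; exists N; split => // x /= h; apply: sN => /= cx.
  by apply: h => _; apply: cvg_EFin; [exact: nearW|exact: cx].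
- exact: iG.
- by apply: aeW => x n _ /=; rewrite lee_fin.
move=> i1 _ h; split; first exact: i1.
by apply: fine_cvg; rewrite fineK//; exact: integrable_fin_num.
Qed.

Lemma L2cv_dominated fs f G : (forall n, measurable_fun setT (fs n)) ->
  measurable_fun setT f -> L2T G ->
  (forall n x, `|fs n x| <= G x) -> (forall x, `|f x| <= G x) ->
  {ae m, forall x, fs n x @[n --> \oo] --> f x} -> L2cv fs f.
Proof.
move=> mfs mf LG fG fG' fcv.
have G0 x : `|G x| = G x by rewrite ger0_norm// (le_trans _ (fG' x)).
split.
- by move=> n; apply: (L2_le (mfs n) LG) => x; rewrite G0.
- by apply: (L2_le mf LG) => x; rewrite G0.
have [] := @Rint_dominated (fun n x => (fs n x - f x) ^+ 2) (cst 0)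
  (fun x => 4 * G x ^+ 2).
- by move=> n; apply: measurable_funX; exact: measurable_funB.
- exact: measurable_cst.
- exact/int1Z/sqr_integrable.
- move=> n x; rewrite ger0_norm ?sqr_ge0//.
  have := fG n x; have := fG' x; rewrite !ler_norml => /andP[a b] /andP[c e].
  have : 0 <= G x by lra.
  nra.
- case: fcv => N [mN N0 sN]; exists N; split => // x /= h; apply: sN => /= cx.
  apply: h; rewrite (_ : 0 = (f x - f x) ^+ 2); last first.
    by rewrite subrr expr0n.
  rewrite expr2; under eq_fun do rewrite expr2.
  have cB : fs n x - f x @[n --> \oo] --> f x - f x.
    by apply: cvgB; [exact: cx|exact: cvg_cst].
  exact: cvgM.
move=> _; rewrite /N2.
by rewrite [X in _ --> X -> _](_ : _ = 0) // Rintegral_cst// mul0r.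
Qed.

End L2_kit.

(** * Smooth functions and bumps *)

Section gz.
Context {R : realType}.
Implicit Types (t s : R) (n : nat).

(** The derivatives of [exp (- 1 / t)] for [t > 0], extended by zero, are linear
    combinations of these functions. *)
Definition gz n t : R := if 0 < t then t^-1 ^+ n * expR (- t^-1) else 0.

Lemma gz_pos n t : 0 < t -> gz n t = t^-1 ^+ n * expR (- t^-1).
Proof. by rewrite /gz => ->. Qed.

Lemma gz_neg n t : t <= 0 -> gz n t = 0.
Proof. by rewrite /gz leNgt => /negbTE ->. Qed.

Lemma gz_ge0 n t : 0 <= gz n t.
Proof.
by rewrite /gz; case: ifPn => // t0; rewrite mulr_ge0 ?expR_ge0// exprn_ge0// invr_ge0 ltW.
Qed.

Lemma exprn_expRN_le n s : 0 <= s -> s ^+ n * expR (- s) <= n`!%:R.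
Proof.
move=> s0; rewrite expRN ler_pdivrMr ?expR_gt0//.
case: n => [|n]; first by rewrite fact0 mul1r expr0 -expR0 ler_expR.
have := expR_ge1Dxn n s0 => h.
have f0 : (0 : R) < n.+1`!%:R by rewrite ltr0n fact_gt0.
have : s ^+ n.+1 / n.+1`!%:R <= expR s by lra.
by rewrite ler_pdivrMr// mulrC.
Qed.

Lemma gz_le n t : gz n t <= n`!%:R.
Proof.
rewrite /gz; case: ifPn => [t0|_]; last by rewrite ler0n.
by apply: exprn_expRN_le; rewrite invr_ge0 ltW.
Qed.

Lemma gz0_le1 t : gz 0 t <= 1.
Proof. exact: gz_le. Qed.

Lemma gz0_gt0 t : 0 < t -> 0 < gz 0 t.
Proof. by move=> t0; rewrite gz_pos// mul1r expR_gt0. Qed.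

Lemma gz_sqr n t : gz n t <= n.+2`!%:R * t ^+ 2.
Proof.
rewrite /gz; case: ifPn => [t0|_]; last by rewrite mulr_ge0 ?sqr_ge0 ?ler0n.
have := @exprn_expRN_le n.+2 t^-1; rewrite invr_ge0 ltW// => /(_ isT) h.
rewrite -ler_pdivrMr ?exprn_gt0//; apply: le_trans h.
rewrite le_eqVlt; apply/orP; left; apply/eqP.
rewrite !exprS; field; by rewrite gt_eqF.
Qed.

Lemma gz0_homo : {homo gz 0 : t s / t <= s}.
Proof.
move=> t s ts; have [t0|t0] := leP t 0; first by rewrite (gz_neg _ t0) gz_ge0.
have s0 := lt_le_trans t0 ts.
by rewrite !gz_pos// !expr0 !mul1r ler_expR lerN2 lef_pV2.
Qed.

Lemma is_derive_line {V : normedModType R} (f : V -> R) x v df :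
  is_derive (0 : R) (1 : R) (fun h : R => f (h *: v + x)) df -> is_derive x v f df.
Proof.
have E : (fun h : R => h^-1 *: (((fun h : R => f (h *: v + x)) \o shift 0) (h *: 1) -
      (fun h : R => f (h *: v + x)) 0)) =
    (fun h : R => h^-1 *: ((f \o shift x) (h *: v) - f x)).
  apply/funext => h /=; rewrite scale0r add0r addr0.
  by rewrite (_ : h *: 1 = h)// /GRing.scale /= mulr1.
move=> [dx dv]; split.
  by move: dx; rewrite /derivable E.
by move: dv; rewrite /derive E.
Qed.

Lemma is_derive_lineP {V : normedModType R} (f : V -> R) x v df (t : R) :
  is_derive (t *: v + x) v f df ->
  is_derive t (1 : R) (fun h : R => f (h *: v + x)) df.
Proof.
have E : (fun h : R => h^-1 *: (((fun h : R => f (h *: v + x)) \o shift t) (h *: 1) -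
      (fun h : R => f (h *: v + x)) t)) =
    (fun h : R => h^-1 *: ((f \o shift (t *: v + x)) (h *: v) - f (t *: v + x))).
  apply/funext => h /=; congr (_ *: (f _ - _)).
  by rewrite (_ : h *: 1 = h) ?scalerDl ?addrA// /GRing.scale /= mulr1.
move=> [dx dv]; split.
  by move: dx; rewrite /derivable E.
by move: dv; rewrite /derive E.
Qed.

(** Applied to [gz n] at 0, where its two branches meet. *)
Lemma is_derive1_flat (f : R -> R) C : (forall h : R, `|f h| <= C * h ^+ 2) ->
  is_derive (0 : R) (1 : R) f 0.
Proof.
move=> fC.
have f0 : f 0 = 0.
  by apply/eqP; rewrite -normr_le0 (le_trans (fC 0))// expr0n mulr0.
have C0 : 0 <= C by have := fC 1; rewrite expr1n mulr1; exact: le_trans.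
have cv : h^-1 *: ((f \o shift 0) (h *: 1) - f 0) @[h --> (0 : R)^'] --> (0 : R).
  apply/cvgr0Pnorm_le => e e0.
  near=> h; rewrite f0 subr0 /= addr0 (_ : h *: 1 = h); last first.
    by rewrite /GRing.scale /= mulr1.
  rewrite normrZ normfV ler_pdivrMl; last by rewrite normr_gt0; near: h; exact: nbhs_dnbhs_neq.
  apply: le_trans (fC h) _; rewrite -[h ^+ 2]real_normK ?num_real// mulrC expr2 -mulrA.
  rewrite ler_wpM2l//.
  have h1 : `|h| <= e / (C + 1).
    near: h; apply: dnbhs0_le; by rewrite divr_gt0// ltr_wpDl.
  apply: (@le_trans _ _ (e / (C + 1) * C)); first by rewrite ler_wpM2r.
  have C1 : 0 < C + 1 by rewrite ltr_wpDl.
  by rewrite mulrAC ler_pdivrMr// ler_wpM2l ?ltW ?ltrDl.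
by split; [apply/cvg_ex; exists 0|exact/cvg_lim].
Unshelve. all: by end_near. Qed.

Lemma is_derive_gz n t : is_derive t (1 : R) (gz n) (gz n.+2 t - n%:R * gz n.+1 t).
Proof.
have [t0|t0|->{t}] := ltgtP t 0.
- rewrite !gz_neg ?ltW// mulr0 subr0.
  have E : \near t, (cst (0 : R)) t = gz n t.
    by near=> s; rewrite gz_neg// ltW//; near: s; exact: lt_nbhsl.
  exact: (near_eq_is_derive E (is_derive_cst (0 : R) t (1 : R))).
- pose F (s : R) := s ^+ n * expR (- s).
  have dF s : is_derive s (1 : R) F (n%:R * s ^+ n.-1 * expR (- s) - s ^+ n * expR (- s)).
    have d1 : is_derive s (1 : R) (fun s => expR (- s)) (expR (- s) * -1).
      have -> : (fun s : R => expR (- s)) = expR \o (- id) by [].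
      exact: (is_derive1_comp (is_derive_expR _)).
    have d2 : is_derive s (1 : R) ((id : R -> R) ^+ n) ((n%:R * s ^+ n.-1) *: 1).
      exact: is_deriveX.
    have -> : F = ((id : R -> R) ^+ n) * (fun s => expR (- s)).
      by apply/funext => r; rewrite /F /GRing.mul /= fctE.
    apply: is_derive_eq (is_deriveM d2 d1) _.
    rewrite /GRing.scale /= mulr1 fctE; ring.
  have dI : is_derive t (1 : R) (fun s : R => s^-1) (- t ^- 2 *: 1).
    by apply: (is_deriveV (f := id)); rewrite gt_eqF.
  apply: (@near_eq_is_derive _ _ _ (F \o (fun s => s^-1))).
    by near=> s; rewrite gz_pos//; near: s; exact: lt_nbhsr.
  apply: is_derive_eq (is_derive1_comp (dF _) dI) _.
  rewrite !gz_pos// /GRing.scale /= mulr1.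
  case: n {F dF} => [|n]; first by rewrite !mul0r !expr2 invfM; ring.
  by rewrite /= !exprS expr0 mulr1 !invfM; ring.
- rewrite !gz_neg// mulr0 subr0; apply: (@is_derive1_flat _ (n.+2)`!%:R) => h.
  by rewrite ger0_norm ?gz_ge0// gz_sqr.
Unshelve. all: by end_near. Qed.

Lemma derivable_cts (f : R -> R) : (forall t, derivable f t (1 : R)) -> continuous f.
Proof. by move=> df t; apply/differentiable_continuous/derivable1_diffP. Qed.

Lemma gz_cts n : continuous (gz n).
Proof. by apply: derivable_cts => t; case: (is_derive_gz n t). Qed.

End gz.

Section smooth.
Context {R : realType} {V : normedModType R}.
Implicit Types f g : V -> R.

(** Smoothness by coinduction: a class of continuous functions that is closed
    under directional derivatives consists of smooth functions. *)
Lemma smooth_class (C : (V -> R) -> Prop) :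
  (forall f, C f -> continuous f) ->
  (forall f, C f -> forall v, exists g, C g /\ forall x, is_derive x v f (g x)) ->
  forall f, C f -> smooth f.
Proof.
move=> Cc Cd f Cf.
have P vs : C (iter_derive vs f).
  elim: vs => //= v vs ih; have [g [Cg dg]] := Cd _ ih v.
  suff -> : (fun x => 'D_v (foldr (fun v0 g0 => fun x0 => 'D_v0 g0 x0) f vs) x) = g by [].
  by apply/funext => x; have [_ ->] := dg x.
move=> vs; split; first exact: Cc (P vs).
by move=> x v; have [g [_ dg]] := Cd _ (P vs) v; case: (dg x).
Qed.

Lemma smooth_cts f : smooth f -> continuous f.
Proof. by move=> /(_ [::])[]. Qed.

Lemma smooth_derivable f : smooth f -> forall x v, derivable f x v.
Proof. by move=> /(_ [::])[]. Qed.

Lemma smooth_is_derive f : smooth f -> forall x v, is_derive x v f ('D_v f x).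
Proof. by move=> sf x v; split => //; exact: smooth_derivable. Qed.

Lemma smoothD f v : smooth f -> smooth ('D_v f).
Proof.
move=> sf vs; have := sf (rcons vs v).
rewrite /iter_derive foldr_rcons; exact.
Qed.

(** A class of functions that is stable under differentiation and built from
    smooth functions by the operations needed below. *)
Inductive sm : (V -> R) -> Prop :=
| sm_smooth f : smooth f -> sm f
| sm_cst (c : R) : sm (cst c)
| sm_lin (l : V -> R) : continuous l ->
    (forall (h : R) x v, l (h *: v + x) = h * l v + l x) -> sm l
| sm_add f g : sm f -> sm g -> sm (fun x => f x + g x)
| sm_mul f g : sm f -> sm g -> sm (fun x => f x * g x)
| sm_gz n f : sm f -> sm (fun x => gz n (f x))
| sm_powR (b : R) f : sm f -> (forall x, 0 < f x) -> sm (fun x => f x `^ b).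

Lemma sm_cts f : sm f -> continuous f.
Proof.
elim=> {f} [f sf|c|l cl _|f g _ cf _ cg|f g _ cf _ cg|n f _ cf|b f _ cf f0] x.
- exact: smooth_cts.
- exact: cvg_cst.
- exact: cl.
- by apply: cvgD; [exact: cf|exact: cg].
- by apply: cvgM; [exact: cf|exact: cg].
- exact: (continuous_comp (cf x) (gz_cts (n := n) (x := f x))).
- apply: (continuous_comp (g := fun r => r `^ b) (cf x)).
  apply/differentiable_continuous/derivable1_diffP.
  by case: (is_derive1_powR b (f0 x)).
Qed.

Lemma is_derive_chain (G : R -> R) f x v dG df :
  is_derive x v f df -> is_derive (f x) (1 : R) G dG ->
  is_derive x v (fun y => G (f y)) (dG * df).
Proof.
move=> dfx dGx; apply: is_derive_line.
have h1 : is_derive (0 : R) (1 : R) (fun h : R => f (h *: v + x)) df.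
  by apply: is_derive_lineP; rewrite scale0r add0r.
apply: (is_derive1_comp (f := G) (g := fun h : R => f (h *: v + x))) => //.
by rewrite scale0r add0r.
Qed.

Lemma sm_derive f : sm f -> forall v, exists g, sm g /\ forall x, is_derive x v f (g x).
Proof.
elim=> {f} [f sf|c|l cl ll|f g _ cf _ cg|f g sf cf sg cg|n f sf cf|b f sf cf f0] v.
- exists ('D_v f); split; first exact/sm_smooth/smoothD.
  by move=> x; exact: smooth_is_derive.
- exists (cst 0); split; first exact: sm_cst.
  by move=> x; exact: is_derive_cst.
- exists (cst (l v)); split; first exact: sm_cst.
  move=> x; apply: is_derive_line.
  have -> : (fun h : R => l (h *: v + x)) = (id : R -> R) * cst (l v) + cst (l x).
    by apply/funext => h; rewrite ll.
  have dl := is_deriveD (is_deriveM (is_derive_id (0 : R) (1 : R))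
    (is_derive_cst (l v) (0 : R) (1 : R))) (is_derive_cst (l x) (0 : R) (1 : R)).
  apply: is_derive_eq dl _.
  by rewrite scale0r add0r addr0 /GRing.scale /= mulr1.
- have [f' [sf' df]] := cf v; have [g' [sg' dg]] := cg v.
  exists (fun x => f' x + g' x); split; first exact: sm_add.
  by move=> x; exact: is_deriveD.
- have [f' [sf' df]] := cf v; have [g' [sg' dg]] := cg v.
  exists (fun x => f x * g' x + g x * f' x); split.
    by apply: sm_add; exact: sm_mul.
  by move=> x; exact: is_deriveM.
- have [f' [sf' df]] := cf v.
  exists (fun x => (gz n.+2 (f x) + cst (- n%:R) x * gz n.+1 (f x)) * f' x); split.
    apply: sm_mul => //; apply: sm_add; first exact: sm_gz.
    by apply: sm_mul; [exact: sm_cst|exact: sm_gz].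
  move=> x; rewrite /cst mulNr.
  exact: (is_derive_chain (df x) (is_derive_gz n (f x))).
- have [f' [sf' df]] := cf v.
  exists (fun x => cst b x * f x `^ (b - 1) * f' x); split.
    apply: sm_mul => //; apply: sm_mul; first exact: sm_cst.
    exact: sm_powR.
  by move=> x; exact: (is_derive_chain (df x) (is_derive1_powR b (f0 x))).
Qed.

Lemma sm_is_smooth f : sm f -> smooth f.
Proof. by apply: smooth_class; [exact: sm_cts|exact: sm_derive]. Qed.

Lemma smooth_cst (c : R) : smooth (cst c : V -> R).
Proof. exact/sm_is_smooth/sm_cst. Qed.

Lemma smooth_add f g : smooth f -> smooth g -> smooth (fun x => f x + g x).
Proof. by move=> sf sg; apply/sm_is_smooth/sm_add; exact: sm_smooth. Qed.

Lemma smooth_mul f g : smooth f -> smooth g -> smooth (fun x => f x * g x).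
Proof. by move=> sf sg; apply/sm_is_smooth/sm_mul; exact: sm_smooth. Qed.

Lemma smooth_gz n f : smooth f -> smooth (fun x => gz n (f x)).
Proof. by move=> sf; apply/sm_is_smooth/sm_gz; exact: sm_smooth. Qed.

Lemma smooth_powR b f : smooth f -> (forall x, 0 < f x) -> smooth (fun x => f x `^ b).
Proof. by move=> sf f0; apply/sm_is_smooth/sm_powR => //; exact: sm_smooth. Qed.

Lemma smooth_prod (I : Type) (s : seq I) (f : I -> V -> R) :
  (forall i, smooth (f i)) -> smooth (fun x => \prod_(i <- s) f i x).
Proof.
move=> sf; elim: s => [|i s ih].
  by under eq_fun do rewrite big_nil; exact: smooth_cst.
have -> : (fun x => \prod_(j <- i :: s) f j x) = (fun x => f i x * \prod_(j <- s) f j x).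
  by apply/funext => x; rewrite big_cons.
exact: (smooth_mul (sf i) ih).
Qed.

Lemma smooth_sum (I : Type) (s : seq I) (f : I -> V -> R) :
  (forall i, smooth (f i)) -> smooth (fun x => \sum_(i <- s) f i x).
Proof.
move=> sf; elim: s => [|i s ih].
  by under eq_fun do rewrite big_nil; exact: smooth_cst.
have -> : (fun x => \sum_(j <- i :: s) f j x) = (fun x => f i x + \sum_(j <- s) f j x).
  by apply/funext => x; rewrite big_cons.
exact: (smooth_add (sf i) ih).
Qed.

Lemma derive_mul f g x v : smooth f -> smooth g ->
  'D_v (fun x => f x * g x) x = f x * 'D_v g x + g x * 'D_v f x.
Proof.
by move=> sf sg; rewrite (@deriveM _ _ f g x v)//; exact: smooth_derivable.
Qed.

Lemma MVT_line f x v (h : R) : smooth f ->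
  exists2 c : R, `|c| <= `|h| & f (h *: v + x) - f x = 'D_v f (c *: v + x) * h.
Proof.
move=> sf; pose F (t : R) := f (t *: v + x); pose dF (t : R) := 'D_v f (t *: v + x).
have dFE t : is_derive t (1 : R) F (dF t).
  by apply: is_derive_lineP; exact: smooth_is_derive.
have cF : continuous F by apply: derivable_cts => t; case: (dFE t).
have F0 : F 0 = f x by rewrite /F scale0r add0r.
have [h0|h0|->] := ltgtP h 0.
- have [|c ci] := MVT h0 (fun t _ => dFE t).
    exact: continuous_subspaceT.
  rewrite F0 sub0r => E; exists c; move: ci; rewrite in_itv/= => /andP[c1 c2].
    by rewrite !ltr0_norm// lerN2 ltW.
  by rewrite -[LHS]opprB E mulrN opprK.
- have [|c ci] := MVT h0 (fun t _ => dFE t).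
    exact: continuous_subspaceT.
  rewrite F0 subr0 => E; exists c; move: ci; rewrite in_itv/= => /andP[c1 c2].
    by rewrite !gtr0_norm// ltW.
  exact: E.
- by exists 0 => //; rewrite scale0r add0r subrr mulr0.
Qed.

End smooth.

(** * Lebesgue measure on row vectors and on space-time *)

Section norms.
Context {R : realType} {d : nat}.
Implicit Types (x : 'rV[R]_d) (z : R * 'rV[R]_d).

Lemma rV_norm_leP x (e : R) : 0 <= e -> (`|x| <= e) <-> (forall i, `|x 0 i| <= e).
Proof.
move=> e0; rewrite (_ : `|x| = \big[Num.max/0]_ij `|x ij.1 ij.2|); last exact: mx_normrE.
split=> [xe i|xe].
  by apply: le_trans xe; rewrite (le_bigmax _ (fun ij => `|x ij.1 ij.2|) (0, i)).
by apply/bigmax_leP; split => // -[j i] _ /=; rewrite ord1.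
Qed.

Lemma rV_norm_ltP x (e : R) : 0 < e -> (`|x| < e) <-> (forall i, `|x 0 i| < e).
Proof.
move=> e0; rewrite (_ : `|x| = \big[Num.max/0]_ij `|x ij.1 ij.2|); last exact: mx_normrE.
split=> [xe i|xe].
  by apply: le_lt_trans xe; rewrite (le_bigmax _ (fun ij => `|x ij.1 ij.2|) (0, i)).
by apply/bigmax_ltP; split => // -[j i] _ /=; rewrite ord1.
Qed.

Lemma E_normE z : `|z| = Num.max `|z.1| `|z.2|.
Proof. exact: prod_normE. Qed.

Lemma E_norm_ltP z e : 0 < e ->
  (`|z| < e) <-> (`|z.1| < e /\ forall i, `|z.2 0 i| < e).
Proof.
move=> e0; rewrite E_normE gt_max; split.
  by move=> /andP[-> /(rV_norm_ltP _ e0) h].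
by move=> [-> h]/=; apply/(rV_norm_ltP _ e0).
Qed.

Lemma E_norm1 z : `|z.1| <= `|z|.
Proof. by rewrite E_normE le_max lexx. Qed.

Lemma E_norm2 z : `|z.2| <= `|z|.
Proof. by rewrite E_normE le_max lexx orbT. Qed.

Lemma rV_coord_le x i : `|x 0 i| <= `|x|.
Proof. by move: i; apply/rV_norm_leP. Qed.

Lemma coord_cts i : continuous (fun x : 'rV[R]_d => x 0 i).
Proof. exact: coord_continuous. Qed.

Lemma E_fst_cts : continuous (fun z : R * 'rV[R]_d => z.1).
Proof. by move=> z; exact: cvg_fst. Qed.

Lemma E_snd_cts : continuous (fun z : R * 'rV[R]_d => z.2).
Proof. by move=> z; exact: cvg_snd. Qed.

Lemma E_coord_cts i : continuous (fun z : R * 'rV[R]_d => z.2 0 i).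
Proof.
move=> z; apply: (continuous_comp (g := fun x : 'rV[R]_d => x 0 i)).
  exact: cvg_snd.
exact: coord_cts.
Qed.

End norms.

Section open_measurable.
Context {R : realType} {d : nat}.
Local Notation E := (R * 'rV[R]_d)%type.

Lemma measurable_coord i : measurable_fun setT (fun x : 'rV[R]_d => x 0 i).
Proof. exact: measurable_mx_entry. Qed.

Lemma measurable_Ecoord i : measurable_fun setT (fun z : E => z.2 0 i).
Proof. exact: (measurableT_comp (measurable_coord i) measurable_snd). Qed.

Lemma measurable_box (A : set R) (B : 'I_d -> set R) : measurable A ->
  (forall i, measurable (B i)) ->
  measurable [set z : E | A z.1 /\ forall i, B i (z.2 0 i)].
Proof.
move=> mA mB.
have -> : [set z : E | A z.1 /\ forall i, B i (z.2 0 i)] =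
    (fst @^-1` A) `&` \bigcap_(i in [set: 'I_d]) ((fun z : E => z.2 0 i) @^-1` B i).
  by apply/seteqP; split => z /= [? h]; split => // i; [move=> _|]; exact: h.
apply: measurableI.
  by rewrite -[X in measurable X]setTI; exact: (@measurable_fst _ _ R 'rV[R]_d).
apply: fin_bigcap_measurable => // i _.
by rewrite -[X in measurable X]setTI; exact: measurable_Ecoord.
Qed.

Lemma measurable_Eball (z : E) e : 0 < e -> measurable [set y : E | `|z - y| < e].
Proof.
move=> e0.
have -> : [set y : E | `|z - y| < e] =
   [set y : E | [set t | `|z.1 - t| < e] y.1 /\
       forall i, [set t | `|z.2 0 i - t| < e] (y.2 0 i)].
  apply/seteqP; split => y /=.
    by move=> /(E_norm_ltP _ e0)[? h]; split => // i; move: (h i); rewrite !mxE.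
  by move=> [? h]; apply/(E_norm_ltP _ e0); split => // i; rewrite !mxE.
have mB t : measurable [set s : R | `|t - s| < e].
  exact: measurable_realfun.measurable_ball.
exact: (measurable_box (mB z.1) (fun i => mB (z.2 0 i))).
Qed.

Lemma rat_near (x e : R) : 0 < e -> exists q : rat, `|x - ratr q| < e.
Proof.
move=> e0; have [] := @dense_rat R (ball x e).
- by exists x; exact: ballxx.
- exact: ball_open.
- by move=> y [xe [q _ qy]]; exists q; move: xe; rewrite -qy.
Qed.

(** The open boxes with rational centres and radii [1 / (n + 1)] form a countable
    base of the topology, and boxes are products of intervals. *)
Lemma open_measurable_E (U : set E) : open U -> measurable U.
Proof.
move=> oU.
pose Q : countType := ((rat * 'rV[rat]_d) * nat)%type.
pose c (i : Q) : E := (ratr i.1.1, map_mx ratr i.1.2).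
pose B (i : Q) : set E := [set y | `|c i - y| < i.2.+1%:R^-1].
pose F (i : Q) := if `[< B i `<=` U >] then B i else set0.
have -> : U = \bigcup_i F i.
  apply/seteqP; split => z; last first.
    by move=> [i _]; rewrite /F; case: asboolP => // h; exact: h.
  move=> Uz; move: (oU); rewrite openE => /(_ _ Uz) /nbhs_ballP[e /= e0 eU].
  have [n _ ne] : exists2 n : nat, True & n.+1%:R^-1 < e / 2.
    exists (Num.truncn (e / 2)^-1) => //.
    rewrite invf_plt ?posrE ?divr_gt0//; exact: truncnS_gt.
  have n0 : (0 : R) < n.+1%:R^-1 by rewrite invr_gt0 ltr0n.
  have [q1 hq1] := rat_near z.1 n0.
  have /choice[q2 hq2] : forall i, exists q : rat, `|z.2 0 i - ratr q| < n.+1%:R^-1.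
    by move=> i; exact: rat_near.
  pose i : Q := ((q1, \row_i q2 i), n).
  have Bz : B i z.
    apply/(E_norm_ltP _ n0); split; first by rewrite /= distrC.
    by move=> j; rewrite !mxE distrC.
  exists i => //; rewrite /F; case: asboolP => // -[] y By; apply: eU.
  rewrite ball_prod_normE /ball_ /= (_ : z - y = (z - c i) + (c i - y)).
    apply: le_lt_trans (ler_normD _ _) _; rewrite [e in ltRHS]splitr.
    apply: ltrD; first by rewrite distrC (lt_trans Bz).
    exact: lt_trans By _.
  by rewrite addrA subrK.
apply: countable_bigcupT_measurable; first exact: countableP.
move=> i; rewrite /F; case: asboolP => // _; apply: measurable_Eball.
by rewrite invr_gt0 ltr0n.
Qed.

Lemma closed_measurable_E (A : set E) : closed A -> measurable A.
Proof.
by move=> cA; rewrite -[A]setCK; apply: measurableC; apply: open_measurable_E;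
  exact: closed_openC.
Qed.

Lemma compact_measurable_E (A : set E) : compact A -> measurable A.
Proof.
move=> cA; apply: closed_measurable_E; exact: compact_closed.
Qed.

Lemma measurable_snd_section (A : set 'rV[R]_d) :
  measurable ((snd : E -> _) @^-1` A) -> measurable A.
Proof.
move=> mA; have := @measurable_pair1 _ _ R 'rV[R]_d 0.
move/(_ _ _ mA); rewrite setTI; exact.
Qed.

Lemma open_measurable_rV (A : set 'rV[R]_d) : open A -> measurable A.
Proof.
move=> oA; apply: measurable_snd_section; apply: open_measurable_E.
apply: open_comp oA => z _; exact: cvg_snd.
Qed.

Lemma compact_measurable_rV (A : set 'rV[R]_d) : compact A -> measurable A.
Proof.
move=> cA; rewrite -[A]setCK; apply: measurableC; apply: open_measurable_rV.
by apply: closed_openC; exact: compact_closed.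
Qed.

Lemma cts_measurable_E (f : E -> R) : continuous f -> measurable_fun setT f.
Proof.
move=> cf; apply: (measurability _ (RGenOpens.measurableE R)).
move=> _ [_ [a [b ->]] <-]; rewrite setTI; apply: open_measurable_E.
by apply: open_comp; [move=> z _; exact: cf|exact: interval_open].
Qed.

Lemma cts_measurable_rV (f : 'rV[R]_d -> R) : continuous f -> measurable_fun setT f.
Proof.
move=> cf; apply: (measurability _ (RGenOpens.measurableE R)).
move=> _ [_ [a [b ->]] <-]; rewrite setTI; apply: open_measurable_rV.
by apply: open_comp; [move=> z _; exact: cf|exact: interval_open].
Qed.

End open_measurable.

Section translation.
Context {R : realType}.
Local Open Scope ereal_scope.

Lemma leb1_shift (c : R) (A : set R) : measurable A ->
  leb1 [set x | A (x + c)%R] = leb1 A.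
Proof.
move=> mA.
have mphi : measurable_fun setT (fun x : measurableTypeR R => (x + c)%R : measurableTypeR R).
  exact: measurable_funD.
pose mu := measure_function_pushforward__canonical__measure_function_Measure
  (@lebesgue_measure R) mphi.
rewrite /leb1 [RHS](@lebesgue_measure_unique _ mu)// => X [[a b] _ <-].
rewrite [RHS](_ : _ = lebesgue_measure `](a - c)%R, (b - c)%R]%classic); last first.
  congr (lebesgue_measure _); apply/seteqP; split => x /=;
  by rewrite !in_itv/= ltrBlDr lerBrDr.
rewrite !lebesgue_measure_itv/= !lte_fin ltrD2r; case: ifP => // _.
by rewrite -!EFinD; congr EFin; rewrite opprB addrA subrK.
Qed.

Lemma ge0_leb1_shift (c : R) (f : R -> \bar R) : measurable_fun setT f ->
  (forall x, 0 <= f x) -> \int[leb1]_x f (x + c)%R = \int[leb1]_x f x.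
Proof.
move=> mf f0.
have mphi : measurable_fun setT (fun x : R => (x + c)%R) by exact: measurable_funD.
rewrite -[LHS](@ge0_integral_pushforward _ _ _ _ _ _ mphi leb1 setT f)//.
pose mu := measure_function_pushforward__canonical__measure_function_Measure
  leb1 mphi.
transitivity (\int[mu]_y f y) => //.
apply: eq_measure_integral => A mA _.
exact: leb1_shift.
Qed.

Lemma ge0_lebSE (d : nat) (f : 'rV[R]_d.+1 -> \bar R) : measurable_fun setT f ->
  (forall x, 0 <= f x) ->
  \int[leb d.+1]_x f x = \int[leb1]_t \int[leb d]_y f (rV_cons (t, y)).
Proof.
move=> mf f0.
rewrite [LHS](@ge0_integral_pushforward _ _ _ _ _ _ (@measurable_rV_cons R d)
  (leb1 \x leb d) setT f)//.
rewrite preimage_setT (fubini_tonelli1 (f \o @rV_cons R d))//.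
  exact: measurableT_comp mf (@measurable_rV_cons R d).
by move=> x /=.
Qed.

Lemma measurable_shift_rV d (c : 'rV[R]_d) : measurable_fun setT (fun x : 'rV[R]_d => (x + c)%R).
Proof.
apply/measurable_fun_mxP => i j; under eq_fun do rewrite mxE.
by apply: measurable_funD => //; exact: measurable_mx_entry.
Qed.

Lemma rV_consD d (t : R) (y : 'rV[R]_d) (c : 'rV[R]_d.+1) :
  (rV_cons (t, y) + c = rV_cons (t + (rV_uncons c).1, y + (rV_uncons c).2))%R.
Proof.
have uncK (x : 'rV[R]_d.+1) : rV_cons (rV_uncons x) = x.
  rewrite /rV_cons /rV_uncons /=.
  have -> : (x 0%R 0%R)%:M = lsubmx (x : 'rV[R]_(1 + d)).
    apply/matrixP => i j; rewrite !ord1 !mxE mulr1n; congr (x _ _); exact/val_inj.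
  exact: (@hsubmxK _ 1 1 d).
rewrite -{1}(uncK c) /rV_cons /= (@add_row_mx _ 1 1 d).
by rewrite raddfD.
Qed.

(** By induction on the dimension, as the measure of dimension [d + 1] is the
    product of the measures of dimensions 1 and [d]. *)
Lemma ge0_leb_shift d (c : 'rV[R]_d) (f : 'rV[R]_d -> \bar R) :
  measurable_fun setT f -> (forall x, 0 <= f x) ->
  \int[leb d]_x f (x + c)%R = \int[leb d]_x f x.
Proof.
elim: d c f => [|d ih] c f mf f0.
  apply: eq_integral => x _; congr f; apply/matrixP => i; by case.
have mfc : measurable_fun setT (fun x : 'rV[R]_d.+1 => f (x + c)%R).
  exact: measurableT_comp mf (measurable_shift_rV c).
rewrite (ge0_lebSE mf f0) (ge0_lebSE mfc (fun x => f0 _)).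
have mg : measurable_fun setT (fun p : R * 'rV[R]_d => f (rV_cons p)).
  exact: measurableT_comp mf (@measurable_rV_cons R d).
transitivity (\int[leb1]_t \int[leb d]_y f (rV_cons ((t + (rV_uncons c).1)%R, y))).
  apply: eq_integral => t _; under eq_integral do rewrite rV_consD.
  rewrite (ih _ (fun y => f (rV_cons ((t + (rV_uncons c).1)%R, y))))//.
  exact: (measurableT_comp mg (measurable_pair1 _)).
apply: (@ge0_leb1_shift _ (fun t => \int[leb d]_y f (rV_cons (t, y)))).
  exact: (@measurable_fun_fubini_tonelli_F _ _ _ _ _ (leb d) (fun p => f (rV_cons p))).
by move=> t; exact: integral_ge0.
Qed.

Context {d : nat}.
Local Notation E := (R * 'rV[R]_d)%type.

Lemma ge0_lebQE (f : E -> \bar R) : measurable_fun setT f -> (forall x, 0 <= f x) ->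
  \int[@lebQ R d]_z f z = \int[leb1]_t \int[leb d]_y f (t, y).
Proof. by move=> mf f0; rewrite -fubini_tonelli1. Qed.

Lemma ge0_lebQ_shift (c : E) (f : E -> \bar R) :
  measurable_fun setT f -> (forall x, 0 <= f x) ->
  \int[@lebQ R d]_z f (z + c)%R = \int[@lebQ R d]_z f z.
Proof.
move=> mf f0.
have ms : measurable_fun setT (fun z : E => (z + c)%R).
  apply: measurable_fun_pair => /=.
    by apply: measurable_funD.
  exact: (measurableT_comp (measurable_shift_rV c.2) measurable_snd).
rewrite (ge0_lebQE mf f0) (ge0_lebQE (measurableT_comp mf ms) (fun x => f0 _)).
rewrite -[RHS](@ge0_leb1_shift c.1); first last.
- by move=> t; exact: integral_ge0.
- exact: (@measurable_fun_fubini_tonelli_F _ _ _ _ _ (leb d) f).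
apply: eq_integral => t _.
rewrite -[RHS](@ge0_leb_shift d c.2)//.
exact: (measurableT_comp mf (measurable_pair1 _)).
Qed.

Lemma lebQ_shift (c : E) (f : E -> R) : measurable_fun setT f ->
  (\int[@lebQ R d]_z f (z + c) = \int[@lebQ R d]_z f z)%R.
Proof.
move=> mf; rewrite /Rintegral; congr fine.
rewrite integralE [RHS]integralE; congr (_ - _).
  have mp : measurable_fun setT (fun z => (f z)%:E)^\+.
    by apply: measurable_funepos; exact/measurable_EFinP.
  rewrite -[RHS](@ge0_lebQ_shift c _ mp)//.
  by apply: eq_integral => z _; rewrite !funeposE.
have mn : measurable_fun setT (fun z => (f z)%:E)^\-.
  by apply: measurable_funeneg; exact/measurable_EFinP.
rewrite -[RHS](@ge0_lebQ_shift c _ mn)//.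
by apply: eq_integral => z _; rewrite !funenegE.
Qed.

End translation.

Section box_measure.
Context {R : realType}.

Lemma closed_norm_le (V : normedModType R) (r : R) : closed [set x : V | `|x| <= r].
Proof.
apply: (@preimage_closed V R (fun x : V => `|x|) [set s | s <= r]).
  by move=> x _; exact: norm_continuous.
exact: closed_le.
Qed.

Lemma leb1_itv (a b : R) : a <= b -> leb1 `[a, b]%classic = (b - a)%:E.
Proof.
rewrite /leb1 lebesgue_measure_itv/= lte_fin le_eqVlt.
by move=> /predU1P[->|->]; rewrite ?ltxx ?subrr.
Qed.

Lemma leb_box d (a b : R) : (a < b) ->
  leb d [set x : 'rV[R]_d | forall i, x 0 i \in `[a, b]] = ((b - a) ^+ d)%:E.
Proof.
move=> ab; elim: d => [|d ih].
  rewrite expr0 /leb /= diracE mem_set//; by move=> /= -[].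
have E : @rV_cons R d @^-1` [set x : 'rV[R]_d.+1 | forall i, x 0 i \in `[a, b]] =
    `[a, b]%classic `*` [set x : 'rV[R]_d | forall i, x 0 i \in `[a, b]].
  apply/seteqP; split => -[t y] /=.
    move=> h; split.
      have := h (lshift d (0 : 'I_1)).
      by rewrite /rV_cons (@row_mxEl _ 1 1 d) mxE mulr1n.
    move=> i; have := h (rshift 1 i).
    by rewrite /rV_cons (@row_mxEr _ 1 1 d).
  move=> [ht hy] i; rewrite -(splitK (i : 'I_(1 + d))).
  case: (fintype.split _) => k /=.
    by rewrite /rV_cons (@row_mxEl _ 1 1 d) ord1 mxE mulr1n.
  by rewrite /rV_cons (@row_mxEr _ 1 1 d).
have mB : measurable [set x : 'rV[R]_d | forall i, x 0 i \in `[a, b]].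
  have -> : [set x : 'rV[R]_d | forall i, x 0 i \in `[a, b]] =
     \bigcap_(i in [set: 'I_d]) ((fun z : 'rV[R]_d => z 0 i) @^-1` `[a, b]%classic).
    by apply/seteqP; split => x /= h i; [move=> _|]; exact: h.
  apply: fin_bigcap_measurable => // i _.
  by rewrite -[X in measurable X]setTI; exact: measurable_coord.
rewrite [LHS](_ : _ = (leb1 \x leb d)%E (@rV_cons R d @^-1`
  [set x : 'rV[R]_d.+1 | forall i, x 0 i \in `[a, b]]))// E.
rewrite product_measure1E//.
transitivity (leb1 `[a, b]%classic *
  leb d [set x : 'rV[R]_d | forall i, (x 0 i \in `[a, b])%R])%E => //.
by rewrite ih leb1_itv ?ltW// -EFinM exprS.
Qed.

Lemma leb_ball_lty d n :
  (leb d [set x : 'rV[R]_d | `|x| <= n%:R]%R < +oo)%E.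
Proof.
apply: (@le_lt_trans _ _ (leb d [set x : 'rV[R]_d | forall i, x 0 i \in `[- n.+1%:R, n.+1%:R]])).
  apply: le_measure; rewrite ?inE.
  - apply: compact_measurable_rV; apply: bounded_closed_compact.
      by exists n%:R; split; [exact: num_real|move=> M nM x /= xn; exact/ltW/(le_lt_trans xn)].
    exact: closed_norm_le.
  - apply: compact_measurable_rV.
    apply: (@rV_compact R d (fun=> `[- n.+1%:R, n.+1%:R]%classic)) => i.
    exact: segment_compact.
  - move=> x /= /rV_norm_leP h i; rewrite in_itv/= -ler_norml.
    by apply: le_trans (h _ i) _; rewrite ?ler0n// ler_nat.
by rewrite leb_box ?ltry// (@lt_trans _ _ 0)// ?oppr_lt0 ltr0n.
Qed.

Lemma lebQ_ball_lty d n :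
  (@lebQ R d [set z | `|z| <= n%:R]%R < +oo)%E.
Proof.
have mB : measurable [set x : 'rV[R]_d | `|x| <= n%:R]%R.
  apply: compact_measurable_rV; apply: bounded_closed_compact.
    by exists n%:R; split; [exact: num_real|move=> M nM x /= xn; exact/ltW/(le_lt_trans xn)].
  exact: closed_norm_le.
have -> : [set z : R * 'rV[R]_d | `|z| <= n%:R]%R =
   `[- n%:R, n%:R]%classic `*` [set x : 'rV[R]_d | `|x| <= n%:R]%R.
  apply/seteqP; split => z /=; rewrite E_normE ge_max in_itv/= -ler_norml.
    by move=> /andP.
  by move=> [-> ->].
rewrite [ltLHS]product_measure1E// lte_mul_pinfty//.
  rewrite [X in X \is a fin_num](_ : _ = leb1 `[- n%:R, n%:R]%classic)//.
  by rewrite leb1_itv// ge0_cp.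
exact: leb_ball_lty.
Qed.

Lemma lebQ_box_gt0 d (e : R) : (0 < e) ->
  (0 < @lebQ R d [set z | `|z| <= e]%R)%E.
Proof.
move=> e0.
have -> : [set z : R * 'rV[R]_d | `|z| <= e]%R =
   `[- e, e]%classic `*` [set x : 'rV[R]_d | forall i, x 0 i \in `[- e, e]].
  apply/seteqP; split => z /=; rewrite E_normE ge_max in_itv/= -ler_norml.
    move=> /andP[-> /rV_norm_leP h]; split=> // i.
    by rewrite in_itv/= -ler_norml h// ltW.
  move=> [-> h]; apply/rV_norm_leP; first exact: ltW.
  by move=> i; have := h i; rewrite in_itv/= -ler_norml.
have ee : (- e < e) by rewrite (@lt_trans _ _ 0)// oppr_lt0.
have mB : measurable [set x : 'rV[R]_d | forall i, x 0 i \in `[- e, e]].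
  apply: compact_measurable_rV.
  apply: (@rV_compact R d (fun=> `[- e, e]%classic)) => i.
  exact: segment_compact.
rewrite [ltRHS]product_measure1E//.
rewrite [ltRHS](_ : _ = leb1 `[(- e)%R, e]%classic *
  leb d [set x : 'rV[R]_d | forall i, (x 0 i \in `[- e, e])%R])%E//.
by rewrite leb_box// leb1_itv ?ltW// -EFinM lte_fin mulr_gt0 ?exprn_gt0// subr_gt0.
Qed.

Lemma compact_E_lty d (K : set (R * 'rV[R]_d)) : compact K ->
  (@lebQ R d K < +oo)%E.
Proof.
move=> cK; have [M [Mr MK]] := compact_bounded cK.
pose n := (Num.truncn (`|M| + 1)).+1.
apply: le_lt_trans (lebQ_ball_lty d n); apply: le_measure; rewrite ?inE.
- exact: compact_measurable_E.
- apply: closed_measurable_E.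
  exact: closed_norm_le.
- move=> x Kx /=; apply: (MK n%:R) => //.
  apply: (@lt_trans _ _ (`|M| + 1)); last exact: truncnS_gt.
  by rewrite (le_lt_trans (ler_norm _))// ltrDl.
Qed.

Lemma compact_rV_lty d (K : set 'rV[R]_d) : compact K -> (leb d K < +oo)%E.
Proof.
move=> cK; have [M [Mr MK]] := compact_bounded cK.
pose n := (Num.truncn (`|M| + 1)).+1.
apply: le_lt_trans (leb_ball_lty d n); apply: le_measure; rewrite ?inE.
- exact: compact_measurable_rV.
- apply: compact_measurable_rV; apply: bounded_closed_compact.
    by exists n%:R; split; [exact: num_real|move=> N nN x /= xn; exact/ltW/(le_lt_trans xn)].
  exact: closed_norm_le.
- move=> x Kx /=; apply: (MK n%:R) => //.
  apply: (@lt_trans _ _ (`|M| + 1)); last exact: truncnS_gt.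
  by rewrite (le_lt_trans (ler_norm _))// ltrDl.
Qed.

End box_measure.

(** * Compactly supported functions and convolution *)

Section uniform.
Context {R : realType} {V : normedModType R}.

(** Heine's theorem. *)
Lemma compact_unif_cts (K : set V) (f : V -> R) : compact K ->
  {within K, continuous f} -> forall e, 0 < e -> exists2 del, 0 < del &
  forall x y, K x -> K y -> `|x - y| < del -> `|f x - f y| <= e.
Proof.
move=> /compact_near_coveringP cK /subspace_continuousP cf e e0.
have e20 : 0 < e / 2 by rewrite divr_gt0.
have H x : K x -> \forall x' \near x & i \near (0 : R)^'+,
    K x' -> forall y, K y -> `|x' - y| < i -> `|f x' - f y| <= e.
  move=> Kx; have /cvgrPdist_le/(_ _ e20) := cf _ Kx.
  rewrite near_withinE => /nbhs_ballP[r /= r0 hr].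
  have r20 : 0 < r / 2 by rewrite divr_gt0.
  exists (ball x (r / 2), [set i | i < r / 2]).
    by split => /=; [exact: nbhsx_ballx|exact: nbhs_right_lt].
  move=> [x' i] /= [xx' ir] Kx' y Ky xy.
  have h1 : `|f x - f x'| <= e / 2.
    by apply: hr => //; apply: le_ball xx'; rewrite ler_pdivrMr// ler_pMr// ler1n.
  have h2 : `|f x - f y| <= e / 2.
    apply: hr => //; rewrite -ball_normE/= (_ : x - y = (x - x') + (x' - y)).
      apply: le_lt_trans (ler_normD _ _) _; rewrite (splitr r).
      apply: ltrD; last exact: lt_trans ir.
      by move: xx'; rewrite -ball_normE.
    by rewrite addrA subrK.
  rewrite (_ : f x' - f y = (f x - f y) - (f x - f x')); last by ring.
  by rewrite (le_trans (ler_normB _ _))// (splitr e) lerD.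
have := cK _ _ (fun i x' => K x' -> forall y, K y -> `|x' - y| < i -> `|f x' - f y| <= e) _ H.
move=> h; have [i [i0 hi]] : exists i : R, 0 < i /\ forall x, K x -> K x ->
    forall y, K y -> `|x - y| < i -> `|f x - f y| <= e.
  have : \forall i \near (0:R)^'+, 0 < i /\ forall x, K x -> K x ->
      forall y, K y -> `|x - y| < i -> `|f x - f y| <= e.
    near=> i; split; first by near: i; exact: nbhs_right_gt.
    by near: i; exact: h.
  exact: filter_ex.
by exists i => // x y Kx Ky; exact: hi.
Unshelve. all: by end_near. Qed.

Lemma compact_cts_bounded (K : set V) (f : V -> R) : compact K ->
  {within K, continuous f} -> exists2 C, 0 <= C & forall x, K x -> `|f x| <= C.
Proof.
move=> cK cf; have /compact_bounded[M [Mr MK]] := continuous_compact cf cK.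
exists (`|M| + 1); first by rewrite addr_ge0.
move=> x Kx; apply: (MK (`|M| + 1)); last by exists x.
by rewrite (le_lt_trans (ler_norm _))// ltrDl.
Qed.

Definition bsupp (M : R) (f : V -> R) := forall z, M < `|z| -> f z = 0.

Lemma bsupp_le M N f : M <= N -> bsupp M f -> bsupp N f.
Proof. by move=> MN sf z Nz; apply: sf; exact: le_lt_trans Nz. Qed.

Lemma bsuppD M f v : bsupp M f -> bsupp M ('D_v f).
Proof.
move=> sf z Mz.
have E : \near z, (cst (0 : R)) z = f z.
  have : \near z, M < `|z|.
    exact: (@norm_continuous _ V z _ (lt_nbhsr Mz)).
  by apply: filterS => y My; rewrite sf.
by have [_ ->] := near_eq_is_derive E (is_derive_cst (0 : R) z v).
Qed.

Hypothesis balls_compact : forall M : R, compact [set z : V | `|z| <= M].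

Lemma cs_bounded M f : continuous f -> bsupp M f ->
  exists2 C, 0 <= C & forall z, `|f z| <= C.
Proof.
move=> cf sf; have [C C0 hC] := compact_cts_bounded (balls_compact (M := M))
  (continuous_subspaceT cf).
exists C => // z; have [zM|Mz] := leP `|z| M; first exact: hC.
by rewrite sf// normr0.
Qed.

Lemma cs_unif M f : continuous f -> bsupp M f -> forall e, 0 < e ->
  exists2 del, 0 < del & forall x y, `|x - y| < del -> `|f x - f y| <= e.
Proof.
move=> cf sf e e0; have [del d0 hd] := compact_unif_cts
  (balls_compact (M := M + 1)) (continuous_subspaceT cf) e0.
exists (Num.min del 1); first by rewrite lt_min d0 ltr01.
move=> x y; rewrite lt_min => /andP[xyd xy1].
have [xM|Mx] := leP `|x| (M + 1); last first.
  rewrite !sf ?subrr ?normr0 ?ltW//; last by rewrite (lt_trans _ Mx)// ltrDl.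
  rewrite -(ltrD2r 1); apply: (lt_le_trans Mx).
  by rewrite -{1}(subrK y x) (le_trans (ler_normD _ _))// addrC lerD2l ltW.
have [yM|My] := leP `|y| (M + 1); first exact: hd.
rewrite !sf ?subrr ?normr0 ?ltW//; first by rewrite (lt_trans _ My)// ltrDl.
rewrite -(ltrD2r 1); apply: (lt_le_trans My).
rewrite -{1}(subrK x y) (le_trans (ler_normD _ _))// addrC lerD2l distrC.
exact: ltW.
Qed.

(** By the mean value theorem the quotient is a value of [D_v f] near [z], and
    [D_v f] is uniformly continuous. *)
Lemma diffq_unif M f v : smooth f -> bsupp M f -> forall e, 0 < e ->
  exists2 del, 0 < del & forall (h : R) z, h != 0 -> `|h| < del ->
    `|h^-1 * (f (h *: v + z) - f z) - 'D_v f z| <= e.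
Proof.
move=> sm sf e e0.
have [del d0 hd] := cs_unif (smooth_cts (smoothD v sm)) (bsuppD v sf) e0.
exists (del / (`|v| + 1)); first by rewrite divr_gt0// ltr_wpDl.
move=> h z h0 hdel; have [c ch ->] := MVT_line z v h sm.
rewrite mulrC mulfK//; apply: hd.
rewrite addrK normrZ; move: hdel; rewrite ltr_pdivlMr ?ltr_wpDl// => hdel.
apply: le_lt_trans hdel; apply: ler_pM => //.
by rewrite lerDl.
Qed.

End uniform.

Section E_theory.
Context {R : realType} {d : nat}.
Local Notation E := (R * 'rV[R]_d)%type.
Local Notation mQ := (@lebQ R d).
Local Notation int1 f := (mQ.-integrable setT (EFin \o f)).

Lemma E_balls_compact (M : R) : compact [set z : E | `|z| <= M].
Proof.
have -> : [set z : E | `|z| <= M] =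
   `[- M, M]%classic `*` [set x : 'rV[R]_d | `|x| <= M].
  apply/seteqP; split => z /=; rewrite E_normE ge_max in_itv/= -ler_norml.
    by move=> /andP.
  by move=> [-> ->].
apply: compact_setX; first exact: segment_compact.
apply: bounded_closed_compact; last exact: closed_norm_le.
by exists M; split; [exact: num_real|move=> N nM x /= xn; exact/ltW/(le_lt_trans xn)].
Qed.

Lemma rV_balls_compact (M : R) : compact [set x : 'rV[R]_d | `|x| <= M].
Proof.
apply: bounded_closed_compact; last exact: closed_norm_le.
by exists M; split; [exact: num_real|move=> N nM x /= xn; exact/ltW/(le_lt_trans xn)].
Qed.

Lemma ball_fin (M : R) : (mQ [set z | `|z| <= M]%R < +oo)%E.
Proof. exact/compact_E_lty/E_balls_compact. Qed.

Lemma measurable_ballE (M : R) : measurable [set z : E | `|z| <= M].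
Proof. by apply: compact_measurable_E; exact: E_balls_compact. Qed.

Lemma bsupp_int (M C : R) (f : E -> R) : measurable_fun setT f -> bsupp M f ->
  (forall z, `|f z| <= C) -> int1 f /\ `|\int[mQ]_z f z| <= C * fine (mQ [set z | `|z| <= M]).
Proof.
move=> mf sf fC.
have C0 : 0 <= C by exact: le_trans (fC 0).
have iI : int1 (fun z => C * \1_[set z : E | `|z| <= M] z).
  by apply: int1Z; apply: indic_int1; [exact: measurable_ballE|exact: ball_fin].
have fI z : `|f z| <= C * \1_[set z : E | `|z| <= M] z.
  rewrite indicE; have [zM|Mz] := leP `|z| M.
    by rewrite mem_set// mulr1.
  by rewrite sf// normr0 mulr_ge0.
have if1 : int1 f by exact: le_integrableT mf iI fI.
split => //; apply: le_trans (le_Rint_norm if1 iI fI) _.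
rewrite RintZ; last by apply: indic_int1; [exact: measurable_ballE|exact: ball_fin].
by rewrite /Rintegral integral_indic ?setIT//; exact: measurable_ballE.
Qed.

Lemma cs_int1 M (f : E -> R) : continuous f -> bsupp M f -> int1 f.
Proof.
move=> cf sf; have [C C0 fC] := cs_bounded E_balls_compact cf sf.
by have [] := bsupp_int (cts_measurable_E cf) sf fC.
Qed.

Lemma cs_L2 M (f : E -> R) : continuous f -> bsupp M f -> L2 mQ setT f.
Proof.
move=> cf sf; apply: L2_of_sq; first exact: cts_measurable_E.
have := @cs_int1 M (fun z => f z ^+ 2); apply.
  move=> z; rewrite (_ : (fun z => f z ^+ 2) = (fun z => f z * f z)).
    by apply: cvgM; exact: cf.
  by apply/funext => y; rewrite expr2.
by move=> z /sf ->; rewrite expr0n.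
Qed.

(** Differentiating the translation invariance of the integral. *)
Lemma int_derive0 M (f : E -> R) v : smooth f -> bsupp M f ->
  \int[mQ]_z 'D_v f z = 0.
Proof.
move=> sf bf; set I := (X in X = _).
pose N := M + `|v|; pose m := fine (mQ [set z | `|z| <= N]).
have m0 : 0 <= m by rewrite fine_ge0.
suff H e : 0 < e -> `|I| <= e * m.
  apply/eqP; rewrite -normr_le0; apply/ler_addgt0Pl => e e0; rewrite addr0.
  have m1 : 0 < m + 1 by rewrite ltr_wpDl.
  apply: le_trans (H (e / (m + 1)) _) _; first by rewrite divr_gt0.
  by rewrite mulrAC ler_pdivrMr// ler_wpM2l ?ltW// ltrDl.
move=> e0; have [del d0 hd] := diffq_unif E_balls_compact v sf bf e0.
pose h := Num.min (del / 2) 1.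
have h0 : 0 < h by rewrite lt_min divr_gt0//=.
have h1 : h <= 1 by rewrite ge_min lexx orbT.
have hdel : `|h| < del.
  rewrite gtr0_norm// gt_min ltr_pdivrMr// mulr_natr mulr2n ltrDl d0//.
have cf := smooth_cts sf.
have if1 := cs_int1 cf bf.
have mshift : measurable_fun setT (fun z => f (h *: v + z)).
  apply: cts_measurable_E => z; apply: (continuous_comp (f := fun z => h *: v + z)).
    by apply: cvgD; [exact: cvg_cst|exact: cvg_id].
  exact: cf.
have bshift : bsupp N (fun z => f (h *: v + z)).
  move=> z Nz; apply: bf; rewrite -(ltrD2r `|v|); apply: (lt_le_trans Nz).
  have : `|z| <= `|h *: v + z| + `|h *: v|.
    by rewrite -{1}(addKr (h *: v) z) addrC (le_trans (ler_normD _ _))// normrN.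
  move/le_trans; apply; rewrite lerD2l normrZ gtr0_norm// ler_piMl//.
have ish : int1 (fun z => f (h *: v + z)).
  have [C C0 fC] := cs_bounded E_balls_compact cf bf.
  by have [] := bsupp_int mshift bshift (fun z => fC _).
have Q0 : \int[mQ]_z (h^-1 * (f (h *: v + z) - f z)) = 0.
  rewrite RintZ; last exact: int1B.
  rewrite RintB//.
  rewrite (_ : \int[mQ]_z f (h *: v + z) = \int[mQ]_z f z) ?subrr ?mulr0//.
  rewrite -[RHS](lebQ_shift (h *: v)); last exact: cts_measurable_E.
  by apply: eq_Rintegral => z _; rewrite addrC.
have iq : int1 (fun z => h^-1 * (f (h *: v + z) - f z)) by apply: int1Z; exact: int1B.
have iD : int1 ('D_v f) by apply: (cs_int1 (smooth_cts (smoothD v sf)) (bsuppD v bf)).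
rewrite -normrN -[- I]add0r -{1}Q0 /I -RintB//.
have bN : bsupp N f by apply: bsupp_le bf; rewrite lerDl.
have [] := @bsupp_int N e (fun z => h^-1 * (f (h *: v + z) - f z) - 'D_v f z).
- exact: int1_measurable (int1B iq iD).
- by move=> z Nz; rewrite bshift// bN// (bsuppD v bN)// subrr mulr0 subrr.
- by move=> z; apply: hd; rewrite ?gt_eqF.
by move=> _; exact.
Qed.

Lemma int_by_parts M (f g : E -> R) v : smooth f -> smooth g -> bsupp M f ->
  \int[mQ]_z (g z * 'D_v f z) = - \int[mQ]_z ('D_v g z * f z).
Proof.
move=> sf sg bf; apply/eqP; rewrite -subr_eq0 opprK; apply/eqP.
have cDf := smooth_cts (smoothD v sf); have cDg := smooth_cts (smoothD v sg).
have bDf := bsuppD v bf.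
rewrite -RintD.
- rewrite -[RHS](@int_derive0 M (fun z => g z * f z) v).
  + by apply: eq_Rintegral => z _; rewrite derive_mul//; congr (_ + _); rewrite mulrC.
  + exact: smooth_mul.
  + by move=> z /bf ->; rewrite mulr0.
- apply: (@cs_int1 M); last by move=> z /bDf ->; rewrite mulr0.
  by move=> z; apply: cvgM; [exact: smooth_cts|exact: cDf].
- apply: (@cs_int1 M); last by move=> z /bf ->; rewrite mulr0.
  by move=> z; apply: cvgM; [exact: cDg|exact: smooth_cts].
Qed.

(** ** Convolution *)

Definition conv (k g : E -> R) (z : E) : R := \int[mQ]_y (k (z - y) * g y).

Lemma sub_cts (z : E) : continuous (fun y : E => z - y).
Proof.
move=> y; apply: cvgB; [exact: cvg_cst|exact: cvg_id].
Qed.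

Lemma conv_int1 (M : R) k g z : continuous k -> bsupp M k -> int1 g ->
  int1 (fun y => k (z - y) * g y).
Proof.
move=> ck bk ig; have [C C0 kC] := cs_bounded E_balls_compact ck bk.
apply: (int1_bounded ig); last by move=> y; exact: kC.
apply: cts_measurable_E => y; apply: continuous_comp; last exact: ck.
exact: sub_cts.
Qed.

Lemma conv_cts (M : R) k g : continuous k -> bsupp M k -> int1 g -> continuous (conv k g).
Proof.
move=> ck bk ig z; apply/cvgrPdist_le => e e0.
pose I := \int[mQ]_y `|g y|.
have I0 : 0 <= I by apply: Rintegral_ge0.
have I1 : 0 < I + 1 by rewrite ltr_wpDl.
have [del d0 hd] := cs_unif E_balls_compact ck bk (divr_gt0 e0 I1).
near=> z'.
have zz' : `|z - z'| < del by near: z'; exact: cvgr_dist_lt.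
rewrite /conv -RintB; [|exact: conv_int1 ck bk ig..].
apply: (@le_trans _ _ (\int[mQ]_y (e / (I + 1) * `|g y|))).
  apply: le_Rint_norm.
  - by apply: int1B; exact: conv_int1 ck bk ig.
  - exact/int1Z/int1_norm.
  move=> y; rewrite -mulrBl normrM ler_wpM2r//; apply: hd.
  by rewrite opprB addrA subrK.
rewrite RintZ; last exact: int1_norm.
by rewrite -/I mulrAC ler_pdivrMr// ler_wpM2l ?ltW// ltrDl.
Unshelve. all: by end_near. Qed.

(** The difference quotients of [k] converge uniformly, so that the integral of
    their product with an integrable [g] converges. *)
Lemma conv_is_derive (M : R) k g v z : smooth k -> bsupp M k -> int1 g ->
  is_derive z v (conv k g) (conv ('D_v k) g z).
Proof.
move=> sk bk ig; have ck := smooth_cts sk.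
have cDk := smooth_cts (smoothD v sk); have bDk := bsuppD v bk.
pose I := \int[mQ]_y `|g y|.
have I0 : 0 <= I by apply: Rintegral_ge0.
have I1 : 0 < I + 1 by rewrite ltr_wpDl.
have cv : h^-1 *: ((conv k g \o shift z) (h *: v) - conv k g z) @[h --> (0 : R)^']
    --> conv ('D_v k) g z.
  apply/cvgrPdist_le => e e0.
  have [del d0 hd] := diffq_unif E_balls_compact v sk bk (divr_gt0 e0 I1).
  near=> h.
  have hdel : `|h| < del by near: h; exact: dnbhs0_lt.
  have h0 : h != 0 by near: h; exact: nbhs_dnbhs_neq.
  rewrite distrC /= /GRing.scale /=.
  have c1 := conv_int1 (h *: v + z) ck bk ig; have c2 := conv_int1 z ck bk ig.
  have c3 := conv_int1 z cDk bDk ig.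
  rewrite /conv -RintB// -RintZ; last exact: int1B.
  rewrite -RintB//; last by apply: int1Z; exact: int1B.
  apply: (@le_trans _ _ (\int[mQ]_y (e / (I + 1) * `|g y|))).
    apply: le_Rint_norm.
    - by apply: int1B => //; apply: int1Z; exact: int1B.
    - exact/int1Z/int1_norm.
    move=> y; rewrite -mulrBl mulrA -mulrBl normrM ler_wpM2r//.
    have -> : h *: v + z - y = h *: v + (z - y) by rewrite addrA.
    exact: hd.
  rewrite RintZ; last exact: int1_norm.
  by rewrite -/I mulrAC ler_pdivrMr// ler_wpM2l ?ltW// ltrDl.
by split; [apply/cvg_ex; eexists; exact: cv|exact/cvg_lim].
Unshelve. all: by end_near. Qed.

Lemma conv_smooth (M : R) k g : smooth k -> bsupp M k -> int1 g -> smooth (conv k g).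
Proof.
move=> sk bk ig.
apply: (@smooth_class _ _ (fun f => exists k', [/\ smooth k', bsupp M k' & f = conv k' g])).
- by move=> _ [k' [sk' bk' ->]]; exact: conv_cts (smooth_cts sk') bk' ig.
- move=> _ [k' [sk' bk' ->]] v; exists (conv ('D_v k') g); split.
    exists ('D_v k'); split; [exact: smoothD|exact: bsuppD|by []].
  by move=> x; exact: conv_is_derive bk' ig.
- by exists k.
Qed.

Lemma conv_supp (M : R) k g (A : set E) : bsupp M k -> (forall y, ~ A y -> g y = 0) ->
  forall z, (forall y, A y -> M < `|z - y|) -> conv k g z = 0.
Proof.
move=> bk Ag z zA; rewrite /conv (@eq_Rintegral _ _ _ _ _ (cst 0)).
  by rewrite Rintegral_cst// mul0r.
move=> y _; have [Ay|nAy] := pselect (A y); first by rewrite bk ?mul0r//; exact: zA.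
by rewrite Ag// mulr0.
Qed.

End E_theory.

(** * Bumps on boxes generate everything *)

Section bumps.
Context {R : realType} {d : nat}.
Local Notation E := (R * 'rV[R]_d)%type.

Definition bt (k a b t : R) : R := gz 0 (k * (t - a)) * gz 0 (k * (b - t)).

Definition bx (k : R) (a b x : 'rV[R]_d) : R :=
  \prod_(i < d) bt k (a 0 i) (b 0 i) (x 0 i).

(** The tensor product of one-dimensional bumps; it increases to the indicator of
    the box as [k] grows. *)
Definition bE (k : R) (a b z : E) : R := bt k a.1 b.1 z.1 * bx k a.2 b.2 z.2.

Definition box (a b : E) : set E :=
  [set z : E | a.1 < z.1 < b.1 /\ forall i, a.2 0 i < z.2 0 i < b.2 0 i].

Lemma bt_ge0 k a b t : 0 <= bt k a b t.
Proof. by rewrite mulr_ge0 ?gz_ge0. Qed.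

Lemma bt_le1 k a b t : bt k a b t <= 1.
Proof. by rewrite mulr_ile1 ?gz_ge0 ?gz0_le1. Qed.

Lemma bt_gt0 k a b t : 0 < k -> a < t < b -> 0 < bt k a b t.
Proof. by move=> k0 /andP[ta tb]; rewrite mulr_gt0 ?gz0_gt0 ?mulr_gt0 ?subr_gt0. Qed.

Lemma bt_out k a b t : 0 < k -> ~~ (a < t < b) -> bt k a b t = 0.
Proof.
move=> k0; rewrite negb_and -!leNgt => /orP[ta|bt'].
  by rewrite /bt gz_neg ?mul0r// pmulr_rle0// subr_le0.
by rewrite /bt [X in _ * X]gz_neg ?mulr0// pmulr_rle0// subr_le0.
Qed.

Lemma bx_ge0 k a b x : 0 <= bx k a b x.
Proof. by apply: prodr_ge0 => i _; exact: bt_ge0. Qed.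

Lemma bx_le1 k a b x : bx k a b x <= 1.
Proof.
suff /andP[] : 0 <= bx k a b x <= 1 by [].
apply: (big_ind (fun r : R => 0 <= r <= 1)).
- by rewrite ler01 lexx.
- by move=> p q /andP[p0 p1] /andP[q0 q1]; rewrite mulr_ge0// mulr_ile1.
- by move=> i _; rewrite bt_ge0 bt_le1.
Qed.

Lemma bx_out k (a b x : 'rV[R]_d) : 0 < k -> ~ (forall i, a 0 i < x 0 i < b 0 i) -> bx k a b x = 0.
Proof.
move=> k0 /existsNP[i /negP h]; rewrite /bx (bigD1 i)//= bt_out ?mul0r//.
Qed.

Lemma bE_ge0 k a b z : 0 <= bE k a b z.
Proof. by rewrite mulr_ge0 ?bt_ge0 ?bx_ge0. Qed.

Lemma bE_le1 k a b z : bE k a b z <= 1.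
Proof. by rewrite mulr_ile1 ?bt_ge0 ?bx_ge0 ?bt_le1 ?bx_le1. Qed.

Lemma bE_norm k a b z : `|bE k a b z| <= 1.
Proof. by rewrite ger0_norm ?bE_ge0 ?bE_le1. Qed.

Lemma bE_out k a b z : 0 < k -> ~ box a b z -> bE k a b z = 0.
Proof.
move=> k0 h; rewrite /bE; have [h1|h1] := boolP (a.1 < z.1 < b.1).
  by rewrite bx_out ?mulr0// => h2; exact: h.
by rewrite bt_out ?mul0r.
Qed.

Lemma smooth_affine (V : normedModType R) (l : V -> R) (p q : R) : continuous l ->
  (forall (h : R) x v, l (h *: v + x) = h * l v + l x) ->
  sm (fun x => p * (l x - q)) /\ sm (fun x => p * (q - l x)).
Proof.
move=> cl ll; split.
  apply: sm_mul; first exact: sm_cst.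
  by apply: sm_add; [exact: sm_lin|exact: (sm_cst (- q))].
have -> : (fun x => p * (q - l x)) = (fun x => cst p x * (cst q x + cst (-1) x * l x)).
  by apply/funext => x /=; rewrite mulN1r.
apply: sm_mul; first exact: sm_cst.
apply: sm_add; first exact: sm_cst.
by apply: sm_mul; [exact: sm_cst|exact: sm_lin].
Qed.

Lemma smooth_bt (V : normedModType R) (l : V -> R) k a b : continuous l ->
  (forall (h : R) x v, l (h *: v + x) = h * l v + l x) ->
  smooth (fun x => bt k a b (l x)).
Proof.
move=> cl ll; apply: sm_is_smooth; apply: sm_mul.
  by apply: sm_gz; exact: (smooth_affine k a cl ll).1.
by apply: sm_gz; exact: (smooth_affine k b cl ll).2.
Qed.

Lemma bt_smooth k a b : smooth (bt k a b : R -> R).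
Proof.
by apply: (@smooth_bt R id) => //; move=> h x v.
Qed.

Lemma bx_smooth k a b : smooth (bx k a b).
Proof.
apply: smooth_prod => i; apply: (@smooth_bt _ (fun x : 'rV[R]_d => x 0 i)).
  exact: coord_cts.
by move=> h x v; rewrite !mxE.
Qed.

Lemma E_fst_lin (h : R) (x v : E) : (h *: v + x).1 = h * v.1 + x.1.
Proof. by []. Qed.

Lemma E_coord_lin i (h : R) (x v : E) : (h *: v + x).2 0 i = h * v.2 0 i + x.2 0 i.
Proof. by rewrite !mxE. Qed.

Lemma bEx_smooth k a b : smooth (fun z : E => bx k a b z.2).
Proof.
apply: smooth_prod => i; apply: (@smooth_bt _ (fun z : E => z.2 0 i)).
  exact: E_coord_cts.
exact: E_coord_lin.
Qed.

Lemma bEt_smooth k a b : smooth (fun z : E => bt k a b z.1).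
Proof. by apply: (@smooth_bt _ (fun z : E => z.1)); [exact: E_fst_cts|exact: E_fst_lin]. Qed.

Lemma bE_smooth k a b : smooth (bE k a b).
Proof. by apply: smooth_mul; [exact: bEt_smooth|exact: bEx_smooth]. Qed.

Lemma bE_cts k a b : continuous (bE k a b).
Proof. exact/smooth_cts/bE_smooth. Qed.

Lemma box_bounded a b z : box a b z -> `|z| <= `|a| + `|b|.
Proof.
have H (x y r : R) : x < r < y -> `|r| <= `|x| + `|y|.
  move=> /andP[xr ry]; rewrite ler_norml; apply/andP; split.
    rewrite opprD; have := lerN2 `|x| x; have := ler_norm (- x); rewrite normrN.
    have := normr_ge0 y; lra.
  have := ler_norm y; have := normr_ge0 x; lra.
move=> [h1 h2]; rewrite E_normE ge_max; apply/andP; split.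
  by apply: le_trans (H _ _ _ h1) _; rewrite lerD ?E_norm1.
apply/rV_norm_leP; first by rewrite addr_ge0.
move=> i; apply: le_trans (H _ _ _ (h2 i)) _.
by rewrite lerD// (le_trans (rV_coord_le _ _))// E_norm2.
Qed.

Lemma bE_bsupp k a b : 0 < k -> bsupp (`|a| + `|b|) (bE k a b).
Proof.
move=> k0 z Mz; apply: bE_out => // /box_bounded.
by rewrite leNgt Mz.
Qed.

Lemma measurable_obox a b : measurable (box a b).
Proof.
have mI (x y : R) : measurable [set r : R | x < r < y].
  rewrite (_ : [set r | _] = `]x, y[%classic); first exact: measurable_itv.
  by apply/seteqP; split => r /=; rewrite in_itv.
exact: (measurable_box (mI a.1 b.1) (fun i => mI (a.2 0 i) (b.2 0 i))).
Qed.

Definition boxes : set (set E) := [set A | exists a b, A = box a b].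

Lemma boxes_setI : setI_closed boxes.
Proof.
move=> _ _ [a [b ->]] [a' [b' ->]].
exists (Num.max a.1 a'.1, \row_i Num.max (a.2 0 i) (a'.2 0 i)).
exists (Num.min b.1 b'.1, \row_i Num.min (b.2 0 i) (b'.2 0 i)).
apply/seteqP; split => z.
  move=> [[/andP[p1 p2] h] [/andP[p3 p4] h']]; split => /=.
    by rewrite gt_max lt_min p1 p2 p3 p4.
  move=> i; rewrite !mxE gt_max lt_min.
  by move: (h i) (h' i) => /andP[-> ->] /andP[-> ->].
move=> [/= h1 h2]; move: h1; rewrite gt_max lt_min => /andP[/andP[p1 p2] /andP[p3 p4]].
split; split; rewrite ?p1 ?p2 ?p3 ?p4//.
  by move=> i; have := h2 i; rewrite !mxE gt_max lt_min => /andP[/andP[-> _] /andP[-> _]].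
by move=> i; have := h2 i; rewrite !mxE gt_max lt_min => /andP[/andP[_ ->] /andP[_ ->]].
Qed.

Lemma truncn_gt_norm (x : R) : exists n : nat, x < n%:R.
Proof. by exists (Num.truncn x).+1; exact: truncnS_gt. Qed.

Lemma boxes_generate (A : set E) : measurable A -> <<s boxes >> A.
Proof.
pose T' := g_sigma_algebraType boxes.
have H1 : measurable_fun setT (fun z : T' => (z : E).1).
  apply: (measurability _ (RGenOInfty.measurableE R)).
  move=> _ [_ [x ->] <-]; rewrite setTI.
  rewrite (_ : _ @^-1` _ = \bigcup_n box (x, const_mx (- n%:R)) (n%:R, const_mx n%:R)).
    apply: sigma_algebra_bigcup => n; apply: sub_sigma_algebra; by do 2 eexists.
  apply/seteqP; split => z /=; rewrite in_itv/= andbT.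
    move=> xz; have [n hn] := truncn_gt_norm `|z|; exists n => //; split => /=.
      by rewrite xz (le_lt_trans _ hn)// (le_trans (ler_norm _))// E_norm1.
    move=> i; rewrite !mxE -ltr_norml (le_lt_trans _ hn)//.
    by rewrite (le_trans (rV_coord_le _ _))// E_norm2.
  by move=> [n _ [/= /andP[]]].
have H2 (i : 'I_d) : measurable_fun setT (fun z : T' => (z : E).2 0 i).
  apply: (measurability _ (RGenOInfty.measurableE R)).
  move=> _ [_ [x ->] <-]; rewrite setTI.
  rewrite (_ : _ @^-1` _ = \bigcup_n box (- n%:R, \row_j (if j == i then x else - n%:R))
      (n%:R, const_mx n%:R)).
    apply: sigma_algebra_bigcup => n; apply: sub_sigma_algebra; by do 2 eexists.
  apply/seteqP; split => z /=; rewrite in_itv/= andbT.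
    move=> xz; have [n hn] := truncn_gt_norm `|z|; exists n => //; split => /=.
      by rewrite -ltr_norml (le_lt_trans _ hn)// E_norm1.
    move=> j; rewrite !mxE.
    have : `|z.2 0 j| < n%:R.
      by rewrite (le_lt_trans _ hn)// (le_trans (rV_coord_le _ _))// E_norm2.
    by rewrite ltr_norml; case: eqP => [->|_] // /andP[_ ->]; rewrite xz.
  by move=> [n _ [/= _ /(_ i)]]; rewrite !mxE eqxx => /andP[].
have H : measurable_fun setT (fun z : T' => (z : E)).
  apply/measurable_fun_pairP; split => //.
  apply/measurable_fun_mxP => i j; rewrite (ord1 i); exact: H2.
by move=> mA; have := H measurableT A mA; rewrite setTI.
Qed.

(** ** Convergence of bumps to the indicators of boxes *)

Lemma gz0_cvg1 (s : R) : 0 < s -> gz 0 (n.+1%:R * s) @[n --> \oo] --> (1 : R).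
Proof.
move=> s0.
have -> : (fun n => gz 0 (n.+1%:R * s)) = (fun n : nat => expR (- (n.+1%:R^-1 * s^-1))).
  by apply/funext => n; rewrite gz_pos ?mulr_gt0// expr0 mul1r invfM.
rewrite -[X in _ --> X]expR0 -[X in expR X]oppr0 -(mul0r s^-1).
apply: continuous_cvg; first exact: continuous_expR.
apply: cvgN; apply: cvgM; last exact: cvg_cst.
exact: cvg_harmonic.
Qed.

Lemma bt_cvg a b t : bt n.+1%:R a b t @[n --> \oo] --> ((a < t < b)%R%:R : R).
Proof.
have [/andP[ta tb]|h] := boolP (a < t < b).
  rewrite -[X in _ --> X](mulr1 1); apply: cvgM; apply: gz0_cvg1; by rewrite subr_gt0.
by under eq_fun do rewrite bt_out//; exact: cvg_cst.
Qed.

Lemma bx_cvg a b x :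
  bx n.+1%:R a b x @[n --> \oo] --> ((\prod_(i < d) (a 0 i < x 0 i < b 0 i)%R%:R) : R).
Proof.
rewrite /bx; elim: (index_enum _) => [|i s ih].
  rewrite big_nil; under eq_fun do rewrite big_nil; exact: cvg_cst.
rewrite big_cons; under eq_fun do rewrite big_cons.
by apply: cvgM => //; exact: bt_cvg.
Qed.

Lemma bE_cvg a b z : bE n.+1%:R a b z @[n --> \oo] --> (\1_(box a b) z : R).
Proof.
have -> : \1_(box a b) z = ((a.1 < z.1 < b.1)%R%:R *
    \prod_(i < d) (a.2 0 i < z.2 0 i < b.2 0 i)%R%:R : R).
  rewrite indicE; have [h1|h1] := boolP (a.1 < z.1 < b.1); last first.
    by rewrite mul0r memNset//; case=> h; rewrite h in h1.
  rewrite mul1r; have [h2|/existsNP[i /negP hi]] :=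
      pselect (forall i, a.2 0 i < z.2 0 i < b.2 0 i).
    by rewrite mem_set// big1// => i _; rewrite h2.
  rewrite memNset; last by move=> [_ /(_ i) h]; rewrite h in hi.
  by rewrite (bigD1 i)//= (negbTE hi) mul0r.
by apply: cvgM; [exact: bt_cvg|exact: bx_cvg].
Qed.

(** Bumps increase to the indicators of boxes, boxes are stable under intersection
    and generate the sigma-algebra, and the sets that satisfy the conclusion form
    a Dynkin system. *)
Lemma bump_indic_ind (a0 b0 : E) (P : (E -> R) -> Prop) :
  (forall k a b, box a b `<=` box a0 b0 -> P (bE k.+1%:R a b)) ->
  (forall c f g, P f -> P g -> P (fun z => c * f z + g z)) ->
  (forall (fs : nat -> E -> R) (f : E -> R), (forall n, P (fs n)) -> (forall n, measurable_fun setT (fs n)) ->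
     (forall n z, `|fs n z| <= \1_(box a0 b0) z) ->
     (forall z, fs n z @[n --> \oo] --> f z) -> measurable_fun setT f -> P f) ->
  forall A, measurable A -> P (\1_(A `&` box a0 b0)).
Proof.
move=> P1 P2 P3.
pose H : set (set E) := [set A | measurable A /\ P (\1_(A `&` box a0 b0))].
have mI A : measurable A -> measurable_fun setT (\1_(A `&` box a0 b0) : E -> R).
  by move=> mA; apply: measurable_indic; apply: measurableI => //; exact: measurable_obox.
have leI A z : `|\1_(A `&` box a0 b0) z| <= \1_(box a0 b0) z :> R.
  rewrite !indicE in_setI; case: (z \in A); case: (z \in box a0 b0);
  by rewrite /= ?normr0 ?normr1.
have HG A : boxes A -> H A.
  move=> [a [b ->]]; split; first exact: measurable_obox.
  have [_ /boxes_setI h] : True /\ boxes (box a b) by split => //; exists a, b.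
  have [|a1 [b1 E1]] := h (box a0 b0); first by exists a0, b0.
  rewrite E1; apply: (P3 (fun n => bE n.+1%:R a1 b1)).
  - by move=> n; apply: P1; rewrite -E1; exact: subIsetr.
  - by move=> n; apply: cts_measurable_E; exact: bE_cts.
  - move=> n z; rewrite indicE; have [zb|zb] := pselect (box a1 b1 z).
      by rewrite mem_set ?bE_norm//; move: zb; rewrite -E1 => -[].
    by rewrite bE_out// normr0.
  - by move=> z; exact: bE_cvg.
  - by apply: measurable_indic; exact: measurable_obox.
have HT : H setT.
  split => //; rewrite setTI; have [] := HG (box a0 b0); first by exists a0, b0.
  by rewrite setIid.
move=> A mA; suff : H A by case.
apply: (@lambda_system_subset _ _ boxes_setI setT H).
- split => //.
  + move=> B C CB [mB PB] [mC PC]; split; first exact: measurableD.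
    have -> : \1_((B `\` C) `&` box a0 b0) =
        (fun z => -1 * \1_(C `&` box a0 b0) z + \1_(B `&` box a0 b0) z) :> (E -> R).
      apply/funext => z; rewrite !indicE (in_setI z (B `\` C)) in_setD !in_setI.
      have : z \in C -> z \in B by rewrite !inE; exact: CB.
      case: (z \in C); case: (z \in B); case: (z \in box a0 b0) => //= h;
      by rewrite ?mulr1n ?mulr0n; try lra; have := h isT.
    exact: P2.
  + move=> F ndF HF; split; first by apply: bigcup_measurable => k _; case: (HF k).
    apply: (P3 (fun n => \1_(F n `&` box a0 b0))) => //.
    * by move=> n; case: (HF n).
    * by move=> n; apply: mI; case: (HF n).
    * move=> z; apply: cvg_near_cst.
      have [[n _ Fz]|nF] := pselect ((\bigcup_i F i) z).
        near=> m; rewrite !indicE !in_setI; congr (_ && _)%:R.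
        have nm : (n <= m)%N by near: m; exact: nbhs_infty_ge.
        have Fmz : F m z by move: z Fz; apply/subsetPset; exact: ndF.
        by rewrite (mem_set Fmz) mem_set//; exists n.
      near=> m; rewrite !indicE !in_setI; congr (_ && _)%:R.
      by rewrite !memNset// => Fz; apply: nF; exists m.
    * by apply: mI; apply: bigcup_measurable => k _; case: (HF k).
- exact: HG.
- by move=> X _ y _.
- exact: boxes_generate.
Unshelve. all: by end_near. Qed.

End bumps.

(** ** The fundamental lemma of the calculus of variations *)
Section fundamental.
Context {R : realType} {d : nat}.
Local Notation E := (R * 'rV[R]_d)%type.
Local Notation mQ := (@lebQ R d).
Local Notation int1 f := (mQ.-integrable setT (EFin \o f)).

(** The functions orthogonal to [g] contain all bumps, hence all indicators by
    [bump_indic_ind]: all integrals of [g] over measurable subsets of the box are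
    0. *)
Lemma box_ae0 (a0 b0 : E) (g : E -> R) :
  int1 (fun z => g z * \1_(box a0 b0) z) ->
  (forall k a b, box a b `<=` box a0 b0 -> \int[mQ]_z (g z * bE k.+1%:R a b z) = 0) ->
  {ae mQ, forall z, box a0 b0 z -> g z = 0}.
Proof.
move=> ig g0.
have bumpE k (a b : E) z : box a b `<=` box a0 b0 ->
    bE k.+1%:R a b z = \1_(box a0 b0) z * bE k.+1%:R a b z.
  move=> ab; rewrite indicE; have [zb|zb] := pselect (box a b z).
    by rewrite mem_set ?mul1r//; exact: ab.
  by rewrite bE_out// mulr0.
have P A : measurable A -> measurable_fun setT (\1_(A `&` box a0 b0) : E -> R) /\
    int1 (fun z => g z * \1_(A `&` box a0 b0) z) /\
    \int[mQ]_z (g z * \1_(A `&` box a0 b0) z) = 0.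
  apply: (@bump_indic_ind _ _ a0 b0 (fun f : E -> R => measurable_fun setT f /\
      int1 (fun z => g z * f z) /\ \int[mQ]_z (g z * f z) = 0)).
  - move=> k a b ab; split; first by apply: cts_measurable_E; exact: bE_cts.
    split; last exact: g0.
    have -> : (fun z => g z * bE k.+1%:R a b z) =
        (fun z => bE k.+1%:R a b z * (g z * \1_(box a0 b0) z)).
      by apply/funext => z; rewrite {1}(bumpE _ _ _ _ ab); ring.
    apply: (int1_bounded ig); first by apply: cts_measurable_E; exact: bE_cts.
    by move=> z; exact: bE_norm.
  - move=> c f h [mf [if1 f0]] [mh [ih h0]]; split.
      by apply: measurable_funD => //; exact: measurable_funM.
    have -> : (fun z => g z * (c * f z + h z)) = (fun z => c * (g z * f z) + g z * h z).
      by apply/funext => z; ring.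
    split; first by apply: int1D => //; exact: int1Z.
    by rewrite RintD ?RintZ ?f0 ?h0 ?mulr0 ?addr0//; exact: int1Z.
  - move=> fs f Pfs mfs fsB fsf mf; split => //.
    have mg n : measurable_fun setT (fun z => g z * fs n z).
      by have [_ [+ _]] := Pfs n; exact: int1_measurable.
    have mgl : measurable_fun setT (fun z => g z * f z).
      apply: (@measurable_fun_cvg _ _ _ _ (fun n z => g z * fs n z)) => // z _.
      by apply: cvgM; [exact: cvg_cst|exact: fsf].
    have [] := @Rint_dominated _ _ _ mQ (fun n z => g z * fs n z)
        (fun z => g z * f z) (fun z => `|g z * \1_(box a0 b0) z|) mg mgl.
    + exact: int1_norm.
    + move=> n z; rewrite !normrM ler_wpM2l//; apply: le_trans (fsB n z) _.
      exact: ler_norm.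
    + by apply: aeW => z; apply: cvgM; [exact: cvg_cst|exact: fsf].
    move=> i1 c1; split => //.
    have E0 : (fun n => \int[mQ]_z (g z * fs n z)) = cst 0.
      by apply/funext => n; have [_ [_]] := Pfs n.
    rewrite E0 in c1.
    exact: (cvg_unique _ c1 (cvg_cst _)).
have H : ae_eq mQ setT (EFin \o (fun z => g z * \1_(box a0 b0) z)) (EFin \o cst (0 : R)).
  apply: integral_ae_eq => //; [by apply/measurable_EFinP; exact: measurable_cst|].
  move=> A _ mA.
  have [_ [iA A0]] := P A mA.
  rewrite [RHS]integral0_eq//.
  have -> : (\int[mQ]_(z in A) (EFin \o (fun z => g z * \1_(box a0 b0) z)%R) z =
      \int[mQ]_z (g z * \1_(A `&` box a0 b0) z)%R%:E)%E.
    rewrite integral_mkcond; apply: eq_integral => z _.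
    rewrite patchE /= !indicE in_setI; case: ifP => //= zA.
    by rewrite mulr0.
  have := integrable_fin_num measurableT iA.
  move: A0; rewrite /Rintegral.
  by case: (\int[mQ]_z _)%E => //= r ->.
case: H => N [mN N0 sN]; exists N; split => // z /= nz; apply: sN => /= h.
apply: nz => zb; move: (h I) => [].
by rewrite indicE mem_set// mulr1.
Qed.

Lemma bigcup_box_ae (a b : nat -> E) (D : set E) (Q : E -> Prop) :
  D `<=` \bigcup_n box (a n) (b n) ->
  (forall n, {ae mQ, forall z, box (a n) (b n) z -> Q z}) ->
  {ae mQ, forall z, D z -> Q z}.
Proof.
move=> Dab H; have H' : {ae mQ, forall z n, box (a n) (b n) z -> Q z}.
  exact/ae_foralln.
case: H' => N [mN N0 sN]; exists N; split => // z /= nz; apply: sN => /= h.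
by apply: nz => Dz; have [n _] := Dab _ Dz; exact: h.
Qed.

End fundamental.

(** * Mollification in the space of square integrable functions *)

Section mollifier.
Context {R : realType} {d : nat}.
Local Notation E := (R * 'rV[R]_d)%type.
Local Notation mQ := (@lebQ R d).
Local Notation int1 f := (mQ.-integrable setT (EFin \o f)).
Local Notation L2T := (L2 mQ setT).

Import HBNNSimple.

Definition cube (e : R) : E := (e, const_mx e).

Definition kap0 (e : R) : E -> R := bE 1 (cube (- e)) (cube e).

(** An even kernel of integral 1. It is a product of functions of the single
    coordinates, so that the convolution with a product is again a product. *)
Definition kap (e : R) (z : E) : R := (\int[mQ]_y kap0 e y)^-1 * kap0 e z.

Lemma kap0_cubeP e z : 0 < e -> box (cube (- e)) (cube e) z <-> `|z| < e.
Proof.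
move=> e0; split.
  move=> [/= h1 h2]; apply/(E_norm_ltP _ e0); rewrite ltr_norml h1; split => // i.
  by have := h2 i; rewrite !mxE ltr_norml.
move=> /(E_norm_ltP _ e0)[h1 h2]; split => /=; first by rewrite -ltr_norml.
by move=> i; rewrite !mxE -ltr_norml.
Qed.

Lemma kap0_bsupp e : 0 < e -> forall z, e <= `|z| -> kap0 e z = 0.
Proof.
by move=> e0 z ez; apply: bE_out => // /(kap0_cubeP _ e0); rewrite ltNge ez.
Qed.

Lemma kap0_even e z : kap0 e (- z) = kap0 e z.
Proof.
have H (r : R) : bt 1 (- e) e (- r) = bt 1 (- e) e r.
  by rewrite /bt mulrC; congr (gz _ _ * gz _ _); ring.
rewrite /kap0 /bE H; congr (_ * _); apply: eq_bigr => i _.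
by rewrite !mxE H.
Qed.

Lemma kap0_int1 e : 0 < e -> int1 (kap0 e).
Proof.
move=> e0; apply: (@cs_int1 _ _ e); first exact: bE_cts.
by move=> z /ltW; exact: kap0_bsupp.
Qed.

Lemma kap0_int_gt0 e : 0 < e -> 0 < \int[mQ]_y kap0 e y.
Proof.
move=> e0; have e20 : 0 < e / 2 by rewrite divr_gt0.
pose p := gz 0 (e / 2) * gz 0 (e / 2); pose c := p * \prod_(i < d) p.
have p0 : 0 < p by rewrite mulr_gt0// gz0_gt0.
have c0 : 0 < c by rewrite mulr_gt0// prodr_gt0.
have cle z : `|z| <= e / 2 -> c <= kap0 e z.
  have H (r : R) : `|r| <= e / 2 -> p <= bt 1 (- e) e r.
    rewrite ler_norml => /andP[h1 h2]; rewrite /bt !mul1r.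
    by apply: ler_pM; rewrite ?gz_ge0//; apply: gz0_homo; lra.
  move=> ze; rewrite /c /kap0 /bE; apply: ler_pM.
  - exact: ltW.
  - by apply: prodr_ge0 => i _; exact: ltW.
  - by rewrite /= ; apply: H; exact: le_trans (E_norm1 _) ze.
  apply: ler_prod => i _; rewrite ltW//= !mxE; apply: H.
  exact: le_trans (rV_coord_le _ _) (le_trans (E_norm2 _) ze).
have mB := @measurable_ballE R d (e / 2); have fB := @ball_fin R d (e / 2).
apply: (@lt_le_trans _ _ (\int[mQ]_y (c * \1_[set z : E | `|z| <= e / 2] y))).
  rewrite RintZ; last exact: indic_int1.
  rewrite mulr_gt0// /Rintegral integral_indic// setIT fine_gt0// fB andbT.
  exact: lebQ_box_gt0.
apply: le_Rint; [by apply: int1Z; exact: indic_int1|exact: kap0_int1|].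
move=> z; rewrite indicE; have [ze|ze] := pselect (`|z| <= e / 2).
  by rewrite mem_set// mulr1 cle.
by rewrite memNset// mulr0 bE_ge0.
Qed.

Lemma kap_ge0 e z : 0 < e -> 0 <= kap e z.
Proof. by move=> e0; rewrite mulr_ge0 ?bE_ge0// invr_ge0 ltW// kap0_int_gt0. Qed.

Lemma kap_smooth e : smooth (kap e).
Proof. by apply: smooth_mul; [exact: smooth_cst|exact: bE_smooth]. Qed.

Lemma kap_out e z : 0 < e -> e <= `|z| -> kap e z = 0.
Proof. by move=> e0 ez; rewrite /kap kap0_bsupp// mulr0. Qed.

Lemma kap_bsupp e : 0 < e -> bsupp e (kap e).
Proof. by move=> e0 z /ltW; exact: kap_out. Qed.

Lemma kap_sym e y z : kap e (y - z) = kap e (z - y).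
Proof. by rewrite /kap -kap0_even opprB. Qed.

Lemma kap_int e z : 0 < e -> int1 (fun y => kap e (z - y)) /\
  \int[mQ]_y kap e (z - y) = 1.
Proof.
move=> e0; have Ek : (fun y => kap e (z - y)) = (fun y => kap e (y + (- z))).
  by apply/funext => y; rewrite kap_sym.
have mk : measurable_fun setT (kap e) by apply: cts_measurable_E; exact/smooth_cts/kap_smooth.
rewrite Ek; split.
  apply: (@cs_int1 _ _ (e + `|z|)).
    have c1 : continuous (fun y : E => y - z).
      by move=> y; apply: cvgB; [exact: cvg_id|exact: cvg_cst].
    by move=> y; exact: (continuous_comp (c1 y) (smooth_cts (kap_smooth e) (x := _))).
  move=> y Ny; apply: kap_out => //; rewrite -(lerD2r `|z|).
  by rewrite (le_trans (ltW Ny))// -{1}(subrK z y) ler_normD.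
rewrite lebQ_shift// RintZ; last exact: kap0_int1.
by rewrite mulVf// gt_eqF// kap0_int_gt0.
Qed.

Definition en (n : nat) : R := n.+1%:R^-1.

Lemma en_gt0 n : 0 < en n.
Proof. by rewrite invr_gt0 ltr0n. Qed.

Lemma en_le1 n : en n <= 1.
Proof. by rewrite invf_le1 ?ltr0n// ler1n. Qed.

Lemma en_cvg0 : en n @[n --> \oo] --> 0.
Proof. exact: cvg_harmonic. Qed.

Definition J (n : nat) (g : E -> R) : E -> R := conv (kap (en n)) g.

Definition Lb (M : R) (g : E -> R) := L2T g /\ bsupp M g.

Lemma Lb_int1 M g : Lb M g -> int1 g.
Proof.
move=> [Lg bg].
apply: (@le_integrableT _ _ _ _ _ (fun z => g z ^+ 2 + \1_[set z : E | `|z| <= M] z)).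
- by case: Lg.
- apply: int1D; first exact: sqr_integrable.
  by apply: indic_int1; [exact: measurable_ballE|exact: ball_fin].
move=> z; rewrite indicE; have [zM|Mz] := pselect (`|z| <= M).
  rewrite mem_set//= -[g z ^+ 2]real_normK ?num_real//.
  by have := sqr_ge0 (`|g z| - 1); nra.
by rewrite memNset//= addr0 bg ?normr0 ?sqr_ge0// ltNge; exact/negP.
Qed.

Lemma J_smooth n g : int1 g -> smooth (J n g).
Proof. by move=> ig; exact: (conv_smooth (kap_smooth _) (kap_bsupp (en_gt0 n)) ig). Qed.

Lemma J_supp n g (A : set E) : (forall y, ~ A y -> g y = 0) ->
  forall z, (forall y, A y -> en n < `|z - y|) -> J n g z = 0.
Proof. by move=> Ag z h; exact: (conv_supp (kap_bsupp (en_gt0 n)) Ag h). Qed.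

Lemma J_bsupp n M g : bsupp M g -> bsupp (M + 1) (J n g).
Proof.
move=> bg z Mz; apply: (@J_supp n g [set y | `|y| <= M]).
  by move=> y /= /negP; rewrite -ltNge; exact: bg.
move=> y /= yM; apply: (le_lt_trans (en_le1 n)).
rewrite -(ltrD2r M) addrC; apply: (lt_le_trans Mz).
by rewrite -{1}(subrK y z) (le_trans (ler_normD _ _))// lerD2l.
Qed.

Lemma J_Lb n M g : Lb M g -> Lb (M + 1) (J n g).
Proof.
move=> Lg; have bJ := J_bsupp n Lg.2; split => //.
by apply: (cs_L2 _ bJ); apply: smooth_cts; apply: J_smooth; exact: Lb_int1 Lg.
Qed.

Lemma J_int1 n g z : int1 g -> int1 (fun y => kap (en n) (z - y) * g y).
Proof.
exact: (conv_int1 z (smooth_cts (kap_smooth _)) (kap_bsupp (en_gt0 n))).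
Qed.

Lemma JD n f g : int1 f -> int1 g ->
  J n (fun z => f z + g z) = (fun z => J n f z + J n g z).
Proof.
move=> if1 ig; apply/funext => z; rewrite /J /conv -RintD; [|exact: J_int1..].
by apply: eq_Rintegral => y _; rewrite mulrDr.
Qed.

Lemma JZ n c f : int1 f -> J n (fun z => c * f z) = (fun z => c * J n f z).
Proof.
move=> if1; apply/funext => z; rewrite /J /conv -RintZ; last exact: J_int1.
by apply: eq_Rintegral => y _; ring.
Qed.

Lemma JB n f g : int1 f -> int1 g ->
  J n (fun z => f z - g z) = (fun z => J n f z - J n g z).
Proof.
move=> if1 ig; apply/funext => z; rewrite /J /conv -RintB; [|exact: J_int1..].
by apply: eq_Rintegral => y _; rewrite mulrBr.
Qed.

(** Jensen's inequality: expand [0 <= \int kap * (g - c)^2] with [c = J n g z]. *)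
Lemma J_sqr_le n M g z : Lb M g ->
  (J n g z) ^+ 2 <= \int[mQ]_y (kap (en n) (z - y) * g y ^+ 2).
Proof.
move=> Lg; have ig := Lb_int1 Lg; set c := J n g z.
have i2 : int1 (fun y => kap (en n) (z - y) * g y ^+ 2).
  by apply: J_int1; apply: sqr_integrable; case: Lg.
have [i0 k1] := kap_int z (en_gt0 n).
have i1 := J_int1 n z ig.
have : 0 <= \int[mQ]_y (kap (en n) (z - y) * (g y - c) ^+ 2).
  by apply: Rintegral_ge0 => y _; rewrite mulr_ge0 ?sqr_ge0// kap_ge0// en_gt0.
have -> : \int[mQ]_y (kap (en n) (z - y) * (g y - c) ^+ 2) =
    \int[mQ]_y (kap (en n) (z - y) * g y ^+ 2 +
      (- (2 * c) * (kap (en n) (z - y) * g y) + c ^+ 2 * kap (en n) (z - y))).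
  by apply: eq_Rintegral => y _; ring.
rewrite RintD//; last by apply: int1D; exact: int1Z.
rewrite RintD; [|exact: int1Z..].
rewrite (RintZ _ i1) (RintZ _ i0) k1 -[\int[mQ]_y (_ * g y)]/c; nra.
Qed.

Lemma measurable_subE : measurable_fun setT (fun p : E * E => p.1 - p.2).
Proof.
apply/measurable_fun_pairP; split.
  apply: measurable_funB.
    exact: (measurableT_comp measurable_fst measurable_fst).
  exact: (measurableT_comp measurable_fst measurable_snd).
apply/measurable_fun_mxP => i j; under eq_fun do rewrite /= !mxE.
apply: measurable_funB.
  have h := measurableT_comp (@measurable_mx_entry R 1 d i j)
    (measurableT_comp (@measurable_snd _ _ R 'rV[R]_d) (@measurable_fst _ _ E E)).
  exact: h.
have h := measurableT_comp (@measurable_mx_entry R 1 d i j)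
    (measurableT_comp (@measurable_snd _ _ R 'rV[R]_d) (@measurable_snd _ _ E E)).
exact: h.
Qed.

Lemma measurable_kapE n : measurable_fun setT (fun p : E * E => kap (en n) (p.1 - p.2)).
Proof.
have mk : measurable_fun setT (kap (en n)).
  by apply: cts_measurable_E; exact/smooth_cts/kap_smooth.
exact: (measurableT_comp mk measurable_subE).
Qed.

(** Integrate [J_sqr_le] in [z] and exchange the integrals: the kernel has
    integral 1 in either variable. *)
Lemma J_contr n M g : Lb M g -> N2 mQ (J n g) <= N2 mQ g.
Proof.
move=> Lg; have [[mg _] bg] := Lg; have [LJ _] := J_Lb n Lg.
have ig2 : int1 (fun y => g y ^+ 2) by apply: sqr_integrable; case: Lg.
pose F (p : E * E) := (kap (en n) (p.1 - p.2) * g p.2 ^+ 2)%:E.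
have mF : measurable_fun setT F.
  apply/measurable_EFinP; apply: measurable_funM; first exact: measurable_kapE.
  by apply: measurable_funX; exact: (measurableT_comp mg measurable_snd).
have F0 p : (0 <= F p)%E by rewrite lee_fin mulr_ge0 ?sqr_ge0// kap_ge0// en_gt0.
have H : (\int[mQ]_z \int[mQ]_y F (z, y) = \int[mQ]_y (g y ^+ 2)%:E)%E.
  rewrite (fubini_tonelli F mF F0); apply: eq_integral => y _.
  rewrite /F /=; under eq_integral do rewrite EFinM.
  have mk : measurable_fun setT (fun z : E => (kap (en n) (z - y))%:E).
    apply/measurable_EFinP; apply: cts_measurable_E => z.
    have c1 : continuous (fun z : E => z - y).
      by move=> x; apply: cvgB; [exact: cvg_id|exact: cvg_cst].
    exact: (continuous_comp (c1 z) (smooth_cts (kap_smooth (en n)) (x := _))).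
  have k0 (z : E) : setT z -> (0 <= (kap (en n) (z - y))%:E)%E.
    by move=> _; rewrite lee_fin kap_ge0// en_gt0.
  have g0 : (0 <= (g y ^+ 2)%:E)%E by rewrite lee_fin sqr_ge0.
  rewrite ge0_integralZr//.
  have [i1 k1] := kap_int y (en_gt0 n).
  have -> : (\int[mQ]_z (kap (en n) (z - y))%:E = 1)%E.
    rewrite (eq_integral (fun z : E => (kap (en n) (y - z))%:E)).
      by rewrite -[LHS]fineK ?(integrable_fin_num _ i1)//; congr EFin; exact: k1.
    by move=> z _; rewrite kap_sym.
  by rewrite mul1e.
rewrite /N2 /Rintegral fine_le//.
- by apply: (integrable_fin_num _ (sqr_integrable LJ)).
- exact: (integrable_fin_num _ ig2).
rewrite -H; apply: ge0_le_integral_nomeas => z _; first by rewrite lee_fin sqr_ge0.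
apply: (@le_trans _ _ (\int[mQ]_y (kap (en n) (z - y) * g y ^+ 2))%:E).
  by rewrite lee_fin; exact: J_sqr_le Lg.
rewrite /Rintegral fineK// (integrable_fin_num _ (J_int1 n z ig2))//.
Qed.

Lemma Lb_mul_bd M (f g : E -> R) C : measurable_fun setT f -> (forall z, `|f z| <= C) ->
  Lb M g -> Lb M (fun z => f z * g z).
Proof.
move=> mf fC [Lg bg]; split; first exact: L2M Lg mf fC.
by move=> z /bg ->; rewrite mulr0.
Qed.

(** Exchange the integrals; the kernel is even. *)
Lemma J_adj n M N f g : Lb M f -> Lb N g ->
  \int[mQ]_z (J n f z * g z) = \int[mQ]_z (f z * J n g z).
Proof.
move=> Lf Lg; have if1 := Lb_int1 Lf; have ig := Lb_int1 Lg.
pose F (p : E * E) := (kap (en n) (p.1 - p.2) * f p.2 * g p.1)%:E.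
have mF : measurable_fun setT F.
  apply/measurable_EFinP; apply: measurable_funM.
    apply: measurable_funM; first exact: measurable_kapE.
    exact: (measurableT_comp (int1_measurable if1) measurable_snd).
  exact: (measurableT_comp (int1_measurable ig) measurable_fst).
have [C C0 kC] := cs_bounded E_balls_compact (smooth_cts (kap_smooth (en n)))
  (kap_bsupp (en_gt0 n)).
have iF : (mQ \x mQ)%E.-integrable setT F.
  apply/integrable12ltyP => //.
  pose I := \int[mQ]_y `|f y|.
  have iI : int1 (fun y => `|f y|) by exact: int1_norm.
  apply: (@le_lt_trans _ _ (\int[mQ]_z (C * I * `|g z|)%:E)%E).
    apply: ge0_le_integral_nomeas => z _.
      by apply: integral_ge0 => y _; exact: abse_ge0.
    apply: (@le_trans _ _ (\int[mQ]_y (C * `|g z| * `|f y|)%:E)%E).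
      apply: ge0_le_integral_nomeas => y _; first exact: abse_ge0.
      rewrite /F /= lee_fin normrM (normrM (kap _ _)).
      have := kC (z - y); have := normr_ge0 (f y); have := normr_ge0 (g z).
      move=> g0 f0 k0; rewrite mulrAC ler_wpM2r// ler_wpM2r//.
    rewrite le_eqVlt; apply/orP; left; apply/eqP.
    have h := int1Z (C * `|g z|) iI.
    rewrite -[LHS]fineK ?(integrable_fin_num _ h)//; congr EFin.
    rewrite [LHS](RintZ (C * `|g z|) iI) -/I; ring.
  have h := int1Z (C * I) (int1_norm ig).
  by have := integrable_lty measurableT h.
have E1 z : (\int[mQ]_y F (z, y) = (J n f z * g z)%:E)%E.
  have h := int1Z (g z) (J_int1 n z if1).
  rewrite (eq_integral (fun y : E => (g z * (kap (en n) (z - y) * f y))%:E)); last first.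
    by move=> y _; rewrite /F /=; congr EFin; ring.
  rewrite -[LHS]fineK ?(integrable_fin_num _ h)//; congr EFin.
  by rewrite [LHS](RintZ (g z) (J_int1 n z if1)) mulrC.
have E2 y : (\int[mQ]_z F (z, y) = (f y * J n g y)%:E)%E.
  have h := int1Z (f y) (J_int1 n y ig).
  rewrite (eq_integral (fun z : E => (f y * (kap (en n) (y - z) * g z))%:E)); last first.
    by move=> z _; rewrite /F /= kap_sym; congr EFin; ring.
  rewrite -[LHS]fineK ?(integrable_fin_num _ h)//; congr EFin.
  by rewrite [LHS](RintZ (f y) (J_int1 n y ig)).
rewrite /Rintegral; congr fine.
under eq_integral do rewrite -E1.
under [RHS]eq_integral do rewrite -E2.
exact: Fubini.
Qed.

Lemma LbB M f g : Lb M f -> Lb M g -> Lb M (fun z => f z - g z).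
Proof.
move=> [Lf bf] [Lg bg]; split; first exact: L2B.
by move=> z Mz; rewrite bf// bg// subrr.
Qed.

Lemma LbD M f g : Lb M f -> Lb M g -> Lb M (fun z => f z + g z).
Proof.
move=> [Lf bf] [Lg bg]; split; first exact: L2D.
by move=> z Mz; rewrite bf// bg// addr0.
Qed.

Lemma LbZ M c f : Lb M f -> Lb M (fun z => c * f z).
Proof.
move=> [Lf bf]; split; first exact: L2Z.
by move=> z Mz; rewrite bf// mulr0.
Qed.

(** Averages of a uniformly continuous function converge uniformly, and their
    supports stay in a ball. *)
Lemma J_cvg_cts M g : continuous g -> bsupp M g -> L2cv mQ (fun n => J n g) g.
Proof.
move=> cg bg; have Lg : Lb M g by split => //; exact: cs_L2 cg bg.
have ig := Lb_int1 Lg.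
split; [by move=> n; case: (J_Lb n Lg)|by case: Lg|].
apply: cvg0_by_eps => e e0.
pose m := fine (mQ [set z | `|z| <= M + 1]).
have m0 : 0 <= m by rewrite fine_ge0.
have m1 : 0 < m + 1 by rewrite ltr_wpDl.
pose e' := Num.min 1 (e / (m + 1)).
have e'0 : 0 < e' by rewrite lt_min ltr01 divr_gt0.
have [del d0 hd] := cs_unif E_balls_compact cg bg e'0.
near=> n.
have nd : en n < del.
  near: n; have /cvgrPdist_lt/(_ _ d0) := en_cvg0.
  by apply: filterS => n; rewrite sub0r normrN ger0_norm// ltW// en_gt0.
have H z : `|J n g z - g z| <= e'.
  have [i0 k1] := kap_int z (en_gt0 n).
  have -> : J n g z - g z = \int[mQ]_y (kap (en n) (z - y) * (g y - g z)).
    rewrite -[g z in LHS]mulr1 -k1 -RintZ// /J /conv -RintB; last 2 first.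
    - exact: J_int1.
    - exact: int1Z.
    by apply: eq_Rintegral => y _; ring.
  apply: (@le_trans _ _ (\int[mQ]_y (e' * kap (en n) (z - y)))).
    apply: le_Rint_norm; [|exact: int1Z|].
      rewrite (_ : _ \o _ = EFin \o (fun y => kap (en n) (z - y) * g y -
          g z * kap (en n) (z - y))).
        by apply: int1B; [exact: J_int1|exact: int1Z].
      by apply/funext => y /=; congr EFin; ring.
    move=> y; rewrite normrM (ger0_norm (kap_ge0 _ (en_gt0 n))).
    have [zy|zy] := ltP `|z - y| (en n).
      rewrite mulrC ler_wpM2r ?kap_ge0 ?en_gt0//; apply: hd.
      by rewrite distrC (lt_trans zy).
    by rewrite kap_out ?en_gt0// mul0r mulr0.
  by rewrite RintZ// k1 mulr1.
have [LJ bJ] := J_Lb n Lg.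
have bD : bsupp (M + 1) (fun z => (J n g z - g z) ^+ 2).
  move=> z Mz; rewrite bJ// bg ?subrr ?expr0n//.
  by apply: le_lt_trans Mz; rewrite lerDl.
have mD : measurable_fun setT (fun z => (J n g z - g z) ^+ 2).
  by apply: measurable_funX; apply: measurable_funB; [case: LJ|case: Lg => -[]].
have [|_ h] := @bsupp_int _ _ (M + 1) e' _ mD bD.
  move=> z; rewrite ger0_norm ?sqr_ge0// -real_normK ?num_real//.
  have := H z; have : e' <= 1 by rewrite ge_min lexx.
  by have := normr_ge0 (J n g z - g z); nra.
apply: (le_trans h); rewrite -/m.
apply: (@le_trans _ _ (e / (m + 1) * m)); first by rewrite ler_wpM2r// ge_min lexx orbT.
by rewrite mulrAC ler_pdivrMr// ler_wpM2l ?ltW// ltrDl.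
Unshelve. all: by end_near. Qed.

Lemma N2_eqr (f g : E -> R) : f =1 g -> N2 mQ f = N2 mQ g.
Proof. by move=> fg; congr N2; apply/funext. Qed.

(** As [J k] is a contraction, [J k f - f] differs from [J k (fs n) - fs n] by at
    most twice the distance from [f] to [fs n], for all [k] at once. *)
Lemma J_cvg_closed M fs f : (forall n, Lb M (fs n)) -> Lb M f ->
  (forall n, L2cv mQ (fun k => J k (fs n)) (fs n)) -> L2cv mQ fs f ->
  L2cv mQ (fun k => J k f) f.
Proof.
move=> Lfs Lf cfs [_ _ cf]; split; [by move=> n; case: (J_Lb n Lf)|by case: Lf|].
apply: cvg0_by_eps => e e0.
have e16 : 0 < e / 16 by rewrite divr_gt0.
have [n hn] : exists n, N2 mQ (fun z => fs n z - f z) <= e / 16.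
  have h : \forall n \near \oo, N2 mQ (fun z => fs n z - f z) <= e / 16.
    exact: (cvgr_le _ cf _ e16).
  by have [n hn] := filter_ex h; exists n.
have [_ _ cn] := cfs n.
have e4 : 0 < e / 4 by rewrite divr_gt0.
near=> k.
have hk : N2 mQ (fun z => J k (fs n) z - fs n z) <= e / 4.
  near: k; exact: (cvgr_le _ cn _ e4).
rewrite ger0_norm ?N2_ge0//.
have L1 := LbB Lf (Lfs n); have L2' := J_Lb k L1.
have E1 : N2 mQ (fun z => J k f z - f z) =
    N2 mQ (fun z => (J k (fun y => f y - fs n y) z + (fs n z - f z)) +
                    (J k (fs n) z - fs n z)).
  apply: N2_eqr => z; rewrite JB; [ring|exact: Lb_int1 Lf|exact: Lb_int1 (Lfs n)].
rewrite E1.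
have LA : L2T (fun z => J k (fun y => f y - fs n y) z + (fs n z - f z)).
  by apply: L2D; [case: L2'|case: (LbB (Lfs n) Lf)].
have LB : L2T (fun z => J k (fs n) z - fs n z).
  by apply: L2B; [case: (J_Lb k (Lfs n))|case: (Lfs n)].
apply: (le_trans (N2D LA LB)).
have h1 := N2D L2'.1 (LbB (Lfs n) Lf).1.
have h2 := J_contr k L1.
have h3 : N2 mQ (fun y => f y - fs n y) = N2 mQ (fun y => fs n y - f y).
  by rewrite -N2N; apply: N2_eqr => y; rewrite opprB.
rewrite h3 in h2; lra.
Unshelve. all: by end_near. Qed.

(** Bumps give indicators, indicators give simple functions, and these are
    dense. *)
Lemma bump_L2_ind (a0 b0 : E) (P : (E -> R) -> Prop) :
  (forall k a b, box a b `<=` box a0 b0 -> P (bE k.+1%:R a b)) ->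
  (forall c (f g : E -> R), P f -> P g -> P (fun z => c * f z + g z)) ->
  (forall (fs : nat -> E -> R) (f : E -> R), (forall n, P (fs n)) ->
     (forall n z, ~ box a0 b0 z -> fs n z = 0) -> (forall z, ~ box a0 b0 z -> f z = 0) ->
     L2cv mQ fs f -> P f) ->
  forall g, L2T g -> (forall z, ~ box a0 b0 z -> g z = 0) -> P g.
Proof.
move=> P1 P2 P3.
have Q0 : P (fun=> 0).
  have h := P1 0%N b0 a0.
  have e0 : bE 1%:R b0 b0 = (fun=> 0).
    apply/funext => z; apply: bE_out => // -[/andP[h1 h2] _].
    by have := lt_trans h1 h2; rewrite ltxx.
  rewrite -e0; apply: P1 => z -[/andP[h1 h2] _].
  by have := lt_trans h1 h2; rewrite ltxx.
have mB := measurable_obox a0 b0.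
have fB : (mQ (box a0 b0) < +oo)%E.
  apply: le_lt_trans (@ball_fin R d (`|a0| + `|b0|)).
  apply: le_measure; rewrite ?inE//; first exact: measurable_ballE.
  by move=> z /box_bounded.
have LB : L2T (\1_(box a0 b0)) := L2_indic mB fB.
have PI A : measurable A -> P (\1_(A `&` box a0 b0)).
  apply: bump_indic_ind => // fs f Pfs mfs fsB fsf mf.
  have fB' z : `|f z| <= \1_(box a0 b0) z.
    have c1 : `|fs n z| @[n --> \oo] --> `|f z| by apply: cvg_norm; exact: fsf.
    rewrite -(cvg_lim _ c1)//; apply: limr_le; first by apply/cvg_ex; exists `|f z|.
    by apply: nearW => n; exact: fsB.
  have B0 (h : E -> R) : (forall z, `|h z| <= \1_(box a0 b0) z) ->
      forall z, ~ box a0 b0 z -> h z = 0.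
    move=> hB z zB; apply/eqP; rewrite -normr_le0; apply: le_trans (hB z) _.
    by rewrite indicE memNset.
  apply: (P3 fs) => //; [by move=> n; apply: B0|exact: B0|].
  by apply: (@L2cv_dominated _ _ _ _ _ _ (\1_(box a0 b0))) => //; exact: aeW.
have PS (h : {nnsfun E >-> R}) : P (fun z => h z * \1_(box a0 b0) z).
  have -> : (fun z => h z * \1_(box a0 b0) z) =
    (fun z => \sum_(y <- finmap.enum_fset (fset_set (range h))) y * \1_(h @^-1` [set y] `&` box a0 b0) z).
    apply/funext => z; rewrite fimfunE fsbig_finite//= mulr_suml.
    apply: eq_bigr => y _; rewrite -mulrA; congr (_ * _).
    by rewrite !indicE in_setI -natrM mulnb.
  elim: (finmap.enum_fset _) => [|y s ih].
    by rewrite (_ : (fun _ => _) = (fun=> 0))//; apply/funext => z; rewrite big_nil.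
  rewrite (_ : (fun _ => _) = (fun z => y * \1_(h @^-1` [set y] `&` box a0 b0) z +
    \sum_(j <- s) j * \1_(h @^-1` [set j] `&` box a0 b0) z)).
    by apply: P2 => //; exact: PI.
  by apply/funext => z; rewrite big_cons.
have PP (g : E -> R) : L2T g -> (forall z, 0 <= g z) ->
    (forall z, ~ box a0 b0 z -> g z = 0) -> P g.
  move=> Lg g0 gB; have mg : measurable_fun setT (EFin \o g).
    by apply/measurable_EFinP; case: Lg.
  pose h := nnsfun_approx measurableT mg.
  have hg z : h n z @[n --> \oo] --> g z.
    have := @cvg_nnsfun_approx _ _ _ _ measurableT _ mg (fun x _ => g0 x) z I.
    by move/fine_cvg.
  have hle n z : h n z <= g z.
    have := nondecreasing_cvgn_le (u_ := fun n => h n z).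
    rewrite (cvg_lim _ (hg z))//; apply.
      by move=> k m km; have /lefP := nd_nnsfun_approx measurableT mg km; exact.
    exact: hg.
  have hB n z : h n z * \1_(box a0 b0) z = h n z.
    rewrite indicE; have [zB|zB] := pselect (box a0 b0 z).
      by rewrite mem_set// mulr1.
    rewrite memNset// mulr0; apply/eqP; rewrite eq_le.
    by have := hle n z; rewrite gB// => ->; rewrite fun_ge0.
  apply: (P3 (fun n z => h n z * \1_(box a0 b0) z)) => //.
    by move=> n z zB; rewrite indicE memNset// mulr0.
  have -> : (fun n z => h n z * \1_(box a0 b0) z) = (fun n z => h n z).
    by apply/funext => n; apply/funext => z; exact: hB.
  apply: (@L2cv_dominated _ _ _ _ _ _ g) => //.
  - by case: Lg.
  - by move=> n z; rewrite ger0_norm ?fun_ge0.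
  - by move=> z; rewrite ger0_norm.
  - exact: aeW.
move=> g Lg gB.
have -> : g = (fun z => -1 * Num.max (- g z) 0 + Num.max (g z) 0).
  apply/funext => z; rewrite !maxEle; case: (leP (g z) 0) => h; case: (leP (- g z) 0) => h'; lra.
have Lm (h : E -> R) : L2T h -> L2T (fun z => Num.max (h z) 0).
  move=> Lh; apply: (L2_le _ Lh).
    by apply: measurable_maxr; [case: Lh|exact: measurable_cst].
  move=> z; rewrite maxEle; case: ifP => // _; by rewrite normr0.
apply: P2.
  apply: PP; first exact/Lm/L2N.
    by move=> z; rewrite le_max lexx orbT.
  by move=> z /gB ->; rewrite oppr0 maxxx.
apply: PP; first exact: Lm.
  by move=> z; rewrite le_max lexx orbT.
by move=> z /gB ->; rewrite maxxx.
Qed.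

Lemma Lb_box M g : Lb M g -> forall z, ~ box (cube (- (`|M| + 1))) (cube (`|M| + 1)) z -> g z = 0.
Proof.
move=> [_ bg] z nz; apply: bg; rewrite ltNge; apply/negP => zM; apply: nz.
apply/kap0_cubeP; first by rewrite ltr_wpDl.
by rewrite (le_lt_trans zM)// (le_lt_trans (ler_norm _))// ltrDl.
Qed.

(** Bumps are continuous, and by [J_cvg_closed] the functions approximated by
    their averages form a closed subspace, so [bump_L2_ind] applies. *)
Theorem J_cvg M g : Lb M g -> L2cv mQ (fun n => J n g) g.
Proof.
move=> Lg; pose r := `|M| + 1; pose a0 := cube (- r); pose b0 := cube r.
pose N := `|a0| + `|b0|.
have bN (f : E -> R) : (forall z, ~ box a0 b0 z -> f z = 0) -> bsupp N f.
  by move=> fB z Nz; apply: fB => /box_bounded; rewrite leNgt Nz.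
suff : Lb N g /\ L2cv mQ (fun n => J n g) g by case.
apply: (@bump_L2_ind a0 b0 (fun g => Lb N g /\ L2cv mQ (fun n => J n g) g)).
- move=> k a b ab.
  have bb : bsupp N (bE k.+1%:R a b).
    by apply: bN => z zB; apply: bE_out => // /ab.
  have cb := @bE_cts R d k.+1%:R a b.
  by split; [split => //; exact: cs_L2 cb bb|exact: J_cvg_cts cb bb].
- move=> c f h [Lf cf] [Lh ch]; split; first by apply: LbD => //; exact: LbZ.
  have -> : (fun n => J n (fun z => c * f z + h z)) =
      (fun n z => (cst c) z * J n f z + J n h z).
    apply/funext => n; rewrite JD; last 2 first.
    - exact/int1Z/(Lb_int1 Lf).
    - exact: Lb_int1 Lh.
    by rewrite JZ//; exact: Lb_int1 Lf.
  by apply: L2cvD => //; apply: (@L2cvM _ _ _ _ _ _ (cst c) `|c|) => //.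
- move=> fs f Pfs fsB fB cfs; have Lf : Lb N f by split; [case: cfs|exact: bN].
  split => //; apply: (J_cvg_closed (M := N) (fs := fs)) => //.
    by move=> n; case: (Pfs n).
  by move=> n; case: (Pfs n).
- by case: Lg.
- exact: Lb_box Lg.
Qed.

End mollifier.

(** * Weak derivatives *)

Section local.
Context {R : realType} {d : nat}.
Local Notation E := (R * 'rV[R]_d)%type.
Local Notation mQ := (@lebQ R d).
Local Notation L2T := (L2 mQ setT).

Definition tr (B : set E) (w : E -> R) : E -> R := fun z => w z * \1_B z.

Lemma trE B w z : B z -> tr B w z = w z.
Proof. by move=> Bz; rewrite /tr indicE mem_set// mulr1. Qed.

Lemma tr_out B w z : ~ B z -> tr B w z = 0.
Proof. by move=> Bz; rewrite /tr indicE memNset// mulr0. Qed.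

Lemma tr_patch B w : tr B w = w \_ B.
Proof.
apply/funext => z; rewrite patchE; case: ifPn => [/set_mem|/negP h].
  exact: trE.
by rewrite tr_out// => Bz; apply: h; rewrite mem_set.
Qed.

Lemma Rint_tr (m : {measure set E -> \bar R}) B w :
  \int[m]_(z in B) w z = \int[m]_z tr B w z.
Proof. by rewrite Rintegral_mkcond tr_patch. Qed.

Lemma int1_tr (m : {measure set E -> \bar R}) B w : measurable B ->
  m.-integrable B (EFin \o w) <-> m.-integrable setT (EFin \o tr B w).
Proof.
move=> mB; rewrite integrable_mkcond//.
suff -> : (EFin \o w) \_ B = EFin \o tr B w by [].
by apply/funext => z; rewrite tr_patch /= !patchE; case: ifP.
Qed.

Lemma measurable_tr B w : measurable B -> measurable_fun B w ->
  measurable_fun setT (tr B w).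
Proof.
by move=> mB mw; rewrite tr_patch; apply/(measurable_restrictT _ mB).
Qed.

Lemma L2_tr B w : measurable B -> L2 mQ B w -> L2T (tr B w).
Proof.
move=> mB [mw w2]; split; first exact: measurable_tr.
move: w2; rewrite integral_mkcond.
rewrite (_ : _ \_ B = fun z => (tr B w z ^+ 2)%:E)//.
apply/funext => z; rewrite tr_patch !patchE; case: ifP => //.
by rewrite expr0n.
Qed.

Lemma L2_trV B w : measurable B -> L2T (tr B w) -> L2 mQ B w.
Proof.
move=> mB [mw w2]; split.
  by move: mw; rewrite tr_patch => /(measurable_restrictT _ mB).
move: w2; rewrite [X in _ -> (X < _)%E]integral_mkcond.
rewrite (_ : _ \_ B = fun z => (tr B w z ^+ 2)%:E)//.
apply/funext => z; rewrite tr_patch !patchE; case: ifP => //.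
by rewrite expr0n.
Qed.

Lemma L2_sub A B w : measurable A -> measurable B -> A `<=` B -> L2 mQ B w -> L2 mQ A w.
Proof.
move=> mA mB AB [mw w2]; split; first exact: measurable_funS mw.
apply: le_lt_trans w2; apply: ge0_subset_integral => //.
  by apply/measurable_EFinP; exact: measurable_funX.
by move=> z _; rewrite lee_fin sqr_ge0.
Qed.

Lemma compact_bd (B : set E) : compact B -> exists M, forall z, B z -> `|z| <= M.
Proof.
move=> /compact_bounded[M [Mr MB]]; exists (`|M| + 1) => z Bz.
by apply: (MB (`|M| + 1)) => //; rewrite (le_lt_trans (ler_norm _))// ltrDl.
Qed.

Lemma Lb_tr B w : compact B -> L2 mQ B w -> exists M, Lb M (tr B w).
Proof.
move=> cB Lw; have [M hM] := compact_bd cB; exists M; split.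
  by apply: L2_tr => //; exact: compact_measurable_E.
by move=> z Mz; rewrite tr_out// => /hM; rewrite leNgt Mz.
Qed.

Lemma off_bsupp B (f : E -> R) : compact B -> (forall z, ~ B z -> f z = 0) ->
  exists M, bsupp M f.
Proof.
move=> cB fB; have [M hM] := compact_bd cB; exists M => z Mz.
by apply: fB => /hM; rewrite leNgt Mz.
Qed.

(** ** Derivatives of averages *)

Lemma smooth_refl (f : E -> R) z : smooth f -> smooth (fun y => f (z - y)) /\
  forall y v, 'D_v (fun y => f (z - y)) y = - 'D_v f (z - y).
Proof.
move=> sf.
have D (g : E -> R) y v : smooth g ->
    is_derive y v (fun y => g (z - y)) (- 'D_v g (z - y)).
  move=> sg; apply: is_derive_line.
  have -> : (fun h : R => g (z - (h *: v + y))) = (fun h : R => g (h *: (- v) + (z - y))).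
    by apply/funext => h; congr g; rewrite opprD scalerN addrCA.
  have -> : - 'D_v g (z - y) = 'D_(- v) g (z - y).
    rewrite /derive; set F := fun h => _; set G := fun h => _.
    have -> : G = (fun h : R => - F (- h)).
      by apply/funext => h; rewrite /F /G /= scalerN scaleNr invrN scaleNr opprK.
    have cF : F h @[h --> 0^'] --> 'D_v g (z - y).
      exact: (smooth_derivable sg (x := z - y) (v := v)).
    suff : (fun h : R => - F (- h)) h @[h --> 0^'] --> - lim (F h @[h --> 0^']).
      by move/cvg_lim => ->.
    apply: cvgN; apply: cvg_trans cF.
    move=> A /= [e e0 eA]; exists e => // h /= he h0.
    by apply: eA; rewrite /= ?oppr_eq0// sub0r opprK -normrN -[- h]sub0r.
  apply: is_derive_lineP; rewrite scale0r add0r; exact: smooth_is_derive.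
split; last by move=> y v; have [_ ->] := D f y v sf.
apply: (@smooth_class _ _ (fun g => exists f' (c : R), smooth f' /\
    g = fun y => c * f' (z - y))).
- move=> _ [f' [c [sf' ->]]] y; apply: cvgM; first exact: cvg_cst.
  apply: (@continuous_comp _ _ _ (fun y : E => z - y) f' y); last exact: smooth_cts sf' _.
  exact: sub_cts.
- move=> _ [f' [c [sf' ->]]] v; exists (fun y => (- c) * 'D_v f' (z - y)); split.
    exists ('D_v f'), (- c); split => //; exact: smoothD.
  move=> y.
  have dl := is_deriveM (is_derive_cst c y v) (D f' y v sf').
  apply: is_derive_eq dl _.
  by rewrite /cst /GRing.scale /= mulr0 addr0 mulrN mulNr.
- by exists f, 1; split => //; apply/funext => y; rewrite mul1r.
Qed.

Lemma J_derive n M (G : E -> R) v : smooth G -> bsupp M G ->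
  'D_v (J n G) = J n ('D_v G).
Proof.
move=> sG bG; have cG := smooth_cts sG; have iG := cs_int1 cG bG.
apply/funext => z.
have [_ ->] := conv_is_derive v z (kap_smooth _) (kap_bsupp (en_gt0 n)) iG.
have [sr Dr] := smooth_refl z (kap_smooth (en n)).
have := @int_by_parts _ _ M G (fun y => kap (en n) (z - y)) v sG sr bG.
rewrite /J /conv => ->.
rewrite -RintN; last first.
  have bGr : bsupp M (fun y => 'D_v (fun y => kap (en n) (z - y)) y * G y).
    by move=> y /bG ->; rewrite mulr0.
  apply: (cs_int1 _ bGr) => y; apply: cvgM; last exact: cG.
  exact: (smooth_cts (smoothD v sr) (x := y)).
by apply: eq_Rintegral => y _; rewrite Dr mulNr opprK.
Qed.

Lemma J_cvg_comp M fs f : (forall n, Lb M (fs n)) -> Lb M f -> L2cv mQ fs f ->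
  L2cv mQ (fun n => J n (fs n)) f.
Proof.
move=> Lfs Lf [_ _ cf]; have [_ _ cJ] := J_cvg Lf.
apply: (@L2cv_le _ _ _ _ _ _ (fun n => 2 * N2 mQ (fun z => fs n z - f z) +
   2 * N2 mQ (fun z => J n f z - f z))).
- by move=> n; case: (J_Lb n (Lfs n)).
- by case: Lf.
- move=> n; have L1 := LbB (Lfs n) Lf; have [L2' _] := J_Lb n L1.
  have [L3 _] := J_Lb n Lf.
  have E1 : N2 mQ (fun z => J n (fs n) z - f z) =
     N2 mQ (fun z => J n (fun y => fs n y - f y) z + (J n f z - f z)).
    by apply: N2_eqr => z; rewrite JB; [ring|exact: Lb_int1 (Lfs n)|exact: Lb_int1 Lf].
  rewrite E1; apply: le_trans (N2D L2' (L2B L3 Lf.1)) _.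
  by rewrite lerD2r ler_wpM2l//; exact: J_contr L1.
- rewrite [X in _ --> X](_ : _ = 2 * 0 + 2 * 0); last by rewrite !mulr0 addr0.
  by apply: cvgD; apply: cvgM; [exact: cvg_cst|exact: cf|exact: cvg_cst|exact: cJ].
Qed.

End local.

Section weak.
Context {R : realType} {d : nat}.
Local Notation E := (R * 'rV[R]_d)%type.
Local Notation mQ := (@lebQ R d).
Local Notation int1 f := (mQ.-integrable setT (EFin \o f)).
Variable T : R.
Local Notation QT := (@QT R d T).
Local Notation oQT := (@oQT R d T).

Lemma oQT_QT : oQT `<=` QT.
Proof.
by move=> z [h1 _]; split => //; move: h1; rewrite /= !in_itv/= => /andP[/ltW-> /ltW->].
Qed.

Lemma oQTP (z : E) : oQT z <-> 0 < z.1 < T.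
Proof. by split => [[]|h]; [|split => //]; rewrite /= in_itv. Qed.

Lemma QTP (z : E) : QT z <-> 0 <= z.1 <= T.
Proof. by split => [[]|h]; [|split => //]; rewrite /= in_itv. Qed.

Lemma measurable_strip (t s : R) : measurable (@strip R d t s).
Proof. by apply: measurableX => //; exact: measurable_itv. Qed.

Lemma measurable_QT : measurable QT.
Proof. exact: measurable_strip. Qed.

Definition cbox (a b : E) : set E :=
  [set z : E | a.1 <= z.1 <= b.1 /\ forall i, a.2 0 i <= z.2 0 i <= b.2 0 i].

Lemma compact_cbox a b : compact (cbox a b).
Proof.
have -> : cbox a b = `[a.1, b.1]%classic `*`
   [set x : 'rV[R]_d | forall i, `[a.2 0 i, b.2 0 i]%classic (x 0 i)].
  apply/seteqP; split => z; rewrite /cbox /= in_itv/=.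
    by move=> [-> h]; split => // i; rewrite in_itv/= h.
  by move=> [-> h]; split => // i; have := h i; rewrite in_itv/=.
apply: compact_setX; first exact: segment_compact.
apply: (@rV_compact R d (fun i => `[a.2 0 i, b.2 0 i]%classic)) => i.
exact: segment_compact.
Qed.

Lemma box_cbox a b : box a b `<=` cbox a b.
Proof.
move=> z [/andP[h1 h2] h]; split; first by rewrite !ltW.
by move=> i; have /andP[h3 h4] := h i; rewrite !ltW.
Qed.

Definition obox (n : nat) : set E := box (en n, const_mx (- n.+1%:R)) (T - en n, const_mx n.+1%:R).

Definition ocbox (n : nat) : set E := cbox (en n, const_mx (- n.+1%:R)) (T - en n, const_mx n.+1%:R).

Lemma ocbox_oQT n : ocbox n `<=` oQT.
Proof.
move=> z [/andP[h1 h2] _]; apply/oQTP; have := en_gt0 n (R := R) => e0.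
by move: h1 h2 => /=; lra.
Qed.

Lemma oQT_cover : oQT `<=` \bigcup_n obox n.
Proof.
move=> z /oQTP/andP[z0 zT].
pose m := Num.min z.1 (T - z.1).
have m0 : 0 < m by rewrite lt_min z0 subr_gt0.
have [N1 hN1] := truncn_gt_norm (R := R) m^-1.
have [N2 hN2] := truncn_gt_norm (R := R) `|z|.
pose n := maxn N1 N2.
have n1 : m^-1 < n.+1%:R by apply: (lt_le_trans hN1); rewrite ler_nat leqW// leq_maxl.
have n2 : `|z| < n.+1%:R by apply: (lt_le_trans hN2); rewrite ler_nat leqW// leq_maxr.
have enm : en n < m by rewrite /en invf_plt ?posrE ?ltr0n.
have [em1 em2] : en n < z.1 /\ en n < T - z.1.
  by move: enm; rewrite lt_min => /andP.
exists n => //; split => /=; first by rewrite em1 ltrBrDl -ltrBrDr.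
move=> i; rewrite !mxE -ltr_norml (le_lt_trans _ n2)//.
by rewrite (le_trans (rV_coord_le _ _))// E_norm2.
Qed.

Lemma test_fun_compact (B : set E) (f : E -> R) : compact B -> B `<=` oQT -> smooth f ->
  (forall z, ~ B z -> f z = 0) -> test_fun oQT f.
Proof. by move=> cB BQ sf fB; split => //; exists B. Qed.

Lemma test_bsupp (psi : E -> R) : test_fun oQT psi -> exists M, bsupp M psi.
Proof. by move=> [_ [K [cK _ pK]]]; exact: off_bsupp pK. Qed.

Lemma test_off (psi : E -> R) z : test_fun oQT psi -> ~ oQT z -> psi z = 0.
Proof. by move=> [_ [K [_ KQ pK]]] nz; apply: pK => /KQ. Qed.

Lemma deriv_off (B : set E) (f : E -> R) v : closed B ->
  (forall z, ~ B z -> f z = 0) -> forall z, ~ B z -> 'D_v f z = 0.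
Proof.
move=> cB fB z nz.
have Ez : \near z, (cst (0 : R)) z = f z.
  have oC : open (~` B) by exact: closed_openC.
  have : \near z, (~` B) z by exact: open_nbhs_nbhs.
  by apply: filterS => y /fB ->.
by have [_ ->] := near_eq_is_derive Ez (is_derive_cst (0 : R) z v).
Qed.

Lemma test_deriv_off (psi : E -> R) v z : test_fun oQT psi -> ~ oQT z -> 'D_v psi z = 0.
Proof.
move=> [_ [K [cK KQ pK]]] nz; apply: (deriv_off (B := K)) => //.
  exact: compact_closed.
by move=> /KQ.
Qed.

Lemma int_test (w psi : E -> R) : (forall z, ~ oQT z -> psi z = 0) ->
  \int[mQ]_(z in oQT) (w z * psi z) = \int[mQ]_z (w z * psi z).
Proof.
move=> h; rewrite Rint_tr; apply: eq_Rintegral => z _.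
have [oz|nz] := pselect (oQT z); first by rewrite trE.
by rewrite tr_out// h// mulr0.
Qed.

Lemma wderivP (v : E) (u : E -> R) : has_wderiv T v u -> is_wderiv T v u (wderiv T v u).
Proof. by move=> h; exact: xgetPex. Qed.

(** Bumps on boxes inside the strip are test functions, so that [box_ae0] applies
    to [g1 - g2]. *)
Lemma wderiv_unique (v : E) (u g1 g2 : E -> R) : is_wderiv T v u g1 -> is_wderiv T v u g2 ->
  {ae mQ, forall z, oQT z -> g1 z = g2 z}.
Proof.
move=> [m1 i1 w1] [m2 i2 w2].
apply: (bigcup_box_ae oQT_cover) => n.
have mB : measurable (obox n) by exact: measurable_obox.
have sub : obox n `<=` ocbox n by exact: box_cbox.
have cB : compact (ocbox n) by exact: compact_cbox.
have loc (g : E -> R) : (forall K, compact K -> K `<=` oQT -> mQ.-integrable K (EFin \o g)) ->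
    int1 (fun z => g z * \1_(obox n) z).
  move=> ig; apply: (int1_tr mQ g mB).1.
  exact: (integrableS (compact_measurable_E cB) mB sub (ig _ cB (@ocbox_oQT n))).
have H : {ae mQ, forall z, obox n z -> g1 z - g2 z = 0}.
  apply: box_ae0.
    have -> : (fun z => (g1 z - g2 z) * \1_(obox n) z) =
        (fun z => g1 z * \1_(obox n) z - g2 z * \1_(obox n) z).
      by apply/funext => z; rewrite mulrBl.
    by apply: int1B; exact: loc.
  move=> k a b ab.
  have tb : test_fun oQT (bE k.+1%:R a b).
    apply: (test_fun_compact cB); [exact: ocbox_oQT|exact: bE_smooth|].
    by move=> z nz; apply: bE_out => // /ab /sub.
  have I (g : E -> R) : (forall K, compact K -> K `<=` oQT -> mQ.-integrable K (EFin \o g)) ->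
      int1 (fun z => g z * bE k.+1%:R a b z).
    move=> ig; have -> : (fun z => g z * bE k.+1%:R a b z) =
        (fun z => bE k.+1%:R a b z * (g z * \1_(obox n) z)).
      apply/funext => z; rewrite indicE; have [zn|zn] := pselect (obox n z).
        by rewrite mem_set// mulr1 mulrC.
      by rewrite memNset// !mulr0 bE_out ?mulr0// => /ab.
    apply: (int1_bounded (loc _ ig)); last by move=> z; exact: bE_norm.
    by apply: cts_measurable_E; exact: bE_cts.
  have E1 (z : E) : ~ oQT z -> bE k.+1%:R a b z = 0 by exact: test_off.
  have -> : (fun z => (g1 z - g2 z) * bE k.+1%:R a b z) =
      (fun z => g1 z * bE k.+1%:R a b z - g2 z * bE k.+1%:R a b z).
    by apply/funext => z; rewrite mulrBl.
  rewrite RintB; [|exact: I..].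
  rewrite -!int_test//; apply/eqP; rewrite subr_eq0; apply/eqP.
  by apply: oppr_inj; rewrite -w1// -w2.
case: H => N [mN N0 sN]; exists N; split => // z /= nz; apply: sN => /= h.
by apply: nz => zn; apply/eqP; rewrite -subr_eq0; apply/eqP; exact: h.
Qed.

Lemma cts_int_compact (f : E -> R) K : continuous f -> compact K ->
  mQ.-integrable K (EFin \o f).
Proof.
move=> cf cK; have mK := compact_measurable_E cK.
have [C C0 fC] := compact_cts_bounded cK (continuous_subspaceT cf).
apply: measurable_bounded_integrable => //.
- exact: compact_E_lty.
- exact: measurable_funTS (cts_measurable_E cf).
- by exists C; split; [exact: num_real|move=> D CD z Kz; exact: le_trans (fC z Kz) (ltW CD)].
Qed.

Lemma wderiv_smooth v (eta : E -> R) : smooth eta -> is_wderiv T v eta ('D_v eta).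
Proof.
move=> se; have cD := smooth_cts (smoothD v se); split.
- exact: measurable_funTS (cts_measurable_E cD).
- by move=> K cK _; exact: cts_int_compact.
- move=> psi tp; have [M bM] := test_bsupp tp.
  rewrite !int_test; last 2 first.
  - by move=> z; exact: test_off.
  - by move=> z; exact: test_deriv_off.
  by rewrite (int_by_parts v tp.1 se bM).
Qed.

Lemma wderiv_smoothE v (eta : E -> R) : smooth eta ->
  {ae mQ, forall z, oQT z -> wderiv T v eta z = 'D_v eta z}.
Proof.
move=> se; apply: wderiv_unique (wderiv_smooth v se).
by apply: wderivP; exists ('D_v eta); exact: wderiv_smooth.
Qed.

Definition loc1 (w : E -> R) : Prop := measurable_fun QT w /\
  forall K, compact K -> K `<=` oQT -> mQ.-integrable K (EFin \o w).

Lemma loc1_wderiv v w w' : is_wderiv T v w w' -> loc1 w'.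
Proof. by case. Qed.

Lemma L2_int_compact w K : compact K -> L2 mQ K w -> mQ.-integrable K (EFin \o w).
Proof.
move=> cK Lw; apply/(int1_tr _ _ (compact_measurable_E cK)).
by have [M LM] := Lb_tr cK Lw; exact: Lb_int1 LM.
Qed.

Lemma loc1_L2 w : measurable_fun QT w -> L2loc_QT T w -> loc1 w.
Proof.
move=> mw Lw; split => // K cK KQ; apply: L2_int_compact => //.
by apply: Lw => // z /KQ /oQT_QT.
Qed.

Lemma int_loc1_test w (psi : E -> R) K : loc1 w -> compact K -> K `<=` oQT ->
  continuous psi -> (forall z, ~ K z -> psi z = 0) -> int1 (fun z => w z * psi z).
Proof.
move=> [mw iw] cK KQ cp pK; have mK := compact_measurable_E cK.
have [M bM] := off_bsupp cK pK.
have [C C0 pC] := cs_bounded E_balls_compact cp bM.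
have -> : (fun z => w z * psi z) = (fun z => psi z * tr K w z).
  apply/funext => z; have [Kz|nK] := pselect (K z); first by rewrite trE// mulrC.
  by rewrite tr_out// pK// !mulr0.
apply: (int1_bounded (C := C)) => //; last exact: cts_measurable_E.
by apply/(int1_tr _ _ mK); exact: iw.
Qed.

Lemma wderivD v w1 w2 g1 g2 (c : R) : loc1 w1 -> loc1 w2 ->
  is_wderiv T v w1 g1 -> is_wderiv T v w2 g2 ->
  is_wderiv T v (fun z => c * w1 z + w2 z) (fun z => c * g1 z + g2 z).
Proof.
move=> l1 l2 d1 d2; have l1' := loc1_wderiv d1; have l2' := loc1_wderiv d2.
have [m1 _ e1] := d1; have [m2 _ e2] := d2; split.
- by apply: measurable_funD => //; apply: measurable_funM.
- move=> K cK KQ; have mK := compact_measurable_E cK.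
  rewrite (_ : _ \o _ = (fun z => c%:E * (EFin \o g1) z + (EFin \o g2) z))%E//.
  apply: integrableD => //; last exact: l2'.2.
  by apply: integrableZl => //; exact: l1'.2.
- move=> psi tp; have [sp [K [cK KQ pK]]] := tp.
  have cp := smooth_cts sp; have cDp := smooth_cts (smoothD v sp).
  have DK := deriv_off v (compact_closed (@norm_hausdorff _ _) cK) pK.
  rewrite !int_test; [|by move=> z; exact: test_off|by move=> z; exact: test_deriv_off].
  transitivity (c * \int[mQ]_z (w1 z * 'D_v psi z) + \int[mQ]_z (w2 z * 'D_v psi z)).
    rewrite -RintZ; last exact: int_loc1_test l1 cK KQ cDp DK.
    rewrite -RintD; first by apply: eq_Rintegral => z _; ring.
    - by apply: int1Z; exact: int_loc1_test l1 cK KQ cDp DK.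
    - exact: int_loc1_test l2 cK KQ cDp DK.
  rewrite -!(int_test _ (psi := 'D_v psi)); try by move=> z; exact: test_deriv_off.
  rewrite e1// e2// !int_test; try by move=> z; exact: test_off.
  rewrite mulrN -opprD; congr (- _).
  rewrite -RintZ; last exact: int_loc1_test l1' cK KQ cp pK.
  rewrite -RintD; first by apply: eq_Rintegral => z _; ring.
  - by apply: int1Z; exact: int_loc1_test l1' cK KQ cp pK.
  - exact: int_loc1_test l2' cK KQ cp pK.
Qed.

(** Test the derivative of [w] with [q * psi]. *)
Lemma wderivM v w g (q : E -> R) : loc1 w -> is_wderiv T v w g -> smooth q ->
  is_wderiv T v (fun z => w z * q z) (fun z => g z * q z + w z * 'D_v q z).
Proof.
move=> lw dg sq; have lg := loc1_wderiv dg; have [mg _ eg] := dg.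
have cq := smooth_cts sq; have cDq := smooth_cts (smoothD v sq).
have mq := measurable_funTS (D := QT) (cts_measurable_E cq).
have mDq := measurable_funTS (D := QT) (cts_measurable_E cDq).
split.
- by apply: measurable_funD; apply: measurable_funM => //; case: lw.
- move=> K cK KQ; have mK := compact_measurable_E cK.
  have H (h p : E -> R) : loc1 h -> continuous p -> mQ.-integrable K (EFin \o (fun z => h z * p z)).
    move=> lh cp; have [C C0 pC] := compact_cts_bounded cK (continuous_subspaceT cp).
    apply/(int1_tr _ _ mK).
    have -> : tr K (fun z => h z * p z) = (fun z => tr K p z * tr K h z).
      apply/funext => z; have [Kz|nK] := pselect (K z); first by rewrite !trE// mulrC.
      by rewrite !tr_out// mul0r.
    apply: (int1_bounded (C := C)); first by apply/(int1_tr _ _ mK); exact: lh.2.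
      by apply: measurable_tr => //; exact: measurable_funTS (cts_measurable_E cp).
    move=> z; have [Kz|nK] := pselect (K z); first by rewrite trE// pC.
    by rewrite tr_out// normr0.
  rewrite (_ : _ \o _ = (fun z => (EFin \o (fun z => (g z * q z)%R)) z +
      (EFin \o (fun z => (w z * 'D_v q z)%R)) z))%E//.
  by apply: integrableD => //; exact: H.
- move=> psi tp; have [sp [K [cK KQ pK]]] := tp.
  have cp := smooth_cts sp; have cDp := smooth_cts (smoothD v sp).
  have DK := deriv_off v (compact_closed (@norm_hausdorff _ _) cK) pK.
  have tqp : test_fun oQT (fun z => q z * psi z).
    apply: (test_fun_compact cK KQ); first exact: smooth_mul.
    by move=> z /pK ->; rewrite mulr0.
  have := eg _ tqp.
  rewrite !int_test; try by move=> z; exact: (test_off tqp).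
  all: try by move=> z; exact: (test_deriv_off v tqp).
  all: try by move=> z; exact: test_off.
  all: try by move=> z; exact: test_deriv_off.
  have -> : (fun z => w z * 'D_v (fun z => q z * psi z) z) =
      (fun z => w z * (q z * 'D_v psi z) + w z * (psi z * 'D_v q z)).
    by apply/funext => z; rewrite derive_mul// mulrDr.
  have i1 : int1 (fun z => w z * (q z * 'D_v psi z)).
    apply: int_loc1_test lw cK KQ _ _; last by move=> z /DK ->; rewrite mulr0.
    by move=> z; apply: cvgM; [exact: cq|exact: cDp].
  have i2 : int1 (fun z => w z * (psi z * 'D_v q z)).
    apply: int_loc1_test lw cK KQ _ _; last by move=> z /pK ->; rewrite mul0r.
    by move=> z; apply: cvgM; [exact: cp|exact: cDq].
  have i3 : int1 (fun z => g z * (q z * psi z)).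
    apply: int_loc1_test lg cK KQ _ _; last by move=> z /pK ->; rewrite mulr0.
    by move=> z; apply: cvgM; [exact: cq|exact: cp].
  rewrite RintD// => h.
  have -> : \int[mQ]_z (w z * q z * 'D_v psi z) = \int[mQ]_z (w z * (q z * 'D_v psi z)).
    by apply: eq_Rintegral => z _; rewrite mulrA.
  have -> : \int[mQ]_z ((g z * q z + w z * 'D_v q z) * psi z) =
     \int[mQ]_z (g z * (q z * psi z) + w z * (psi z * 'D_v q z)).
    by apply: eq_Rintegral => z _; ring.
  by move: h; rewrite RintD// => /(canRL (addrK _)) ->; rewrite opprD.
Qed.

(** Averaging commutes with weak derivatives away from the boundary of the set to
    which the functions are truncated. *)
Lemma J_wderiv n (B : set E) v w w' z : compact B -> B `<=` oQT ->
  is_wderiv T v w w' -> mQ.-integrable B (EFin \o w) ->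
  (forall y, `|z - y| < en n -> B y) ->
  'D_v (J n (tr B w)) z = J n (tr B w') z.
Proof.
move=> cB BQ [_ _ ew] iw zB; have mB := compact_measurable_E cB.
have iw' : int1 (tr B w) by apply/(int1_tr _ _ mB).
have [_ ->] := conv_is_derive v z (kap_smooth _) (kap_bsupp (en_gt0 n)) iw'.
have [sr Dr] := smooth_refl z (kap_smooth (en n)).
have kB y : ~ B y -> kap (en n) (z - y) = 0.
  move=> nB; apply: kap_out; first exact: en_gt0.
  by rewrite leNgt; apply/negP => /zB.
have tk : test_fun oQT (fun y => kap (en n) (z - y)).
  exact: (test_fun_compact cB BQ).
have := ew _ tk; rewrite !int_test; try by move=> y; exact: (test_off tk).
  all: try by move=> y; exact: (test_deriv_off v tk).
have DB := deriv_off v (compact_closed (@norm_hausdorff _ _) cB) kB.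
have -> : (fun y => w y * 'D_v (fun y => kap (en n) (z - y)) y) =
    (fun y => - ('D_v (kap (en n)) (z - y) * tr B w y)).
  apply/funext => y; have [By|nB] := pselect (B y).
    by rewrite trE// Dr mulrN mulrC.
  by rewrite tr_out// DB// !mulr0 oppr0.
rewrite RintN; last first.
  exact: (conv_int1 z (smooth_cts (smoothD v (kap_smooth (en n))))
    (bsuppD v (kap_bsupp (en_gt0 n))) iw').
move/oppr_inj; rewrite /conv => ->; rewrite /J /conv; apply: eq_Rintegral => y _.
have [By|nB] := pselect (B y); first by rewrite trE// mulrC.
by rewrite tr_out// kB// !mulr0.
Qed.

End weak.

(** * The mollified test functions *)

Section L2_more.
Context d0 (X : measurableType d0) (R : realType).
Variable m : {measure set X -> \bar R}.
Local Notation int1 f := (m.-integrable setT (EFin \o f)).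

Lemma L2cv_shift N fs f : L2cv m fs f -> L2cv m (fun n => fs (n + N)%N) f.
Proof.
move=> [Lfs Lf cf]; split => //.
by move: cf; rewrite -(cvg_shiftn N).
Qed.

Lemma le_Rint_ae (f g : X -> R) : int1 f -> int1 g -> {ae m, forall x, f x <= g x} ->
  \int[m]_x f x <= \int[m]_x g x.
Proof.
move=> If Ig fg; rewrite -subr_ge0 -RintB//.
rewrite (@Rintegral_ae_ext _ _ _ _ _ _ (fun x => `|g x - f x|)).
  by apply: Rintegral_ge0 => x _; exact: normr_ge0.
by apply: filterS fg => x fgx _; rewrite ger0_norm// subr_ge0.
Qed.

Lemma int1_finite (B : set X) (f : X -> R) C : measurable B -> (m B < +oo)%E ->
  measurable_fun setT f -> (forall x, `|f x| <= C) -> (forall x, ~ B x -> f x = 0) ->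
  int1 f.
Proof.
move=> mB Boo mf fC f0.
have -> : f = (fun x => f x * \1_B x).
  apply/funext => x; rewrite indicE; have [Bx|nB] := pselect (B x).
    by rewrite mem_set// mulr1.
  by rewrite f0// mul0r.
apply: int1_bounded fC => //.
exact: indic_int1.
Qed.

End L2_more.

Section core.
Context {R : realType} {d : nat}.
Local Notation E := (R * 'rV[R]_d)%type.
Local Notation mQ := (@lebQ R d).
Local Notation int1 f := (mQ.-integrable setT (EFin \o f)).
Variables (T : R) (B0 B : set E) (N : nat) (zeta : E -> R).
Hypothesis cB0 : compact B0.
Hypothesis cB : compact B.
Hypothesis BQ : B `<=` oQT T.
Hypothesis thick : forall z y, B0 z -> `|z - y| <= en N -> B y.
Hypothesis szeta : smooth zeta.
Hypothesis zeta0 : forall z, ~ B0 z -> zeta z = 0.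

(** The second average makes the test function smooth. Being self-adjoint, it
    moves from there to the function that multiplies the test function, which so
    becomes an average as well. *)
Definition mol (w : E -> R) n : E -> R := J n (fun z => zeta z * J n (tr B w) z).

Let mB : measurable B. Proof. exact: compact_measurable_E. Qed.

Lemma core_sub : B0 `<=` B.
Proof. by move=> z Bz; apply: (thick Bz); rewrite subrr normr0 ltW// en_gt0. Qed.

Lemma en_le n k : (n <= k)%N -> en k <= en n :> R.
Proof. by move=> nk; rewrite /en lef_pV2 ?posrE ?ltr0n// ler_nat ltnS. Qed.

Lemma Lb_off (p g : E -> R) M : continuous p -> (forall z, ~ B0 z -> p z = 0) ->
  Lb M g -> Lb M (fun z => p z * g z).
Proof.
move=> cp p0 Lg; have [K bK] := off_bsupp cB0 p0.
have [C C0 pC] := cs_bounded E_balls_compact cp bK.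
by apply: Lb_mul_bd pC Lg; exact: cts_measurable_E.
Qed.

Lemma Dzeta0 v z : ~ B0 z -> 'D_v zeta z = 0.
Proof.
by apply: deriv_off => //; apply: (compact_closed (@norm_hausdorff _ _)).
Qed.

Lemma offJ_cvg (p w : E -> R) : continuous p -> (forall z, ~ B0 z -> p z = 0) ->
  L2 mQ B w -> exists M, (forall n, Lb M (fun z => p z * J n (tr B w) z)) /\
    L2cv mQ (fun n z => p z * J n (tr B w) z) (fun z => p z * tr B w z).
Proof.
move=> cp p0 Lw; have [M LM] := Lb_tr cB Lw.
have [K bK] := off_bsupp cB0 p0.
have [C C0 pC] := cs_bounded E_balls_compact cp bK.
exists (M + 1); split; first by move=> n; apply: Lb_off => //; exact: J_Lb.
by apply: (L2cvM (C := C)) => //; [exact: J_cvg LM|exact: cts_measurable_E].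
Qed.

Lemma Lb_le (M K : R) (g : E -> R) : M <= K -> Lb M g -> Lb K g.
Proof. by move=> MK [Lg bg]; split => //; exact: bsupp_le bg. Qed.

Lemma L2cv_Lb M (fs : nat -> E -> R) f : (forall n, Lb M (fs n)) ->
  (forall z, ~ B z -> f z = 0) -> L2cv mQ fs f -> exists K, (forall n, Lb K (fs n)) /\ Lb K f.
Proof.
move=> Lfs f0 [_ Lf _]; have [K bK] := off_bsupp cB f0.
exists (Num.max M K); split.
  by move=> n; apply: Lb_le (Lfs n); rewrite le_max lexx.
by split => //; apply: bsupp_le bK; rewrite le_max lexx orbT.
Qed.

Section mol_theory.
Variable w : E -> R.
Hypothesis Lw : L2 mQ B w.

Lemma mol_int1 n : int1 (fun z => zeta z * J n (tr B w) z).
Proof.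
have [M [LM _]] := offJ_cvg (smooth_cts szeta) zeta0 Lw.
exact: Lb_int1 (LM n).
Qed.

Lemma mol_smooth n : smooth (mol w n).
Proof. by apply: J_smooth; exact: mol_int1. Qed.

Lemma tr_smooth n : smooth (J n (tr B w)).
Proof. by have [M LM] := Lb_tr cB Lw; apply: J_smooth; exact: Lb_int1 LM. Qed.

Lemma J_off (g : E -> R) n z : (forall y, ~ B0 y -> g y = 0) -> (N <= n)%N -> ~ B z -> J n g z = 0.
Proof.
move=> g0 Nn nB; apply: (J_supp (A := B0)) => // y By; rewrite ltNge; apply/negP => h.
apply: nB; apply: (thick By); rewrite distrC (le_trans h)//; exact: en_le.
Qed.

Lemma mol_off n z : (N <= n)%N -> ~ B z -> mol w n z = 0.
Proof. by apply: J_off => y /zeta0 ->; rewrite mul0r. Qed.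

Lemma mol_cvg : L2cv mQ (fun n => mol w (n + N)) (fun z => zeta z * tr B w z).
Proof.
apply: (L2cv_shift N (fs := mol w)).
have [M [LM cM]] := offJ_cvg (smooth_cts szeta) zeta0 Lw.
have [|K [L1 L2']] := L2cv_Lb LM _ cM; first by move=> z nz; rewrite tr_out// mulr0.
exact: J_cvg_comp L1 L2' cM.
Qed.

Lemma core_Jderive n v w' : (N <= n)%N -> is_wderiv T v w w' -> forall z, B0 z ->
  'D_v (J n (tr B w)) z = J n (tr B w') z.
Proof.
move=> Nn dw z Bz; apply: (J_wderiv cB BQ dw); first exact: L2_int_compact.
by move=> y zy; apply: (thick Bz); rewrite (le_trans (ltW zy))//; exact: en_le.
Qed.

Lemma mol_derive n v w' : (N <= n)%N -> is_wderiv T v w w' ->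
  'D_v (mol w n) = J n (fun z => 'D_v zeta z * J n (tr B w) z + zeta z * J n (tr B w') z).
Proof.
move=> Nn dw; have sJ := tr_smooth n.
have [K bK] := off_bsupp cB0 zeta0.
have bz : bsupp K (fun z => zeta z * J n (tr B w) z) by move=> z /bK ->; rewrite mul0r.
rewrite /mol (J_derive n v (smooth_mul szeta sJ) bz); congr (J n _).
apply/funext => z; rewrite derive_mul// addrC mulrC.
have [Bz|nB] := pselect (B0 z); first by rewrite (core_Jderive Nn dw).
by rewrite zeta0// !mul0r.
Qed.

Lemma mol_derive_cvg v w' : is_wderiv T v w w' -> L2 mQ B w' ->
  L2cv mQ (fun n => 'D_v (mol w (n + N)))
    (fun z => 'D_v zeta z * tr B w z + zeta z * tr B w' z).
Proof.
move=> dw Lw'.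
have [M [LM cM]] := offJ_cvg (smooth_cts (smoothD v szeta)) (@Dzeta0 v) Lw.
have [M' [LM' cM']] := offJ_cvg (smooth_cts szeta) zeta0 Lw'.
have cs := L2cvD cM cM'.
have Ls n : Lb (Num.max M M') (fun z => 'D_v zeta z * J n (tr B w) z + zeta z * J n (tr B w') z).
  apply: LbD; first by apply: Lb_le (LM n); rewrite le_max lexx.
  by apply: Lb_le (LM' n); rewrite le_max lexx orbT.
have [|K [L1 L2']] := L2cv_Lb Ls _ cs.
  by move=> z nz; rewrite !tr_out// !mulr0 addr0.
have := L2cv_shift N (J_cvg_comp L1 L2' cs).
rewrite (_ : (fun n => J (n + N) _) = (fun n => 'D_v (mol w (n + N))))//.
by apply/funext => n; rewrite (mol_derive _ dw)// leq_addl.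
Qed.

(** Integrate by parts: [omega D(zeta omega)] and [D zeta omega^2 / 2] differ by
    the derivative of [zeta omega^2 / 2]. *)
Lemma int_self v n : \int[mQ]_z (J n (tr B w) z * 'D_v (fun z => zeta z * J n (tr B w) z) z) =
  2^-1 * \int[mQ]_z (J n (tr B w) z * ('D_v zeta z * J n (tr B w) z)).
Proof.
have so := tr_smooth n; set o := J n (tr B w); set A := LHS.
have [K bK] := off_bsupp cB0 zeta0.
have bz : bsupp K (fun z => zeta z * o z) by move=> z /bK ->; rewrite mul0r.
have := int_by_parts v (smooth_mul szeta so) so bz; rewrite -/o -/A => AE.
have co := smooth_cts so; have cDo := smooth_cts (smoothD v so).
have cz := smooth_cts szeta; have cDz := smooth_cts (smoothD v szeta).
have i1 : int1 (fun z => o z * ('D_v zeta z * o z)).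
  apply: (cs_int1 (M := K)); last by move=> z Kz; rewrite (bsuppD v bK Kz) mul0r mulr0.
  by move=> z; apply: cvgM; [exact: co|apply: cvgM; [exact: cDz|exact: co]].
have i2 : int1 (fun z => 'D_v o z * (zeta z * o z)).
  apply: (cs_int1 (M := K)); last by move=> z /bK ->; rewrite mul0r mulr0.
  by move=> z; apply: cvgM; [exact: cDo|apply: cvgM; [exact: cz|exact: co]].
have : A = \int[mQ]_z (o z * ('D_v zeta z * o z)) + \int[mQ]_z ('D_v o z * (zeta z * o z)).
  rewrite -RintD//; apply: eq_Rintegral => z _; rewrite derive_mul//.
  ring.
move: AE; set I1 := \int[mQ]_z _; set I2 := \int[mQ]_z _ => AE.
by move: AE; clearbody A I1 I2 => ->; lra.
Qed.

End mol_theory.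

(** With [u = v - w]: the derivative falls on [v], which has one, while the term
    with [w] is [int_self] for [omega = J n w], hence only contains the square of
    [w]. *)
Lemma mol_time (dir : E) (u v vt : E -> R) : L2 mQ B u -> L2 mQ B v -> L2 mQ B vt ->
  is_wderiv T dir v vt ->
  \int[mQ]_z (tr B u z * 'D_dir (mol (fun z => v z - u z) (n + N)) z) @[n --> \oo] -->
  - (\int[mQ]_z (zeta z * vt z * (v z - u z))) - 2^-1 * \int[mQ]_z ('D_dir zeta z * (v z - u z) ^+ 2).
Proof.
move=> Lu Lv Lvt dv; set w : E -> R := fun z => v z - u z.
have trw : tr B w = (fun z => tr B v z - tr B u z).
  by apply/funext => z; rewrite /tr /w mulrBl.
have Lw : L2 mQ B w.
  by apply: L2_trV => //; rewrite trw; apply: L2B; exact: L2_tr.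
have [Mu Lbu] := Lb_tr cB Lu; have [Mv Lbv] := Lb_tr cB Lv; have [Mw Lbw] := Lb_tr cB Lw.
have [K bK] := off_bsupp cB0 zeta0.
have cz := smooth_cts szeta; have cDz := smooth_cts (smoothD dir szeta).
have EQn n : \int[mQ]_z (tr B u z * 'D_dir (mol w (n + N)) z) =
    - (\int[mQ]_z (J (n + N) (tr B vt) z * (zeta z * J (n + N) (tr B w) z)))
    - 2^-1 * \int[mQ]_z (J (n + N) (tr B w) z * ('D_dir zeta z * J (n + N) (tr B w) z)).
  set k := (n + N)%N; set o := J k (tr B w).
  have so : smooth o by exact: tr_smooth.
  have sv : smooth (J k (tr B v)) by exact: tr_smooth.
  have sG := smooth_mul szeta so.
  have bG : bsupp K (fun z => zeta z * o z) by move=> z /bK ->; rewrite mul0r.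
  have cDG := smooth_cts (smoothD dir sG); have bDG := bsuppD dir bG.
  have LG : Lb K ('D_dir (fun z => zeta z * o z)).
    by split => //; exact: cs_L2 cDG bDG.
  have DE : 'D_dir (mol w k) = J k ('D_dir (fun z => zeta z * o z)) by exact: J_derive sG bG.
  transitivity (\int[mQ]_z (tr B u z * J k ('D_dir (fun z => zeta z * o z)) z)).
    by apply: eq_Rintegral => z _; rewrite -DE.
  rewrite -(J_adj k Lbu LG).
  have -> : J k (tr B u) = (fun z => J k (tr B v) z - o z).
    rewrite /o trw JB; [|exact: Lb_int1 Lbv|exact: Lb_int1 Lbu].
    by apply/funext => z; rewrite subKr.
  have i1 : int1 (fun z => J k (tr B v) z * 'D_dir (fun z => zeta z * o z) z).
    apply: (cs_int1 (M := K)); last by move=> z /bDG ->; rewrite mulr0.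
    by move=> z; apply: cvgM; [exact: smooth_cts sv _|exact: cDG].
  have i2 : int1 (fun z => o z * 'D_dir (fun z => zeta z * o z) z).
    apply: (cs_int1 (M := K)); last by move=> z /bDG ->; rewrite mulr0.
    by move=> z; apply: cvgM; [exact: smooth_cts so _|exact: cDG].
  have -> : \int[mQ]_z ((J k (tr B v) z - o z) * 'D_dir (fun z => zeta z * o z) z) =
     \int[mQ]_z (J k (tr B v) z * 'D_dir (fun z => zeta z * o z) z) -
     \int[mQ]_z (o z * 'D_dir (fun z => zeta z * o z) z).
    by rewrite -RintB//; apply: eq_Rintegral => z _; rewrite mulrBl.
  have H1 := int_by_parts dir sG sv bG.
  have H2 := int_self Lw dir k.
  transitivity (- (\int[mQ]_z ('D_dir (J k (tr B v)) z * (zeta z * o z))) -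
      2^-1 * \int[mQ]_z (o z * ('D_dir zeta z * o z))).
    by apply: f_equal2; [exact: H1|apply: f_equal; exact: H2].
  congr (- _ - _).
  apply: eq_Rintegral => z _; have [Bz|nB] := pselect (B0 z).
    by rewrite (core_Jderive _ _ dv)// leq_addl.
  by rewrite zeta0// !mul0r !mulr0.
rewrite (eq_cvg _ _ EQn).
have cw := L2cv_shift N (J_cvg Lbw).
have [Mt Lbt] := Lb_tr cB Lvt; have ct := L2cv_shift N (J_cvg Lbt).
have [_ [_ c1]] := offJ_cvg cz zeta0 Lw.
have [_ [_ c2]] := offJ_cvg cDz (@Dzeta0 dir) Lw.
have e1 : \int[mQ]_z (zeta z * vt z * w z) = \int[mQ]_z (tr B vt z * (zeta z * tr B w z)).
  apply: eq_Rintegral => z _; have [Bz|nB] := pselect (B0 z).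
    by rewrite !trE; [ring|exact: core_sub..].
  by rewrite zeta0// !mul0r mulr0.
have e2 : \int[mQ]_z ('D_dir zeta z * w z ^+ 2) = \int[mQ]_z (tr B w z * ('D_dir zeta z * tr B w z)).
  apply: eq_Rintegral => z _; have [Bz|nB] := pselect (B0 z).
    by rewrite !trE; [ring|exact: core_sub..].
  by rewrite Dzeta0// !mul0r mulr0.
rewrite e1 e2; apply: cvgB; first by apply: cvgN; exact: L2cv_int ct (L2cv_shift N c1).
by apply: cvgM; [exact: cvg_cst|exact: L2cv_int cw (L2cv_shift N c2)].
Qed.

End core.

(** * Testing the equation with the mollified functions *)

Section core_obstacle.
Context {R : realType} {d : nat}.
Local Notation E := (R * 'rV[R]_d)%type.
Local Notation mQ := (@lebQ R d).
Local Notation int1 f := (mQ.-integrable setT (EFin \o f)).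
Variables (T : R) (B0 B : set E) (N : nat) (zeta : E -> R).
Hypothesis cB0 : compact B0.
Hypothesis cB : compact B.
Hypothesis BQ : B `<=` oQT T.
Hypothesis thick : forall z y, B0 z -> `|z - y| <= en N -> B y.
Hypothesis szeta : smooth zeta.
Hypothesis zeta0 : forall z, ~ B0 z -> zeta z = 0.
Hypothesis zeta_ge0 : forall z, 0 <= zeta z.

Variables (h u v : E -> R) (mu : {measure set E -> \bar R}).
Hypothesis mB' : measurable_fun (QT T) (fun z => h z - u z).
Hypothesis cF0 : {within oQT T, continuous (fun z => h z - u z)}.
Hypothesis Lw : L2 mQ B (fun z => v z - u z).
Hypothesis vh : {ae mQ, forall z, QT T z -> h z <= v z}.
Hypothesis uh : forall z, QT T z -> h z <= u z.
Hypothesis muB : (mu B < +oo)%E.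
Hypothesis mu_min : forall xi, C0_plus T xi ->
    (\int[mu]_(z in QT T) ((u z - h z) * xi z)%:E = 0)%E.

Let w : E -> R := fun z => v z - u z.
Let F0 : E -> R := fun z => h z - u z.
Let mB : measurable B. Proof. exact: compact_measurable_E. Qed.

Let BQT : B `<=` QT T. Proof. by move=> z /BQ; exact: oQT_QT. Qed.

Lemma within_sub (A D : set E) (g : E -> R) : D `<=` A ->
  {within A, continuous g} -> {within D, continuous g}.
Proof. by move=> DA; exact: continuous_subspaceW. Qed.

Lemma J_ge_cst n (c : R) (g : E -> R) x : int1 g ->
  {ae mQ, forall y, `|x - y| < en n -> c <= g y} -> c <= J n g x.
Proof.
move=> ig gc; have [k1 k2] := kap_int x (en_gt0 n).
rewrite -[c]mulr1 -k2 -RintZ// /J /conv.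
apply: le_Rint_ae; [exact: int1Z|exact: J_int1|].
apply: filterS gc => y gy; rewrite mulrC.
have [xy|xy] := ltP `|x - y| (en n).
  by apply: ler_wpM2l; [exact: kap_ge0 (en_gt0 n)|exact: gy].
by rewrite kap_out ?en_gt0// !mul0r.
Qed.

Lemma zeta_int1 : int1 zeta.
Proof. by have [K bK] := off_bsupp cB0 zeta0; exact: cs_int1 (smooth_cts szeta) bK. Qed.

(** Almost everywhere [w >= h - u], and [h - u] is continuous: on the small ball
    where the two averages are taken it exceeds [F0 z - del]. *)
Lemma mol_ge (del rho : R) n z : 0 < del ->
  (forall x y, B x -> B y -> `|x - y| < rho -> `|F0 x - F0 y| <= del) ->
  (N <= n)%N -> en n + en n < rho -> B z ->
  (F0 z - del) * J n zeta z <= mol B zeta w n z.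
Proof.
move=> del0 unif Nn enr Bz; set c := F0 z - del.
have ik := zeta_int1; rewrite {1}/J /conv -RintZ; last exact: J_int1.
have [Mw Lbw] := Lb_tr cB Lw.
have iw := Lb_int1 Lbw.
have iz : int1 (fun x => zeta x * J n (tr B w) x) by exact: (mol_int1 cB0 cB szeta zeta0 Lw n).
rewrite /mol {1}/J /conv; apply: le_Rint; [apply: int1Z; exact: J_int1|exact: J_int1|].
move=> x; rewrite mulrCA; have [zx|zx] := ltP `|z - x| (en n); last first.
  by rewrite kap_out ?en_gt0// !mul0r.
apply: ler_wpM2l; first exact: kap_ge0 (en_gt0 n).
have [Bx|nB] := pselect (B0 x); last by rewrite zeta0// mul0r mulr0.
rewrite mulrC; apply: ler_wpM2l; first exact: zeta_ge0.
apply: J_ge_cst => //; apply: filterS vh => y hy xy.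
have By : B y by apply: (thick Bx); rewrite (le_trans (ltW xy))//; exact: en_le.
rewrite trE//; apply: (@le_trans _ _ (F0 y)); last first.
  by rewrite /F0 /w lerD2r; apply: hy; exact: BQT.
have zy : `|z - y| < rho.
  rewrite -(subrK x z) -addrA (le_lt_trans (ler_normD _ _))//.
  by rewrite (lt_trans _ enr)// ltrD.
have := unif _ _ Bz By zy; rewrite ler_norml => /andP[_].
by rewrite /c; lra.
Qed.

Lemma Rint_off (m : {measure set E -> \bar R}) (g : E -> R) :
  (forall z, ~ B z -> g z = 0) -> \int[m]_(z in QT T) g z = \int[m]_z g z.
Proof.
move=> g0; rewrite Rint_tr; congr (Rintegral _ _ _); apply/funext => z.
have [Bz|nB] := pselect (B z); first by rewrite trE//; exact: BQT.
by rewrite /tr g0// mul0r.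
Qed.

Lemma mu_int1 (g : E -> R) : continuous g -> (forall z, ~ B z -> g z = 0) ->
  mu.-integrable setT (EFin \o g).
Proof.
move=> cg g0; have [M bM] := off_bsupp cB g0.
have [C C0 gC] := cs_bounded E_balls_compact cg bM.
by apply: (int1_finite mB muB _ gC g0); exact: cts_measurable_E.
Qed.

Lemma Jzeta_off n z : (N <= n)%N -> ~ B z -> J n zeta z = 0.
Proof. by move=> Nn; exact: (J_off thick zeta0 Nn). Qed.

(** The minimality condition tested with [J n zeta]. *)
Lemma mu_F0 n : (N <= n)%N -> mu.-integrable setT (EFin \o (fun z => F0 z * J n zeta z)) /\
  \int[mu]_z (F0 z * J n zeta z) = 0.
Proof.
move=> Nn; have cJ : continuous (J n zeta) by apply: smooth_cts; exact: J_smooth zeta_int1.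
have J0 z : ~ B z -> J n zeta z = 0 by exact: Jzeta_off.
have J_ge0 z : 0 <= J n zeta z.
  by apply: J_ge_cst zeta_int1 _; exact: nearW.
have off z : ~ B z -> F0 z * J n zeta z = 0 by move=> /J0 ->; rewrite mulr0.
have [C C0 FC] := compact_cts_bounded cB (within_sub BQ cF0).
have iF : mu.-integrable setT (EFin \o (fun z => F0 z * J n zeta z)).
  have -> : (fun z => F0 z * J n zeta z) = (fun z => tr B F0 z * J n zeta z).
    apply/funext => z; have [Bz|nB] := pselect (B z); first by rewrite trE.
    by rewrite J0// !mulr0.
  apply: (int1_bounded (C := C)); first exact: mu_int1.
    by apply: measurable_tr => //; apply: measurable_funS mB' => //; exact: measurable_QT.
  move=> z; have [Bz|nB] := pselect (B z); first by rewrite trE//; exact: FC.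
  by rewrite tr_out// normr0.
split => //.
have xiP : C0_plus T (J n zeta).
  split => //; first exact: continuous_subspaceT.
  by exists B; split => // z _; exact: J0.
have := mu_min xiP => min0.
rewrite -Rint_off//.
have -> : \int[mu]_(z in QT T) (F0 z * J n zeta z) =
    fine (\int[mu]_(z in QT T) (- ((u z - h z) * J n zeta z)%:E))%E.
  rewrite /Rintegral; congr fine; apply: eq_integral => z _.
  by rewrite -EFinN /F0 -mulNr opprB.
rewrite integral_ge0N ?min0 ?oppe0//.
by move=> z Qz; rewrite lee_fin mulr_ge0// subr_ge0; exact: uh.
Qed.

(** By [mol_ge] the integrand is at least [F0 * J n zeta - del * J n zeta]; the
    first part has integral 0 by [mu_F0], and the second is small as [J n zeta] is
    bounded uniformly in [n] and [mu B] is finite. *)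
Lemma mol_mu (eps : R) : 0 < eps ->
  \forall n \near \oo, - eps <= \int[mu]_(z in QT T) mol B zeta w (n + N) z.
Proof.
move=> eps0.
have [K bK] := off_bsupp cB0 zeta0.
have [C C0 zC] := cs_bounded E_balls_compact (smooth_cts szeta) bK.
pose A := C * fine (mu B) + 1.
have A0 : 0 < A by rewrite ltr_wpDl// mulr_ge0// fine_ge0.
pose del := eps / A; have del0 : 0 < del by rewrite divr_gt0.
have [rho rho0 unif] := compact_unif_cts cB (within_sub BQ cF0) del0.
have en0 : (en n + en n : R) @[n --> \oo] --> (0 : R).
  by rewrite -[X in _ --> X]addr0; apply: cvgD; exact: en_cvg0.
have near_rho : \forall n \near \oo, en n + en n < rho by exact: (cvgr_lt _ en0).
near=> n; have Nn : (N <= n + N)%N by exact: leq_addl.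
have enr : en (n + N) + en (n + N) < rho.
  apply: (@le_lt_trans _ _ (en n + en n)); last by near: n; exact: near_rho.
  by apply: lerD; apply: en_le; exact: leq_addr.
set k := (n + N)%N.
have cJ : continuous (J k zeta) by apply: smooth_cts; exact: J_smooth zeta_int1.
have J0 z : ~ B z -> J k zeta z = 0 by exact: Jzeta_off.
have JC z : J k zeta z <= C.
  have [k1 k2] := kap_int z (en_gt0 k).
  rewrite -[C]mulr1 -k2 -RintZ// /J /conv.
  apply: le_Rint; [exact: J_int1 zeta_int1|exact: int1Z|].
  move=> y; rewrite mulrC ler_wpM2r//; first exact: kap_ge0 (en_gt0 k).
  exact: le_trans (ler_norm _) (zC y).
have cM : continuous (mol B zeta w k) by apply: smooth_cts; exact: (mol_smooth cB0 cB szeta zeta0 Lw k).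
have M0 z : ~ B z -> mol B zeta w k z = 0 by move=> nB; exact: (mol_off thick zeta0).
have [iF F_0] := mu_F0 Nn.
have iJ := mu_int1 cJ J0; have iM := mu_int1 cM M0.
rewrite Rint_off//.
apply: (@le_trans _ _ (\int[mu]_z (F0 z * J k zeta z - del * J k zeta z))).
  rewrite RintB//; last exact: int1Z.
  rewrite F_0 sub0r lerN2 RintZ//.
  have iB : mu.-integrable setT (EFin \o (\1_B : E -> R)) by exact: indic_int1.
  have : \int[mu]_z J k zeta z <= \int[mu]_z (C * \1_B z).
    apply: le_Rint => //; first exact: int1Z.
    move=> z; rewrite indicE; have [Bz|nB] := pselect (B z).
      by rewrite mem_set// mulr1.
    by rewrite memNset// mulr0 J0.
  rewrite RintZ// /Rintegral integral_indic// setIT => le1.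
  apply: (@le_trans _ _ (del * A)); last by rewrite /del divfK// gt_eqF.
  apply: ler_wpM2l; first exact: ltW.
  by apply: le_trans le1 _; rewrite /A lerDl.
apply: le_Rint => //; first by apply: int1B => //; exact: int1Z.
move=> z; have [Bz|nB] := pselect (B z); last by rewrite J0// M0// !mulr0 subr0.
by rewrite -mulrBl; exact: mol_ge unif Nn enr Bz.
Unshelve. all: by end_near. Qed.

(** The equation tested with [mol w n]; the terms with [P] and [F] converge
    because [mol w n] and its space derivatives do, and the term with [mu] is
    bounded below by [mol_mu]. *)
Lemma core_ineq (P : E -> 'rV[R]_d) (F : E -> R) (dw : 'I_d -> E -> R) (tau : R) :
  (forall eta, smooth eta -> (forall z, ~ B z -> eta z = 0) ->
     \int[mQ]_z (tr B u z * 'D_dirt eta z)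
     + 2^-1 * (\sum_i \int[mQ]_z (tr B (fun y => P y 0 i) z * 'D_(dirx i) eta z))
     = \int[mQ]_z (tr B F z * eta z) + \int[mu]_(z in QT T) eta z) ->
  (forall i, L2 mQ B (fun y => P y 0 i)) -> L2 mQ B F ->
  (forall i, is_wderiv T (dirx i) w (dw i)) -> (forall i, L2 mQ B (dw i)) ->
  \int[mQ]_z (tr B u z * 'D_dirt (mol B zeta w (n + N)) z) @[n --> \oo] --> tau ->
  0 <= tau + 2^-1 * (\sum_i \int[mQ]_z (P z 0 i * ('D_(dirx i) zeta z * w z + zeta z * dw i z)))
    - \int[mQ]_z (F z * (zeta z * w z)).
Proof.
move=> EQ LP LF dwP Ldw ctau.
have c1 := mol_cvg N cB0 cB szeta zeta0 Lw.
have c2 i := mol_derive_cvg cB0 cB BQ thick szeta zeta0 Lw (dwP i) (Ldw i).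
have offz (a b : E -> R) : \int[mQ]_z (a z * (zeta z * b z)) =
    \int[mQ]_z (tr B a z * (zeta z * tr B b z)).
  apply: eq_Rintegral => z _; have [Bz|nB] := pselect (B0 z).
    by have Bz' := core_sub thick Bz; rewrite !trE.
  by rewrite zeta0// !mul0r !mulr0.
have lim1 : \int[mQ]_z (tr B F z * mol B zeta w (n + N) z) @[n --> \oo] -->
    \int[mQ]_z (F z * (zeta z * w z)).
  by rewrite offz; apply: L2cv_int c1; apply: L2cv_cst; exact: L2_tr.
have lim2 : (\sum_i \int[mQ]_z (tr B (fun y => P y 0 i) z * 'D_(dirx i) (mol B zeta w (n + N)) z))
    @[n --> \oo] -->
    (\sum_i \int[mQ]_z (P z 0 i * ('D_(dirx i) zeta z * w z + zeta z * dw i z))).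
  apply: cvg_big => [|i _]; first exact: add_continuous.
  have -> : \int[mQ]_z (P z 0 i * ('D_(dirx i) zeta z * w z + zeta z * dw i z)) =
      \int[mQ]_z (tr B (fun y => P y 0 i) z *
         ('D_(dirx i) zeta z * tr B w z + zeta z * tr B (dw i) z)).
    apply: eq_Rintegral => z _; have [Bz|nB] := pselect (B0 z).
      by have Bz' := core_sub thick Bz; rewrite !trE.
    by rewrite zeta0// (Dzeta0 cB0 zeta0)// !mul0r addr0 !mulr0.
  by apply: L2cv_int (c2 i); apply: L2cv_cst; exact: L2_tr.
set lim := (X in 0 <= X).
have climit : \int[mu]_(z in QT T) mol B zeta w (n + N) z @[n --> \oo] --> lim.
  have HH : (\int[mQ]_z (tr B u z * 'D_dirt (mol B zeta w (n + N)) z)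
     + 2^-1 * (\sum_i \int[mQ]_z (tr B (fun y => P y 0 i) z * 'D_(dirx i) (mol B zeta w (n + N)) z))
     - \int[mQ]_z (tr B F z * mol B zeta w (n + N) z)) @[n --> \oo] --> lim.
    apply: cvgB; last exact: lim1.
    by apply: cvgD; [exact: ctau|apply: cvgM; [exact: cvg_cst|exact: lim2]].
  apply: cvg_trans HH; apply: near_eq_cvg; near=> n.
  have Nn : (N <= n + N)%N by exact: leq_addl.
  have := EQ (mol B zeta w (n + N)) (mol_smooth cB0 cB szeta zeta0 Lw _)
    (fun z => mol_off thick zeta0 _ Nn (z := z)).
  by move=> ->; rewrite addrC addKr.
rewrite leNgt; apply/negP => lim0.
have e0 : 0 < - lim / 2 by rewrite divr_gt0// oppr_gt0.
have := mol_mu e0 => H1.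
have H2 : \forall n \near \oo, \int[mu]_(z in QT T) mol B zeta w (n + N) z < lim / 2.
  by apply: (cvgr_lt _ climit); lra.
have [n [h1 h2]] : exists n, - (- lim / 2) <= \int[mu]_(z in QT T) mol B zeta w (n + N) z /\
    \int[mu]_(z in QT T) mol B zeta w (n + N) z < lim / 2.
  by near \oo => n; exists n; split; near: n.
by have := le_lt_trans h1 h2; lra.
Unshelve. all: by end_near. Qed.

End core_obstacle.

(** * Time slices *)

Section slices.
Context {R : realType} {d : nat}.
Local Notation E := (R * 'rV[R]_d)%type.
Local Notation mQ := (@lebQ R d).
Local Notation int1 f := (mQ.-integrable setT (EFin \o f)).

Lemma ae_slices (Q : E -> Prop) : {ae mQ, forall z, Q z} ->
  {ae @leb1 R, forall t, {ae leb d, forall x, Q (t, x)}}.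
Proof.
move=> [N [mN N0 sN]].
have mf : measurable_fun setT (fun t => leb d (xsection N t)).
  exact: (@measurable_fun_xsection _ _ _ _ _ (leb d) _ mN).
have I0 : (\int[@leb1 R]_t `|leb d (xsection N t)| = 0)%E.
  rewrite -[RHS]N0 /lebQ /product_measure1.
  by apply: eq_integral => t _; rewrite gee0_abs.
have := (ae_eq_integral_abs (@leb1 R) measurableT mf).1 I0.
move=> [A [mA A0 sA]]; exists A; split => // t /= nt; apply: sA => /= h; apply: nt.
exists (xsection N t); split; first exact: measurable_xsection.
  exact: h.
by move=> x /= nx; rewrite /xsection /= mem_set//; exact: sN.
Qed.

(** A null set of times cannot contain an interval. *)
Lemma ae_pick (Q : R -> Prop) (a b : R) : a < b -> {ae @leb1 R, forall t, Q t} ->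
  exists t, a < t < b /\ Q t.
Proof.
move=> ab [N [mN N0 sN]]; apply: contrapT => h.
pose a' := a + (b - a) / 4; pose b' := a + (b - a) / 2.
have ab' : a' <= b' by rewrite /a' /b'; lra.
have sub : `[a', b']%classic `<=` N.
  move=> t; rewrite /= in_itv/= => /andP[h1 h2]; apply: sN => /= Qt; apply: h; exists t.
  by split => //; move: h1 h2; rewrite /a' /b' => h1 h2; apply/andP; split; lra.
have : (leb1 `[a', b']%classic <= leb1 N)%E by apply: le_measure; rewrite ?inE.
by rewrite N0 leb1_itv// lee_fin /a' /b'; lra.
Qed.

Lemma Fubini_R (f : E -> R) : int1 f ->
  [/\ {ae @leb1 R, forall t, (leb d).-integrable setT (EFin \o (fun x => f (t, x)))},
      (@leb1 R).-integrable setT (EFin \o (fun t => \int[leb d]_x f (t, x))) &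
      \int[mQ]_z f z = \int[@leb1 R]_t \int[leb d]_x f (t, x)].
Proof.
move=> If.
have ae1 := ae_integrable1 If.
have iF := integrable_fubini_F If.
have aeF : ae_eq leb1 setT (fubini_F (leb d) (EFin \o f))
    (EFin \o (fun t => \int[leb d]_x f (t, x))).
  apply: filterS ae1 => t it _ /=; rewrite /fubini_F /Rintegral fineK//.
  exact: integrable_fin_num it.
have mG : measurable_fun setT (EFin \o (fun t => \int[leb d]_x f (t, x))).
  apply/measurable_EFinP.
  have := measurableT_comp (fine_measurable measurableT) (measurable_int _ iF).
  exact.
split => //.
  apply/integrableP; split => //; have /integrableP[_] := iF.
  apply: le_lt_trans; rewrite le_eqVlt; apply/orP; left; apply/eqP.
  by apply: integral_ae_ext; apply: filterS aeF => t ht tT; rewrite ht.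
rewrite {1}/Rintegral -(integral12_prod_meas1 If); congr fine.
apply: ae_eq_integral => //; exact: measurable_int iF.
Qed.

End slices.

(** * The coefficients *)

Section coefficients.
Context {R : realType} {d : nat}.
Local Notation E := (R * 'rV[R]_d)%type.
Local Notation mQ := (@lebQ R d).
Local Notation L2T := (L2 mQ setT).

Lemma enorm_sqr (x : 'rV[R]_d) : enorm x ^+ 2 = \sum_i x 0 i ^+ 2.
Proof.
rewrite sqr_sqrtr; first by apply: eq_bigr => i _; rewrite expr2.
by apply: sumr_ge0 => i _; rewrite -expr2 sqr_ge0.
Qed.

Lemma enorm_le (x : 'rV[R]_d) : enorm x <= \sum_i `|x 0 i|.
Proof.
have S0 : 0 <= \sum_i `|x 0 i| by exact: sumr_ge0.
rewrite -(ler_pXn2r (n := 2)) ?nnegrE ?sqrtr_ge0// enorm_sqr expr2 mulr_suml.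
apply: ler_sum => i _; rewrite -(real_normK (num_real (x 0 i))) expr2 ler_wpM2l//.
by rewrite (bigD1 i)//= lerDl sumr_ge0.
Qed.

Variables (T Lambda : R) (a sigma : E -> 'M[R]_d).
Hypothesis ma : measurable_fun (QT T) a.
Hypothesis a_upper : forall z (xi : 'rV[R]_d), QT T z ->
  \sum_i \sum_j a z i j * xi 0 i * xi 0 j <= Lambda * enorm xi ^+ 2.
Hypothesis msigma : measurable_fun (QT T) sigma.
Hypothesis sigmaE : forall z, QT T z -> sigma z *m (sigma z)^T = a z.

Lemma a_diag z i : QT T z -> a z i i <= Lambda.
Proof.
move=> Qz; have := a_upper (delta_mx 0 i) Qz.
rewrite enorm_sqr (bigD1 i)//= (bigD1 i)//= !mxE !eqxx !mulr1.
rewrite big1 => [|j ji]; last by rewrite !mxE (negbTE ji) mulr0.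
rewrite big1 => [|k ki]; last first.
  by rewrite big1// => j _; rewrite !mxE (negbTE ki) mulr0 mul0r.
rewrite (bigD1 i)//= mxE !eqxx big1 => [|j ji]; last by rewrite !mxE (negbTE ji) expr0n.
by rewrite !addr0 expr1n mulr1.
Qed.

(** Both coefficients are bounded: the rows of [sigma] have squared length
    [a_ii <= Lambda]. *)
Lemma coef_bd : exists2 C, 0 <= C & forall z i j, QT T z ->
  `|a z i j| <= C /\ `|sigma z i j| <= C.
Proof.
exists (2 * `|Lambda| + 1); first by rewrite addr_ge0// mulr_ge0.
move=> z i j Qz.
have aE k l : a z k l = \sum_m sigma z k m * sigma z l m.
  by rewrite -sigmaE// mxE; apply: eq_bigr => m _; rewrite !mxE.
have diag k : \sum_m sigma z k m ^+ 2 <= `|Lambda|.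
  apply: le_trans (ler_norm _); apply: le_trans (a_diag k Qz).
  by rewrite aE; apply: ler_sum => m _; rewrite expr2.
have L0 := normr_ge0 Lambda.
split.
  rewrite aE (le_trans (ler_norm_sum _ _ _))//.
  apply: (@le_trans _ _ (\sum_m (sigma z i m ^+ 2 + sigma z j m ^+ 2))).
    apply: ler_sum => m _; rewrite normrM -[X in _ <= X + _]real_normK ?num_real//.
    rewrite -[X in _ <= _ + X]real_normK ?num_real//.
    by have := sqr_ge0 (`|sigma z i m| - `|sigma z j m|); nra.
  by rewrite big_split /=; have := diag i; have := diag j; lra.
have : `|sigma z i j| ^+ 2 <= `|Lambda|.
  rewrite real_normK ?num_real//; apply: le_trans (diag i).
  by rewrite (bigD1 j)//= lerDl; apply: sumr_ge0 => m _; rewrite sqr_ge0.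
by have := normr_ge0 (sigma z i j); nra.
Qed.

Lemma L2_lin (D : set E) (C : R) (c w : 'I_d -> E -> R) : measurable D -> D `<=` QT T ->
  (forall j, measurable_fun (QT T) (c j)) -> (forall j z, QT T z -> `|c j z| <= C) ->
  (forall j, L2 mQ D (w j)) -> L2 mQ D (fun z => \sum_j w j z * c j z).
Proof.
move=> mD DQ mc cC Lw; apply: L2_trV => //.
have -> : tr D (fun z => \sum_j w j z * c j z) = (fun z => \sum_j (tr D (c j) z * tr D (w j) z)).
  apply/funext => z; have [Dz|nD] := pselect (D z).
    by rewrite trE//; apply: eq_bigr => j _; rewrite !trE// mulrC.
  by rewrite tr_out// big1// => j _; rewrite !tr_out// mulr0.
apply: L2_sum_seq => j; apply: (L2M (C := `|C|)).
- exact: L2_tr.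
- by apply: measurable_tr => //; apply: measurable_funS (mc j) => //; exact: measurable_QT.
- move=> z; have [Dz|nD] := pselect (D z); last by rewrite tr_out// normr0.
  by rewrite trE// (le_trans (cC j z (DQ _ Dz)))// ler_norm.
Qed.

Variable u : E -> R.
Hypothesis gradm : forall i, measurable_fun (QT T) (wderiv T (dirx i) u).
Local Notation P := (fun z => grad T u z *m (a z)^T).

Lemma flux_sum z i : P z 0 i = \sum_j wderiv T (dirx j) u z * a z i j.
Proof. by rewrite mxE; apply: eq_bigr => j _; rewrite !mxE. Qed.

Lemma measurable_a i j : measurable_fun (QT T) (fun z => a z i j).
Proof. exact: (measurable_fun_mxP _ _).1 ma i j. Qed.

Lemma measurable_sigma i j : measurable_fun (QT T) (fun z => sigma z i j).
Proof. exact: (measurable_fun_mxP _ _).1 msigma i j. Qed.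

Lemma flux_L2 (D : set E) (r : E -> R) i : measurable D -> D `<=` QT T ->
  (forall j, L2 mQ D (fun z => wderiv T (dirx j) u z * r z)) ->
  L2 mQ D (fun z => P z 0 i * r z).
Proof.
move=> mD DQ Lr; have [C C0 bC] := coef_bd.
have -> : (fun z => P z 0 i * r z) = (fun z => \sum_j (wderiv T (dirx j) u z * r z) * a z i j).
  apply/funext => z; rewrite flux_sum mulr_suml; apply: eq_bigr => j _; ring.
apply: (L2_lin (C := C)) => //; first by move=> j; exact: measurable_a.
by move=> j z Qz; case: (bC z i j Qz).
Qed.

Variables (f : E -> R -> 'rV[R]_d -> R) (g : E -> R) (M : R).
Hypothesis M_gt0 : 0 < M.
Hypothesis mf : measurable_fun (QT T `*` setT `*` setT)
          (fun p : (R * 'rV[R]_d) * R * 'rV[R]_d => f p.1.1 p.1.2 p.2).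
Hypothesis f_growth : forall z y z1, QT T z ->
     `|f z y z1| <= g z + M * (`|y| + enorm z1).
Hypothesis mu' : measurable_fun (QT T) u.
Local Notation F := (fu T sigma f u).

Lemma fu_measurable : measurable_fun (QT T) F.
Proof.
pose G' (z : E) : 'rV[R]_d := \row_j tr (QT T) (fun z => (grad T u z *m (sigma z)^T) 0 j) z.
have mG : measurable_fun setT G'.
  apply/measurable_fun_mxP => i j.
  rewrite (_ : (fun z => _) = tr (QT T) (fun z => (grad T u z *m (sigma z)^T) i j)); last first.
    by apply/funext => z; rewrite mxE ord1.
  apply: measurable_tr; first exact: measurable_QT.
  have -> : (fun z => (grad T u z *m (sigma z)^T) i j) =
     (fun z => \sum_k wderiv T (dirx k) u z * sigma z j k).
    by apply/funext => z; rewrite ord1 mxE; apply: eq_bigr => k _; rewrite !mxE.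
  apply: measurable_sum => k; apply: measurable_funM; first exact: gradm.
  exact: measurable_sigma.
have := @measurable_comp _ _ _ _ _ _ (QT T `*` setT `*` setT)
  (fun p : E * R * 'rV[R]_d => f p.1.1 p.1.2 p.2) (QT T)
  (fun z => ((z, u z), grad T u z *m (sigma z)^T)).
apply => //.
- by apply: measurableX => //; apply: measurableX => //; exact: measurable_QT.
- by move=> _ [z Qz <-].
- have mu1 := measurable_tr (measurable_QT T) mu'.
  have := measurable_fun_pair (measurable_fun_pair (@measurable_id _ E setT) mu1) mG.
  move=> /(measurable_funTS (D := QT T)); apply: eq_measurable_fun => z /set_mem Qz.
  rewrite /= trE//; congr pair; apply/rowP => j; rewrite mxE trE//.
Qed.

Lemma L2_abs (w : E -> R) : L2T w -> L2T (fun z => `|w z|).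
Proof.
move=> Lw; apply: (L2_le _ Lw); last by move=> z; rewrite normr_id.
by apply: measurableT_comp => //; case: Lw.
Qed.

Lemma fu_L2 (K : set E) : measurable K -> K `<=` QT T -> L2 mQ K g -> L2 mQ K u ->
  (forall i, L2 mQ K (wderiv T (dirx i) u)) -> L2 mQ K F.
Proof.
move=> mK KQ Lg Lu Lgr; have [C C0 bC] := coef_bd.
apply: L2_trV => //.
pose s i z := \sum_j wderiv T (dirx j) u z * sigma z i j.
have Ls i : L2 mQ K (s i).
  apply: (L2_lin (C := C)) => //; first by move=> j; exact: measurable_sigma.
  by move=> j z Qz; case: (bC z i j Qz).
pose G z := `|tr K g z| + M * (`|tr K u z| + \sum_i `|tr K (s i) z|).
have LG : L2T G.
  apply: L2D; first by apply: L2_abs; exact: L2_tr.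
  apply: L2Z; apply: L2D; first by apply: L2_abs; exact: L2_tr.
  by apply: L2_sum_seq => i; apply: L2_abs; exact: L2_tr.
apply: (L2_le _ LG).
  by apply: measurable_tr => //; apply: measurable_funS fu_measurable => //; exact: measurable_QT.
move=> z; have S0 : 0 <= \sum_i `|tr K (s i) z| by exact: sumr_ge0.
have G0 : 0 <= G z by rewrite addr_ge0// mulr_ge0 ?addr_ge0// ltW.
rewrite (ger0_norm G0); have [Kz|nK] := pselect (K z); last by rewrite tr_out// normr0.
rewrite trE//; apply: le_trans (f_growth _ _ (KQ _ Kz)) _.
rewrite /G !trE// lerD ?ler_norm//; apply: ler_wpM2l; first exact: ltW.
rewrite lerD2l; apply: le_trans (enorm_le _) _; apply: ler_sum => i _.
rewrite trE// le_eqVlt; apply/orP; left; apply/eqP; congr (`|_|).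
by rewrite mxE; apply: eq_bigr => j _; rewrite !mxE.
Qed.

End coefficients.

(** * Functions of the space variable *)

Section fundamental_rV.
Context {R : realType} {d : nat}.
Local Notation E := (R * 'rV[R]_d)%type.
Local Notation mQ := (@lebQ R d).
Local Notation int1 f := (mQ.-integrable setT (EFin \o f)).
Local Notation iR f := ((leb d).-integrable setT (EFin \o f)).

Lemma int1_tensor (p : R -> R) (w : 'rV[R]_d -> R) :
  (@leb1 R).-integrable setT (EFin \o p) -> iR w -> int1 (fun z => p z.1 * w z.2).
Proof.
move=> ip iw; have mp := int1_measurable ip; have mw := int1_measurable iw.
have mpw : measurable_fun setT (fun z : E => p z.1 * w z.2).
  by apply: measurable_funM; apply: measurableT_comp.
apply/integrableP; split; first exact/measurable_EFinP.
rewrite ge0_lebQE => [|| z]; last exact: abse_ge0.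
- have -> : (fun t : R => \int[leb d]_y `|(EFin \o (fun z : E => (p z.1 * w z.2)%R)) (t, y)|)%E =
    (fun t => `|p t|%:E * \int[leb d]_y `|w y|%:E)%E.
    apply/funext => t; rewrite -ge0_integralZl//.
    + by apply: eq_integral => y _ /=; rewrite normrM EFinM.
    + by apply/measurable_EFinP; exact: measurableT_comp.
  have /integrableP[_ foo] := iw; have /integrableP[_ poo] := ip.
  have m1 : measurable_fun setT (fun t => (`|p t|)%:E).
    by apply/measurable_EFinP; exact: measurableT_comp.
  have W0 : (0 <= \int[leb d]_y `|w y|%:E)%E by exact: integral_ge0.
  have P0 : (0 <= \int[@leb1 R]_t `|p t|%:E)%E by exact: integral_ge0.
  rewrite (@ge0_integralZr _ _ _ (@leb1 R) _ measurableT (fun t => (`|p t|)%:E) m1)//.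
  by apply: lte_mul_pinfty => //; rewrite ge0_fin_numE.
- by apply: measurableT_comp => //; exact/measurable_EFinP.
Qed.

Lemma leb1_itv_lty (a b : R) : (leb1 `[a, b]%classic < +oo)%E.
Proof.
have [ab|ba] := leP a b; first by rewrite leb1_itv// ltry.
by rewrite set_itv_ge ?measure0// bnd_simp -ltNge.
Qed.

Lemma bt_int1 k a b : 0 < k -> (@leb1 R).-integrable setT (EFin \o bt k a b).
Proof.
move=> k0; have mI : measurable `[a, b]%classic by exact: measurable_itv.
apply: (int1_finite (B := `[a, b]%classic) (C := 1)) => //.
- exact: leb1_itv_lty.
- have sb := bt_smooth k a b (R := R).
  have cb := smooth_cts sb.
  exact: continuous_measurable_fun.
- by move=> t; rewrite ger0_norm ?bt_ge0// bt_le1.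
- move=> t /= nt; apply: bt_out => //; apply/negP => /andP[h1 h2]; apply: nt.
  by rewrite in_itv/= !ltW.
Qed.

(** The fundamental lemma of the calculus of variations on the space alone; it
    follows from the one on space-time applied to functions constant in time. *)
Lemma rV_ae0 (w : 'rV[R]_d -> R) :
  (forall n : nat, iR (fun x => w x * \1_[set y | `|y| <= n%:R] x)) ->
  (forall k (a b : 'rV[R]_d), \int[leb d]_x (w x * bx k.+1%:R a b x) = 0) ->
  {ae leb d, forall x, w x = 0}.
Proof.
move=> iw w0.
have H : {ae mQ, forall z, (0 < z.1 < 1)%R -> w z.2 = 0}.
  apply: (@bigcup_box_ae _ _ (fun n => (0, const_mx (- n%:R))) (fun n => (1, const_mx n%:R))
    [set z | (0 < z.1 < 1)%R] (fun z => w z.2 = 0)).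
    move=> z z01; have [n zn] := truncn_gt_norm (R := R) `|z|; exists n => //; split => //= i.
    by rewrite !mxE -ltr_norml (le_lt_trans _ zn)// (le_trans (rV_coord_le _ _))// E_norm2.
  move=> n; apply: (@box_ae0 _ _ _ _ (fun z => w z.2)).
    pose w1 x := w x * \1_[set y | `|y| <= n%:R] x.
    have i1 : int1 (fun z => \1_(`[0, 1]%classic) z.1 * w1 z.2).
      apply: int1_tensor; last exact: iw.
      by apply: indic_int1; [exact: measurable_itv|exact: leb1_itv_lty].
    have -> : (fun z => w z.2 * \1_(box (0, const_mx (- n%:R)) (1, const_mx n%:R)) z) =
      (fun z => \1_(box (0, const_mx (- n%:R)) (1, const_mx n%:R)) z *
         (\1_(`[0, 1]%classic) z.1 * w1 z.2) : R).
      apply/funext => z; rewrite [in RHS]indicE /w1.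
      have [bz|nb] := pselect (box (0, const_mx (- n%:R)) (1, const_mx n%:R) z); last first.
        by rewrite indicE memNset// mulr0 mul0r.
      rewrite !indicE !mem_set// ?mulr1 ?mul1r//.
        have /rV_norm_leP h : forall i, `|z.2 0 i| <= n%:R.
          by move=> i; have [_ /(_ i)] := bz; rewrite !mxE -ltr_norml => /ltW.
        exact: h.
      by have [/andP[/ltW h1 /ltW h2] _] := bz; rewrite /= in_itv/= h1 h2.
    apply: (int1_bounded (C := 1)) => //.
      by apply: measurable_indic; exact: measurable_obox.
    by move=> z; rewrite indicE; case: (_ \in _); rewrite ?normr1 ?normr0.
  move=> k a b _.
  have k0 : 0 < k.+1%:R :> R by rewrite ltr0n.
  have iwb : iR (fun x => w x * bx k.+1%:R a.2 b.2 x).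
    have [n' hn] := truncn_gt_norm (R := R) (`|a| + `|b|).
    have -> : (fun x => w x * bx k.+1%:R a.2 b.2 x) =
      (fun x => bx k.+1%:R a.2 b.2 x * (w x * \1_[set y | `|y| <= n'%:R] x)).
      apply/funext => x; rewrite indicE; have [xn|xn] := leP `|x| n'%:R.
        by rewrite mem_set// mulr1 mulrC.
      rewrite memNset/=; last by rewrite leNgt xn.
      rewrite !mulr0 bx_out ?mulr0// => h; move: xn; rewrite ltNge => /negP; apply.
      apply: le_trans (ltW hn); have S0 : 0 <= `|a| + `|b| by rewrite addr_ge0.
      apply/(rV_norm_leP _ S0) => i; have /andP[h1 h2] := h i.
      have ha : `|a.2 0 i| <= `|a| by rewrite (le_trans (rV_coord_le _ _))// E_norm2.
      have hb : `|b.2 0 i| <= `|b| by rewrite (le_trans (rV_coord_le _ _))// E_norm2.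
      move: ha hb; rewrite !ler_norml => /andP[a1 a2] /andP[b1 b2].
      have := normr_ge0 a; have := normr_ge0 b => p1 p2.
      by apply/andP; split; lra.
    apply: (int1_bounded (C := 1)) => //.
      by apply: cts_measurable_rV; apply: smooth_cts; exact: bx_smooth.
    by move=> x; rewrite ger0_norm ?bx_ge0// bx_le1.
  have It := int1_tensor (bt_int1 a.1 b.1 k0) iwb.
  have [_ _] := Fubini_R It.
  have -> : (fun t : R => \int[leb d]_x (bt k.+1%:R a.1 b.1 (t, x).1 *
      (w (t, x).2 * bx k.+1%:R a.2 b.2 (t, x).2))) = fun=> 0.
    by apply/funext => t /=; rewrite (RintZ (bt k.+1%:R a.1 b.1 t) iwb) w0 mulr0.
  rewrite Rintegral_cst ?mul0r// => I0.
  by rewrite -[RHS]I0; apply: eq_Rintegral => z _; rewrite /bE mulrCA.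
have [t [t01 Ht]] := ae_pick ltr01 (ae_slices H).
by apply: filterS Ht => x; apply.
Qed.

End fundamental_rV.

Lemma pair_cts {R : realType} {V W : normedModType R} (t : V) :
  continuous (fun x : W => (t, x)).
Proof.
move=> x; apply/cvgrPdist_lt => e e0; near=> y.
have xy : `|x - y| < e by near: y; exact: cvgr_dist_lt.
by rewrite prod_normE /= subrr normr0 gt_max e0.
Unshelve. all: by end_near. Qed.

(** * The equation tested with smooth functions *)

Section op_equation.
Context {R : realType} {d : nat}.
Local Notation E := (R * 'rV[R]_d)%type.
Local Notation mQ := (@lebQ R d).

Lemma null_slice (t : R) : mQ ([set t] `*` setT) = 0%E.
Proof.
rewrite /lebQ product_measure1E//.
have h : (@leb1 R [set t] = 0)%E by rewrite -set_itv1 leb1_itv// subrr.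
by apply: etrans (mul0e (leb d setT)); congr (_ * _)%E; exact: h.
Qed.

Lemma strip_cst (t : R) : @strip R d t t = [set t] `*` setT.
Proof. by rewrite /strip set_itv1. Qed.

Variable T : R.
Hypothesis T_gt0 : 0 < T.

Lemma QT_oQT_ae : {ae mQ, forall z, QT T z -> oQT T z}.
Proof.
have m0 t : measurable ([set t] `*` setT : set E) by apply: measurableX.
exists (([set 0] `*` setT) `|` ([set T] `*` setT)); split.
- by apply: measurableU; apply: measurableX.
- exact: etrans (measureU0 (m0 0) (m0 T) (null_slice T)) (null_slice 0).
- move=> z /= nz; have [h|h] := pselect (z.1 = 0 \/ z.1 = T).
    by case: h => ->; [left|right].
  exfalso; apply: nz => /QTP/andP[h1 h2]; apply/oQTP; rewrite !lt_neqAle h1 h2 !andbT.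
  by apply/andP; split; apply/eqP => e; apply: h; [left|right].
Qed.

Lemma ae_strip t (Q : E -> Prop) : t \in `[0, T] -> {ae mQ, forall z, oQT T z -> Q z} ->
  {ae mQ, forall z, strip t T z -> Q z}.
Proof.
rewrite in_itv/= => /andP[t0 _] HQ; apply: filterS2 HQ QT_oQT_ae => z hQ hz [h1 h2].
apply/hQ/hz; split => //; move: h1; rewrite /= !in_itv/= => /andP[h1 ->].
by rewrite (le_trans t0 h1).
Qed.

(** Unlike [bsupp] this leaves the time variable free, as is needed to test the
    equation at the end points. *)
Definition xsupp (n : R) (p : E -> R) := forall z, n < `|z.2| -> p z = 0.

Lemma xsupp_D n p v : xsupp n p -> xsupp n ('D_v p).
Proof.
move=> pn z nz; apply: (deriv_off v (B := [set z : E | `|z.2| <= n])).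
- have -> : [set z : E | `|z.2| <= n] = (snd : E -> _) @^-1` [set x | `|x| <= n] by [].
  by apply: closed_comp => [y _|]; [exact: E_snd_cts|exact: closed_norm_le].
- by move=> y /negP; rewrite -ltNge; exact: pn.
- by apply/negP; rewrite -ltNge.
Qed.

Definition slab (n : R) : set E := cbox (- T, const_mx (- n)) (2 * T, const_mx n).

Lemma slab_bd n (p : E -> R) : continuous p -> xsupp n p ->
  exists2 C, 0 <= C & forall z, - T <= z.1 <= 2 * T -> `|p z| <= C.
Proof.
move=> cp pn; have cK : compact (slab n) by exact: compact_cbox.
have [C C0 pC] := compact_cts_bounded cK (continuous_subspaceT cp).
exists C => // z zT; have [zn|zn] := leP `|z.2| n; last by rewrite pn// normr0.
apply: pC; split => // i; rewrite !mxE -ler_norml.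
exact: le_trans (rV_coord_le _ _) zn.
Qed.

Lemma xsupp_L2 n (p : E -> R) : continuous p -> xsupp n p -> L2 mQ (QT T) p.
Proof.
move=> cp pn; have [C C0 pC] := slab_bd cp pn.
have mp := cts_measurable_E cp.
have mtr : measurable_fun setT (tr (QT T) p).
  by apply: measurable_tr; [exact: measurable_QT|exact: measurable_funTS].
apply: L2_trV; first exact: measurable_QT.
apply: L2_of_sq => //; have cK : compact (slab n) by exact: compact_cbox.
apply: (int1_finite (B := slab n) (C := C ^+ 2)).
- exact: compact_measurable_E.
- exact: compact_E_lty.
- exact: measurable_funX.
- move=> z; rewrite ger0_norm ?sqr_ge0// -real_normK ?num_real//.
  rewrite ler_pXn2r ?nnegrE//.
  have [Qz|nQ] := pselect (QT T z); last by rewrite tr_out// normr0.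
  by rewrite trE//; apply: pC; move/QTP: Qz => /andP[h1 h2]; apply/andP; split; lra.
- move=> z nK; have [Qz|nQ] := pselect (QT T z); last by rewrite tr_out// expr0n.
  rewrite trE// pn ?expr0n// ltNge; apply/negP => zn; apply: nK.
  move/QTP: Qz => /andP[h1 h2]; split; first by apply/andP; split => /=; lra.
  by move=> i; rewrite !mxE -ler_norml; exact: le_trans (rV_coord_le _ _) zn.
Qed.

Lemma L2_ae (D : set E) (p p' : E -> R) : measurable_fun D p' ->
  {ae mQ, forall z, D z -> p z = p' z} -> L2 mQ D p -> L2 mQ D p'.
Proof.
move=> mp' pp' [_ p2]; split => //; apply: le_lt_trans p2.
rewrite le_eqVlt; apply/orP; left; apply/eqP; apply: integral_ae_ext.
by apply: filterS pp' => z h Dz; rewrite h.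
Qed.

Lemma mulr_cst1 (p : E -> R) : (fun z => p z * (cst 1 : 'rV[R]_d -> R) z.2) = p.
Proof. by apply/funext => z; rewrite mulr1. Qed.

Lemma QT_ae (Q : E -> Prop) : {ae mQ, forall z, oQT T z -> Q z} ->
  {ae mQ, forall z, QT T z -> Q z}.
Proof. by move=> h; apply: (filterS2 _ _ h QT_oQT_ae) => z h1 h2 /h2/h1. Qed.

Lemma smooth_W11_0 n (eta : E -> R) : smooth eta -> xsupp n eta -> W11_0 T eta.
Proof.
move=> se en'; have hw v : has_wderiv T v eta by exists ('D_v eta); exact: wderiv_smooth.
have LD v : L2 mQ (QT T) (wderiv T v eta).
  have [mw _ _] := wderivP (hw v).
  apply: L2_ae mw _ (xsupp_L2 (smooth_cts (smoothD v se)) (xsupp_D v en')).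
  by apply: QT_ae; apply: filterS (wderiv_smoothE T v se) => z h oz; rewrite h.
split; last first.
  have cK : compact (cbox (0, const_mx (- n)) (T, const_mx n) : set E) by exact: compact_cbox.
  exists (cbox (0, const_mx (- n)) (T, const_mx n)); split => //.
    by move=> z [h1 _]; apply/QTP.
  apply: nearW => z Qz nK; apply: en'; rewrite ltNge; apply/negP => zn; apply: nK.
  split; first by move/QTP: Qz.
  by move=> i; rewrite !mxE -ler_norml; exact: le_trans (rV_coord_le _ _) zn.
split; last by rewrite /L2rho_QT mulr_cst1; exact: LD.
  split; first by rewrite /L2rho_QT mulr_cst1; exact: xsupp_L2 (smooth_cts se) en'.
  by move=> i; split => //; rewrite /L2rho_QT mulr_cst1; exact: LD.
exact: hw.
Qed.

(** No exceptional set is needed, so that capacity only enters through the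
    capacity of the empty set. *)
Lemma smooth_qc (eta : E -> R) : continuous eta -> qc_version T eta eta.
Proof.
move=> ce; split; [exact: measurable_funTS (cts_measurable_E ce)| |exact: nearW].
move=> eps eps0; exists set0; split => //; last exact: continuous_subspaceT.
apply: (@le_lt_trans _ _ 0%E); last by rewrite lte_fin.
apply: (@le_trans _ _ (cap_open T set0)).
  by apply: ereal_inf_lbound; exists set0 => //; split => //; exact: open0.
apply: ub_ereal_sup => _ [K [_ K0] <-].
have {K0} -> : K = set0 by apply/seteqP; split.
apply: (@le_trans _ _ (energy T (fun=> 0 : R))).
  apply: ereal_inf_lbound; exists (fun=> 0) => //; split.
    split; first exact: (@smooth_cst _ E (0 : R)).
    by exists set0; split => //; exact: compact0.
  by move=> z; rewrite indicE memNset.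
rewrite /energy (eq_integral (fun=> 0%E)) ?integral0//.
move=> z _; have D0 v : 'D_v (fun=> 0 : R) z = 0 by exact: (@derive_val _ _ _ _ _ _ _ (is_derive_cst (0 : R) z v)).
by rewrite D0 big1 => [|i _]; rewrite ?D0 expr0n ?addr0.
Qed.

(** By the mean value theorem [t |-> eta (t, x)] is Lipschitz uniformly in [x],
    and the slices live in a common ball. *)
Lemma smooth_C_version n (eta : E -> R) : smooth eta -> xsupp n eta ->
  C_version T (cst 1) eta (fun t x => eta (t, x)).
Proof.
move=> se en'; split.
  by apply: nearW => t _; exact: nearW.
have ce := smooth_cts se.
pose K := [set x : 'rV[R]_d | `|x| <= n].
have cK : compact K by exact: rV_balls_compact.
have mK := compact_measurable_rV cK; have Koo := compact_rV_lty cK.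
have cs t : continuous (fun x : 'rV[R]_d => eta (t, x)).
  move=> x; apply: (@continuous_comp _ _ _ (fun x : 'rV[R]_d => (t, x) : E) eta); last exact: ce.
  exact: pair_cts.
have Kout t x : ~ K x -> eta (t, x) = 0.
  by move=> nK; apply: en' => /=; rewrite ltNge; apply/negP.
have [C C0 etaC] := slab_bd ce en'.
have [C' C'0 DC] := slab_bd (smooth_cts (smoothD dirt se)) (xsupp_D dirt en').
move=> t; rewrite in_itv/= => /andP[t0 tT]; split.
  have -> : (fun x => eta (t, x) * (cst 1 : 'rV[R]_d -> R) x) = (fun x => eta (t, x)).
    by apply/funext => x; rewrite mulr1.
  have mt := cts_measurable_rV (cs t).
  apply: L2_of_sq => //; apply: (int1_finite (B := K) (C := C ^+ 2)) => //.
  - exact: measurable_funX.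
  - move=> x; rewrite ger0_norm ?sqr_ge0// -real_normK ?num_real//.
    by rewrite ler_pXn2r ?nnegrE//; apply: etaC => /=; apply/andP; split; lra.
  - by move=> x nK; rewrite Kout// expr0n.
have lip s x : 0 <= s <= T -> `|eta (s, x) - eta (t, x)| <= C' * `|s - t|.
  move=> /andP[s0 sT]; have [c ct E1] := MVT_line (t, x) dirt (s - t) se.
  have -> : (s, x) = (s - t) *: dirt + (t, x) :> E.
    rewrite /dirt; apply/pair_equal_spec; split => /=; last by rewrite scaler0 add0r.
    by rewrite /GRing.scale /= mulr1 subrK.
  rewrite E1 normrM ler_wpM2r//; apply: DC => /=.
  rewrite /GRing.scale /= mulr1; move: ct; rewrite ler_norml => /andP[c1 c2].
  have : `|s - t| <= T by rewrite ler_norml; apply/andP; split; lra.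
  by move=> h; apply/andP; split; lra.
apply: (@squeeze_cvge _ _ _ _ (cst 0%E) _
    (fun s => ((C' * `|s - t|) ^+ 2 * fine (leb d K))%:E)); last 2 first.
- exact: cvg_cst.
- apply: cvg_EFin; first exact: nearW.
  apply: cvg_within_filter.
  have c1 : C' * `|s - t| @[s --> t] --> C' * `|t - t|.
    apply: cvgM; first exact: cvg_cst.
    by apply: cvg_norm; apply: cvgB; [exact: cvg_id|exact: cvg_cst].
  have c2 : (C' * `|s - t|) ^+ 2 * fine (leb d K) @[s --> t] -->
      (C' * `|t - t|) * (C' * `|t - t|) * fine (leb d K).
    by apply: cvgM; [exact: cvgM|exact: cvg_cst].
  by move: c2; rewrite subrr normr0 mulr0 !mul0r.
near=> s; have sT : 0 <= s <= T.
  have : `[0, T]%classic s by near: s; exact: withinT.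
  by rewrite /= in_itv.
rewrite integral_ge0//=; last by move=> x _; rewrite lee_fin sqr_ge0.
apply: (@le_trans _ _ (\int[leb d]_x ((C' * `|s - t|) ^+ 2 * \1_K x)%R%:E)%E).
  apply: ge0_le_integral_nomeas => x _; first by rewrite lee_fin sqr_ge0.
  rewrite lee_fin mulr1 indicE; have [Kx|nK] := pselect (K x); last first.
    by rewrite !Kout// subrr expr0n memNset// mulr0.
  rewrite mem_set// mulr1 -real_normK ?num_real// ler_pXn2r ?nnegrE ?mulr_ge0//.
  exact: lip.
under eq_integral do rewrite EFinM.
rewrite ge0_integralZl//=; last 2 first.
- by apply/measurable_EFinP; exact: measurable_indic.
- by rewrite lee_fin sqr_ge0.
by rewrite integral_indic// setIT [X in (_ <= X)%E]EFinM fineK// ge0_fin_numE.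
Unshelve. all: by end_near. Qed.

Variables (a sigma : E -> 'M[R]_d) (phi : 'rV[R]_d -> R).
Variables (f : E -> R -> 'rV[R]_d -> R) (u : E -> R) (ub : R -> 'rV[R]_d -> R).
Variable mu : {measure set E -> \bar R}.
Local Notation P := (fun z => grad T u z *m (a z)^T).
Local Notation F := (fu T sigma f u).
Hypothesis OPeq : forall eta etab etaq t, W11_0 T eta ->
  C_version T (cst 1) eta etab -> qc_version T eta etaq -> t \in `[0, T] ->
  mu.-integrable (QT T) (EFin \o etaq) /\
  \int[mQ]_(z in strip t T) (u z * dt T eta z)
  + 2^-1 * \int[mQ]_(z in strip t T) dot (grad T u z *m (a z)^T) (grad T eta z)
  = \int[mQ]_(z in strip t T) (F z * eta z) + \int[mu]_(z in strip t T) etaq z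
    + \int[leb d]_x (phi x * etab T x) - \int[leb d]_x (ub t x * etab t x).

Lemma OP_smooth n (eta : E -> R) t : smooth eta -> xsupp n eta -> t \in `[0, T] ->
  \int[mQ]_(z in strip t T) (u z * 'D_dirt eta z)
  + 2^-1 * \int[mQ]_(z in strip t T) (\sum_i P z 0 i * 'D_(dirx i) eta z)
  = \int[mQ]_(z in strip t T) (F z * eta z) + \int[mu]_(z in strip t T) eta z
    + \int[leb d]_x (phi x * eta (T, x)) - \int[leb d]_x (ub t x * eta (t, x)).
Proof.
move=> se en' tT.
have [_ <-] := OPeq (smooth_W11_0 se en') (smooth_C_version se en')
  (smooth_qc (smooth_cts se)) tT.
congr (_ + _ * _).
  apply: Rintegral_ae_ext; apply: ae_strip tT _.
  by apply: filterS (wderiv_smoothE T dirt se) => z hz oz; rewrite /dt hz.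
apply: Rintegral_ae_ext; apply: ae_strip tT _.
have H : {ae mQ, forall z, forall i, oQT T z -> wderiv T (dirx i) eta z = 'D_(dirx i) eta z}.
  by apply: filter_forall => i; exact: wderiv_smoothE.
apply: filterS H => z hz oz; rewrite /dot; apply: eq_bigr => i _.
by rewrite [in RHS]/grad [in RHS]mxE hz.
Qed.

(** Start the equation at [t = 0]: [eta] vanishes at both end points, and the two
    boundary terms with it. *)
Lemma OP_compact (B : set E) (eta : E -> R) : compact B -> B `<=` oQT T ->
  (forall i, L2 mQ B (fun z => P z 0 i)) ->
  smooth eta -> (forall z, ~ B z -> eta z = 0) ->
  \int[mQ]_z (tr B u z * 'D_dirt eta z)
  + 2^-1 * (\sum_i \int[mQ]_z (tr B (fun y => P y 0 i) z * 'D_(dirx i) eta z))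
  = \int[mQ]_z (tr B F z * eta z) + \int[mu]_(z in QT T) eta z.
Proof.
move=> cB BQ LP se e0; have mB := compact_measurable_E cB.
have BQT z : B z -> QT T z by move=> /BQ/oQT_QT.
have [M hM] := compact_bd cB.
have en' : xsupp M eta.
  by move=> z Mz; apply: e0 => /hM; rewrite leNgt (lt_le_trans Mz)// E_norm2.
have De0 v z : ~ B z -> 'D_v eta z = 0.
  by apply: deriv_off => //; exact: (compact_closed (@norm_hausdorff _ _)).
have h0 : (0 : R) \in `[0, T] by rewrite in_itv/= lexx ltW.
have := OP_smooth se en' h0.
have eT x : eta (T, x) = 0 by apply: e0 => /BQ/oQTP; rewrite /= ltxx andbF.
have e00 x : eta (0, x) = 0 by apply: e0 => /BQ/oQTP; rewrite /= ltxx.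
have -> : \int[leb d]_x (phi x * eta (T, x)) = 0.
  rewrite (_ : (fun x => _) = fun=> 0); last by apply/funext => x; rewrite eT mulr0.
  by rewrite Rintegral_cst// mul0r.
have -> : \int[leb d]_x (ub 0 x * eta (0, x)) = 0.
  rewrite (_ : (fun x => _) = fun=> 0); last by apply/funext => x; rewrite e00 mulr0.
  by rewrite Rintegral_cst// mul0r.
rewrite addr0 subr0.
have trM (w p : E -> R) : (forall z, ~ B z -> p z = 0) ->
    tr (strip 0 T) (fun z => w z * p z) = (fun z => tr B w z * p z).
  move=> p0; apply/funext => z; have [Bz|nB] := pselect (B z).
    by rewrite !trE//; exact: BQT.
  by rewrite p0// mulr0 /tr p0// mulr0 mul0r.
rewrite (Rint_tr _ _ (fun z => u z * 'D_dirt eta z)) trM; last exact: De0.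
rewrite (Rint_tr _ _ (fun z => F z * eta z)) trM//.
rewrite (Rint_tr _ _ (fun z => \sum_i _)).
rewrite (_ : tr _ (fun z => \sum_i _) =
    (fun z => \sum_i (tr B (fun y => P y 0 i) z * 'D_(dirx i) eta z))); last first.
  apply/funext => z; rewrite /tr mulr_suml; apply: eq_bigr => i _.
  exact: (congr1 (fun q : E -> R => q z) (trM (fun y => P y 0 i) _ (De0 (dirx i)))).
rewrite Rint_sum// => i; apply: mul_integrable; first exact: L2_tr.
have [K bK] := off_bsupp cB (De0 (dirx i)).
exact: cs_L2 (smooth_cts (smoothD _ se)) bK.
Qed.

Lemma Rint_null (m : {measure set E -> \bar R}) (D : set E) (p : E -> R) :
  measurable D -> m D = 0%E -> \int[m]_(z in D) p z = 0.
Proof.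
move=> mD D0; rewrite (@Rintegral_ae_ext _ _ _ _ _ _ (fun=> 0)); first by rewrite Rintegral_cst// mul0r.
by exists D; split => // z /= nz; apply: contrapT => nD; apply: nz.
Qed.

(** Start the equation at [t = T]: the space-time integrals run over a set that is
    null for Lebesgue measure and for [mu], so that [phi] and [ub T] have the same
    integrals against all bumps. *)
Lemma OP_final : mu ([set T] `*` setT) = 0%E -> L2loc_Rd phi ->
  (forall K, compact K -> L2continuous T K (cst 1) ub) ->
  {ae leb d, forall x, ub T x = phi x}.
Proof.
move=> muT Lphi Lub.
have hT : T \in `[0, T] by rewrite in_itv/= lexx ltW.
have iK (w : 'rV[R]_d -> R) (K : set 'rV[R]_d) : compact K -> L2 (leb d) K w ->
    (leb d).-integrable setT (EFin \o (fun x => w x * \1_K x)).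
  move=> cK [mw w2]; have mK := compact_measurable_rV cK.
  have E1 : (fun x => w x * \1_K x) = w \_ K.
    apply/funext => x; rewrite patchE indicE; case: (x \in K); by rewrite ?mulr1 ?mulr0.
  have L1 : L2 (leb d) setT (w \_ K).
    split; first exact/(measurable_restrictT _ mK).
    move: w2; rewrite integral_mkcond (_ : _ \_ K = fun z => ((w \_ K) z ^+ 2)%:E)//.
    by apply/funext => z; rewrite !patchE; case: ifP => // _; rewrite expr0n.
  have L2' : L2 (leb d) setT (\1_K : 'rV[R]_d -> R) by apply: L2_indic => //; exact: compact_rV_lty.
  have E2 : (fun x => (w \_ K) x * \1_K x) = (fun x => w x * \1_K x).
    by apply/funext => x; rewrite patchE indicE; case: (x \in K); rewrite ?mulr1 ?mulr0.
  by have := mul_integrable L1 L2'; rewrite E2.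
have L2ub K : compact K -> L2 (leb d) K (ub T).
  move=> cK; have [+ _] := Lub K cK T hT.
  by rewrite (_ : (fun x => _) = ub T)//; apply/funext => x; rewrite mulr1.
suff H : {ae leb d, forall x, ub T x - phi x = 0}.
  by apply: filterS H => x /eqP; rewrite subr_eq0 => /eqP.
apply: rV_ae0.
  move=> n; have cn : compact [set y : 'rV[R]_d | `|y| <= n%:R] by exact: rV_balls_compact.
  have := int1B (iK _ _ cn (L2ub _ cn)) (iK _ _ cn (Lphi _ cn)).
  by rewrite (_ : (fun x => _) = (fun x => (ub T x - phi x) * \1_[set y | `|y| <= n%:R] x))//;
    apply/funext => x; rewrite mulrBl.
move=> k p q; pose eta := fun z : E => bx k.+1%:R p q z.2.
have se : smooth eta by exact: bEx_smooth.
have bout x : `|p| + `|q| < `|x| -> bx k.+1%:R p q x = 0.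
  move=> xn; apply: bx_out; rewrite ?ltr0n// => h; move: xn; rewrite ltNge => /negP; apply.
  have S0 : 0 <= `|p| + `|q| by rewrite addr_ge0.
  apply/(rV_norm_leP _ S0) => i; have /andP[h1 h2] := h i.
  have := rV_coord_le p i; have := rV_coord_le q i.
  have := normr_ge0 p; have := normr_ge0 q => p1 p2.
  by rewrite !ler_norml => /andP[a1 a2] /andP[b1 b2]; apply/andP; split; lra.
have en' : xsupp (`|p| + `|q|) eta by move=> z; exact: bout.
have := OP_smooth se en' hT.
have mS : measurable ([set T] `*` setT : set E) by apply: measurableX.
have N1 (w : E -> R) := Rint_null w mS (null_slice T).
have N2' (w : E -> R) := Rint_null w mS muT.
rewrite strip_cst !N1 !N2' mulr0 !add0r => /esym/eqP.
rewrite subr_eq0 => /eqP HH.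
have [n hn] := truncn_gt_norm (R := R) (`|p| + `|q|).
have cn : compact [set y : 'rV[R]_d | `|y| <= n%:R] by exact: rV_balls_compact.
have ib w : L2 (leb d) [set y : 'rV[R]_d | `|y| <= n%:R] w ->
    (leb d).-integrable setT (EFin \o (fun x => w x * bx k.+1%:R p q x)).
  move=> /(iK _ _ cn) iw.
  have -> : (fun x => w x * bx k.+1%:R p q x) =
     (fun x => bx k.+1%:R p q x * (w x * \1_[set y : 'rV[R]_d | `|y| <= n%:R] x)).
    apply/funext => x; rewrite indicE; have [xn|xn] := leP `|x| n%:R.
      by rewrite mem_set// mulr1 mulrC.
    by rewrite bout ?mulr0 ?mul0r// (lt_trans hn).
  apply: (int1_bounded (C := 1)) => //.
    by apply: cts_measurable_rV; apply: smooth_cts; exact: bx_smooth.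
  by move=> x; rewrite ger0_norm ?bx_ge0// bx_le1.
rewrite (_ : (fun x => _) = (fun x => ub T x * bx k.+1%:R p q x - phi x * bx k.+1%:R p q x)); last first.
  by apply/funext => x; rewrite mulrBl.
rewrite RintB; [|exact: ib (L2ub _ cn)|exact: ib (Lphi _ cn)].
by move: HH; rewrite /eta /= => ->; rewrite subrr.
Qed.

End op_equation.

(** * The weight, space cutoffs and one-sided approximate identities *)

Section gz_more.
Context {R : realType}.

Lemma gz0_ge (t : R) : 0 < t -> 1 - t^-1 <= gz 0 t.
Proof. by move=> t0; rewrite gz_pos// expr0 mul1r; exact: expR_ge1Dx. Qed.

Lemma gz_le_inv n (t : R) : 0 < t -> gz n t <= t^-1 ^+ n.
Proof.
move=> t0; rewrite gz_pos// ler_piMr ?exprn_ge0 ?invr_ge0 ?ltW//.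
by rewrite expR_lt1 oppr_lt0 invr_gt0.
Qed.

Lemma natS_cvgy (c : R) : 0 < c -> (n.+1%:R * c - 1)^-1 @[n --> \oo] --> (0 : R).
Proof.
move=> c0; apply: cvg0_by_eps => e e0; near=> n.
have h : (e^-1 + 1) / c < n.+1%:R.
  apply: (@lt_le_trans _ _ n%:R); last by rewrite ler_nat.
  by near: n; exact: nbhs_infty_gtr.
have h2 : e^-1 < n.+1%:R * c - 1 by move: h; rewrite ltr_pdivrMr//; lra.
have h3 : 0 < n.+1%:R * c - 1 by apply: lt_trans h2; rewrite invr_gt0.
by rewrite ger0_norm ?invr_ge0 ?ltW// invf_plt ?posrE.
Unshelve. all: by end_near. Qed.

Lemma near_pos (c : R) : 0 < c -> \forall n \near \oo, 0 < n.+1%:R * c - 1.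
Proof.
move=> c0; near=> n; have h : c^-1 < n.+1%:R.
  apply: (@lt_le_trans _ _ n%:R); last by rewrite ler_nat.
  by near: n; exact: nbhs_infty_gtr.
by rewrite subr_gt0 -ltr_pdivrMr// div1r.
Unshelve. all: by end_near. Qed.

Lemma gz0_cvgy (c : R) : 0 < c -> gz 0 (n.+1%:R * c - 1) @[n --> \oo] --> (1 : R).
Proof.
move=> c0; apply: (@squeeze_cvgr _ _ _ _ (fun n => 1 - (n.+1%:R * c - 1)^-1) (fun=> 1)).
- near=> n; rewrite gz0_le1 andbT; apply: gz0_ge; near: n; exact: near_pos.
- by rewrite -[X in _ --> X]subr0; apply: cvgB; [exact: cvg_cst|exact: natS_cvgy].
- exact: cvg_cst.
Unshelve. all: by end_near. Qed.

Lemma gz_cvg0 k (c : R) : 0 < c -> gz k.+1 (n.+1%:R * c - 1) @[n --> \oo] --> (0 : R).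
Proof.
move=> c0; apply: (@squeeze_cvgr _ _ _ _ (fun=> 0) (fun n => (n.+1%:R * c - 1)^-1 ^+ k.+1)).
- near=> n; rewrite gz_ge0/=; apply: gz_le_inv; near: n; exact: near_pos.
- exact: cvg_cst.
- elim: k => [|k ih]; first by under eq_fun do rewrite expr1; exact: natS_cvgy.
  under eq_fun do rewrite exprS.
  by have := cvgM (natS_cvgy c0) ih; rewrite mulr0; exact.
Unshelve. all: by end_near. Qed.

Lemma is_derive_affine {V : normedModType R} (l : V -> R) (p q : R) x v :
  (forall (h : R) x v, l (h *: v + x) = h * l v + l x) ->
  is_derive x v (fun y => p * l y + q) (p * l v).
Proof.
move=> ll; apply: is_derive_line.
have -> : (fun h : R => p * l (h *: v + x) + q) = (id : R -> R) * cst (p * l v) + cst (p * l x + q).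
  apply/funext => h; rewrite ll.
  by change (p * (h * l v + l x) + q = h * (p * l v) + (p * l x + q)); ring.
have dl := is_deriveD (is_deriveM (is_derive_id (0 : R) (1 : R))
  (is_derive_cst (p * l v) (0 : R) (1 : R))) (is_derive_cst (p * l x + q) (0 : R) (1 : R)).
apply: is_derive_eq dl _.
by rewrite scale0r add0r addr0 /GRing.scale /= mulr1.
Qed.

End gz_more.

Section weight.
Context {R : realType} {d : nat}.
Local Notation E := (R * 'rV[R]_d)%type.

Definition sE (z : E) : R := 1 + \sum_i z.2 0 i ^+ 2.
(** Powers of [1 + |x|^2], among them the weight [varrho] and its square. They are
    smooth, and their logarithmic derivatives are bounded ([pw_Dx]). *)
Definition pw (b : R) (z : E) : R := sE z `^ b.

Lemma sE_ge1 z : 1 <= sE z.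
Proof. by rewrite lerDl sumr_ge0// => i _; rewrite sqr_ge0. Qed.

Lemma sE_gt0 z : 0 < sE z.
Proof. exact: lt_le_trans ltr01 (sE_ge1 z). Qed.

Lemma sE_coord (z : E) i : z.2 0 i ^+ 2 < sE z.
Proof.
rewrite /sE (bigD1 i)//= addrCA ltrDl ltr_wpDr// sumr_ge0// => j _.
by rewrite sqr_ge0.
Qed.

Lemma sE_coord2 (z : E) i : `|2 * z.2 0 i| <= sE z.
Proof.
have := sE_coord z i; have h := sE_ge1 z.
rewrite /sE (bigD1 i)//=; set S := \sum_(_ | _) _ => _.
have S0 : 0 <= S by apply: sumr_ge0 => j _; rewrite sqr_ge0.
set x := z.2 0 i; rewrite ler_norml; apply/andP; split.
  by have := sqr_ge0 (x + 1); nra.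
by have := sqr_ge0 (x - 1); nra.
Qed.

Lemma pw_gt0 b z : 0 < pw b z.
Proof. by rewrite powR_gt0// sE_gt0. Qed.

Lemma sE_smooth : smooth sE.
Proof.
apply: (smooth_add (smooth_cst (1 : R))); apply: smooth_sum => i.
have -> : (fun z : E => z.2 0 i ^+ 2) = (fun z => z.2 0 i * z.2 0 i).
  by apply/funext => z; rewrite expr2.
have h : sm (fun z : E => z.2 0 i).
  by apply: sm_lin; [exact: E_coord_cts|move=> h x v; exact: E_coord_lin].
by apply/sm_is_smooth/sm_mul.
Qed.

Lemma pw_smooth b : smooth (pw b).
Proof. by apply: smooth_powR; [exact: sE_smooth|exact: sE_gt0]. Qed.

Lemma is_derive_sE z v : is_derive z v sE (\sum_i 2 * z.2 0 i * v.2 0 i).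
Proof.
have h i : is_derive z v (fun z : E => z.2 0 i) (v.2 0 i).
  have := is_derive_affine 1 0 z v (fun h x v => @E_coord_lin _ _ i h x v).
  rewrite mul1r; congr (is_derive _ _ _ _).
  by apply/funext => y; rewrite mul1r addr0.
have h2 i : is_derive z v (fun z : E => z.2 0 i ^+ 2) (2 * z.2 0 i * v.2 0 i).
  have := is_deriveM (h i) (h i); rewrite /GRing.scale /=.
  have -> : z.2 0 i * v.2 0 i + z.2 0 i * v.2 0 i = 2 * z.2 0 i * v.2 0 i by ring.
  by congr (is_derive _ _ _ _); apply/funext => y; rewrite expr2.
have hs : is_derive z v (\sum_i (fun z : E => z.2 0 i ^+ 2)) (\sum_i 2 * z.2 0 i * v.2 0 i).
  by apply: is_derive_sum.
have := is_deriveD (is_derive_cst (1 : R) z v) hs; rewrite add0r.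
by congr (is_derive _ _ _ _); apply/funext => y; rewrite /sE fctE /= fct_sumE.
Qed.

Lemma is_derive_pw b z v :
  is_derive z v (pw b) (b * sE z `^ (b - 1) * \sum_i 2 * z.2 0 i * v.2 0 i).
Proof. exact: (is_derive_chain (is_derive_sE z v) (is_derive1_powR b (sE_gt0 z))). Qed.

Lemma pw_Dt b z : 'D_dirt (pw b) z = 0.
Proof.
have [_ ->] := is_derive_pw b z dirt.
by rewrite big1 ?mulr0// => i _; rewrite mxE mulr0.
Qed.

Lemma pw_Dx b z i : `|'D_(dirx i) (pw b) z| <= `|b| * pw b z.
Proof.
have [_ ->] := is_derive_pw b z (dirx i).
rewrite (bigD1 i)//= big1 => [|j ji]; last by rewrite !mxE (negbTE ji) andbF mulr0.
rewrite !mxE !eqxx mulr1 addr0 normrM normrM -mulrA ler_wpM2l//.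
rewrite ger0_norm ?powR_ge0//.
have -> : pw b z = sE z `^ (b - 1) * sE z.
  rewrite /pw -[X in _ = _ * X](powRr1 (ltW (sE_gt0 z))) -powRD ?subrK//.
  by apply/implyP => _; rewrite gt_eqF// sE_gt0.
by rewrite ler_wpM2l ?powR_ge0//; exact: sE_coord2.
Qed.

Lemma varrhoE alpha z : varrho alpha z.2 = pw (- alpha) z.
Proof. by rewrite /varrho enorm_sqr. Qed.

Lemma varrho_sqr alpha z : varrho alpha z.2 ^+ 2 = pw (- (alpha * 2)) z.
Proof. by rewrite varrhoE /pw -powR_mulrn ?powR_ge0// -powRrM mulNr. Qed.

(** The cutoffs increase to 1, have compact support in space and their gradients
    are bounded and tend to 0: by [pw_Dx] the gradient of [(n + 1) / sE] is at most
    [(n + 1) / sE], and [y * gz 2 (y - 1)] is bounded. *)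
Definition chi (n : nat) (z : E) : R := gz 0 (n.+1%:R * pw (-1) z - 1).

Lemma chi_ge0 n z : 0 <= chi n z.
Proof. exact: gz_ge0. Qed.

Lemma chi_le1 n z : chi n z <= 1.
Proof. exact: gz0_le1. Qed.

Lemma chi_le n m z : (n <= m)%N -> chi n z <= chi m z.
Proof.
move=> nm; apply: gz0_homo; rewrite lerD2r ler_wpM2r ?(ltW (pw_gt0 _ _))//.
by rewrite ler_nat ltnS.
Qed.

Lemma chi_smooth n : smooth (chi n).
Proof.
apply: smooth_gz; apply: (smooth_add (smooth_mul (smooth_cst n.+1%:R) (pw_smooth _))
  (smooth_cst (-1))).
Qed.

Lemma chi_cvg z : chi n z @[n --> \oo] --> (1 : R).
Proof. by apply: gz0_cvgy; exact: pw_gt0. Qed.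

Lemma chi_xsupp n : xsupp n.+1%:R (chi n).
Proof.
move=> z zn; apply: gz_neg; rewrite subr_le0.
have n0 : 0 < n.+1%:R :> R by rewrite ltr0n.
suff h : n.+1%:R <= sE z.
  by rewrite /pw powR_inv1 ?(ltW (sE_gt0 z))// ler_pdivrMr ?sE_gt0// mul1r.
rewrite leNgt; apply/negP => h; move: zn; rewrite ltNge => /negP; apply.
apply/(rV_norm_leP _ (ltW n0)) => i.
have : `|z.2 0 i| ^+ 2 <= n.+1%:R ^+ 2.
  rewrite real_normK ?num_real// (le_trans (ltW (sE_coord z i)))//.
  by rewrite (le_trans (ltW h))// expr2 ler_peMl ?ler1n// ler0n.
by rewrite ler_pXn2r ?nnegrE// ltW.
Qed.

Lemma is_derive_chi n z v : is_derive z v (chi n)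
  (gz 2 (n.+1%:R * pw (-1) z - 1) * (n.+1%:R * 'D_v (pw (-1)) z)).
Proof.
have h1 : is_derive z v (fun z => n.+1%:R * pw (-1) z - 1) (n.+1%:R * 'D_v (pw (-1)) z).
  have dp := smooth_is_derive (pw_smooth (-1)) z v.
  have := is_deriveB (is_deriveZ n.+1%:R dp) (is_derive_cst (1 : R) z v).
  by rewrite subr0.
have := is_derive_chain h1 (is_derive_gz 0 (n.+1%:R * pw (-1) z - 1)).
by rewrite mul0r subr0.
Qed.

Lemma chi_Dt n z : 'D_dirt (chi n) z = 0.
Proof. by have [_ ->] := is_derive_chi n z dirt; rewrite pw_Dt !mulr0. Qed.

Lemma chi_Dx_le n z i : `|'D_(dirx i) (chi n) z| <=
  gz 1 (n.+1%:R * pw (-1) z - 1) + gz 2 (n.+1%:R * pw (-1) z - 1).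
Proof.
have [_ ->] := is_derive_chi n z (dirx i).
set y := n.+1%:R * pw (-1) z; have h := pw_Dx (-1) z i.
rewrite normrM (ger0_norm (gz_ge0 _ _)) normrM (ger0_norm (ler0n _ _)).
have hy : n.+1%:R * `|'D_(dirx i) (pw (-1)) z| <= y.
  by rewrite ler_wpM2l// (le_trans h)// normrN normr1 mul1r.
apply: le_trans (ler_wpM2l (gz_ge0 _ _) hy) _.
have [y1|y1] := ltP 0 (y - 1); last by rewrite !gz_neg// mul0r addr0.
have -> : gz 2 (y - 1) * y = gz 1 (y - 1) + gz 2 (y - 1); last by [].
rewrite !gz_pos//; have n0 : y - 1 != 0 by rewrite gt_eqF.
by move: (expR _) => e; field.
Qed.

Lemma chi_Dx_bd n z i : `|'D_(dirx i) (chi n) z| <= 3.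
Proof.
apply: le_trans (chi_Dx_le n z i) _.
apply: le_trans (lerD (gz_le 1 _) (gz_le 2 _)) _.
by rewrite -natrD.
Qed.

Lemma chi_Dx_cvg z i : 'D_(dirx i) (chi n) z @[n --> \oo] --> (0 : R).
Proof.
apply/norm_cvg0P.
apply: (@squeeze_cvgr _ _ _ _ (fun=> 0) (fun n => gz 1 (n.+1%:R * pw (-1) z - 1) +
   gz 2 (n.+1%:R * pw (-1) z - 1))).
- by apply: nearW => n; rewrite normr_ge0 /= chi_Dx_le.
- exact: cvg_cst.
- rewrite -[X in _ --> X]addr0; apply: cvgD; apply: gz_cvg0; exact: pw_gt0.
Qed.

Definition cw (n : nat) (b : R) (z : E) : R := chi n z * pw b z.

Lemma cw_smooth n b : smooth (cw n b).
Proof. exact: smooth_mul (chi_smooth n) (pw_smooth b). Qed.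

Lemma cw_ge0 n b z : 0 <= cw n b z.
Proof. by rewrite mulr_ge0 ?chi_ge0// ltW// pw_gt0. Qed.

Lemma cw_Dt n b z : 'D_dirt (cw n b) z = 0.
Proof.
rewrite /cw derive_mul; [|exact: chi_smooth|exact: pw_smooth].
by rewrite pw_Dt chi_Dt !mulr0 addr0.
Qed.

Lemma cw_Dx n b z i : 'D_(dirx i) (cw n b) z =
  chi n z * 'D_(dirx i) (pw b) z + pw b z * 'D_(dirx i) (chi n) z.
Proof. by rewrite /cw derive_mul//; [exact: chi_smooth|exact: pw_smooth]. Qed.

Lemma cw_Dx_le n b z i : `|'D_(dirx i) (cw n b) z| <= (`|b| + 3) * pw b z.
Proof.
rewrite cw_Dx (le_trans (ler_normD _ _))// mulrDl lerD//.
  rewrite normrM (ger0_norm (chi_ge0 _ _)) (le_trans _ (pw_Dx b z i))//.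
  by rewrite ler_piMl// chi_le1.
by rewrite normrM (ger0_norm (ltW (pw_gt0 _ _))) mulrC ler_wpM2r ?(ltW (pw_gt0 _ _))// chi_Dx_bd.
Qed.

Lemma cw_cvg b z : cw n b z @[n --> \oo] --> pw b z.
Proof. by rewrite -[X in _ --> X]mul1r; apply: cvgM; [exact: chi_cvg|exact: cvg_cst]. Qed.

Lemma cw_Dx_cvg b z i : 'D_(dirx i) (cw n b) z @[n --> \oo] --> 'D_(dirx i) (pw b) z.
Proof.
under eq_fun do rewrite cw_Dx.
have := cvgD (cvgM (chi_cvg z) (cvg_cst ('D_(dirx i) (pw b) z)))
  (cvgM (cvg_cst (pw b z)) (chi_Dx_cvg z i)).
by rewrite mul1r mulr0 addr0; exact.
Qed.

End weight.

Section approximate_identity.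
Context {R : realType}.
Local Notation m1 := (@leb1 R).

Lemma Rint_mul_indic d0 (X : measurableType d0) (m : {measure set X -> \bar R}) (D : set X) (p : X -> R) :
  \int[m]_(t in D) p t = \int[m]_t (p t * \1_D t).
Proof.
rewrite Rintegral_mkcond; congr (Rintegral _ _ _); apply/funext => t.
by rewrite patchE indicE; case: (t \in D); rewrite ?mulr1 ?mulr0.
Qed.

Lemma int1_indic d0 (X : measurableType d0) (m : {measure set X -> \bar R}) (D : set X) (p : X -> R) :
  measurable D -> m.-integrable D (EFin \o p) -> m.-integrable setT (EFin \o (fun t => p t * \1_D t)).
Proof.
move=> mD ip; have := (integrable_mkcond (EFin \o p) mD).1 ip.
rewrite (_ : _ \_ D = EFin \o (fun t => p t * \1_D t))//.
by apply/funext => t; rewrite patchE /= indicE; case: (t \in D); rewrite ?mulr1 ?mulr0.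
Qed.

(** The integral concentrates near [b], where [W] is almost constant. The
    continuous version [Wb] is needed, as the value of [W] at the single point [b]
    means nothing. *)
Lemma approx_id (c e b : R) (ker : nat -> R -> R) (W Wb : R -> R) :
  (forall k, measurable_fun setT (ker k)) -> (forall k t, 0 <= ker k t) ->
  (forall k, exists C, forall t, ker k t <= C) ->
  \int[m1]_(t in `[c, e]%classic) ker k t @[k --> \oo] --> (1 : R) ->
  (forall del, 0 < del -> forall eps, 0 < eps -> \forall k \near \oo,
     forall t, t \in `[c, e] -> del <= `|t - b| -> ker k t <= eps) ->
  m1.-integrable `[c, e]%classic (EFin \o W) ->
  {ae m1, forall t, t \in `[c, e] -> W t = Wb t} ->
  (forall eps, 0 < eps -> exists2 del, 0 < del & forall t, t \in `[c, e] ->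
     `|t - b| < del -> `|Wb t - Wb b| <= eps) ->
  \int[m1]_(t in `[c, e]%classic) (ker k t * W t) @[k --> \oo] --> Wb b.
Proof.
move=> mk k0 kC kint ksmall iW WE cW; set D := `[c, e]%classic; set w := Wb b.
have mD : measurable D by exact: measurable_itv.
pose V t := W t * \1_D t.
have iV : m1.-integrable setT (EFin \o V) by exact: int1_indic.
have iD : m1.-integrable setT (EFin \o (\1_D : R -> R)).
  by apply: indic_int1 => //; exact: leb1_itv_lty.
have ik k (p : R -> R) : m1.-integrable setT (EFin \o p) ->
    m1.-integrable setT (EFin \o (fun t => ker k t * p t)).
  move=> ip; have [C hC] := kC k; apply: (int1_bounded (C := C) ip (mk k)).
  by move=> t; rewrite ger0_norm.
pose Y t := `|V t| + `|w| * \1_D t.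
have iY : m1.-integrable setT (EFin \o Y) by apply: int1D; [exact: int1_norm|exact: int1Z].
have Y0 t : 0 <= Y t by rewrite addr_ge0 ?mulr_ge0// indicE ler0n.
set I := \int[m1]_t Y t.
have I0 : 0 <= I by apply: Rintegral_ge0 => t _.
have main : (\int[m1]_(t in D) (ker k t * W t) - w * \int[m1]_(t in D) ker k t) @[k --> \oo] --> (0 : R).
  apply: cvg0_by_eps => eps eps0.
  pose e1 := eps / 4; pose e2 := eps / (2 * (I + 1)).
  have e10 : 0 < e1 by rewrite divr_gt0.
  have e20 : 0 < e2 by rewrite divr_gt0// mulr_gt0// ltr_wpDl.
  have [del del0 hdel] := cW _ e10.
  near=> k.
  have small : forall t, t \in `[c, e] -> del <= `|t - b| -> ker k t <= e2.
    by near: k; exact: ksmall.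
  have mass : \int[m1]_t (ker k t * \1_D t) <= 2.
    rewrite -Rint_mul_indic; apply: ltW; near: k.
    by apply: (cvgr_lt _ kint); rewrite ltr1n.
  have i1 := ik k _ iV; have i2 := ik k _ iD; have i3 := int1Z w i2.
  have E1 : \int[m1]_(t in D) (ker k t * W t) - w * \int[m1]_(t in D) ker k t =
      \int[m1]_t (ker k t * V t - w * (ker k t * \1_D t)).
    rewrite (RintB i1 i3) (RintZ w i2); congr (_ - _ * _); rewrite Rint_mul_indic//.
    by apply: eq_Rintegral => t _; rewrite /V mulrA.
  rewrite E1.
  have iR : m1.-integrable setT (EFin \o (fun t => e1 * (ker k t * \1_D t) + e2 * Y t)).
    exact: int1D (int1Z e1 i2) (int1Z e2 iY).
  apply: (@le_trans _ _ (\int[m1]_t (e1 * (ker k t * \1_D t) + e2 * Y t))).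
    apply: le_trans (le_normr_Rintegral measurableT (int1B i1 i3)) _.
    apply: le_Rint_ae (int1_norm (int1B i1 i3)) iR _.
    apply: filterS WE => t WEt; have [Dt|nD] := pselect (D t); last first.
      by rewrite /Y /V indicE memNset// !(mulr0, subr0, normr0, addr0).
    have tD : t \in `[c, e] by [].
    have -> : ker k t * V t - w * (ker k t * \1_D t) = ker k t * (W t - w).
      by rewrite /V indicE mem_set// !mulr1; ring.
    have -> : e1 * (ker k t * \1_D t) + e2 * Y t = e1 * ker k t + e2 * (`|W t| + `|w|).
      by rewrite /Y /V indicE mem_set// !mulr1.
    rewrite normrM (ger0_norm (k0 _ _)).
    have [tb|tb] := ltP `|t - b| del.
      apply: ler_wpDr; first by rewrite mulr_ge0 ?addr_ge0// ltW.
      by rewrite mulrC ler_wpM2r// WEt// hdel.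
    apply: ler_wpDl; first by rewrite mulr_ge0// ltW.
    by apply: ler_pM => //; [exact: small|exact: ler_normB].
  rewrite (RintD (int1Z e1 i2) (int1Z e2 iY)) (RintZ e1 i2) (RintZ e2 iY).
  have h1 : e1 * \int[m1]_t (ker k t * \1_D t) <= eps / 2.
    by apply: le_trans (ler_wpM2l (ltW e10) mass) _; rewrite /e1; lra.
  have h2 : e2 * I <= eps / 2.
    rewrite /e2 invfM mulrA -[X in _ <= X]mulr1 -mulrA ler_wpM2l ?divr_ge0 ?(ltW eps0)//.
    by rewrite ler_pdivrMl ?ltr_wpDl// mulr1 lerDl.
  by rewrite -/I; lra.
have fin : ((\int[m1]_(t in D) (ker k t * W t) - w * \int[m1]_(t in D) ker k t)
    + w * \int[m1]_(t in D) ker k t) @[k --> \oo] --> 0 + w * 1.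
  by apply: cvgD main _; apply: cvgM kint; exact: cvg_cst.
move: fin; rewrite add0r mulr1; apply: cvg_trans; apply: near_eq_cvg; near=> k.
by rewrite subrK.
Unshelve. all: by end_near. Qed.

(** The derivative of a time cutoff: a kernel whose mass concentrates at [b], on
    the left of it for [s = 1] and on the right for [s = -1]. *)
Definition ker (s b : R) (k : nat) (t : R) : R :=
  k.+1%:R * gz 2 (k.+1%:R * (s * (b - t)) - 1).

Lemma ker_cts s b k : continuous (ker s b k).
Proof.
move=> t; apply: cvgM; first exact: cvg_cst.
apply: (@continuous_comp _ _ _ (fun t => k.+1%:R * (s * (b - t)) - 1) (gz 2) t); last exact: gz_cts.
apply: cvgB; last exact: cvg_cst.
apply: cvgM; first exact: cvg_cst.
apply: cvgM; first exact: cvg_cst.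
by apply: cvgB; [exact: cvg_cst|exact: cvg_id].
Qed.

Lemma ker_ge0 s b k t : 0 <= ker s b k t.
Proof. by rewrite mulr_ge0 ?gz_ge0. Qed.

Lemma ker_is_derive (s b : R) k t : s * s = 1 ->
  is_derive t (1 : R) (fun t => - s * gz 0 (k.+1%:R * (s * (b - t)) - 1)) (ker s b k t).
Proof.
move=> ss.
have h1 : is_derive t (1 : R) (fun t : R => k.+1%:R * (s * (b - t)) - 1) (- (k.+1%:R * s)).
  have h := @is_derive_affine R R id (- (k.+1%:R * s)) (k.+1%:R * (s * b) - 1) t 1 (fun h x v => erefl).
  have -> : - (k.+1%:R * s) = - (k.+1%:R * s) * id (1 : R) by rewrite mulr1.
  by move: h; congr (is_derive _ _ _ _); apply/funext => x /=; ring.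
have h2 := is_derive_chain h1 (is_derive_gz 0 _).
have h3 := is_deriveZ (- s) h2.
apply: is_derive_eq h3 _; rewrite /ker /GRing.scale /= mul0r subr0 mulrN mulrNN mulrCA.
by rewrite [s * (_ * s)]mulrCA ss mulr1 mulrC.
Qed.

Lemma ker_int s b k (T : R) : s * s = 1 -> 0 < T -> \int[m1]_(t in `[0, T]%classic) ker s b k t =
  - s * gz 0 (k.+1%:R * (s * (b - T)) - 1) - (- s * gz 0 (k.+1%:R * (s * b) - 1)).
Proof.
move=> ss T0; pose F t := - s * gz 0 (k.+1%:R * (s * (b - t)) - 1).
have dF t : derivable F t 1 by have [] := ker_is_derive b k t ss.
have cF := derivable_cts dF.
have -> : - s * gz 0 (k.+1%:R * (s * b) - 1) = F 0 by rewrite /F subr0.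
rewrite /Rintegral (_ : \int[m1]_(t in _) _ = (F T)%:E - (F 0)%:E)%E//.
have c1 : {within `[0, T], continuous (ker s b k)} by apply: continuous_subspaceT; exact: ker_cts.
have c2 : derivable_oo_LRcontinuous F 0 T.
  split => //; first by apply: cvg_at_right_filter; exact: cF.
  by apply: cvg_at_left_filter; exact: cF.
have c3 : {in `]0, T[, (F : R -> R)^`()%classic =1 ker s b k}.
  by move=> t _; rewrite derive1E; have [_ ->] := ker_is_derive b k t ss.
rewrite -(continuous_FTC2 T0 c1 c2 c3).
have mid : measurable_fun setT (id : R -> measurableTypeR R) by move=> _ Y mY; rewrite setTI.
have mk : measurable_fun (`[0, T]%classic : set (measurableTypeR R)) (EFin \o ker s b k).
  apply/measurable_EFinP; apply: measurable_funTS.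
  by apply: continuous_measurable_fun; exact: ker_cts.
have k0 : {in (`[0, T]%classic : set (measurableTypeR R)), forall y, (0 <= (EFin \o ker s b k) y)%E}.
  by move=> y _; rewrite lee_fin ker_ge0.
have := @ge0_integral_pushforward _ _ R (measurableTypeR R) R id mid (@leb1 R) _ _ (measurable_itv _) mk k0.
by move=> h; exact: esym h.
Qed.

Lemma ker_small (s b : R) : s * s = 1 -> forall del, 0 < del -> forall eps, 0 < eps ->
  \forall k \near \oo, forall t, (0 < s * (b - t) -> del <= `|t - b| -> ker s b k t <= eps) /\
    (s * (b - t) <= 0 -> ker s b k t <= eps).
Proof.
move=> ss del del0 eps eps0; near=> k => t.
have n0 : 0 < k.+1%:R :> R by rewrite ltr0n.
split => [st tb|st]; last first.
  rewrite /ker gz_neg ?mulr0 ?(ltW eps0)// subr_le0.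
  by rewrite (@le_trans _ _ 0)// mulr_ge0_le0.
have nE : `|t - b| = s * (b - t).
  rewrite -(ger0_norm (ltW st)) normrM distrC.
  have -> : `|s| = 1; last by rewrite mul1r.
  by apply/eqP; rewrite -(@eqrXn2 _ 2)// ?expr1n// real_normK ?num_real// expr2 ss.
move: tb; rewrite nE => tb; set y := k.+1%:R * (s * (b - t)).
have big : 2 / del + 4 / (del ^+ 2 * eps) < k.+1%:R.
  apply: (@lt_le_trans _ _ k%:R); last by rewrite ler_nat.
  by near: k; exact: nbhs_infty_gtr.
have p1 : 0 < 2 / del by rewrite divr_gt0.
have p2 : 0 < 4 / (del ^+ 2 * eps) by rewrite divr_gt0// mulr_gt0// exprn_gt0.
have b1 : 2 < k.+1%:R * del by rewrite -ltr_pdivrMr//; lra.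
have b2 : 4 < k.+1%:R * del ^+ 2 * eps by rewrite -mulrA -ltr_pdivrMr ?mulr_gt0 ?exprn_gt0//; lra.
have y1 : k.+1%:R * del / 2 <= y - 1.
  by have : k.+1%:R * del <= y by [rewrite /y ler_wpM2l|]; lra.
have y0 : 0 < y - 1 by apply: lt_le_trans y1; lra.
apply: le_trans (ler_wpM2l (ltW n0) (gz_le_inv 2 y0)) _.
rewrite exprVn ler_pdivrMr ?exprn_gt0//.
have : (k.+1%:R * del / 2) ^+ 2 <= (y - 1) ^+ 2.
  by rewrite ler_pXn2r ?nnegrE ?(ltW y0)//; apply: ltW; lra.
move=> /(ler_wpM2l (ltW eps0)); apply: le_trans.
have -> : eps * (k.+1%:R * del / 2) ^+ 2 = k.+1%:R * ((k.+1%:R * del ^+ 2 * eps) / 4) by field.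
by rewrite ler_peMr//; lra.
Unshelve. all: by end_near. Qed.

(** The hypothesis on [s * b] says that [b] is not the end point on the side from
    which the kernel approaches: [b > 0] for [s = 1] and [b < T] for [s = -1]. *)
Lemma ker_approx (s b T : R) (W Wb : R -> R) : 0 < T -> s * s = 1 -> b \in `[0, T] ->
  0 < s * b + (1 - s) / 2 * T ->
  m1.-integrable `[0, T]%classic (EFin \o W) ->
  {ae m1, forall t, t \in `[0, T] -> W t = Wb t} ->
  (forall eps, 0 < eps -> exists2 del, 0 < del & forall t, t \in `[0, T] ->
     `|t - b| < del -> `|Wb t - Wb b| <= eps) ->
  \int[m1]_(t in `[0, T]%classic) (ker s b k t * W t) @[k --> \oo] --> Wb b.
Proof.
move=> T0 ss; rewrite in_itv/= => /andP[b0 bT] sb iW WE cW; apply: approx_id => //.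
- by move=> k; apply: continuous_measurable_fun; exact: ker_cts.
- by move=> k t; exact: ker_ge0.
- by move=> k; exists (k.+1%:R * 2`!%:R) => t; rewrite ler_wpM2l// gz_le.
- have [s1|s1] : s = 1 \/ s = -1.
    have : s ^+ 2 == 1 ^+ 2 by rewrite expr1n expr2 ss.
    by rewrite eqf_sqr => /orP[/eqP|/eqP]; [left|right].
  - have h : gz 0 (k.+1%:R * b - 1) @[k --> \oo] --> (1 : R).
      by apply: gz0_cvgy; move: sb; rewrite s1; lra.
    apply: cvg_trans h; apply: near_eq_cvg; near=> k; rewrite ker_int// s1 !mul1r.
    rewrite (gz_neg _ (t := _ * (b - T) - 1)) ?mulr0 ?sub0r ?mulN1r ?opprK//.
    rewrite subr_le0 (@le_trans _ _ 0)// mulr_ge0_le0// subr_le0//.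
  - have h : gz 0 (k.+1%:R * (T - b) - 1) @[k --> \oo] --> (1 : R).
      by apply: gz0_cvgy; move: sb; rewrite s1; lra.
    apply: cvg_trans h; apply: near_eq_cvg; near=> k; rewrite ker_int// s1 opprK !mul1r.
    rewrite (gz_neg _ (t := _ * (-1 * b) - 1)) ?subr0.
      by congr (gz 0 (_ * _ - 1)); rewrite mulN1r opprB.
    by rewrite subr_le0 (@le_trans _ _ 0)// mulr_ge0_le0// mulN1r oppr_le0.
- move=> del del0 eps eps0; near=> k => t tD tb.
  have [h1 h2] : (0 < s * (b - t) -> del <= `|t - b| -> ker s b k t <= eps) /\
    (s * (b - t) <= 0 -> ker s b k t <= eps) by move: t {tD tb}; near: k; exact: ker_small.
  by have [h|h] := leP (s * (b - t)) 0; [exact: h2|exact: h1].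
Unshelve. all: by end_near. Qed.

End approximate_identity.

(** * Continuity in time of the slices *)

Section Lcont.
Context {R : realType} {d : nat}.
Local Notation ld := (leb d).
Local Notation L2x := (L2 (@leb R d) setT).
Implicit Types (g : R -> 'rV[R]_d -> R) (c p : 'rV[R]_d -> R).

(** Continuity in time of the slices [g t] in the space of square integrable
    functions with weight [c], with real integrals. *)
Definition Lcont (T : R) c g := forall t, t \in `[0, T] ->
  L2x (fun x => g t x * c x) /\
  forall eps, 0 < eps -> exists2 del, 0 < del & forall s, s \in `[0, T] ->
    `|s - t| < del -> N2 ld (fun x => (g s x - g t x) * c x) <= eps.

Lemma L2_N2E (m : {measure set 'rV[R]_d -> \bar R}) (p : 'rV[R]_d -> R) : L2 m setT p ->
  (\int[m]_x (p x ^+ 2)%:E = (N2 m p)%:E)%E.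
Proof.
move=> Lp; rewrite /N2 /Rintegral fineK//; apply: integrable_fin_num => //.
exact: sqr_integrable.
Qed.

Lemma L2continuous_Lcont T c g : L2continuous T setT c g -> Lcont T c g.
Proof.
move=> Lg t tT; have [Lt ct] := Lg t tT; split => // eps eps0.
have : \forall s \near within `[0, T]%classic (nbhs t),
    (\int[ld]_x (((g s x - g t x) * c x) ^+ 2)%:E < eps%:E)%E.
  apply: (ct [set y | (y < eps%:E)%E]); apply: open_nbhs_nbhs; split; last by rewrite /= lte_fin.
  exact: open_ereal_lt_ereal.
move=> [del /= del0 hdel]; exists del => // s sT st.
have [Ls _] := Lg s sT.
have LD : L2x (fun x => (g s x - g t x) * c x).
  rewrite (_ : (fun x => _) = (fun x => g s x * c x - g t x * c x)); first exact: L2B.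
  by apply/funext => x; rewrite mulrBl.
rewrite -lee_fin -L2_N2E//; apply: ltW; apply: hdel => //=.
by rewrite distrC.
Qed.

Lemma Lcont_mul T C p c g : measurable_fun setT p -> (forall x, `|p x| <= C) ->
  Lcont T c g -> Lcont T (fun x => p x * c x) g.
Proof.
move=> mp pC Lg t tT; have [Lt ct] := Lg t tT.
have C0 : 0 <= C by apply: le_trans (pC 0).
have E1 (q : 'rV[R]_d -> R) : (fun x => q x * (p x * c x)) = (fun x => p x * (q x * c x)).
  by apply/funext => x; rewrite mulrCA.
split => [|eps eps0]; first by rewrite E1; exact: L2M Lt mp pC.
have e1 : 0 < eps / (C ^+ 2 + 1) by rewrite divr_gt0// ltr_wpDl// sqr_ge0.
have [del del0 hdel] := ct _ e1; exists del => // s sT st.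
have [Ls _] := Lg s sT.
have LD : L2x (fun x => (g s x - g t x) * c x).
  rewrite (_ : (fun x => _) = (fun x => g s x * c x - g t x * c x)); first exact: L2B.
  by apply/funext => x; rewrite mulrBl.
rewrite E1; apply: le_trans (N2M LD mp pC) _.
apply: le_trans (ler_wpM2l (sqr_ge0 _) (hdel s sT st)) _.
rewrite mulrCA ler_piMr ?(ltW eps0)// ler_pdivrMr ?mul1r ?lerDl// ltr_wpDl// sqr_ge0//.
Qed.

Lemma LcontB T c g1 g2 : Lcont T c g1 -> Lcont T c g2 ->
  Lcont T c (fun t x => g1 t x - g2 t x).
Proof.
move=> L1 L2' t tT; have [Lt1 c1] := L1 t tT; have [Lt2 c2] := L2' t tT.
have E0 (q1 q2 : 'rV[R]_d -> R) : (fun x => (q1 x - q2 x) * c x) = (fun x => q1 x * c x - q2 x * c x).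
  by apply/funext => x; rewrite mulrBl.
split => [|eps eps0]; first by rewrite E0; exact: L2B.
have e1 : 0 < eps / 4 by rewrite divr_gt0.
have [d1 d10 h1] := c1 _ e1; have [d2 d20 h2] := c2 _ e1.
exists (Num.min d1 d2); first by rewrite lt_min d10.
move=> s sT; rewrite lt_min => /andP[s1 s2].
have [Ls1 _] := L1 s sT; have [Ls2 _] := L2' s sT.
have LD1 : L2x (fun x => (g1 s x - g1 t x) * c x) by rewrite E0; exact: L2B.
have LD2 : L2x (fun x => (g2 s x - g2 t x) * c x) by rewrite E0; exact: L2B.
have -> : (fun x => (g1 s x - g2 s x - (g1 t x - g2 t x)) * c x) =
    (fun x => (g1 s x - g1 t x) * c x + - ((g2 s x - g2 t x) * c x)).
  by apply/funext => x; ring.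
apply: le_trans (N2D LD1 (L2N LD2)) _; rewrite N2N.
by have := h1 s sT s1; have := h2 s sT s2; lra.
Qed.

Lemma Lcont_quad T c p g t : measurable_fun setT p -> (forall x, `|p x| <= 1) ->
  Lcont T c g -> t \in `[0, T] -> forall eps, 0 < eps -> exists2 del, 0 < del &
  forall s, s \in `[0, T] -> `|s - t| < del ->
    `|\int[ld]_x (p x * (g s x * c x) ^+ 2) - \int[ld]_x (p x * (g t x * c x) ^+ 2)| <= eps.
Proof.
move=> mp p1 Lg tT eps eps0; have [Lt ct] := Lg t tT.
set Nt := N2 ld (fun x => g t x * c x); have N0 : 0 <= Nt by exact: N2_ge0.
pose e := eps / (4 * (Nt + 1)); have e0 : 0 < e by rewrite divr_gt0// mulr_gt0// ltr_wpDl.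
pose et := eps / (2 * (1 + 2 * e^-1)).
have et0 : 0 < et by rewrite divr_gt0// mulr_gt0// addr_gt0// mulr_gt0// invr_gt0.
have [del del0 hdel] := ct _ et0; exists del => // s sT st.
have [Ls _] := Lg s sT.
set a := fun x => g s x * c x; set b := fun x => g t x * c x.
have LD : L2x (fun x => a x - b x) by exact: L2B.
have ND : N2 ld (fun x => a x - b x) <= et.
  rewrite (_ : (fun x => _) = (fun x => (g s x - g t x) * c x)); first exact: hdel.
  by apply/funext => x; rewrite mulrBl.
have ip (w : 'rV[R]_d -> R) : L2x w -> ld.-integrable setT (EFin \o (fun x => p x * w x ^+ 2)).
  by move=> Lw; apply: (int1_bounded _ mp p1); exact: sqr_integrable.
rewrite -RintB; [|exact: ip..].
have iD := sqr_integrable LD.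
have iM : ld.-integrable setT (EFin \o (fun x => `|a x - b x| * `|b x|)).
  have := int1_norm (mul_integrable LD Lt).
  by rewrite (_ : (fun x => _) = (fun x => `|a x - b x| * `|b x|))//; apply/funext => x; rewrite normrM.
apply: (@le_trans _ _ (\int[ld]_x ((a x - b x) ^+ 2 + 2 * (`|a x - b x| * `|b x|)))).
  apply: le_Rint_norm; [by apply: int1B; exact: ip|by apply: int1D => //; exact: int1Z|].
  move=> x; rewrite -mulrBr normrM -[X in _ <= X]mul1r; apply: ler_pM => //.
  rewrite subr_sqr normrM -[X in _ <= X + _]real_normK ?num_real// expr2 mulrCA -mulrDr.
  rewrite ler_wpM2l//; have -> : a x + b x = (a x - b x) + 2 * b x by ring.
  by rewrite (le_trans (ler_normD _ _))// normrM (ger0_norm (ler0n _ 2)) lerD2l.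
rewrite (RintD iD (int1Z 2 iM)) (RintZ 2 iM).
have La : L2x (fun x => `|a x - b x|).
  by apply: (L2_le _ LD) => [|x]; [apply: measurableT_comp => //; case: LD|rewrite normr_id].
have Lb' : L2x (fun x => `|b x|).
  by apply: (L2_le _ Lt) => [|x]; [apply: measurableT_comp => //; case: Lt|rewrite normr_id].
have e'0 : 0 < e^-1 by rewrite invr_gt0.
have := int_mul_le e'0 La Lb'.
have NE (w : 'rV[R]_d -> R) : N2 ld (fun x => `|w x|) = N2 ld w.
  by apply: eq_Rintegral => x _; rewrite real_normK ?num_real.
rewrite !NE invrK => /(le_trans (ler_norm _)) hI.
rewrite -/(N2 ld (fun x => a x - b x)).
have h1 : N2 ld (fun x => a x - b x) * (1 + 2 * e^-1) <= eps / 2.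
  apply: le_trans (ler_wpM2r _ ND) _; first by rewrite addr_ge0// mulr_ge0// ltW.
  have w0 : 1 + 2 * e^-1 != 0 by rewrite gt_eqF// addr_gt0// mulr_gt0.
  by rewrite /et; move: w0; move: (1 + 2 * e^-1) => w0 w00; rewrite le_eqVlt; apply/orP; left; apply/eqP; field.
have h2 : 2 * (e * Nt) <= eps / 2.
  have -> : eps / 2 = 2 * (e * (Nt + 1)).
    by rewrite /e invfM; field; rewrite gt_eqF// ltr_wpDl.
  by rewrite ler_wpM2l// ler_wpM2l ?(ltW e0)// lerDl.
move: hI h1 h2; rewrite -/Nt; lra.
Qed.

Lemma L2continuous_indic T (K : set 'rV[R]_d) g : measurable K ->
  L2continuous T K (cst 1) g -> Lcont T (\1_K) g.
Proof.
move=> mK Lg; apply: L2continuous_Lcont => t tT; have [[mt t2] ct] := Lg t tT.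
have IE (p : 'rV[R]_d -> R) : (\int[ld]_(x in K) ((p x * (cst 1 : 'rV[R]_d -> R) x) ^+ 2)%:E =
    \int[ld]_x ((p x * \1_K x) ^+ 2)%:E)%E.
  rewrite integral_mkcond; apply: eq_integral => x _.
  by rewrite patchE indicE; case: (x \in K); rewrite ?mulr1// mulr0 expr0n.
split.
  split; last by rewrite -IE.
  rewrite (_ : (fun x => _) = (fun x => g t x * (cst 1 : 'rV[R]_d -> R) x) \_ K).
    exact/(measurable_restrictT _ mK).
  by apply/funext => x; rewrite patchE indicE; case: (x \in K); rewrite ?mulr1 ?mulr0.
by under eq_fun do rewrite -IE.
Qed.

End Lcont.

(** * Cutoff inequalities *)

(** The data are truncated to compact sets, on which they are square
    integrable. *)
Notation tested_equation T u F P mu := (forall B eta, compact B -> B `<=` oQT T -> smooth eta ->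
  (forall z, ~ B z -> eta z = 0) ->
  \int[@lebQ _ _]_z (tr B u z * 'D_dirt eta z)
  + 2^-1 * (\sum_i \int[@lebQ _ _]_z (tr B (fun y => P y 0 i) z * 'D_(dirx i) eta z))
  = \int[@lebQ _ _]_z (tr B F z * eta z) + \int[mu]_(z in QT T) eta z).

Section limits.
Context d0 (X : measurableType d0) (R : realType) (m : {measure set X -> \bar R}).
Local Notation int1 f := (m.-integrable setT (EFin \o f)).

(** A bound on the truncated integrals passes to the limit even if the limit is not
    integrable: if the negative part has infinite integral there is nothing to
    prove, otherwise monotone convergence bounds the positive part. *)
Lemma cutoff_limit (G : X -> R) (chi : nat -> X -> R) (Z : nat -> R) (Z0 S : R) :
  measurable_fun setT G -> (forall n, measurable_fun setT (chi n)) ->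
  (forall n x, 0 <= chi n x <= 1) ->
  (forall x n k, (n <= k)%N -> chi n x <= chi k x) ->
  (forall x, chi n x @[n --> \oo] --> (1 : R)) ->
  (forall n, int1 (fun x => chi n x * G x)) -> Z @ \oo --> Z0 ->
  (forall n, Z n + \int[m]_x (chi n x * G x) <= S) ->
  (Z0%:E + \int[m]_x (G x)%:E <= S%:E)%E.
Proof.
move=> mG mchi chi01 chi_le chi1 iG cZ ZS.
pose p x := Num.max (G x) 0; pose q x := Num.max (- G x) 0.
have p0 x : 0 <= p x by rewrite le_max lexx orbT.
have q0 x : 0 <= q x by rewrite le_max lexx orbT.
have mp : measurable_fun setT p by apply: measurable_maxr.
have mq : measurable_fun setT q by apply: measurable_maxr => //; exact: measurableT_comp.
have -> : (\int[m]_x (G x)%:E = \int[m]_x (p x)%:E - \int[m]_x (q x)%:E)%E.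
  by rewrite integralE; congr (_ - _)%E; apply: eq_integral => x _;
    rewrite ?funeposE ?funenegE /= -?EFinN -EFin_max.
have Q0 : (0 <= \int[m]_x (q x)%:E)%E by apply: integral_ge0 => x _; rewrite lee_fin.
have := leey (\int[m]_x (q x)%:E)%E; rewrite le_eqVlt => /orP[/eqP ->|Qoo].
  by rewrite /= addeNy addeNy leNye.
have qfin : (\int[m]_x (q x)%:E)%E \is a fin_num by rewrite ge0_fin_numE.
set Q := fine (\int[m]_x (q x)%:E)%E.
have QE : (\int[m]_x (q x)%:E = Q%:E)%E by rewrite fineK.
have iq : int1 q.
  apply/integrableP; split; first exact/measurable_EFinP.
  by rewrite (eq_integral (fun x => (q x)%:E))// => x _; rewrite gee0_abs// lee_fin.
have chi0 n x : 0 <= chi n x by case/andP: (chi01 n x).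
have chi1' n x : chi n x <= 1 by case/andP: (chi01 n x).
have icq n : int1 (fun x => chi n x * q x).
  by apply: (int1_bounded (C := 1) iq) => // x; rewrite ger0_norm.
have icp n : int1 (fun x => chi n x * p x).
  have := int1D (iG n) (icq n); congr (_.-integrable _ (_ \o _)); apply/funext => x.
  rewrite -mulrDr; congr (_ * _); rewrite /p /q.
  have [g|g] := leP (G x) 0; first by rewrite max_l ?oppr_ge0// subrr.
  by rewrite max_r ?addr0// oppr_le0 ltW.
have bound n : ((\int[m]_x (chi n x * p x)%:E) <= (S - Z n + Q)%:E)%E.
  have -> : (\int[m]_x (chi n x * p x)%:E)%E = (\int[m]_x (chi n x * p x))%:E.
    by rewrite /Rintegral fineK//; exact: integrable_fin_num (icp n).
  rewrite lee_fin.
  have E1 : \int[m]_x (chi n x * p x) = \int[m]_x (chi n x * G x) + \int[m]_x (chi n x * q x).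
    rewrite -(RintD (iG n) (icq n)); apply: eq_Rintegral => x _.
    rewrite -mulrDr; congr (_ * _); rewrite /p /q.
    have [g|g] := leP (G x) 0; first by rewrite max_l ?oppr_ge0// subrr.
    by rewrite max_r ?addr0// oppr_le0 ltW.
  have h1 : \int[m]_x (chi n x * q x) <= Q.
    by apply: le_Rint (icq n) iq _ => x; rewrite ler_piMl.
  by rewrite E1; have := ZS n; lra.
have cp : (\int[m]_x (chi n x * p x)%:E)%E @[n --> \oo] --> (\int[m]_x (p x)%:E)%E.
  have h := @cvg_monotone_convergence _ _ _ m setT measurableT (fun n x => (chi n x * p x)%:E).
  have mE n : measurable_fun setT (fun x => (chi n x * p x)%:E).
    by apply/measurable_EFinP; apply: measurable_funM.
  have -> : (\int[m]_x (p x)%:E = \int[m]_x limn (fun n => (chi n x * p x)%:E))%E.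
    apply: eq_integral => x _; apply/esym/cvg_lim => //.
    apply: cvg_EFin; first exact: nearW.
    by rewrite -[X in _ --> X]mul1r; apply: cvgM; [exact: chi1|exact: cvg_cst].
  apply: h => // [n x _|x _ n k nk]; first by rewrite lee_fin mulr_ge0.
  by rewrite lee_fin ler_wpM2r// chi_le.
have cS : (S - Z n + Q)%:E @[n --> \oo] --> (S - Z0 + Q)%:E.
  apply: cvg_EFin; first exact: nearW.
  by apply: cvgD; [apply: cvgB => //; exact: cvg_cst|exact: cvg_cst].
have le : (\int[m]_x (p x)%:E <= (S - Z0 + Q)%:E)%E by exact: lee_cvg_to cp cS (nearW _ bound).
have P0 : (0 <= \int[m]_x (p x)%:E)%E by apply: integral_ge0 => x _; rewrite lee_fin.
have pfin : (\int[m]_x (p x)%:E)%E \is a fin_num.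
  by rewrite ge0_fin_numE// (le_lt_trans le)// ltry.
by move: le; rewrite QE -(fineK pfin) -EFinN -!EFinD !lee_fin; lra.
Qed.

End limits.

Section variational.
Context {R : realType} {d : nat}.
Local Notation E := (R * 'rV[R]_d)%type.
Local Notation mQ := (@lebQ R d).
Local Notation int1 f := (mQ.-integrable setT (EFin \o f)).

(** The averages must stay in a region where the functions are square integrable:
    a box inside the open strip has a compact neighbourhood inside the strip. *)
Lemma thick_box (T s e n : R) : 0 < s -> e < T -> exists (N : nat) (B : set E),
  [/\ compact B, B `<=` oQT T & forall z y, cbox (s, const_mx (- n)) (e, const_mx n) z ->
     `|z - y| <= en N -> B y].
Proof.
move=> s0 eT.
have [N hN] := truncn_gt_norm (R := R) (Num.min s (T - e))^-1.
have m0 : 0 < Num.min s (T - e) by rewrite lt_min s0 subr_gt0.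
have eN : en N < Num.min s (T - e).
  by rewrite /en invf_plt ?posrE ?ltr0n// (lt_le_trans hN)// ler_nat.
move: eN; rewrite lt_min => /andP[e1 e2].
exists N, (cbox (s - en N, const_mx (- (n + 1))) (e + en N, const_mx (n + 1))); split.
- exact: compact_cbox.
- by move=> z [/andP[/= h1 h2] _]; apply/oQTP; apply/andP; split; lra.
- move=> z y [/andP[/= h1 h2] h3] zy.
  have n1 := le_trans (E_norm1 (z - y)) zy.
  have n2 := le_trans (E_norm2 (z - y)) zy.
  move: n1; rewrite /= ler_norml => /andP[a1 a2].
  split => /=; first by apply/andP; split; lra.
  move=> i; have := h3 i; rewrite !mxE => /andP[b1 b2].
  have := le_trans (rV_coord_le (z - y).2 i) n2; rewrite !mxE ler_norml => /andP[c1 c2].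
  by have := en_le1 N (R := R) => e3; apply/andP; split; lra.
Qed.

Variables (T alpha : R).
Hypothesis T_gt0 : 0 < T.
Local Notation r := (@varrho R d alpha).
Local Notation b := (- (alpha * 2)).

Lemma rho_gt0 x : 0 < r x.
Proof. by have := varrhoE alpha ((0, x) : E) => /= ->; exact: pw_gt0. Qed.

Lemma rho_cts : continuous (fun z : E => r z.2).
Proof.
rewrite (_ : (fun z : E => r z.2) = pw (- alpha)); first exact: smooth_cts (pw_smooth _).
by apply/funext => z; rewrite varrhoE.
Qed.

Lemma rho_L2 (p : E -> R) : L2rho_QT T r p ->
  measurable_fun (QT T) p /\ L2loc_QT T p.
Proof.
move=> Lp; have [mp _] := Lp.
have pE : p = (fun z => pw alpha z * (p z * r z.2)).
  apply/funext => z; rewrite varrhoE mulrCA /pw -powRD ?subrr ?powRr0 ?mulr1//.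
  by apply/implyP => _; rewrite gt_eqF// sE_gt0.
have cpw := smooth_cts (pw_smooth alpha : smooth (pw alpha : E -> R)).
split.
  by rewrite pE; apply: measurable_funM => //; exact: measurable_funTS (cts_measurable_E cpw).
move=> K cK KQ; have mK := compact_measurable_E cK.
have [C C0 hC] := compact_cts_bounded cK (continuous_subspaceT cpw).
apply: L2_trV => //.
have -> : tr K p = (fun z => tr K (pw alpha) z * tr K (fun z => p z * r z.2) z).
  apply/funext => z; have [Kz|nK] := pselect (K z); last by rewrite !tr_out// mul0r.
  by rewrite !trE// {1}pE.
apply: (L2M (C := C)).
- by apply: L2_tr => //; exact: L2_sub mK (measurable_QT T) KQ Lp.
- by apply: measurable_tr => //; exact: measurable_funTS (cts_measurable_E cpw).
- move=> z; have [Kz|nK] := pselect (K z); last by rewrite tr_out// normr0.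
  by rewrite trE//; exact: hC.
Qed.

Lemma rho_int1 (p p' g : E -> R) C : L2rho_QT T r p -> L2rho_QT T r p' ->
  measurable_fun setT g -> (forall z, `|g z| <= C) ->
  int1 (tr (QT T) (fun z => g z * (p z * r z.2 * (p' z * r z.2)))).
Proof.
move=> Lp Lp' mg gC; have mQT := measurable_QT (d := d) T.
have := int1_bounded (mul_integrable (L2_tr mQT Lp) (L2_tr mQT Lp')) mg gC.
congr (_.-integrable _ (_ \o _)); apply/funext => z.
have [Qz|nQ] := pselect (QT T z); first by rewrite !trE.
by rewrite !tr_out// !mul0r mulr0.
Qed.

Lemma L2rhoB (p p' : E -> R) : L2rho_QT T r p -> L2rho_QT T r p' ->
  L2rho_QT T r (fun z => p z - p' z).
Proof.
move=> Lp Lp'; have mQT := measurable_QT (d := d) T; apply: L2_trV => //.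
have -> : tr (QT T) (fun z => (p z - p' z) * r z.2) =
    (fun z => tr (QT T) (fun z => p z * r z.2) z - tr (QT T) (fun z => p' z * r z.2) z).
  by apply/funext => z; rewrite /tr !mulrBl.
by apply: L2B; exact: L2_tr.
Qed.

Lemma W01_facts (v : E -> R) : W01 T r v ->
  [/\ measurable_fun (QT T) v, L2loc_QT T v, loc1 T v &
    forall i, [/\ is_wderiv T (dirx i) v (wderiv T (dirx i) v),
       L2rho_QT T r (wderiv T (dirx i) v) & L2loc_QT T (wderiv T (dirx i) v)]].
Proof.
move=> [Lv gv]; have [mv lv] := rho_L2 Lv.
split => //; first exact: loc1_L2.
move=> i; have [hw Lw] := gv i; split => //; first exact: wderivP.
by have [_] := rho_L2 Lw.
Qed.

Lemma W01B (v u : E -> R) : W01 T r v -> W01 T r u ->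
  let w := fun z => v z - u z in
  [/\ L2rho_QT T r w, L2loc_QT T w, loc1 T w &
   forall i, let dw := fun z => wderiv T (dirx i) v z - wderiv T (dirx i) u z in
     [/\ is_wderiv T (dirx i) w dw, L2rho_QT T r dw & L2loc_QT T dw]].
Proof.
move=> Wv Wu w; have [mv lv lv1 gv] := W01_facts Wv; have [mu' lu lu1 gu] := W01_facts Wu.
have Lw : L2rho_QT T r w by apply: L2rhoB; [case: Wv|case: Wu].
have [mw lw] := rho_L2 Lw.
split => //; first exact: loc1_L2.
move=> i dw; have [d1 L1 _] := gv i; have [d2 L2' _] := gu i.
have Ldw : L2rho_QT T r dw by exact: L2rhoB.
split => //; last by have [_] := rho_L2 Ldw.
have := wderivD (-1) lu1 lv1 d2 d1.
congr (is_wderiv _ _ _ _); apply/funext => z; by rewrite mulN1r addrC.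
Qed.

Variables (ob u F : E -> R) (P : E -> 'rV[R]_d) (mu : {measure set E -> \bar R}).
Hypothesis Wu : W01 T r u.
Hypothesis cu : {within oQT T, continuous u}.
Hypothesis ch : {within QT T, continuous ob}.
Hypothesis mh : measurable_fun (QT T) ob.
Hypothesis uh : forall z, QT T z -> ob z <= u z.
Hypothesis radon_mu : radon T mu.
Hypothesis mu_min : forall xi, C0_plus T xi ->
    (\int[mu]_(z in QT T) ((u z - ob z) * xi z)%:E = 0)%E.
Hypothesis LP : forall i, L2rho_QT T r (fun z => P z 0 i).
Hypothesis mF : measurable_fun (QT T) F.
Hypothesis LF : L2loc_QT T F.
Hypothesis EQ : tested_equation T u F P mu.

(** [core_ineq] with the compact set of [thick_box], on which all data are square
    integrable. *)
Lemma cutoff_ineq (s e n : R) (zeta v : E -> R) (tau : R) : 0 < s -> e < T ->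
  smooth zeta -> (forall z, 0 <= zeta z) ->
  (forall z, ~ cbox (s, const_mx (- n)) (e, const_mx n) z -> zeta z = 0) ->
  W01 T r v -> above_obstacle T ob v ->
  (forall B N, compact B -> B `<=` oQT T ->
    (forall z y, cbox (s, const_mx (- n)) (e, const_mx n) z -> `|z - y| <= en N -> B y) ->
    \int[mQ]_z (tr B u z * 'D_dirt (mol B zeta (fun z => v z - u z) (m + N)) z) @[m --> \oo] --> tau) ->
  0 <= tau + 2^-1 * (\sum_i \int[mQ]_z (P z 0 i * ('D_(dirx i) zeta z * (v z - u z) +
         zeta z * (wderiv T (dirx i) v z - wderiv T (dirx i) u z))))
    - \int[mQ]_z (F z * (zeta z * (v z - u z))).
Proof.
move=> s0 eT sz z0 zoff Wv vh lim.
have [N [B [cB BQ thick]]] := thick_box n s0 eT.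
have BQT : B `<=` QT T by move=> z /BQ/oQT_QT.
have [Lw lw lw1 gw] := W01B Wv Wu; have [mu' lu _ _] := W01_facts Wu.
have cB0 : compact (cbox (s, const_mx (- n)) (e, const_mx n) : set E) by exact: compact_cbox.
have cF0 : {within oQT T, continuous (fun z => ob z - u z)}.
  move=> z; apply: (@continuousB _ R (subspace (oQT T)) ob u z); last exact: cu.
  exact: (continuous_subspaceW (@oQT_QT _ _ T) ch).
have mF0 : measurable_fun (QT T) (fun z => ob z - u z) by exact: measurable_funB.
apply: (core_ineq cB0 cB BQ thick sz zoff z0 mF0 cF0 _ vh uh _ mu_min (P := P) (F := F)) => //.
- exact: lw.
- exact: radon_mu.
- by move=> eta; exact: EQ.
- by move=> i; have [_] := rho_L2 (LP i); apply.
- exact: LF.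
- by move=> i; have [] := gw i.
- by move=> i; have [_ _] := gw i; apply.
- exact: lim.
Qed.

(** ** Time cutoffs *)

Definition tc (p1 q1 p2 q2 : R) (z : E) : R := gz 0 (p1 * z.1 + q1) * gz 0 (p2 * z.1 + q2).

Lemma fst_smooth : smooth (fun z : E => z.1).
Proof. by apply/sm_is_smooth/sm_lin; [exact: E_fst_cts|move=> c x v; exact: E_fst_lin]. Qed.

Lemma affine_smooth p q : smooth (fun z : E => p * z.1 + q).
Proof. exact: smooth_add (smooth_mul (smooth_cst p) fst_smooth) (smooth_cst q). Qed.

Lemma tc_smooth p1 q1 p2 q2 : smooth (tc p1 q1 p2 q2).
Proof. by apply: smooth_mul; apply: smooth_gz; exact: affine_smooth. Qed.

Lemma tc_is_derive p1 q1 p2 q2 z v : is_derive z v (tc p1 q1 p2 q2)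
  ((p1 * gz 2 (p1 * z.1 + q1) * gz 0 (p2 * z.1 + q2)
    + p2 * gz 0 (p1 * z.1 + q1) * gz 2 (p2 * z.1 + q2)) * v.1).
Proof.
have h (p q : R) : is_derive z v (fun z : E => gz 0 (p * z.1 + q)) (gz 2 (p * z.1 + q) * (p * v.1)).
  have := is_derive_chain (is_derive_affine p q z v E_fst_lin) (is_derive_gz 0 (p * z.1 + q)).
  by rewrite mul0r subr0.
have := is_deriveM (h p1 q1) (h p2 q2).
by move=> H; apply: is_derive_eq H _; rewrite /GRing.scale /=; ring.
Qed.

Lemma tc_ge0 p1 q1 p2 q2 z : 0 <= tc p1 q1 p2 q2 z.
Proof. by rewrite mulr_ge0 ?gz_ge0. Qed.

Lemma tc_le1 p1 q1 p2 q2 z : tc p1 q1 p2 q2 z <= 1.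
Proof. by rewrite -[leRHS]mulr1 ler_pM ?gz_ge0 ?gz0_le1. Qed.

Lemma tc_Dx p1 q1 p2 q2 z i : 'D_(dirx i) (tc p1 q1 p2 q2) z = 0.
Proof. by have [_ ->] := tc_is_derive p1 q1 p2 q2 z (dirx i); rewrite mulr0. Qed.

(** Cutoffs exhausting the open interval: the first factor is supported in [t > 1
    / (k + 1)], the second in [t < T - 1 / (k + 1)]. *)
Definition th (k : nat) : E -> R := tc k.+1%:R (-1) (- k.+1%:R) (k.+1%:R * T - 1).

Lemma th_Dt k z : 'D_dirt (th k) z = ker (-1) 0 k z.1 * gz 0 (- k.+1%:R * z.1 + (k.+1%:R * T - 1))
  - gz 0 (k.+1%:R * z.1 + -1) * ker 1 T k z.1.
Proof.
have [_ ->] := tc_is_derive k.+1%:R (-1) (- k.+1%:R) (k.+1%:R * T - 1) z dirt.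
rewrite /ker /= mulr1.
have -> : k.+1%:R * (-1 * (0 - z.1)) - 1 = k.+1%:R * z.1 + -1 by ring.
have -> : k.+1%:R * (1 * (T - z.1)) - 1 = - k.+1%:R * z.1 + (k.+1%:R * T - 1) by ring.
ring.
Qed.

Lemma th_out k z : ~~ (en k < z.1 < T - en k) -> th k z = 0.
Proof.
have k0 : 0 < k.+1%:R :> R by rewrite ltr0n.
rewrite negb_and -!leNgt => /orP[h|h].
  rewrite /th /tc (gz_neg _ (t := _ + -1)) ?mul0r//.
  rewrite subr_le0; move: h; rewrite /en => /(ler_wpM2l (ltW k0)).
  by rewrite divff// gt_eqF.
rewrite /th /tc (gz_neg _ (t := _ + (_ - 1))) ?mulr0//.
move: h; rewrite /en => /(ler_wpM2l (ltW k0)); rewrite mulrBr divff ?gt_eqF//.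
by lra.
Qed.

Lemma th_off k z : ~ oQT T z -> th k z = 0.
Proof.
move=> nz; apply: th_out; apply/negP => /andP[h1 h2]; apply: nz; apply/oQTP.
by have := en_gt0 k (R := R); move: h1 h2; lra.
Qed.

Lemma th_cvg z : oQT T z -> th n z @[n --> \oo] --> (1 : R).
Proof.
move=> /oQTP/andP[z0 zT]; rewrite /th /tc -[X in _ --> X]mulr1; apply: cvgM.
  exact: gz0_cvgy.
have -> : (fun n : nat => gz 0 (- n.+1%:R * z.1 + (n.+1%:R * T - 1))) =
    (fun n : nat => gz 0 (n.+1%:R * (T - z.1) - 1)).
  by apply/funext => n; congr (gz _ _); ring.
by apply: gz0_cvgy; rewrite subr_gt0.
Qed.

Lemma th_lim G : int1 G -> (forall z, ~ QT T z -> G z = 0) ->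
  \int[mQ]_z (th n z * G z) @[n --> \oo] --> \int[mQ]_z G z.
Proof.
move=> iG G0; have mG := int1_measurable iG.
have ptw : {ae mQ, forall z, th n z * G z @[n --> \oo] --> G z}.
  apply: filterS (@QT_oQT_ae R d T) => z hz.
  have [Qz|nQ] := pselect (QT T z).
    by rewrite -[X in _ --> X]mul1r; apply: cvgM; [exact: th_cvg (hz Qz)|exact: cvg_cst].
  by rewrite G0//; under eq_fun do rewrite mulr0; exact: cvg_cst.
apply: (Rint_dominated _ mG (int1_norm iG) _ ptw).2.
- move=> n; apply: measurable_funM => //; apply: cts_measurable_E.
  by apply: smooth_cts; exact: tc_smooth.
- move=> n z; rewrite normrM ler_piMl// ger0_norm ?tc_ge0//; exact: tc_le1.
Qed.

Lemma cw_rho n z : cw n b z = chi n z * (r z.2 * r z.2).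
Proof. by rewrite -expr2 varrho_sqr. Qed.

Definition zeta (k n : nat) (z : E) : R := th k z * cw n b z.

Lemma zeta_smooth k n : smooth (zeta k n).
Proof. exact: smooth_mul (tc_smooth _ _ _ _) (cw_smooth n b). Qed.

Lemma zeta_ge0 k n z : 0 <= zeta k n z.
Proof. by rewrite mulr_ge0 ?tc_ge0 ?cw_ge0. Qed.

Lemma xsupp_cbox (s e n : R) (th c : E -> R) : (forall z, ~~ (s < z.1 < e) -> th z = 0) ->
  xsupp n c -> forall z, ~ cbox (s, const_mx (- n)) (e, const_mx n) z -> th z * c z = 0.
Proof.
move=> th0 c0 z nz; have [zt|zt] := boolP (s < z.1 < e); last by rewrite th0// mul0r.
rewrite c0 ?mulr0// ltNge; apply/negP => zn; apply: nz; split => /=.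
  by case/andP: zt => h1 h2; rewrite !ltW.
by move=> i; rewrite !mxE -ler_norml (le_trans (rV_coord_le _ _)).
Qed.

Lemma cw_xsupp n c : xsupp n.+1%:R (cw n c : E -> R).
Proof. by move=> z /chi_xsupp h; rewrite /cw h mul0r. Qed.

Lemma zeta_off k n z : ~ cbox (en k, const_mx (- n.+1%:R)) (T - en k, const_mx n.+1%:R) z ->
  zeta k n z = 0.
Proof. by apply: xsupp_cbox; [exact: th_out|exact: cw_xsupp]. Qed.

Lemma zeta_Dx k n z i : 'D_(dirx i) (zeta k n) z = th k z * 'D_(dirx i) (cw n b) z.
Proof.
rewrite /zeta derive_mul; [|exact: tc_smooth|exact: cw_smooth].
by rewrite tc_Dx mulr0 addr0.
Qed.

Lemma zeta_Dt k n z : 'D_dirt (zeta k n) z = cw n b z * 'D_dirt (th k) z.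
Proof.
rewrite /zeta derive_mul; [|exact: tc_smooth|exact: cw_smooth].
by rewrite cw_Dt mulr0 add0r.
Qed.

Lemma th_tr k (p : E -> R) : (fun z => th k z * p z) = (fun z => th k z * tr (QT T) p z).
Proof.
apply/funext => z; have [Qz|nQ] := pselect (QT T z); first by rewrite trE.
by rewrite (@th_off k z) ?mul0r// => /oQT_QT.
Qed.

Section data.
Variable v : E -> R.
Hypothesis Wv : W01 T r v.
Let w := fun z => v z - u z.
Let dw i := fun z => wderiv T (dirx i) v z - wderiv T (dirx i) u z.

(** The integrands of the terms with [a grad u], with [f_u] and with the time
    derivative of the cutoff, for the space cutoff [cw n b]. *)
Definition G2 n i := tr (QT T) (fun z => P z 0 i * ('D_(dirx i) (cw n b) z * w z + cw n b z * dw i z)).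
Definition G3 n := tr (QT T) (fun z => cw n b z * (F z * w z)).
Definition G0 n := tr (QT T) (fun z => cw n b z * w z ^+ 2).

Lemma tr_ext (p q : E -> R) : (forall z, QT T z -> p z = q z) -> tr (QT T) p = tr (QT T) q.
Proof.
move=> pq; apply/funext => z; have [Qz|nQ] := pselect (QT T z); first by rewrite !trE// pq.
by rewrite !tr_out.
Qed.

Lemma trD (p q : E -> R) : tr (QT T) (fun z => p z + q z) = (fun z => tr (QT T) p z + tr (QT T) q z).
Proof. by apply/funext => z; rewrite /tr mulrDl. Qed.

Lemma chi_norm n (z : E) : `|chi n z| <= 1.
Proof. by rewrite ger0_norm ?chi_ge0// chi_le1. Qed.

Lemma measurable_chi n : measurable_fun setT (chi n : E -> R).
Proof. by apply: cts_measurable_E; apply: smooth_cts; exact: chi_smooth. Qed.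

Let gr (n : nat) (i : 'I_d) (z : E) := 'D_(dirx i) (cw n b) z * pw (- b) z.

Lemma pwV (z : E) : pw (- b) z * pw b z = 1.
Proof.
rewrite /pw -powRD ?addNr ?powRr0//; apply/implyP => _; by rewrite gt_eqF// sE_gt0.
Qed.

Lemma gr_le n i z : `|gr n i z| <= `|b| + 3.
Proof.
rewrite /gr normrM (ger0_norm (ltW (pw_gt0 _ _))).
apply: le_trans (ler_wpM2r (ltW (pw_gt0 _ _)) (cw_Dx_le n b z i)) _.
by rewrite -mulrA [pw b z * _]mulrC pwV mulr1.
Qed.

Lemma measurable_gr n i : measurable_fun setT (gr n i).
Proof.
apply: cts_measurable_E => z; apply: cvgM.
  exact: smooth_cts (smoothD (dirx i) (cw_smooth n b)) _.
exact: smooth_cts (pw_smooth _) _.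
Qed.

Lemma G2E n i : G2 n i = (fun z =>
  tr (QT T) (fun z => gr n i z * (P z 0 i * r z.2 * (w z * r z.2))) z +
  tr (QT T) (fun z => chi n z * (P z 0 i * r z.2 * (dw i z * r z.2))) z).
Proof.
rewrite -trD; apply: tr_ext => z _; rewrite cw_rho mulrDr; congr (_ + _); last ring.
rewrite /gr; have : pw (- b) z * (r z.2 * r z.2) = 1 by rewrite -expr2 varrho_sqr pwV.
move: (pw _ _) (r z.2) => x y xy; have -> : 'D_(dirx i) (cw n b) z * x * (P z 0 i * y * (w z * y)) =
  'D_(dirx i) (cw n b) z * (P z 0 i * w z) * (x * (y * y)) by ring.
by rewrite xy; ring.
Qed.

Lemma G2_int1 n i : int1 (G2 n i).
Proof.
have [Lw _ _ gw] := W01B Wv Wu; have [_ Ldw _] := gw i.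
rewrite G2E; apply: int1D.
  exact: rho_int1 (LP i) Lw (measurable_gr n i) (@gr_le n i).
exact: rho_int1 (LP i) Ldw (measurable_chi n) (@chi_norm n).
Qed.

Lemma G0_int1 n : int1 (G0 n).
Proof.
have [Lw _ _ _] := W01B Wv Wu.
have := rho_int1 Lw Lw (measurable_chi n) (@chi_norm n).
congr (_.-integrable _ (_ \o _)); apply: tr_ext => z _; rewrite cw_rho.
by rewrite /w; ring.
Qed.

Lemma alpha_bd (z : E) n : 0 <= alpha -> cw n b z <= 1.
Proof.
move=> a0; rewrite -[leRHS]mulr1; apply: ler_pM; rewrite ?chi_ge0 ?chi_le1 ?(ltW (pw_gt0 _ _))//.
rewrite /pw -[leRHS](powRr0 (sE z)); apply: ler_powR; first exact: sE_ge1.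
by rewrite oppr_le0 mulr_ge0.
Qed.

Lemma G3_int1 n : 0 <= alpha -> int1 (G3 n).
Proof.
move=> a0; have [_ lw _ _] := W01B Wv Wu.
pose K := cbox (0, const_mx (- n.+1%:R)) (T, const_mx n.+1%:R) : set E.
have cK : compact K by exact: compact_cbox.
have mK := compact_measurable_E cK.
have KQ : K `<=` QT T by move=> z [h1 _]; apply/QTP.
have LFK := L2_tr mK (LF cK KQ); have LwK := L2_tr mK (lw _ cK KQ).
have mc : measurable_fun setT (cw n b : E -> R).
  by apply: cts_measurable_E; apply: smooth_cts; exact: cw_smooth.
have cC (z : E) : `|cw n b z| <= 1 by rewrite ger0_norm ?cw_ge0// alpha_bd.
have := int1_bounded (mul_integrable LFK LwK) mc cC.
congr (_.-integrable _ (_ \o _)); apply/funext => z; rewrite /G3.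
have [Kz|nK] := pselect (K z); first by rewrite !trE//; exact: KQ.
rewrite [tr K F z]tr_out// mul0r mulr0; have [Qz|nQ] := pselect (QT T z); last by rewrite tr_out.
rewrite trE// cw_xsupp ?mul0r// ltNge; apply/negP => zn; apply: nK; split; first by move/QTP: Qz.
by move=> i; rewrite !mxE -ler_norml (le_trans (rV_coord_le _ _)).
Qed.

(** [cutoff_ineq] for [th k * cw n b], where only the limit [tau] of the term with
    the time derivative is left open: it is treated differently for weak and for
    strong solutions. *)
Lemma zeta_ineq k n tau : 0 <= alpha -> above_obstacle T ob v ->
  (forall B N, compact B -> B `<=` oQT T ->
    (forall z y, cbox (en k, const_mx (- n.+1%:R)) (T - en k, const_mx n.+1%:R) z ->
        `|z - y| <= en N -> B y) ->
    \int[mQ]_z (tr B u z * 'D_dirt (mol B (zeta k n) w (m + N)) z) @[m --> \oo] --> tau) ->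
  0 <= tau + 2^-1 * (\sum_i \int[mQ]_z (th k z * G2 n i z)) - \int[mQ]_z (th k z * G3 n z).
Proof.
move=> a0 vh lim; have ek := en_gt0 k (R := R).
have eT : T - en k < T by rewrite ltrBlDr ltrDl.
have := cutoff_ineq ek eT (zeta_smooth k n) (zeta_ge0 k n) (@zeta_off k n) Wv vh lim.
congr (is_true (0 <= _ + _ * _ - _)).
  apply: eq_bigr => i _; rewrite /G2 -th_tr; apply: eq_Rintegral => z _.
  by rewrite zeta_Dx /zeta /w /dw; ring.
by rewrite /G3 -th_tr; apply: eq_Rintegral => z _; rewrite /zeta /w; ring.
Qed.

(** The product rule turns the pairing with [w * rho^2] into the limiting
    integrand; [cw n b] and its gradient are bounded by multiples of [rho^2],
    which makes dominated convergence apply. *)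
Lemma G2_lim i : \int[mQ]_z G2 n i z @[n --> \oo] -->
  \int[mQ]_(z in QT T) (P z 0 i * wderiv T (dirx i) (fun z => w z * r z.2 ^+ 2) z) /\
  int1 (tr (QT T) (fun z => P z 0 i * wderiv T (dirx i) (fun z => w z * r z.2 ^+ 2) z)).
Proof.
have [Lw lw l1w gw] := W01B Wv Wu; have [dwP Ldw _] := gw i.
have one z : `|cst (1 : R) (z : E)| <= 1 by rewrite normr1.
have i1 := rho_int1 (LP i) Lw (measurable_cst (1 : R)) one.
have i2 := rho_int1 (LP i) Ldw (measurable_cst (1 : R)) one.
pose D1 := tr (QT T) (fun z => cst 1 z * (P z 0 i * r z.2 * (w z * r z.2))).
pose D2 := tr (QT T) (fun z => cst 1 z * (P z 0 i * r z.2 * (dw i z * r z.2))).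
pose Y z := (`|b| + 3) * `|D1 z| + `|D2 z|.
have iY : int1 Y by apply: int1D; [apply: int1Z; exact: int1_norm|exact: int1_norm].
pose H := tr (QT T) (fun z => P z 0 i * ('D_(dirx i) (pw b) z * w z + pw b z * dw i z)).
have mP : measurable_fun (QT T) (fun z => P z 0 i) by case: (rho_L2 (LP i)).
have mw : measurable_fun (QT T) w by case: (rho_L2 Lw).
have mdw : measurable_fun (QT T) (dw i) by case: (rho_L2 Ldw).
have mD : measurable_fun (QT T) ('D_(dirx i) (pw b : E -> R)).
  by apply: measurable_funTS; apply: cts_measurable_E; apply: smooth_cts; apply: smoothD; exact: pw_smooth.
have mpw : measurable_fun (QT T) (pw b : E -> R).
  by apply: measurable_funTS; apply: cts_measurable_E; apply: smooth_cts; exact: pw_smooth.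
have mH : measurable_fun setT H.
  apply: measurable_tr; first exact: measurable_QT.
  by apply: measurable_funM => //; apply: measurable_funD; apply: measurable_funM.
have bound n z : `|G2 n i z| <= Y z.
  rewrite G2E /Y (le_trans (ler_normD _ _))//; apply: lerD.
    have -> : tr (QT T) (fun z => gr n i z * (P z 0 i * r z.2 * (w z * r z.2))) z = gr n i z * D1 z.
      by rewrite /D1 /tr /=; ring.
    by rewrite normrM ler_wpM2r// gr_le.
  have -> : tr (QT T) (fun z => chi n z * (P z 0 i * r z.2 * (dw i z * r z.2))) z = chi n z * D2 z.
    by rewrite /D2 /tr /=; ring.
  by rewrite normrM ler_piMl// chi_norm.
have ptw : {ae mQ, forall z, G2 n i z @[n --> \oo] --> H z}.
  apply: nearW => z; rewrite /G2 /H /tr; apply: cvgM; last exact: cvg_cst.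
  apply: cvgM; first exact: cvg_cst.
  by apply: cvgD; apply: cvgM; [exact: cw_Dx_cvg|exact: cvg_cst|exact: cw_cvg|exact: cvg_cst].
have [iH cH] := Rint_dominated (fun n => int1_measurable (G2_int1 n i)) mH iY bound ptw.
have wE : {ae mQ, forall z, QT T z ->
    P z 0 i * ('D_(dirx i) (pw b) z * w z + pw b z * dw i z) =
    P z 0 i * wderiv T (dirx i) (fun z => w z * r z.2 ^+ 2) z}.
  have qE : (fun z => w z * r z.2 ^+ 2) = (fun z => w z * pw b z).
    by apply/funext => z; rewrite varrho_sqr.
  have dM := wderivM l1w dwP (pw_smooth b).
  have hw := wderivP (ex_intro _ _ dM : has_wderiv T (dirx i) (fun z => w z * pw b z)).
  apply: QT_ae => //; apply: filterS (wderiv_unique dM hw) => z hz oz.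
  by rewrite qE -hz// /w /dw; ring.
split.
  rewrite (_ : \int[mQ]_(z in QT T) _ = \int[mQ]_z H z)//.
  by rewrite /H -Rint_tr; apply: Rintegral_ae_ext; apply: filterS wE => z hz Qz; rewrite hz.
have [mg _ _] : is_wderiv T (dirx i) (fun z => w z * r z.2 ^+ 2)
    (wderiv T (dirx i) (fun z => w z * r z.2 ^+ 2)).
  apply: wderivP; exists (fun z => dw i z * pw b z + w z * 'D_(dirx i) (pw b) z).
  have := wderivM l1w dwP (pw_smooth b); congr (is_wderiv _ _ _ _).
  by apply/funext => z; rewrite varrho_sqr.
have mR : measurable_fun setT (tr (QT T) (fun z => P z 0 i * wderiv T (dirx i) (fun z => w z * r z.2 ^+ 2) z)).
  by apply: measurable_tr; [exact: measurable_QT|apply: measurable_funM].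
apply/integrableP; split; first exact/measurable_EFinP.
have /integrableP[_] := iH; apply: le_lt_trans; rewrite le_eqVlt; apply/orP; left; apply/eqP.
apply: integral_ae_ext; apply: filterS wE => z hz _; apply: (congr1 abse); apply: (congr1 EFin).
by rewrite /H /tr; have [Qz|nQ] := pselect (QT T z); [rewrite hz|rewrite indicE memNset// !mulr0].
Qed.

End data.

End variational.

(** * Weak solutions *)

Lemma lim_ge0 (R : realType) (x : nat -> R) (l : R) : x @ \oo --> l -> (forall k, 0 <= x k) -> 0 <= l.
Proof.
by move=> cx x0; apply: (ler_cvg_to (cvg_cst (0 : R)) cx); exact: nearW.
Qed.

Section weak_solution.
Context {R : realType} {d : nat}.
Local Notation E := (R * 'rV[R]_d)%type.
Local Notation mQ := (@lebQ R d).
Local Notation int1 f := (mQ.-integrable setT (EFin \o f)).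
Local Notation m1 := (@leb1 R).
Variables (T alpha : R).
Hypothesis T_gt0 : 0 < T.
Hypothesis alpha_ge0 : 0 <= alpha.
Local Notation r := (@varrho R d alpha).

Lemma rho_le1 x : r x <= 1.
Proof.
have := varrhoE alpha ((0, x) : E) => /= ->.
by rewrite /pw -[leRHS](powRr0 (sE ((0, x) : E))); apply: ler_powR; rewrite ?sE_ge1// oppr_le0.
Qed.

Lemma measurable_rho : measurable_fun setT r.
Proof.
apply: cts_measurable_rV => x.
apply: (@continuous_comp _ _ _ (fun x => (0, x) : E) (fun z : E => r z.2) x).
  exact: pair_cts.
exact: rho_cts.
Qed.

Lemma int_trE (m : {measure set E -> \bar R}) (D : set E) (p : E -> R) :
  (\int[m]_(z in D) (p z)%:E = \int[m]_z (tr D p z)%:E)%E.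
Proof.
rewrite integral_mkcond; apply: eq_integral => z _.
by rewrite patchE /tr indicE; case: (z \in D); rewrite ?mulr1 ?mulr0.
Qed.

Definition Kball (n : nat) : set 'rV[R]_d := [set x | `|x| <= n.+1%:R].

Lemma measurable_Kball n : measurable (Kball n).
Proof. by apply: compact_measurable_rV; exact: rV_balls_compact. Qed.

Lemma indic_bd (X : Type) (D : set X) x : `|\1_D x : R| <= 1.
Proof. by rewrite indicE; case: (x \in D); rewrite ?normr1 ?normr0. Qed.

(** Continuity in time holds locally for [u] and with the full weight for [v];
    cutting the weight to a ball makes it available for both. *)
Definition rK n (x : 'rV[R]_d) : R := r x * \1_(Kball n) x.

Lemma Lcont_rho n (g : R -> 'rV[R]_d -> R) : L2continuous T setT r g -> Lcont T (rK n) g.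
Proof.
move=> /L2continuous_Lcont Lg.
have mI : measurable_fun setT (\1_(Kball n) : 'rV[R]_d -> R).
  by apply: measurable_indic; exact: measurable_Kball.
have := Lcont_mul mI (indic_bd (Kball n)) Lg.
by congr (Lcont _ _ _); apply/funext => x; rewrite /rK mulrC.
Qed.

Lemma Lcont_loc n (g : R -> 'rV[R]_d -> R) : (forall K, compact K -> L2continuous T K (cst 1) g) ->
  Lcont T (rK n) g.
Proof.
move=> Lg; apply: (@Lcont_mul _ _ T 1 r); first exact: measurable_rho.
  by move=> x; rewrite ger0_norm ?rho_le1// ltW// rho_gt0.
apply: L2continuous_indic; first exact: measurable_Kball.
by apply: Lg; exact: rV_balls_compact.
Qed.

Variables (g : E -> R) (gb : R -> 'rV[R]_d -> R).
Hypothesis gs : {ae m1, forall t, t \in `[0, T] -> {ae leb d, forall x, g (t, x) = gb t x}}.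

Definition Wb (p : 'rV[R]_d -> R) n t : R := \int[leb d]_x (p x * (gb t x * rK n x) ^+ 2).

(** By Fubini this is [ker_approx] for the integrals over the slices, which agree
    for almost every time with a function that is continuous in time. *)
Lemma ker_slices (A : R -> R) (p : E -> R) (c : 'rV[R]_d -> R) n (s t0 : R) :
  continuous A -> (forall t, `|A t| <= 1) -> s * s = 1 -> t0 \in `[0, T] ->
  0 < s * t0 + (1 - s) / 2 * T -> Lcont T (rK n) gb ->
  measurable_fun setT c -> (forall x, `|c x| <= 1) -> (forall x, ~ Kball n x -> c x = 0) ->
  (forall z, p z = c z.2 * (r z.2 * r z.2)) ->
  int1 (tr (QT T) (fun z => p z * g z ^+ 2)) ->
  \int[mQ]_z (ker s t0 k z.1 * (A z.1 * tr (QT T) (fun z => p z * g z ^+ 2) z)) @[k --> \oo] -->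
    A t0 * Wb c n t0.
Proof.
move=> cA A1 ss t0T st Lg mc c1 c0 pE iG; set G := tr _ _.
have mA : measurable_fun setT A by exact: continuous_measurable_fun.
have iAG : int1 (fun z => A z.1 * G z).
  by apply: (int1_bounded iG (measurableT_comp mA measurable_fst)) => z; exact: A1.
have [G1 _ _] := Fubini_R iG; have [_ G2 _] := Fubini_R iAG.
pose W t := \int[leb d]_x (A t * G (t, x)).
have GW : {ae m1, forall t, \int[leb d]_x (A t * G (t, x)) = A t * \int[leb d]_x G (t, x)}.
  by apply: filterS G1 => t it; rewrite (RintZ _ it).
have mI : measurable (`[0, T]%classic : set R) by exact: measurable_itv.
have WE : {ae m1, forall t, t \in `[0, T] -> W t = A t * Wb c n t}.
  apply: filterS2 gs GW => t ht gt tT; rewrite /W gt; congr (_ * _).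
  apply: Rintegral_ae_ext; apply: filterS (ht tT) => x hx _; rewrite /G trE; last by split.
  rewrite pE /= hx /rK indicE; have [Kx|nK] := pselect (Kball n x).
    by rewrite mem_set// mulr1; ring.
  by rewrite c0// !mul0r.
have iW : m1.-integrable `[0, T]%classic (EFin \o W).
  exact: integrableS measurableT mI _ G2.
have cW eps : 0 < eps -> exists2 del, 0 < del & forall t, t \in `[0, T] ->
     `|t - t0| < del -> `|A t * Wb c n t - A t0 * Wb c n t0| <= eps.
  move=> e0; have [d1 d10 h1] := Lcont_quad mc c1 Lg t0T (divr_gt0 e0 (ltr0n _ 2)).
  have K0 : 0 < 2 * (`|Wb c n t0| + 1) by rewrite mulr_gt0// ltr_wpDl.
  have /cvgrPdist_lt /(_ _ (divr_gt0 e0 K0)) /nbhs_ballP[d2 /= d20 h2] := cA t0.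
  exists (Num.min d1 d2); first by rewrite lt_min d10.
  move=> t tT; rewrite lt_min => /andP[t1 t2].
  have -> : A t * Wb c n t - A t0 * Wb c n t0 = A t * (Wb c n t - Wb c n t0) + (A t - A t0) * Wb c n t0 by ring.
  apply: le_trans (ler_normD _ _) _; rewrite [leRHS]splitr !normrM; apply: lerD.
    by rewrite -[leRHS]mul1r; apply: ler_pM => //; exact: h1.
  have : `|A t0 - A t| < eps / (2 * (`|Wb c n t0| + 1)) by apply: h2; rewrite /ball /= distrC.
  rewrite distrC => /ltW h; apply: le_trans (ler_wpM2r (normr_ge0 _) h) _.
  have -> : eps / (2 * (`|Wb c n t0| + 1)) * `|Wb c n t0| = eps / 2 * (`|Wb c n t0| / (`|Wb c n t0| + 1)).
    by field; rewrite gt_eqF// ltr_wpDl.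
  by rewrite ler_piMr ?divr_ge0 ?(ltW e0)// ler_pdivrMr ?mul1r ?lerDl// ltr_wpDl.
have := ker_approx T_gt0 ss t0T st iW WE cW.
apply: cvg_trans; apply: near_eq_cvg; apply: nearW => k.
have mk : measurable_fun setT (fun z : E => ker s t0 k z.1).
  apply: measurableT_comp => //; apply: continuous_measurable_fun; exact: ker_cts.
have ik : int1 (fun z => ker s t0 k z.1 * (A z.1 * G z)).
  apply: (int1_bounded (C := k.+1%:R * 2`!%:R) iAG mk) => z.
  by rewrite ger0_norm ?ker_ge0// ler_wpM2l// gz_le.
have [_ _ ->] := Fubini_R ik.
have [i1 _ _] := Fubini_R iAG.
rewrite [LHS]Rint_mul_indic; apply: Rintegral_ae_ext; apply: filterS i1 => t it _ /=.
rewrite (RintZ (ker s t0 k t) it) -/(W t) indicE.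
have [tT|tT] := boolP (t \in `[0, T]); first by rewrite mem_set ?mulr1.
rewrite /W (_ : (fun x => _) = fun=> 0) ?Rintegral_cst ?mul0r ?mulr0 ?mul0r//.
by apply/funext => x; rewrite /G tr_out ?mulr0// => -[]; rewrite /= (negbTE tT).
Qed.

End weak_solution.

Section weak_conclusion.
Context {R : realType} {d : nat}.
Local Notation E := (R * 'rV[R]_d)%type.
Local Notation mQ := (@lebQ R d).
Local Notation int1 f := (mQ.-integrable setT (EFin \o f)).
Local Notation m1 := (@leb1 R).
Variables (T alpha : R).
Hypothesis T_gt0 : 0 < T.
Hypothesis alpha_ge0 : 0 <= alpha.
Local Notation r := (@varrho R d alpha).
Local Notation b := (- (alpha * 2)).

Variables (ob u F : E -> R) (P : E -> 'rV[R]_d) (mu : {measure set E -> \bar R}).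
Hypothesis Wu : W01 T r u.
Hypothesis cu : {within oQT T, continuous u}.
Hypothesis ch : {within QT T, continuous ob}.
Hypothesis mh : measurable_fun (QT T) ob.
Hypothesis uh : forall z, QT T z -> ob z <= u z.
Hypothesis radon_mu : radon T mu.
Hypothesis mu_min : forall xi, C0_plus T xi ->
    (\int[mu]_(z in QT T) ((u z - ob z) * xi z)%:E = 0)%E.
Hypothesis LP : forall i, L2rho_QT T r (fun z => P z 0 i).
Hypothesis mF : measurable_fun (QT T) F.
Hypothesis LF : L2loc_QT T F.
Hypothesis EQ : tested_equation T u F P mu.
Variables (phi : 'rV[R]_d -> R) (ub : R -> 'rV[R]_d -> R).
Hypothesis us : slice_version T u ub.
Hypothesis uC : forall K, compact K -> L2continuous T K (cst 1) ub.
Hypothesis uphi : {ae leb d, forall x, ub T x = phi x}.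

Variables (v : E -> R) (vb : R -> 'rV[R]_d -> R).
Hypothesis Wv : W11 T r v.
Hypothesis vh : above_obstacle T ob v.
Hypothesis vC : C_version T r v vb.

Let w z := v z - u z.
Let Wv0 : W01 T r v. Proof. by case: Wv. Qed.
Let wb t x := vb t x - ub t x.

Definition G1 n := tr (QT T) (fun z => cw n b z * (dt T v z * w z)).

Lemma G1E n : G1 n = tr (QT T) (fun z => chi n z * (dt T v z * r z.2 * (w z * r z.2))).
Proof. by apply: tr_ext => z _; rewrite cw_rho; ring. Qed.

Lemma Lw_rho : L2rho_QT T r w.
Proof. by have [] := W01B Wv0 Wu. Qed.

Lemma G1_int1 n : int1 (G1 n).
Proof.
rewrite G1E; apply: (rho_int1 _ Lw_rho (measurable_chi n) (@chi_norm _ _ n)).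
by case: Wv.
Qed.

Lemma w_slices : {ae m1, forall t, t \in `[0, T] -> {ae leb d, forall x, w (t, x) = wb t x}}.
Proof.
apply: filterS2 us vC.1 => t hu hv tT.
by apply: filterS2 (hu tT) (hv tT) => x; rewrite /w /wb => -> ->.
Qed.

Lemma Lcont_w n : Lcont T (rK alpha n) wb.
Proof.
apply: LcontB; first exact: Lcont_rho vC.2.
exact: Lcont_loc.
Qed.

(** [zeta_ineq] with [mol_time] as [k] tends to infinity. The derivative of [th k]
    concentrates at the two end points: near 0 it is positive and its contribution
    is dropped, near [T] it produces the final slice. *)
Lemma weak_n n : \int[mQ]_z G1 n z - 2^-1 * (\sum_i \int[mQ]_z G2 T alpha u P v n i z)
  + \int[mQ]_z G3 T alpha u F v n z <= 2^-1 * Wb alpha wb (fun x => chi n ((0, x) : E)) n T.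
Proof.
have TT : T \in `[0, T] by rewrite in_itv/= lexx ltW.
have i1 := G1_int1 n; have i2 i := G2_int1 Wu LP Wv0 n i.
have i3 := G3_int1 Wu LF Wv0 n alpha_ge0; have i0 := G0_int1 Wu Wv0 n.
set c := fun x => chi n ((0, x) : E).
have mc : measurable_fun setT c.
  apply: cts_measurable_rV => x.
  apply: (@continuous_comp _ _ _ (fun x => (0, x) : E) (chi n) x); first exact: pair_cts.
  exact: smooth_cts (chi_smooth n) _.
have lim0 : \int[mQ]_z (ker 1 T k z.1 * G0 T alpha u v n z) @[k --> \oo] --> Wb alpha wb c n T.
  have -> : (fun k => \int[mQ]_z (ker 1 T k z.1 * G0 T alpha u v n z)) =
      (fun k => \int[mQ]_z (ker 1 T k z.1 * ((cst 1 : R -> R) z.1 * G0 T alpha u v n z))).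
    by apply/funext => k; apply: eq_Rintegral => z _; rewrite mul1r.
  rewrite -[X in _ --> X]mul1r.
  apply: (ker_slices T_gt0 w_slices (A := cst 1) (p := cw n b)) => //.
  - by move=> t; exact: cvg_cst.
  - by move=> t; rewrite normr1.
  - by rewrite mulr1.
  - by rewrite subrr !mul0r mul1r addr0.
  - exact: Lcont_w.
  - by move=> x; exact: chi_norm.
  - by move=> x nK; apply: chi_xsupp => /=; rewrite ltNge; apply/negP.
  - by move=> z; rewrite cw_rho.
have key k : 0 <= - (\int[mQ]_z (th T k z * G1 n z)) + 2^-1 * \int[mQ]_z (ker 1 T k z.1 * G0 T alpha u v n z)
    + 2^-1 * (\sum_i \int[mQ]_z (th T k z * G2 T alpha u P v n i z)) - \int[mQ]_z (th T k z * G3 T alpha u F v n z).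
  have sz := zeta_smooth T alpha k n (d := d).
  have zoff := @zeta_off R d T alpha k n.
  have cB0 : compact (cbox (en k, const_mx (- n.+1%:R)) (T - en k, const_mx n.+1%:R) : set E).
    exact: compact_cbox.
  have [_ lv _ _] := W01_facts Wv0; have [_ lu _ _] := W01_facts Wu.
  have [_ hdt Ldt] := Wv; have [_ ldt] := rho_L2 Ldt.
  apply: le_trans (zeta_ineq Wu cu ch mh uh radon_mu mu_min LP LF EQ Wv0 alpha_ge0 vh
     (k := k) (n := n) (tau := - (\int[mQ]_z (zeta T alpha k n z * dt T v z * w z))
       - 2^-1 * \int[mQ]_z ('D_dirt (zeta T alpha k n) z * w z ^+ 2)) _) _.
    move=> B N cB BQ thick; have BQT : B `<=` QT T by move=> z /BQ/oQT_QT.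
    apply: (mol_time cB0 cB BQ thick sz zoff); [exact: lu|exact: lv|exact: ldt|].
    exact: wderivP.
  rewrite !lerD2r; apply: lerD.
    rewrite le_eqVlt; apply/orP; left; apply/eqP; congr (- _).
    rewrite /G1 -(th_tr T k (fun z => cw n b z * (dt T v z * w z))).
    by apply: eq_Rintegral => z _; rewrite /zeta; ring.
  rewrite -mulrN ler_wpM2l ?invr_ge0//.
  have DE z : 'D_dirt (zeta T alpha k n) z * w z ^+ 2 = 'D_dirt (th T k) z * G0 T alpha u v n z.
    rewrite /G0; have [Qz|nQ] := pselect (QT T z).
      by rewrite trE// zeta_Dt; rewrite /w; ring.
    rewrite tr_out// mulr0 (Dzeta0 cB0 zoff) ?mul0r// => -[/andP[/= h1 h2] _]; apply: nQ.
    by apply/QTP; have := en_gt0 k (R := R) => e0; apply/andP; split; lra.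
  have dbd (z : E) : `|'D_dirt (th T k) z| <= k.+1%:R * 2 + k.+1%:R * 2.
    rewrite th_Dt; apply: le_trans (ler_normB _ _) _.
    have kb s t0 t : `|ker s t0 k t| <= k.+1%:R * 2 :> R.
      by rewrite ger0_norm ?ker_ge0// ler_wpM2l//; exact: gz_le.
    have gb p : `|gz 0 p| <= 1 :> R by rewrite ger0_norm ?gz_ge0// gz0_le1.
    by apply: lerD; rewrite normrM; [rewrite -[leRHS]mulr1|rewrite -[leRHS]mul1r]; apply: ler_pM.
  have mD : measurable_fun setT ('D_dirt (th T k) : E -> R).
    by apply: cts_measurable_E; apply: smooth_cts; apply: smoothD; exact: tc_smooth.
  have iD := int1_bounded i0 mD dbd.
  rewrite (_ : (fun z => 'D_dirt (zeta T alpha k n) z * w z ^+ 2) =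
    (fun z => 'D_dirt (th T k) z * G0 T alpha u v n z)); last by apply/funext => z; exact: DE.
  rewrite -RintN//; apply: le_Rint; first exact: int1N.
    have mk : measurable_fun setT (fun z : E => ker 1 T k z.1).
      by apply: measurableT_comp => //; apply: continuous_measurable_fun; exact: ker_cts.
    apply: (int1_bounded (C := k.+1%:R * 2) i0 mk) => z.
    by rewrite ger0_norm ?ker_ge0// ler_wpM2l//; exact: gz_le.
  move=> z; rewrite -mulNr; apply: ler_wpM2r.
    by rewrite /G0 /tr mulr_ge0// mulr_ge0 ?cw_ge0 ?sqr_ge0.
  rewrite th_Dt opprB lerBlDr ler_wpDr ?mulr_ge0 ?ker_ge0 ?gz_ge0//.
  by rewrite ler_piMl ?ker_ge0 ?gz0_le1.
have L1 := th_lim i1 (fun z nQ => tr_out _ nQ).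
have L2' i := th_lim (i2 i) (fun z nQ => tr_out _ nQ).
have L3 := th_lim i3 (fun z nQ => tr_out _ nQ).
suff : 0 <= - (\int[mQ]_z G1 n z) + 2^-1 * Wb alpha wb c n T
    + 2^-1 * (\sum_i \int[mQ]_z G2 T alpha u P v n i z) - \int[mQ]_z G3 T alpha u F v n z by lra.
apply: (lim_ge0 _ key).
apply: cvgB; last exact: L3.
apply: cvgD; last first.
  apply: cvgM; first exact: cvg_cst.
  by apply: cvg_big => [|i _]; [exact: add_continuous|exact: L2'].
by apply: cvgD; [exact: cvgN|apply: cvgM => //; exact: cvg_cst].
Qed.

(** [weak_n] as [n] tends to infinity. The integral of [F * w * rho^2] need not be
    finite, so [cutoff_limit] is used; at time [T] the function [u] is [phi]. *)
Lemma weak_inequality :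
  ((\int[mQ]_(z in QT T) (dt T v z * (v z - u z) * r z.2 ^+ 2)
   - 2^-1 * \sum_i \int[mQ]_(z in QT T) (P z 0 i * wderiv T (dirx i) (fun z => w z * r z.2 ^+ 2) z))%:E
   + \int[mQ]_(z in QT T) (F z * w z * r z.2 ^+ 2)%:E
   <= (2^-1)%:E * sqnorm r (fun x => phi x - vb T x)%R)%E.
Proof.
set psi := (X in sqnorm r X).
have := leey (sqnorm r psi); rewrite le_eqVlt => /orP[/eqP ->|soo].
  by rewrite gt0_muley ?lte_fin// leey.
have s0 : (0 <= sqnorm r psi)%E.
  by apply: integral_ge0 => x _; rewrite lee_fin sqr_ge0.
have sfin : sqnorm r psi \is a fin_num by rewrite ge0_fin_numE.
rewrite -(fineK sfin) -EFinM; set S := fine _.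
have TT : T \in `[0, T] by rewrite in_itv/= lexx ltW.
have WS n : Wb alpha wb (fun x => chi n ((0, x) : E)) n T <= S.
  have [Lt _] := Lcont_w n TT.
  have mc : measurable_fun setT (fun x => chi n ((0, x) : E)).
    apply: cts_measurable_rV => x.
    apply: (@continuous_comp _ _ _ (fun x => (0, x) : E) (chi n) x); first exact: pair_cts.
    exact: smooth_cts (chi_smooth n) _.
  have iW := int1_bounded (sqr_integrable Lt) mc (fun x => @chi_norm _ _ n ((0, x) : E)).
  rewrite -lee_fin /S (fineK sfin) /Wb /Rintegral fineK; last exact: integrable_fin_num iW.
  have -> : sqnorm r psi = (\int[leb d]_x ((wb T x * r x) ^+ 2)%:E)%E.
    apply: integral_ae_ext; apply: filterS uphi => x hx _; rewrite /psi /wb hx.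
    by rewrite -sqrrN -mulNr opprB.
  apply: ge0_le_integral_nomeas => x _; first by rewrite lee_fin mulr_ge0 ?chi_ge0 ?sqr_ge0.
  rewrite lee_fin /rK mulrA exprMn mulrCA -[leRHS]mulr1; apply: ler_wpM2l; first exact: sqr_ge0.
  have I1 : (\1_(Kball n) x : R) ^+ 2 <= 1.
    by rewrite indicE; case: (_ \in _); rewrite ?expr1n ?expr0n.
  by rewrite -[leRHS]mulr1; apply: ler_pM; rewrite ?chi_ge0 ?chi_le1 ?sqr_ge0.
rewrite int_trE.
have [Lw1 _ _ _] := W01B Wv0 Wu; have [mw _] := rho_L2 Lw1.
have mr2 : measurable_fun (QT T) (fun z : E => r z.2 ^+ 2).
  by apply: measurable_funTS; apply: measurable_funX; apply: cts_measurable_E; exact: rho_cts.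
apply: (@cutoff_limit _ _ _ _ _ (fun n => chi n)
  (fun n => \int[mQ]_z G1 n z - 2^-1 * (\sum_i \int[mQ]_z G2 T alpha u P v n i z))).
- apply: measurable_tr; first exact: measurable_QT.
  by apply: measurable_funM => //; apply: measurable_funM.
- by move=> n; exact: measurable_chi.
- by move=> n z; rewrite chi_ge0 chi_le1.
- by move=> z n k; exact: chi_le.
- exact: chi_cvg.
- move=> n; have := G3_int1 Wu LF Wv0 n alpha_ge0; congr (_.-integrable _ (_ \o _)).
  by apply/funext => z; rewrite /G3 /tr cw_rho /w; ring.
- apply: cvgB; last first.
    apply: cvgM; first exact: cvg_cst.
    apply: cvg_big => [|i _]; first exact: add_continuous.
    by have [] := G2_lim Wu LP Wv0 i.
  have iL : int1 (tr (QT T) (fun z => cst 1 z * (dt T v z * r z.2 * (w z * r z.2)))).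
    apply: (rho_int1 _ Lw_rho (C := 1)) => //; first by case: Wv.
    by move=> z; rewrite normr1.
  rewrite Rint_tr (_ : tr (QT T) (fun z => dt T v z * (v z - u z) * r z.2 ^+ 2) =
    tr (QT T) (fun z => cst 1 z * (dt T v z * r z.2 * (w z * r z.2)))); last first.
    by apply: tr_ext => z _; rewrite /w /=; ring.
  set H := tr _ _.
  have G1H n z : G1 n z = chi n z * H z by rewrite G1E /H /tr /=; ring.
  apply: (Rint_dominated (G := fun z => `|H z|) _ _ _ _ _).2.
  + by move=> n; exact: int1_measurable (G1_int1 n).
  + exact: int1_measurable iL.
  + exact: int1_norm.
  + by move=> n z; rewrite G1H normrM ler_piMl// chi_norm.
  + apply: nearW => z; rewrite -[X in _ --> X]mul1r.
    under eq_fun do rewrite G1H.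
    by apply: cvgM; [exact: chi_cvg|exact: cvg_cst].
- move=> n; apply: le_trans (_ : 2^-1 * Wb alpha wb (fun x => chi n ((0, x) : E)) n T <= _); last first.
    by rewrite ler_wpM2l ?invr_ge0.
  apply: le_trans (weak_n n); rewrite lerD2l le_eqVlt; apply/orP; left; apply/eqP.
  by apply: eq_Rintegral => z _; rewrite /G3 /tr cw_rho /w; ring.
Qed.

End weak_conclusion.

(** * Slices of functions of the energy space *)

Section affine_composition.
Context {R : realType}.

Lemma smooth_affine_comp (V W : normedModType R) (A L : V -> W) (f : W -> R) :
  continuous A -> (forall (h : R) x v, A (h *: v + x) = h *: L v + A x) -> smooth f ->
  smooth (fun x => f (A x)) /\ forall x v, 'D_v (fun x => f (A x)) x = 'D_(L v) f (A x).
Proof.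
move=> cA AL sf.
have D (g : W -> R) x v : smooth g -> is_derive x v (fun x => g (A x)) ('D_(L v) g (A x)).
  move=> sg; apply: is_derive_line.
  have -> : (fun h : R => g (A (h *: v + x))) = (fun h : R => g (h *: L v + A x)).
    by apply/funext => h; rewrite AL.
  by apply: is_derive_lineP; rewrite scale0r add0r; exact: smooth_is_derive.
split; last by move=> x v; have [_ ->] := D f x v sf.
apply: (@smooth_class _ _ (fun g => exists2 f', smooth f' & g = fun x => f' (A x))).
- move=> _ [f' sf' ->] x.
  apply: (@continuous_comp _ _ _ A f' x); [exact: cA|exact: smooth_cts sf' _].
- move=> _ [f' sf' ->] v; exists (fun x => 'D_(L v) f' (A x)); split.
    by exists ('D_(L v) f') => //; exact: smoothD.
  by move=> x; exact: D.
- by exists f.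
Qed.

Variable d : nat.
Local Notation E := (R * 'rV[R]_d)%type.

Lemma smooth_slice_x (f : E -> R) t : smooth f -> smooth (fun x => f (t, x)) /\
  forall x v, 'D_v (fun x => f (t, x)) x = 'D_(0, v) f (t, x).
Proof.
move=> sf; apply: (@smooth_affine_comp _ _ (fun x => (t, x) : E) (fun v => (0, v) : E)) => //.
  exact: pair_cts.
by move=> h x v; apply/pair_equal_spec; rewrite /= scaler0 add0r.
Qed.

Lemma smooth_slice_t (f : E -> R) x : smooth f -> smooth (fun t : R => f (t, x)) /\
  forall t v, 'D_v (fun t : R => f (t, x)) t = 'D_(v, 0) f (t, x).
Proof.
move=> sf; apply: (@smooth_affine_comp _ _ (fun t => (t, x) : E) (fun v => (v, 0) : E)) => //.
  move=> t; apply/cvgrPdist_lt => e e0; near=> s.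
  have ts : `|t - s| < e by near: s; exact: cvgr_dist_lt.
  by rewrite prod_normE /= subrr normr0 gt_max e0 ts.
by move=> h t v; apply/pair_equal_spec; rewrite /= scaler0 add0r.
Unshelve. all: by end_near. Qed.

Lemma smooth_lift (Q : 'rV[R]_d -> R) : smooth Q -> smooth (fun z : E => Q z.2) /\
  forall z v, 'D_v (fun z : E => Q z.2) z = 'D_(v.2) Q z.2.
Proof.
move=> sQ; apply: (@smooth_affine_comp _ _ (fun z : E => z.2) (fun v : E => v.2)) => //.
exact: E_snd_cts.
Qed.

End affine_composition.

Section rV_calculus.
Context {R : realType} {d : nat}.
Local Notation E := (R * 'rV[R]_d)%type.
Local Notation ld := (@leb R d).
Local Notation iR f := (ld.-integrable setT (EFin \o f)).
Local Notation m1 := (@leb1 R).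

Lemma rV_cs_int1 M (f : 'rV[R]_d -> R) : continuous f -> bsupp M f -> iR f.
Proof.
move=> cf bf; have [C C0 fC] := cs_bounded rV_balls_compact cf bf.
have cK : compact [set x : 'rV[R]_d | `|x| <= M] by exact: rV_balls_compact.
apply: (int1_finite (compact_measurable_rV cK) (compact_rV_lty cK) _ fC).
  exact: cts_measurable_rV.
by move=> x /negP; rewrite -ltNge; exact: bf.
Qed.

(** From the same fact on space-time, multiplying [f] by a bump in time. *)
Lemma rV_int_derive0 M (f : 'rV[R]_d -> R) v : smooth f -> bsupp M f ->
  \int[ld]_x 'D_v f x = 0.
Proof.
move=> sf bf; pose p : R -> R := bt 1 0 1.
have sp : smooth (fun z : E => p z.1) by exact: bEt_smooth.
have [sl Dl] := smooth_lift sf.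
have bF : bsupp (Num.max 1 M) (fun z : E => p z.1 * f z.2).
  move=> z; rewrite E_normE gt_max => /andP[h1 h2].
  have [zM|Mz] := leP `|z.2| M; last by rewrite bf ?mulr0.
  have z1 : 1 < `|z.1|.
    case/orP: (le_total `|z.1| `|z.2|) => zz; last by rewrite -(max_idPl zz).
    by move: h2; rewrite (max_idPr zz) ltNge zM.
  rewrite /p bt_out ?mul0r//; apply/negP => /andP[z0 z1'].
  by move: z1; rewrite ger0_norm ?(ltW z0)// => /(lt_trans z1'); rewrite ltxx.
have pD z : 'D_((0, v) : E) (fun z : E => p z.1) z = 0.
  have [_ ->] : is_derive z ((0, v) : E) (fun z : E => p z.1) 0; last by [].
  apply: is_derive_line.
  have -> : (fun h : R => p (h *: ((0, v) : E) + z).1) = cst (p z.1).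
    by apply/funext => h; rewrite /= scaler0 add0r.
  exact: is_derive_cst.
have := int_derive0 ((0, v) : E) (smooth_mul sp sl) bF.
have -> : (fun z : E => 'D_((0, v) : E) (fun z : E => p z.1 * f z.2) z) = (fun z => p z.1 * 'D_v f z.2).
  by apply/funext => z; rewrite derive_mul// pD mulr0 addr0 Dl.
have iD : iR ('D_v f) := rV_cs_int1 (smooth_cts (smoothD v sf)) (bsuppD v bf).
have ip : m1.-integrable setT (EFin \o p) by exact: bt_int1.
have [_ _ ->] := Fubini_R (int1_tensor ip iD) => /=.
under eq_Rintegral do rewrite (RintZ _ iD) mulrC.
rewrite (RintZ _ ip) => /eqP; rewrite mulf_eq0 => /orP[/eqP//|/eqP p0].
have : \int[m1]_t p t <> 0; last by [].
move=> {p0}; apply/eqP; rewrite gt_eqF// lt_neqAle eq_sym; apply/andP; split; last first.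
  by apply: Rintegral_ge0 => t _; exact: bt_ge0.
apply/negP => /eqP p0.
have /(ae_eq_integral_abs _ measurableT (measurable_int _ ip)) H : (\int[m1]_t `|(EFin \o p) t| = 0)%E.
  rewrite (eq_integral (fun t => (p t)%:E)) => [|t _]; last by rewrite /= ger0_norm ?bt_ge0.
  by rewrite -(fineK (integrable_fin_num _ ip))// -/(Rintegral m1 setT p) p0.
have [t [t01 /(_ Logic.I) []]] := ae_pick ltr01 H.
by move=> pt0; have := bt_gt0 (k := 1) ltr01 t01; rewrite -/(p t) pt0 ltxx.
Qed.

Lemma rV_by_parts M (f Q : 'rV[R]_d -> R) v : smooth f -> smooth Q -> bsupp M Q ->
  \int[ld]_x (f x * 'D_v Q x) = - \int[ld]_x ('D_v f x * Q x).
Proof.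
move=> sf sQ bQ; have bfQ : bsupp M (fun x => f x * Q x) by move=> x /bQ ->; rewrite mulr0.
have := rV_int_derive0 v (smooth_mul sf sQ) bfQ.
have -> : 'D_v (fun x => f x * Q x) = (fun x => f x * 'D_v Q x + 'D_v f x * Q x).
  by apply/funext => x; rewrite derive_mul// [Q x * _]mulrC.
rewrite RintD; first by move/eqP; rewrite addr_eq0 => /eqP.
- apply: (rV_cs_int1 (M := M)) => [|x Mx]; last by rewrite (bsuppD v bQ Mx) mulr0.
  exact: (smooth_cts (smooth_mul sf (smoothD v sQ))).
- apply: (rV_cs_int1 (M := M)) => [|x Mx]; last by rewrite (bQ _ Mx) mulr0.
  exact: (smooth_cts (smooth_mul (smoothD v sf) sQ)).
Qed.

Lemma test_rV (f : 'rV[R]_d -> R) : test_fun setT f <-> smooth f /\ exists M, bsupp M f.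
Proof.
split=> [[sf [K [cK _ f0]]]|[sf [M bf]]]; split => //.
  have [M [Mr MB]] := compact_bounded cK; exists (`|M| + 1) => x Mx; apply: f0 => Kx.
  have := MB (`|M| + 1); rewrite (le_lt_trans (ler_norm _)) ?ltrDl// => /(_ isT x Kx).
  by rewrite /= leNgt Mx.
exists [set x | `|x| <= M]; split => //; first exact: rV_balls_compact.
by move=> x /negP; rewrite -ltNge; exact: bf.
Qed.

Lemma bx_bsupp k (a b : 'rV[R]_d) : 0 < k -> bsupp (`|a| + `|b|) (bx k a b).
Proof.
move=> k0 x xn; apply: bx_out => // h; move: xn; rewrite ltNge => /negP; apply.
have S0 : 0 <= `|a| + `|b| by rewrite addr_ge0.
apply/(rV_norm_leP _ S0) => i; have /andP[h1 h2] := h i.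
have := rV_coord_le a i; have := rV_coord_le b i.
have := normr_ge0 a; have := normr_ge0 b => p1 p2.
by rewrite !ler_norml => /andP[a1 a2] /andP[b1 b2]; apply/andP; split; lra.
Qed.

Lemma loc_int_test (w psi : 'rV[R]_d -> R) M : (forall K, compact K -> ld.-integrable K (EFin \o w)) ->
  continuous psi -> bsupp M psi -> iR (fun x => w x * psi x).
Proof.
move=> iw cp bp; have [C C0 pC] := cs_bounded rV_balls_compact cp bp.
have cK : compact [set x : 'rV[R]_d | `|x| <= M] by exact: rV_balls_compact.
have := int1_bounded (int1_indic (compact_measurable_rV cK) (iw _ cK)) (cts_measurable_rV cp) pC.
congr (_.-integrable _ (_ \o _)); apply/funext => x; rewrite indicE.
have [xM|Mx] := leP `|x| M; first by rewrite mem_set// mulr1 mulrC.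
by rewrite bp// mul0r mulr0.
Qed.

Lemma wderivx_unique v (w g1 g2 : 'rV[R]_d -> R) : is_wderivx v w g1 -> is_wderivx v w g2 ->
  {ae ld, forall x, g1 x = g2 x}.
Proof.
move=> [m1' i1 e1] [m2' i2 e2].
suff H : {ae ld, forall x, g1 x - g2 x = 0}.
  by apply: filterS H => x /eqP; rewrite subr_eq0 => /eqP.
apply: rV_ae0 => [n|k a b].
  have cK : compact [set x : 'rV[R]_d | `|x| <= n%:R] by exact: rV_balls_compact.
  have mK := compact_measurable_rV cK.
  have := int1B (int1_indic mK (i1 _ cK)) (int1_indic mK (i2 _ cK)).
  by congr (_.-integrable _ (_ \o _)); apply/funext => x; rewrite mulrBl.
have k0 : 0 < k.+1%:R :> R by rewrite ltr0n.
have sb : smooth (bx k.+1%:R a b) by exact: bx_smooth.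
have bb : bsupp (`|a| + `|b|) (bx k.+1%:R a b) by exact: bx_bsupp.
have tb : test_fun setT (bx k.+1%:R a b) by apply/test_rV; split => //; exists (`|a| + `|b|).
have -> : (fun x => (g1 x - g2 x) * bx k.+1%:R a b x) =
    (fun x => g1 x * bx k.+1%:R a b x - g2 x * bx k.+1%:R a b x).
  by apply/funext => x; rewrite mulrBl.
rewrite RintB; [|exact: loc_int_test i1 (smooth_cts sb) bb|exact: loc_int_test i2 (smooth_cts sb) bb].
by apply/eqP; rewrite subr_eq0; apply/eqP; apply: oppr_inj; rewrite -e1// -e2.
Qed.

Lemma wderivxP v (w : 'rV[R]_d -> R) : has_wderivx v w -> is_wderivx v w (wderivx v w).
Proof. by move=> h; exact: xgetPex. Qed.

Lemma ae_subseq (a : nat -> R -> R) : (forall n, m1.-integrable setT (EFin \o a n)) ->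
  (forall n t, 0 <= a n t) -> \int[m1]_t a n t @[n --> \oo] --> (0 : R) ->
  exists2 s : nat -> nat, (forall n, (n <= s n)%N) &
    {ae m1, forall t, a (s n) t @[n --> \oo] --> (0 : R)}.
Proof.
move=> ia a0 ca.
have ex n : exists k, (n <= k)%N /\ \int[m1]_t a k t <= 2^-1 ^+ n.
  have p0 : 0 < (2^-1 : R) ^+ n by rewrite exprn_gt0// invr_gt0.
  near \oo => k; exists k; split; first by near: k; exact: nbhs_infty_ge.
  by apply: ltW; near: k; apply: (cvgr_lt _ ca).
have [s sP] := choice ex; exists s; first by move=> n; case: (sP n).
have ma n : measurable_fun setT (fun t => (a (s n) t)%:E).
  by apply/measurable_EFinP; exact: int1_measurable (ia _).
have IE n : (\int[m1]_t (a (s n) t)%:E = (\int[m1]_t a (s n) t)%:E)%E.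
  by rewrite /Rintegral fineK//; exact: integrable_fin_num (ia _).
have fin : (\int[m1]_t (\sum_(0 <= n <oo) (a (s n) t)%:E) < +oo)%E.
  rewrite integral_nneseries//; last by move=> n t _; rewrite lee_fin.
  apply: (@le_lt_trans _ _ (\sum_(0 <= n <oo) ((2^-1 : R) ^+ n)%:E)%E).
    apply: lee_nneseries => [n _ _|n _].
      by apply: integral_ge0 => t _; rewrite lee_fin a0.
    by rewrite IE lee_fin; case: (sP n).
  have -> : (\sum_(0 <= n <oo) ((2^-1 : R) ^+ n)%:E)%E = (2 : R)%:E.
    apply/cvg_lim => //.
    have -> : (fun n : nat => \sum_(0 <= k < n) ((2^-1 : R) ^+ k)%:E)%E =
        EFin \o series (geometric 1 2^-1 : R ^nat).
      apply/funext => n; rewrite /series /= sumEFin; congr EFin.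
      by apply: eq_bigr => k _; rewrite /geometric /= mul1r.
    apply: cvg_EFin; first exact: nearW.
    have := @cvg_geometric_series R 1 2^-1; rewrite (_ : 1 / (1 - 2^-1) = 2); last by field.
    by apply; rewrite ger0_norm ?invr_ge0// invf_lt1// ltr1n.
  by rewrite ltry.
have mS : measurable_fun setT (fun t => \sum_(0 <= n <oo) (a (s n) t)%:E)%E.
  apply: ge0_emeasurable_sum => // n t _ _; by rewrite lee_fin.
have iS : m1.-integrable setT (fun t => \sum_(0 <= n <oo) (a (s n) t)%:E)%E.
  apply/integrableP; split => //; rewrite (eq_integral (fun t => \sum_(0 <= n <oo) (a (s n) t)%:E)%E)//.
  by move=> t _; rewrite gee0_abs// nneseries_ge0// => n _ _; rewrite lee_fin.
have := integrable_ae measurableT iS.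
apply: filterS => t /(_ Logic.I) ft.
have : cvgn (series (fun n => a (s n) t)).
  apply: nondecreasing_is_cvgn.
    by apply/nondecreasing_seqP => n; rewrite /series /= big_nat_recr//= lerDl.
  exists (fine (\sum_(0 <= n <oo) (a (s n) t)%:E)%E) => _ [n _ <-].
  rewrite -lee_fin fineK// /series /= -sumEFin.
  by apply: nneseries_lim_ge => k _ _; rewrite lee_fin.
exact: cvg_series_cvg_0.
Unshelve. all: by end_near. Qed.

End rV_calculus.

Section slices_of_weak_derivatives.
Context {R : realType} {d : nat}.
Local Notation E := (R * 'rV[R]_d)%type.
Local Notation mQ := (@lebQ R d).
Local Notation ld := (@leb R d).
Local Notation int1 f := (mQ.-integrable setT (EFin \o f)).
Local Notation iR f := (ld.-integrable setT (EFin \o f)).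
Local Notation m1 := (@leb1 R).
Variables (T : R).
Hypothesis T_gt0 : 0 < T.
Implicit Types e f : E -> R.

Lemma measurable_section f t : measurable_fun setT f -> measurable_fun setT (fun x => f (t, x)).
Proof.
by move=> mf; apply: (measurableT_comp mf); exact: measurable_pair1.
Qed.

Lemma section_L2 f : L2 mQ setT f -> {ae m1, forall t, L2 ld setT (fun x => f (t, x))}.
Proof.
move=> Lf; have [+ _ _] := Fubini_R (sqr_integrable Lf).
apply: filterS => t it; apply: L2_of_sq => //.
by apply: measurable_section; case: Lf.
Qed.

Lemma m1_ae_neq (c : R) : {ae m1, forall t, t != c}.
Proof.
exists [set c]; split; [exact: measurable_set1|exact: lebesgue_measure_set1|].
by move=> t /=; apply: contra_notP => tc; apply/eqP.
Qed.

Lemma ae_opening (Q : R -> Prop) : {ae m1, forall t, 0 < t < T -> Q t} ->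
  {ae m1, forall t, t \in `[0, T] -> Q t}.
Proof.
move=> H; have H0 := m1_ae_neq 0; have HT := m1_ae_neq T.
apply: filterS3 H H0 HT => t Ht t0 tT; rewrite in_itv /= => /andP[h0 h1].
by apply: Ht; rewrite !lt_neqAle h0 h1 tT eq_sym t0.
Qed.

Variables (e e' : E -> R) (v : 'rV[R]_d).
Hypothesis Le : L2loc_QT T e.
Hypothesis Le' : L2loc_QT T e'.
Hypothesis me : measurable_fun (QT T) e.
Hypothesis De : is_wderiv T (0, v) e e'.

Let B0 N := cbox (en N, const_mx (- N%:R)) (T - en N, const_mx N%:R) : set E.

Lemma B0_in N (t : R) (x : 'rV[R]_d) : en N <= t <= T - en N -> `|x| <= N%:R -> B0 N (t, x).
Proof.
move=> tN xN; split => // i; rewrite !mxE -ler_norml.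
exact: le_trans (rV_coord_le x i) xN.
Qed.

(** For the averages of [e] this is classical, on every slice. Along a subsequence
    the slices of the averages converge for almost every time, and this null set
    of times serves all test functions [Q] at once. *)
Lemma slice_by_parts N : {ae m1, forall t, en N <= t <= T - en N ->
  forall Q, smooth Q -> bsupp N%:R Q ->
  \int[ld]_x (e (t, x) * 'D_v Q x) = - \int[ld]_x (e' (t, x) * Q x)}.
Proof.
have [N0 [B [cB BQ thick]]] := @thick_box R d T (en N) (T - en N) N%:R (en_gt0 N) (ltac:(rewrite ltrBlDr ltrDl; exact: en_gt0)).
have mB := compact_measurable_E cB.
have LB : L2 mQ B e by apply: Le => // z /BQ /oQT_QT.
have LB' : L2 mQ B e' by apply: Le' => // z /BQ /oQT_QT.
have [M1 Lb1] := Lb_tr cB LB; have [M2 Lb2] := Lb_tr cB LB'.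
pose f n := J n (tr B e); pose g n := J n (tr B e').
have cf := J_cvg Lb1; have cg := J_cvg Lb2.
have B0B z : B0 N z -> B z by move=> Bz; apply: (thick _ _ Bz); rewrite subrr normr0 ltW// en_gt0.
have sf n : smooth (f n) by apply: J_smooth; exact: Lb_int1 Lb1.
have sg n : smooth (g n) by apply: J_smooth; exact: Lb_int1 Lb2.
have Df n z : (N0 <= n)%N -> B0 N z -> 'D_((0, v) : E) (f n) z = g n z.
  move=> Nn Bz; apply: (J_wderiv cB BQ De); first exact: L2_int_compact LB.
  move=> y zy; apply: (thick _ _ Bz); apply: le_trans (ltW zy) _; exact: en_le.
pose a n (z : E) := (f n z - tr B e z) ^+ 2 + (g n z - tr B e' z) ^+ 2.
have Lfd n : L2 mQ setT (fun z => f n z - tr B e z) by case: cf => L1 L0 _; exact: L2B (L1 n) L0.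
have Lgd n : L2 mQ setT (fun z => g n z - tr B e' z) by case: cg => L1 L0 _; exact: L2B (L1 n) L0.
have ia n : int1 (a n) by apply: int1D; exact: sqr_integrable.
pose A n t := \int[ld]_x a n (t, x).
have FA n := Fubini_R (ia n).
have iA n : m1.-integrable setT (EFin \o A n) by case: (FA n).
have A0 n t : 0 <= A n t by apply: Rintegral_ge0 => x _; rewrite addr_ge0// sqr_ge0.
have cA : \int[m1]_t A n t @[n --> \oo] --> (0 : R).
  have -> : (fun n => \int[m1]_t A n t) = (fun n => N2 mQ (fun z => f n z - tr B e z) +
      N2 mQ (fun z => g n z - tr B e' z)).
    apply/funext => n; case: (FA n) => _ _ <-.
    by rewrite RintD//; exact: sqr_integrable.
  rewrite -[0 : R]addr0; apply: cvgD; first by case: cf.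
  by case: cg.
have [s sn cs] := ae_subseq iA A0 cA.
have aeE := section_L2 (proj1 Lb1); have aeE' := section_L2 (proj1 Lb2).
have aeF : {ae m1, forall t, forall n, iR (fun x => a n (t, x))}.
  by apply/ae_foralln => n; case: (FA n).
apply: filterS2 (filterI cs aeE) (filterI aeE' aeF) => t [ct Lt] [Lt' iat] tN Q sQ bQ.
have bsl M (p : E -> R) : bsupp M p -> bsupp M (fun x => p (t, x)).
  by move=> bp x Mx; apply: bp; rewrite E_normE lt_max Mx orbT.
have Lft n : L2 ld setT (fun x => f n (t, x)).
  apply: L2_of_sq; first by apply: measurable_section; exact: cts_measurable_E (smooth_cts (sf n)).
  have [sx _] := smooth_slice_x t (sf n).
  apply: (rV_cs_int1 (M := M1 + 1)).
    exact: (smooth_cts (smooth_mul sx sx)).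
  move=> x xM /=; have -> : f n (t, x) = 0 by exact: (bsl _ _ (J_bsupp n (proj2 Lb1)) x xM).
  by rewrite expr0n.
have Lgt n : L2 ld setT (fun x => g n (t, x)).
  apply: L2_of_sq; first by apply: measurable_section; exact: cts_measurable_E (smooth_cts (sg n)).
  have [sx _] := smooth_slice_x t (sg n).
  apply: (rV_cs_int1 (M := M2 + 1)).
    exact: (smooth_cts (smooth_mul sx sx)).
  move=> x xM /=; have -> : g n (t, x) = 0 by exact: (bsl _ _ (J_bsupp n (proj2 Lb2)) x xM).
  by rewrite expr0n.
have c1 : L2cv ld (fun n x => f (s n) (t, x)) (fun x => tr B e (t, x)).
  apply: (L2cv_le (fun n => Lft (s n)) Lt _ ct) => n.
  apply: le_Rint; [exact/sqr_integrable/L2B|exact: iat|move=> x].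
  by rewrite /a lerDl sqr_ge0.
have c2 : L2cv ld (fun n x => g (s n) (t, x)) (fun x => tr B e' (t, x)).
  apply: (L2cv_le (fun n => Lgt (s n)) Lt' _ ct) => n.
  apply: le_Rint; [exact/sqr_integrable/L2B|exact: iat|move=> x].
  by rewrite /a lerDr sqr_ge0.
have LQ p : smooth p -> bsupp N%:R p -> L2 ld setT p.
  move=> sp bp; apply: L2_of_sq; first exact: cts_measurable_rV (smooth_cts sp).
  apply: (rV_cs_int1 (M := N%:R)); first exact: (smooth_cts (smooth_mul sp sp)).
  by move=> x xM; rewrite bp// expr0n.
have bDQ := bsuppD v bQ; have sDQ := smoothD v sQ.
have l1 := L2cv_int c1 (L2cv_cst (LQ _ sDQ bDQ)).
have l2 := L2cv_int c2 (L2cv_cst (LQ _ sQ bQ)).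
have E1 : \int[ld]_x (tr B e (t, x) * 'D_v Q x) = \int[ld]_x (e (t, x) * 'D_v Q x).
  apply: eq_Rintegral => x _; have [xN|Nx] := leP `|x| N%:R; last by rewrite bDQ// !mulr0.
  by rewrite trE//; apply: B0B; exact: B0_in.
have E2 : \int[ld]_x (tr B e' (t, x) * Q x) = \int[ld]_x (e' (t, x) * Q x).
  apply: eq_Rintegral => x _; have [xN|Nx] := leP `|x| N%:R; last by rewrite bQ// !mulr0.
  by rewrite trE//; apply: B0B; exact: B0_in.
rewrite -E1 -E2.
have l1' : - (\int[ld]_x (g (s n) (t, x) * Q x)) @[n --> \oo] --> \int[ld]_x (tr B e (t, x) * 'D_v Q x).
  apply: cvg_trans l1; apply: near_eq_cvg; near=> n.
  have [sx Dx] := smooth_slice_x t (sf (s n)).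
  rewrite (rV_by_parts v sx sQ bQ); congr (- _); apply: eq_Rintegral => x _.
  have [xN|Nx] := leP `|x| N%:R; last by rewrite bQ// !mulr0.
  rewrite Dx Df//; last exact: B0_in.
  by apply: leq_trans (sn n); near: n; exact: nbhs_infty_ge.
apply: (cvg_unique _ l1' _) => //.
by apply: cvgN.
Unshelve. all: by end_near. Qed.

Lemma slice_wderivx : {ae m1, forall t, t \in `[0, T] ->
  is_wderivx v (fun x => e (t, x)) (fun x => e' (t, x))}.
Proof.
pose D n : set E := cbox (0, const_mx (- n%:R)) (T, const_mx n%:R).
have cD n : compact (D n) by exact: compact_cbox.
have DQ n : D n `<=` QT T by move=> z [h _]; apply/QTP.
have mD n := compact_measurable_E (cD n).
have LD n : L2 mQ setT (tr (D n) e') by apply: L2_tr => //; exact: Le'.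
have ae1 : {ae m1, forall t n, L2 ld setT (fun x => tr (D n) e' (t, x))}.
  by apply/ae_foralln => n; exact: section_L2.
have ae2 : {ae m1, forall t N, en N <= t <= T - en N ->
  forall Q, smooth Q -> bsupp N%:R Q ->
  \int[ld]_x (e (t, x) * 'D_v Q x) = - \int[ld]_x (e' (t, x) * Q x)}.
  by apply/ae_foralln => n; exact: slice_by_parts.
apply: ae_opening; apply: filterS2 ae1 ae2 => t L1 L2' /andP[t0 tT].
have Dx n x : `|x| <= n%:R -> D n (t, x).
  move=> xn; split; first by rewrite /= !ltW.
  by move=> i; rewrite !mxE -ler_norml; exact: le_trans (rV_coord_le x i) xn.
split.
- have mm : measurable_fun setT (tr (QT T) e') by apply: measurable_tr; [exact: measurable_QT|case: De].
  have := measurable_section t mm.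
  congr (measurable_fun _ _); apply/funext => x; rewrite trE//.
  by apply/QTP; rewrite /= !ltW.
- move=> K cK; have mK := compact_measurable_rV cK.
  have [M [Mr MB]] := compact_bounded cK.
  have [n Mn] := truncn_gt_norm (`|M| + 1).
  have Kn x : K x -> `|x| <= n%:R.
    move=> Kx; apply: le_trans (ltW Mn); apply: MB => //.
    by rewrite (le_lt_trans (ler_norm _)) ?ltrDl.
  have LK : L2 ld setT (\1_K : 'rV[R]_d -> R) by apply: L2_indic => //; exact: compact_rV_lty.
  have iK := mul_integrable (L1 n) LK.
  have := integrableS measurableT mK (@subsetT _ K) iK.
  apply: eq_integrable => // x /set_mem Kx.
  by rewrite /= trE ?indicE ?mem_set ?mulr1//; apply: Dx; exact: Kn.
- move=> Q /test_rV[sQ [M bQ]].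
  have [n1 Mn] := truncn_gt_norm (`|M| + 1).
  have tmin : 0 < Num.min t (T - t) by rewrite lt_min t0 subr_gt0.
  have [n2 tn] := truncn_gt_norm (Num.min t (T - t))^-1.
  pose N := maxn n1 n2.
  have eN : en N <= Num.min t (T - t).
    rewrite /en -(invrK (Num.min _ _)) lef_pV2 ?posrE ?invr_gt0// ?ltr0n//.
    apply: le_trans (ltW tn) _; rewrite ler_nat (leq_trans (leq_maxr n1 n2))//.
  apply: (L2' N) => //.
    by move: eN; rewrite le_min => /andP[-> h]; rewrite lerBrDr -lerBrDl.
  apply: bsupp_le bQ; apply: le_trans (ler_norm _) _; apply: (@le_trans _ _ (`|M| + 1)); first by rewrite lerDl.
  by apply: le_trans (ltW Mn) _; rewrite ler_nat leq_maxl.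
Qed.

End slices_of_weak_derivatives.

Section energy_slices.
Context {R : realType} {d : nat}.
Local Notation E := (R * 'rV[R]_d)%type.
Local Notation mQ := (@lebQ R d).
Local Notation ld := (@leb R d).
Local Notation m1 := (@leb1 R).
Variables (T alpha : R).
Hypothesis T_gt0 : 0 < T.
Hypothesis alpha_ge0 : 0 <= alpha.
Local Notation r := (@varrho R d alpha).
Local Notation IT := (`[0, T]%classic : set R).

(** The derivatives are part of the data: the derivatives chosen by [wderiv] obey
    the rules of calculus only almost everywhere. *)
Definition W01d e (e' : 'I_d -> E -> R) := [/\ L2rho_QT T r e,
  forall i, is_wderiv T (dirx i) e (e' i) & forall i, L2rho_QT T r (e' i)].

Definition W1d (w : 'rV[R]_d -> R) (w' : 'I_d -> 'rV[R]_d -> R) := [/\ L2rho r w,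
  forall i, is_wderivx (delta_mx 0 i) w (w' i) & forall i, L2rho r (w' i)].

(** The squared energy norms of a function of [x], of a slice, and on
    space-time. *)
Definition SV (w : 'rV[R]_d -> R) (w' : 'I_d -> 'rV[R]_d -> R) : R :=
  N2 ld (fun x => w x * r x) + \sum_i N2 ld (fun x => w' i x * r x).

Definition SW e (e' : 'I_d -> E -> R) t := SV (fun x => e (t, x)) (fun i x => e' i (t, x)).

Definition NW e (e' : 'I_d -> E -> R) : R := N2 mQ (tr (QT T) (fun z => e z * r z.2)) +
  \sum_i N2 mQ (tr (QT T) (fun z => e' i z * r z.2)).

Lemma L2rho_ae (w1 w2 : 'rV[R]_d -> R) : measurable_fun setT w2 ->
  {ae ld, forall x, w1 x = w2 x} -> L2rho r w1 -> L2rho r w2 /\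
  N2 ld (fun x => w1 x * r x) = N2 ld (fun x => w2 x * r x).
Proof.
move=> m2 h [_ L]; split; last first.
  by apply: Rintegral_ae_ext; apply: filterS h => x -> _.
split; first by apply: measurable_funM => //; exact: measurable_rho.
move: L; congr (_ < _)%E; apply: integral_ae_ext.
by apply: filterS h => x -> _.
Qed.

Lemma W1d_W1 w w' : W1d w w' -> W1 r w /\ W1sqnorm r w = (SV w w')%:E.
Proof.
move=> [Lw dw Lw'].
have H i : is_wderivx (delta_mx 0 i) w (wderivx (delta_mx 0 i) w).
  by apply: wderivxP; exists (w' i).
have ae i := wderivx_unique (dw i) (H i).
have HL i := L2rho_ae (let: And3 m _ _ := H i in m) (ae i) (Lw' i).
split; first by split => // i; split; [exists (w' i)|exact: (HL i).1].
rewrite /W1sqnorm /SV /sqnorm L2_N2E// EFinD; congr (_ + _)%E.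
rewrite -sumEFin; apply: eq_bigr => i _; rewrite L2_N2E; last exact: (HL i).1.
by rewrite (HL i).2.
Qed.

Lemma W01_W01d e : W01 T r e -> W01d e (fun i => wderiv T (dirx i) e).
Proof.
by move=> [Lw h]; split => // i; have [h1 h2] := h i => //; exact: wderivP.
Qed.

Lemma rhoK (p : 'rV[R]_d -> R) x : p x * r x * (r x)^-1 = p x.
Proof. by rewrite mulfK// gt_eqF// rho_gt0. Qed.

Lemma SV_ge0 w w' : 0 <= SV w w'.
Proof. by rewrite addr_ge0 ?N2_ge0//; apply: sumr_ge0 => i _; exact: N2_ge0. Qed.

Lemma W01d_slices e e' : W01d e e' -> {ae m1, forall t, t \in `[0, T] ->
  W1d (fun x => e (t, x)) (fun i x => e' i (t, x))}.
Proof.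
move=> [Le De Le'].
have [me Lle] := rho_L2 Le.
have sl p : L2rho_QT T r p -> {ae m1, forall t, t \in `[0, T] -> L2rho r (fun x => p (t, x))}.
  move=> Lp; have := section_L2 (L2_tr (@measurable_QT R d T) Lp).
  apply: filterS => t + tT; rewrite /L2rho.
  have -> : (fun x => tr (QT T) (fun z : E => p z * r z.2) (t, x)) = (fun x => p (t, x) * r x); last by [].
  by apply/funext => x; rewrite trE//; apply/QTP; move: tT; rewrite in_itv.
have h1 := sl _ Le.
have h2 : {ae m1, forall t (i : 'I_d), t \in `[0, T] -> L2rho r (fun x => e' i (t, x))}.
  by apply: (@filter_forall _ _ (fun i t => _)) => i; exact: sl.
have h3 : {ae m1, forall t (i : 'I_d), t \in `[0, T] ->
    is_wderivx (delta_mx 0 i) (fun x => e (t, x)) (fun x => e' i (t, x))}.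
  apply: (@filter_forall _ _ (fun i t => _)) => i.
  have Ll := (rho_L2 (Le' i)).2.
  by apply: slice_wderivx (De i).
by apply: filterS3 h1 h2 h3 => t a1 a2 a3 tT; split => [|i|i]; [exact: a1|exact: a3|exact: a2].
Qed.

Lemma tr_section (p : E -> R) (t : R) x :
  tr (QT T) p (t, x) = p (t, x) * \1_IT t.
Proof.
rewrite /tr !indicE; congr (_ * (_ : bool)%:R); apply/idP/idP => /set_mem h; apply/mem_set.
  by move/QTP: h; rewrite /= in_itv.
by apply/QTP; move: h; rewrite /= in_itv.
Qed.

Lemma SW_int e e' : W01d e e' -> m1.-integrable setT (EFin \o (fun t => SW e e' t * \1_IT t)) /\
  \int[m1]_t (SW e e' t * \1_IT t) = NW e e'.
Proof.
move=> [Le _ Le'].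
have sl p : L2rho_QT T r p ->
    m1.-integrable setT (EFin \o (fun t => N2 ld (fun x => p (t, x) * r x) * \1_IT t)) /\
    \int[m1]_t (N2 ld (fun x => p (t, x) * r x) * \1_IT t) = N2 mQ (tr (QT T) (fun z => p z * r z.2)).
  move=> Lp; have [_ i1 E1] := Fubini_R (sqr_integrable (L2_tr (@measurable_QT R d T) Lp)).
  have FE : (fun t => \int[ld]_x (tr (QT T) (fun z => p z * r z.2) (t, x) ^+ 2)) =
      (fun t => N2 ld (fun x => p (t, x) * r x) * \1_IT t).
    apply/funext => t; rewrite indicE; case: (boolP (t \in IT)) => tI; rewrite ?mulr1 ?mulr0.
      by apply: eq_Rintegral => x _; rewrite tr_section indicE tI mulr1.
    transitivity (\int[ld]_x (0 : R)); last by rewrite /Rintegral integral0.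
    by apply: eq_Rintegral => x _; rewrite tr_section indicE (negbTE tI) mulr0 expr0n.
  by rewrite -FE; split => //; rewrite E1.
have [i0 E0] := sl _ Le.
have -> : (fun t => SW e e' t * \1_IT t) = (fun t => N2 ld (fun x => e (t, x) * r x) * \1_IT t +
    \sum_i N2 ld (fun x => e' i (t, x) * r x) * \1_IT t).
  by apply/funext => t; rewrite /SW /SV mulrDl mulr_suml.
have is' : m1.-integrable setT (EFin \o (fun t => \sum_i N2 ld (fun x => e' i (t, x) * r x) * \1_IT t)).
  by apply: int1_sum => i; case: (sl _ (Le' i)).
split; first exact: int1D.
rewrite RintD// E0 Rint_sum => [|i]; last by case: (sl _ (Le' i)).
by congr (_ + _); apply: eq_bigr => i _; case: (sl _ (Le' i)).
Qed.

End energy_slices.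

(** * The time derivative as a functional on the energy space *)

Section dual.
Context {R : realType} {d : nat}.
Local Notation E := (R * 'rV[R]_d)%type.
Local Notation ld := (@leb R d).
Local Notation m1 := (@leb1 R).
Variables (T alpha : R).
Hypothesis T_gt0 : 0 < T.
Hypothesis alpha_ge0 : 0 <= alpha.
Local Notation r := (@varrho R d alpha).
Local Notation W1a := (@W1d R d alpha).
Local Notation SVa := (@SV R d alpha).
Local Notation IT := (`[0, T]%classic : set R).

Lemma Rint_eq0 (p : 'rV[R]_d -> R) : (forall x, p x = 0) -> \int[ld]_x p x = 0.
Proof.
move=> p0; transitivity (\int[ld]_x (0 : R)); first exact: eq_Rintegral.
by rewrite /Rintegral integral0.
Qed.

Lemma rhoV_cts : continuous (fun x : 'rV[R]_d => (r x)^-1).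
Proof.
have -> : (fun x => (r x)^-1) = (fun x => pw alpha ((0, x) : E)).
  by apply/funext => x; rewrite (varrhoE alpha ((0, x) : E)) /pw powRN invrK.
have [h _] := smooth_slice_x 0 (@pw_smooth R d alpha).
exact: (smooth_cts h).
Qed.

Lemma L2rho_loc (w : 'rV[R]_d -> R) : L2rho r w -> forall K, compact K -> ld.-integrable K (EFin \o w).
Proof.
move=> Lw K cK; have mK := compact_measurable_rV cK.
have [C C0 hC] := compact_cts_bounded cK (continuous_subspaceT rhoV_cts).
have mV : measurable_fun setT (fun x : 'rV[R]_d => (r x)^-1) by exact: cts_measurable_rV rhoV_cts.
have LK : L2 ld setT (\1_K : 'rV[R]_d -> R) by apply: L2_indic => //; exact: compact_rV_lty.
have LV : L2 ld setT (fun x => (r x)^-1 * \1_K x * \1_K x).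
  apply: (L2M (C := C) LK); first by apply: measurable_funM => //; exact: measurable_indic.
  move=> x; rewrite normrM indicE; case: (boolP (x \in K)) => [/set_mem Kx|_].
    by rewrite normr1 mulr1 hC.
  by rewrite normr0 mulr0.
have iK := mul_integrable Lw LV.
have := integrableS measurableT mK (@subsetT _ K) iK.
apply: eq_integrable => // x xK /=; rewrite indicE xK !mulr1.
by rewrite rhoK.
Qed.

Lemma is_wderivx_lin v c (w1 w2 g1 g2 : 'rV[R]_d -> R) : L2rho r w1 -> L2rho r w2 ->
  is_wderivx v w1 g1 -> is_wderivx v w2 g2 ->
  is_wderivx v (fun x => c * w1 x + w2 x) (fun x => c * g1 x + g2 x).
Proof.
move=> L1 L2' [m1' i1 e1] [m2' i2 e2]; split.
- by apply: measurable_funD => //; apply: measurable_funM.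
- move=> K cK; have mK := compact_measurable_rV cK.
  have := integrableD mK (integrableZl mK c (i1 _ cK)) (i2 _ cK).
  by apply: eq_integrable => // x _ /=; rewrite EFinD EFinM.
- move=> psi tpsi; have [sp [M bp]] := (test_rV psi).1 tpsi.
  have cD : continuous ('D_v psi) := smooth_cts (smoothD v sp).
  have cp := smooth_cts sp.
  have bD := bsuppD v bp.
  have j1 := loc_int_test (L2rho_loc L1) cD bD.
  have j2 := loc_int_test (L2rho_loc L2') cD bD.
  have k1 := loc_int_test i1 cp bp.
  have k2 := loc_int_test i2 cp bp.
  have -> : (fun x => (c * w1 x + w2 x) * 'D_v psi x) =
      (fun x => c * (w1 x * 'D_v psi x) + w2 x * 'D_v psi x).
    by apply/funext => x; rewrite mulrDl mulrA.
  have -> : (fun x => (c * g1 x + g2 x) * psi x) =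
      (fun x => c * (g1 x * psi x) + g2 x * psi x).
    by apply/funext => x; rewrite mulrDl mulrA.
  rewrite (RintD (int1Z c j1) j2) (RintD (int1Z c k1) k2) (RintZ c j1) (RintZ c k1) e1// e2//.
  by rewrite opprD mulrN.
Qed.

Lemma L2rho_lin c (w1 w2 : 'rV[R]_d -> R) : L2rho r w1 -> L2rho r w2 ->
  L2rho r (fun x => c * w1 x + w2 x).
Proof.
move=> L1 L2'; have := L2D (L2Z c L1) L2'; rewrite /L2rho.
have -> // : (fun x => c * (w1 x * r x) + w2 x * r x) = (fun x => (c * w1 x + w2 x) * r x).
by apply/funext => x; rewrite mulrDl mulrA.
Qed.

Lemma W1d_lin c w1 w1' w2 w2' : W1a w1 w1' -> W1a w2 w2' ->
  W1a (fun x => c * w1 x + w2 x) (fun i x => c * w1' i x + w2' i x).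
Proof.
move=> [a1 b1 c1] [a2 b2 c2]; split; first exact: L2rho_lin.
  by move=> i; exact: is_wderivx_lin.
by move=> i; exact: L2rho_lin.
Qed.

Lemma W1d_0 : W1a (fun=> 0) (fun _ _ => 0).
Proof.
have L0 : L2rho r (fun=> 0 : R).
  rewrite /L2rho (_ : (fun x => _) = (fun=> 0)); first exact: L2_0.
  by apply/funext => x; rewrite mul0r.
split => // i; split => //.
- by move=> K cK; apply: (eq_integrable _ (cst 0%E)) => //; [exact: compact_measurable_rV|exact: integrable0].
- by move=> psi _; rewrite !Rint_eq0 ?oppr0// => x; rewrite mul0r.
Qed.

Lemma W1d_Z c w w' : W1a w w' ->
  W1a (fun x => c * w x) (fun i x => c * w' i x).
Proof.
move=> h; have := W1d_lin c h W1d_0; congr (W1d _ _ _).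
  by apply/funext => x; rewrite addr0.
by apply/funext => i; apply/funext => x; rewrite addr0.
Qed.

Lemma N2Z (c : R) (p : 'rV[R]_d -> R) : L2 ld setT p -> N2 ld (fun x => c * p x) = c ^+ 2 * N2 ld p.
Proof.
move=> Lp; rewrite /N2 -(RintZ _ (sqr_integrable Lp)).
by apply: eq_Rintegral => x _; rewrite exprMn.
Qed.

Lemma SV_Z c w w' : W1a w w' ->
  SVa (fun x => c * w x) (fun i x => c * w' i x) = c ^+ 2 * SVa w w'.
Proof.
move=> [Lw _ Lw']; rewrite /SV mulrDr mulr_sumr -(N2Z c Lw); congr (_ + _).
  by congr (N2 ld _); apply/funext => x; rewrite mulrA.
apply: eq_bigr => i _; rewrite -(N2Z c (Lw' i)).
by congr (N2 ld _); apply/funext => x; rewrite mulrA.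
Qed.

Section functional.
Variable l : ('rV[R]_d -> R) -> R.
Hypothesis Hl : W1dual r l.

Lemma dual_lin c w1 w1' w2 w2' : W1a w1 w1' -> W1a w2 w2' ->
  l (fun x => c * w1 x + w2 x) = c * l w1 + l w2.
Proof. by move=> /W1d_W1[h1 _] /W1d_W1[h2 _]; exact: Hl.1. Qed.

Lemma dual_Z c w w' : W1a w w' -> l (fun x => c * w x) = c * l w.
Proof.
move=> h; have l0 : l (fun=> 0) = 0.
  have := dual_lin 1 W1d_0 W1d_0; rewrite (_ : (fun x => _) = (fun=> 0)).
    by rewrite mul1r => /eqP; rewrite -subr_eq0 opprD addrA subrr sub0r oppr_eq0 => /eqP.
  by apply/funext => x; rewrite mul1r addr0.
have := dual_lin c h W1d_0; rewrite l0 addr0 => <-.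
by congr l; apply/funext => x; rewrite addr0.
Qed.

Lemma dual_norm_fin : dual_norm r l = (fine (dual_norm r l))%:E /\ 0 <= fine (dual_norm r l).
Proof.
have [W0 S0] := W1d_W1 W1d_0.
have ge0 : (0 <= dual_norm r l)%E.
  apply: (@le_trans _ _ (`|l (fun=> 0)|)%:E); first by rewrite lee_fin.
  apply: ereal_sup_ubound; exists (fun=> 0) => //; split => //; rewrite S0 lee_fin.
  have z0 : N2 ld (fun x : 'rV[R]_d => 0 * r x) = 0.
    by apply: Rint_eq0 => x; rewrite mul0r expr0n.
  by rewrite /SV z0 big1 ?addr0.
split; last exact: fine_ge0.
by rewrite fineK// ge0_fin_numE//; exact: Hl.2.
Qed.

(** The bound [|l w| <= |l| |w|] follows from homogeneity, and the
    arithmetic-geometric inequality makes it additive in the squares. *)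
Lemma dual_bound w w' e : 0 < e -> W1a w w' ->
  `|l w| <= e * fine (dual_norm r l) ^+ 2 + e^-1 * SVa w w'.
Proof.
move=> e0 h; have [Dfin D0] := dual_norm_fin; set D := fine _ in Dfin D0 *.
apply/ler_addgt0Pr => del del0.
pose S' := SVa w w' + e * del.
have S0 : 0 < S' by rewrite ltr_wpDl ?mulr_gt0// SV_ge0.
pose s := Num.sqrt S'; have s0 : 0 < s by rewrite sqrtr_gt0.
have ss : s ^+ 2 = S' by rewrite sqr_sqrtr// ltW.
have hc := W1d_Z s^-1 h; have [Wc Sc] := W1d_W1 hc.
have : (`|l (fun x => (s^-1 * w x)%R)|%:E <= D%:E)%E.
  rewrite -Dfin; apply: ereal_sup_ubound; exists (fun x => s^-1 * w x) => //; split => //.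
  rewrite Sc lee_fin (SV_Z _ h) exprVn ss mulrC ler_pdivrMr// mul1r /S' lerDl mulr_ge0 ?ltW//.
rewrite (dual_Z _ h) lee_fin normrM ger0_norm ?invr_ge0 ?(ltW s0)// mulrC ler_pdivrMr// => H.
apply: le_trans H _.
have -> : e * D ^+ 2 + e^-1 * SVa w w' + del = e * D ^+ 2 + e^-1 * s ^+ 2.
  by rewrite ss /S' -addrA (mulrDr e^-1 (SVa w w') (e * del)) mulKf ?gt_eqF.
rewrite -(ler_pM2l e0) mulrDr mulVKf ?gt_eqF//.
have := sqr_ge0 (e * D - s); have : 0 <= e * D * s.
  by apply: mulr_ge0; [apply: mulr_ge0 => //; exact: ltW|exact: ltW].
by move=> p1 p2; nra.
Qed.

End functional.
Section ell.
Variables (u : E -> R) (Lam : R -> ('rV[R]_d -> R) -> R).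
Hypothesis HL : dual_dt T r u Lam.
Local Notation W01a := (@W01d R d T alpha).
Local Notation SWa := (@SW R d alpha).
Local Notation NWa := (@NW R d T alpha).

(** For fixed [w] the function [t |-> Lam t w] is measurable; for the slices of a
    function of [t] and [x] measurability has to be proved along with everything
    else. *)
Definition aem (g : R -> R) := exists2 g' : R -> R, measurable_fun setT g' &
  {ae m1, forall t, t \in `[0, T] -> g t = g' t}.

(** The function [t |-> dual_norm r (Lam t)] is not known to be measurable; only
    its integral as a supremum over simple functions is used. *)
Definition D2 t : R := fine (dual_norm r (Lam t)) ^+ 2.
Definition CL : R := fine (\int[m1]_(t in IT) (D2 t)%:E).

Lemma D2_ge0 t : 0 <= D2 t. Proof. exact: sqr_ge0. Qed.

Lemma D2_lty : (\int[m1]_(t in IT) (D2 t)%:E = CL%:E)%E.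
Proof.
rewrite /CL fineK// ge0_fin_numE; last by apply: integral_ge0 => t _; rewrite lee_fin D2_ge0.
have [HW _ + _] := HL; congr (_ < _)%E; apply: eq_integral => t /set_mem tT.
have /HW /dual_norm_fin[-> _] : t \in `[0, T] by [].
by rewrite /D2 EFin_expe.
Qed.

Lemma CL_ge0 : 0 <= CL.
Proof. by apply: fine_ge0; apply: integral_ge0 => t _; rewrite lee_fin D2_ge0. Qed.

Lemma measurable_IT : measurable IT. Proof. exact: measurable_itv. Qed.

Lemma aem_rep g g' : {ae m1, forall t, t \in `[0, T] -> g t = g' t} ->
  \int[m1]_(t in IT) g t = \int[m1]_t (g' t * \1_IT t).
Proof.
move=> H; rewrite (Rint_mul_indic m1 IT g); apply: Rintegral_ae_ext.
apply: filterS H => t h _; rewrite indicE; case: (boolP (t \in IT)) => [/set_mem tT|_]; last by rewrite !mulr0.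
by rewrite h.
Qed.

(** The positive part of [(|g'| - S / e) / e] is measurable and lies below [D2],
    so its integral is at most [CL], and monotonicity of the integral does not
    require that [D2] be measurable. *)
Lemma envelope (g' S : R -> R) e : measurable_fun setT g' -> 0 < e ->
  m1.-integrable setT (EFin \o (fun t => S t * \1_IT t)) ->
  {ae m1, forall t, t \in `[0, T] -> `|g' t| <= e * D2 t + e^-1 * S t} ->
  m1.-integrable setT (EFin \o (fun t => g' t * \1_IT t)) /\
  `|\int[m1]_t (g' t * \1_IT t)| <= e * CL + e^-1 * \int[m1]_t (S t * \1_IT t).
Proof.
move=> mg e0 iS H.
have m1I : measurable_fun setT (\1_IT : R -> R) by apply: measurable_indic; exact: measurable_IT.
have mgI : measurable_fun setT (fun t => g' t * \1_IT t) by exact: measurable_funM.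
have mS := int1_measurable iS.
pose p t : R := Num.max 0 (e^-1 * (`|g' t * \1_IT t| - e^-1 * (S t * \1_IT t))).
have mp : measurable_fun setT p.
  apply: measurable_maxr => //; apply: measurable_funM => //.
  apply: measurable_funB; first exact: measurableT_comp.
  exact: measurable_funM.
have p0 t : 0 <= p t by rewrite le_max lexx.
have ple : (\int[m1]_t (p t)%:E <= CL%:E)%E.
  rewrite -D2_lty [X in (_ <= X)%E]integral_mkcond.
  have -> : (\int[m1]_t (p t)%:E = \int[m1]_t (Num.min (p t) (D2 t * \1_IT t))%:E)%E.
    apply: integral_ae_ext; apply: filterS H => t h _; congr EFin; apply/esym/min_idPl.
    rewrite ge_max mulr_ge0 ?D2_ge0//= indicE; case: (boolP (t \in IT)) => [/set_mem tT|_].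
      rewrite !mulr1 mulrC ler_pdivrMr// lerBlDr mulrC; exact: h.
    by rewrite !mulr0 normr0 subrr mulr0.
  apply: ge0_le_integral_nomeas => t _.
    by rewrite lee_fin le_min p0 mulr_ge0 ?D2_ge0.
  rewrite patchE; case: ifPn => tI; rewrite lee_fin ge_min indicE.
    by rewrite tI mulr1 lexx orbT.
  by rewrite (negbTE tI) mulr0 lexx orbT.
have ip : m1.-integrable setT (EFin \o p).
  apply/integrableP; split; first exact/measurable_EFinP.
  rewrite (eq_integral (fun t => (p t)%:E)) => [|t _]; last by rewrite /= ger0_norm.
  by apply: le_lt_trans ple _; rewrite ltry.
have ib : m1.-integrable setT (EFin \o (fun t => e * p t + e^-1 * (S t * \1_IT t))).
  by apply: int1D; exact: int1Z.
have gle t : `|g' t * \1_IT t| <= e * p t + e^-1 * (S t * \1_IT t).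
  rewrite -lerBlDr; apply: (@le_trans _ _ (e * (e^-1 * (`|g' t * \1_IT t| - e^-1 * (S t * \1_IT t))))).
    by rewrite mulVKf ?gt_eqF.
  by rewrite ler_pM2l// le_max lexx orbT.
have ig := le_integrableT mgI ib gle.
split => //; apply: le_trans (le_Rint_norm ig ib gle) _.
rewrite (RintD (int1Z e ip) (int1Z e^-1 iS)) (RintZ e ip) (RintZ e^-1 iS) lerD2r ler_pM2l//.
by rewrite /Rintegral -lee_fin fineK//; exact: integrable_fin_num ip.
Qed.

(** The time derivative of [u] as a functional on space-time functions. *)
Definition ell (e : E -> R) : R := \int[m1]_(t in IT) Lam t (fun x => e (t, x)).
Definition ellok (e : E -> R) := aem (fun t => Lam t (fun x => e (t, x))).

Lemma Lam_slice e e' eps : 0 < eps -> W01a e e' -> {ae m1, forall t, t \in `[0, T] ->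
  `|Lam t (fun x => e (t, x))| <= eps * D2 t + eps^-1 * SWa e e' t}.
Proof.
move=> eps0 We; apply: filterS (W01d_slices We) => t h tT.
have [HW _ _ _] := HL.
exact: (dual_bound (HW t tT) eps0 (h tT)).
Qed.

Lemma ell_bd e e' eps : 0 < eps -> W01a e e' -> ellok e ->
  `|ell e| <= eps * CL + eps^-1 * NWa e e'.
Proof.
move=> eps0 We [g' mg H]; rewrite /ell (aem_rep H).
have [iS <-] := SW_int We.
apply: (envelope mg eps0 iS _).2.
by apply: filterS2 H (Lam_slice eps0 We) => t h1 h2 tT; rewrite -h1// h2.
Qed.

Lemma ell_int e e' : W01a e e' -> ellok e -> exists2 g' : R -> R,
  m1.-integrable setT (EFin \o (fun t => g' t * \1_IT t)) &
  {ae m1, forall t, t \in `[0, T] -> Lam t (fun x => e (t, x)) = g' t}.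
Proof.
move=> We [g' mg H]; exists g' => //.
have [iS _] := SW_int We.
apply: (envelope mg ltr01 iS _).1.
by apply: filterS2 H (Lam_slice ltr01 We) => t h1 h2 tT; rewrite -h1// h2.
Qed.

Lemma W01d_lin c (e1 : E -> R) e1' (e2 : E -> R) e2' : W01a e1 e1' -> W01a e2 e2' ->
  W01a (fun z => c * e1 z + e2 z) (fun i z => c * e1' i z + e2' i z).
Proof.
have L p q : L2rho_QT T r p -> L2rho_QT T r q -> L2rho_QT T r (fun z => c * p z + q z).
  move=> Lp Lq; apply: L2_trV; first exact: measurable_QT.
  have := L2D (L2Z c (L2_tr (@measurable_QT R d T) Lp)) (L2_tr (@measurable_QT R d T) Lq).
  by congr (L2 _ _ _); apply/funext => z; rewrite /tr !mulrA -mulrDl -mulrDl.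
move=> [a1 b1 c1] [a2 b2 c2]; split; [exact: L| |by move=> i; exact: L].
have [m1' L1] := rho_L2 a1; have [m2' L2'] := rho_L2 a2.
by move=> i; apply: wderivD => //; exact: loc1_L2.
Qed.

Lemma ell_lin c (e1 : E -> R) e1' (e2 : E -> R) e2' : W01a e1 e1' -> W01a e2 e2' ->
  ellok e1 -> ellok e2 -> ellok (fun z => c * e1 z + e2 z) /\
  ell (fun z => c * e1 z + e2 z) = c * ell e1 + ell e2.
Proof.
move=> W1' W2' o1 o2.
have [g1 i1 h1] := ell_int W1' o1; have [g2 i2 h2] := ell_int W2' o2.
have H : {ae m1, forall t, t \in `[0, T] -> Lam t (fun x => c * e1 (t, x) + e2 (t, x)) =
    c * (g1 t * \1_IT t) + g2 t * \1_IT t}.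
  have [HW _ _ _] := HL.
  have s1 := W01d_slices W1'; have s2 := W01d_slices W2'.
  apply: filterS2 (filterI h1 h2) (filterI s1 s2) => t [k1 k2] [w1 w2] tT.
  rewrite (dual_lin (HW t tT) c (w1 tT) (w2 tT)) k1// k2// indicE mem_set ?mulr1//.
split.
  exists (fun t => c * (g1 t * \1_IT t) + g2 t * \1_IT t) => //.
  by apply: int1_measurable (int1D (int1Z c i1) i2).
rewrite /ell (aem_rep H) (aem_rep h1) (aem_rep h2) -(RintZ c i1) -(RintD (int1Z c i1) i2).
by apply: eq_Rintegral => t _; rewrite indicE; case: (_ \in _); rewrite ?mulr1 ?mulr0 ?mulr0 ?addr0.
Qed.

(** Continuity is [ell_bd] for the differences. A subsequence of their slices
    tends to 0 in the energy space for almost every time, hence so do the values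
    of [Lam t], and measurability passes to the limit. *)
Lemma ell_cvg (em : nat -> E -> R) (em' : nat -> 'I_d -> E -> R) (e : E -> R) e' :
  (forall n, W01a (em n) (em' n)) -> W01a e e' -> (forall n, ellok (em n)) ->
  NWa (fun z => em n z - e z) (fun i z => em' n i z - e' i z) @[n --> \oo] --> (0 : R) ->
  ellok e /\ ell (em n) @[n --> \oo] --> ell e.
Proof.
move=> Wm We om cN.
have WB n : W01a (fun z => em n z - e z) (fun i z => em' n i z - e' i z).
  have := W01d_lin (-1) We (Wm n); congr (W01d _ _ _ _).
    by apply/funext => z; rewrite mulN1r addrC.
  by apply/funext => i; apply/funext => z; rewrite mulN1r addrC.
pose A n t := SWa (fun z => em n z - e z) (fun i z => em' n i z - e' i z) t * \1_IT t.
have iA n : m1.-integrable setT (EFin \o A n) := (SW_int (WB n)).1.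
have A0 n t : 0 <= A n t by rewrite mulr_ge0// ?SV_ge0// indicE.
have cA : \int[m1]_t A n t @[n --> \oo] --> (0 : R).
  by rewrite (_ : (fun n => _) = (fun n => NWa (fun z => em n z - e z) (fun i z => em' n i z - e' i z)))//;
     apply/funext => n; exact: (SW_int (WB n)).2.
have [s sn cs] := ae_subseq iA A0 cA.
have oe : ellok e.
  have /choice[g gP] n : exists g' : R -> R, measurable_fun setT g' /\
      {ae m1, forall t, t \in `[0, T] -> Lam t (fun x => em n (t, x)) = g' t}.
    by have [g' a1 a2] := om n; exists g'.
  have ag : {ae m1, forall t n, t \in `[0, T] -> Lam t (fun x => em n (t, x)) = g n t}.
    by apply/ae_foralln => n; case: (gP n).
  have sm : {ae m1, forall t n, t \in `[0, T] -> W1a (fun x => em n (t, x)) (fun i x => em' n i (t, x))}.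
    by apply/ae_foralln => n; exact: W01d_slices.
  have se := W01d_slices We.
  have cv : {ae m1, forall t, t \in `[0, T] -> g (s n) t @[n --> \oo] --> Lam t (fun x => e (t, x))}.
    apply: filterS2 (filterI cs ag) (filterI sm se) => t [ct kg] [km ke] tT.
    have [HW _ _ _] := HL.
    have tI : t \in IT by exact: mem_set.
    rewrite (_ : (fun n => g (s n) t) = (fun n => Lam t (fun x => em (s n) (t, x)))); last first.
      by apply/funext => n; rewrite kg.
    apply/subr_cvg0; apply: cvg0_by_eps => eps eps0.
    have D0 := D2_ge0 t.
    pose del := eps / (2 * (D2 t + 1)).
    have del0 : 0 < del by rewrite divr_gt0// mulr_gt0// ltr_wpDl.
    have cS : A (s n) t @[n --> \oo] --> (0 : R) by exact: ct.
    near=> n.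
    have hA : A (s n) t < del * (eps / 2).
      by near: n; apply: (cvgr_lt _ cS); rewrite mulr_gt0// divr_gt0.
    have := dual_bound (HW t tT) del0 (W1d_lin (-1) (ke tT) (km (s n) tT)).
    rewrite (dual_lin (HW t tT) (-1) (ke tT) (km (s n) tT)) mulN1r addrC -/(D2 t).
    move=> h; apply: le_trans h _.
    have -> : SVa (fun x => -1 * e (t, x) + em (s n) (t, x)) (fun i x => -1 * e' i (t, x) + em' (s n) i (t, x))
        = A (s n) t.
      rewrite /A indicE tI mulr1 /SW; congr (SV _ _ _).
        by apply/funext => x; rewrite mulN1r addrC.
      by apply/funext => i; apply/funext => x; rewrite mulN1r addrC.
    have h1 : del * D2 t <= eps / 2.
      rewrite /del -mulrA [X in _ <= X]mulrC [X in _ <= X]mulrC ler_pM2l// invfM -mulrA.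
      rewrite -[X in _ <= X]mulr1 ler_pM2l ?invr_gt0// mulrC ler_pdivrMr ?mul1r ?lerDl//.
      by rewrite ltr_wpDl.
    have h2 : del^-1 * A (s n) t <= eps / 2.
      by rewrite mulrC ler_pdivrMr// mulrC ltW.
    by apply: le_trans (lerD h1 h2) _; rewrite -splitr.
  have [N [mN N0 HN]] := filterI cv (@filterT _ _ _ : {ae m1, forall t, True}).
  have mNC : measurable (IT `\` N) by apply: measurableD => //; exact: measurable_IT.
  exists (fun t => Lam t (fun x => e (t, x)) * \1_(IT `\` N) t).
    apply: (@measurable_fun_cvg _ _ _ setT (fun n t => g (s n) t * \1_(IT `\` N) t)).
      by move=> n; apply: measurable_funM; [case: (gP (s n))|exact: measurable_indic].
    move=> t _; rewrite indicE; case: (boolP (t \in IT `\` N)) => [/set_mem[tI tN]|_].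
      under eq_fun do rewrite mulr1.
      rewrite mulr1; have : ~ ~ ((t \in `[0, T] -> g (s n) t @[n --> \oo] --> Lam t (fun x => e (t, x))) /\ True).
        by move=> nh; apply: tN; exact: HN.
      by move=> /contrapT[h _]; exact: h.
    under eq_fun do rewrite mulr0.
    by rewrite mulr0; exact: cvg_cst.
  exists N; split => // t /= nh; apply: contrapT => tN; apply: nh => tT.
  by rewrite indicE mem_set ?mulr1.
split => //.
apply/subr_cvg0; apply: cvg0_by_eps => eps eps0.
have C0 := CL_ge0.
pose del := eps / (2 * (CL + 1)).
have del0 : 0 < del by rewrite divr_gt0// mulr_gt0// ltr_wpDl.
near=> n.
have hA : NWa (fun z => em n z - e z) (fun i z => em' n i z - e' i z) < del * (eps / 2).
  by near: n; apply: (cvgr_lt _ cN); rewrite mulr_gt0// divr_gt0.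
have [ob obE] := ell_lin (-1) We (Wm n) oe (om n).
have eqE : (fun z => -1 * e z + em n z) = (fun z => em n z - e z).
  by apply/funext => z; rewrite mulN1r addrC.
rewrite eqE in ob obE.
have := ell_bd del0 (WB n) ob; rewrite obE mulN1r addrC => h; apply: le_trans h _.
have h1 : del * CL <= eps / 2.
  rewrite /del -mulrA [X in _ <= X]mulrC [X in _ <= X]mulrC ler_pM2l// invfM -mulrA.
  rewrite -[X in _ <= X]mulr1 ler_pM2l ?invr_gt0// mulrC ler_pdivrMr ?mul1r ?lerDl//.
  by rewrite ltr_wpDl.
have h2 : del^-1 * NWa (fun z => em n z - e z) (fun i z => em' n i z - e' i z) <= eps / 2.
  by rewrite mulrC ler_pdivrMr// mulrC ltW.
by apply: le_trans (lerD h1 h2) _; rewrite -splitr.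
Unshelve. all: by end_near. Qed.

End ell.
End dual.

(** * The functional on averages *)

Section convolution_L2.
Context {R : realType} {d : nat}.
Local Notation E := (R * 'rV[R]_d)%type.
Local Notation mQ := (@lebQ R d).
Local Notation int1 f := (mQ.-integrable setT (EFin \o f)).
Local Notation L2T := (L2 mQ setT).

Lemma sq_le_of_eps (x a b : R) : 0 <= x -> 0 < a -> 0 <= b ->
  (forall e, 0 < e -> x <= e * a + e^-1 * b) -> x ^+ 2 <= 4 * a * b.
Proof.
move=> x0 a0 b0 h; have [->|xn] := eqVneq x 0.
  by rewrite expr0n !mulr_ge0// ltW.
have xp : 0 < x by rewrite lt_neqAle eq_sym xn.
have e0 : 0 < x / (2 * a) by rewrite divr_gt0// mulr_gt0.
have := h _ e0; have -> : x / (2 * a) * a = x / 2 by field; rewrite gt_eqF.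
have -> : (x / (2 * a))^-1 * b = 2 * a * b / x by field; rewrite ?xn ?gt_eqF.
move=> H; have {}H : x / 2 <= 2 * a * b / x by lra.
have : x / 2 * x <= 2 * a * b by rewrite -ler_pdivlMr.
by move=> H2; rewrite expr2; lra.
Qed.

Lemma convD (k M c : R) (K f g : E -> R) : continuous K -> bsupp k K -> Lb M f -> Lb M g ->
  conv K (fun z => c * f z + g z) = (fun z => c * conv K f z + conv K g z).
Proof.
move=> cK bK Lf Lg; apply/funext => z; rewrite /conv.
have i1 := conv_int1 z cK bK (Lb_int1 Lf); have i2 := conv_int1 z cK bK (Lb_int1 Lg).
rewrite -(RintZ c i1) -(RintD (int1Z c i1) i2).
by apply: eq_Rintegral => y _; rewrite mulrDr mulrCA.
Qed.

Lemma conv_bsupp (k M : R) (K g : E -> R) : bsupp k K -> bsupp M g -> bsupp (k + M) (conv K g).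
Proof.
move=> bK bg z zk; apply: (conv_supp (A := [set y | `|y| <= M]) bK).
  by move=> y /negP; rewrite -ltNge; exact: bg.
move=> y /= yM; have := lerB_normD z (- y); rewrite normrN.
have := lerB_dist z y => h1 h2; lra.
Qed.

(** By [int_mul_le], since [K (z - y)] is square integrable over the ball
    uniformly in [z]. *)
Lemma conv_sup (k M : R) (K : E -> R) : continuous K -> bsupp k K ->
  exists2 C, 0 <= C & forall g z, Lb M g -> conv K g z ^+ 2 <= C * N2 mQ g.
Proof.
move=> cK bK; have [C0 C00 hC] := cs_bounded E_balls_compact cK bK.
pose I : E -> R := \1_[set y | `|y| <= M].
have LI : L2T I := L2_indic (measurable_ballE M) (ball_fin M).
exists (4 * (C0 ^+ 2 * N2 mQ I + 1)); first by rewrite mulr_ge0// addr_ge0// mulr_ge0 ?sqr_ge0 ?N2_ge0.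
move=> g z Lg; rewrite -real_normK ?num_real//; apply: sq_le_of_eps => //; first by rewrite ltr_wpDl// mulr_ge0 ?sqr_ge0 ?N2_ge0.
  exact: N2_ge0.
move=> e e0; rewrite /conv.
have LK : L2T (fun y => K (z - y) * I y).
  apply: (L2M (C := C0) LI); last by move=> y; exact: hC.
  by apply: cts_measurable_E => y; apply: (@continuous_comp _ _ _ (fun y : E => z - y) K);
    [exact: sub_cts|exact: cK].
have -> : (fun y => K (z - y) * g y) = (fun y => K (z - y) * I y * g y).
  apply/funext => y; rewrite /I indicE; case: (boolP (y \in _)) => [_|/negP h]; first by rewrite mulr1.
  rewrite (proj2 Lg) ?mulr0// ltNge; apply/negP => yM; apply: h; exact: mem_set.
apply: le_trans (int_mul_le e0 LK (proj1 Lg)) _; rewrite lerD2r ler_pM2l//.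
apply: le_trans (N2M (C := C0) LI _ _) _.
- by apply: cts_measurable_E => y; apply: (@continuous_comp _ _ _ (fun y : E => z - y) K);
    [exact: sub_cts|exact: cK].
- by move=> y; exact: hC.
by rewrite lerDl.
Qed.

Lemma conv_Lb (k M : R) (K g : E -> R) : continuous K -> bsupp k K -> Lb M g ->
  Lb (k + M) (conv K g).
Proof.
move=> cK bK Lg; have bc := conv_bsupp bK (proj2 Lg); split => //.
by apply: cs_L2 bc; exact: conv_cts cK bK (Lb_int1 Lg).
Qed.

Lemma conv_L2cv (k M : R) (K : E -> R) fs f : continuous K -> bsupp k K ->
  (forall n, Lb M (fs n)) -> Lb M f -> L2cv mQ fs f -> L2cv mQ (fun n => conv K (fs n)) (conv K f).
Proof.
move=> cK bK Ln L0 [_ _ c0]; have [C C0 hC] := conv_sup M cK bK.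
pose V := fine (mQ [set z : E | `|z| <= k + M]).
have LB n : Lb M (fun z => -1 * f z + fs n z) by apply: LbD (Ln n); exact: LbZ.
have EB n : (fun z => -1 * f z + fs n z) = (fun z => fs n z - f z).
  by apply/funext => z; rewrite mulN1r addrC.
apply: (L2cv_le (e := fun n => C * N2 mQ (fun z => fs n z - f z) * V)).
- by move=> n; exact: (conv_Lb cK bK (Ln n)).1.
- exact: (conv_Lb cK bK L0).1.
- move=> n; rewrite -EB.
  have -> : (fun z => conv K (fs n) z - conv K f z) = conv K (fun z => -1 * f z + fs n z).
    by rewrite (convD (-1) cK bK L0 (Ln n)); apply/funext => z; rewrite mulN1r addrC.
  have Lc := conv_Lb cK bK (LB n).
  have [_ h] : int1 (fun z => conv K (fun z => -1 * f z + fs n z) z ^+ 2) /\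
     `|\int[mQ]_z (conv K (fun z => -1 * f z + fs n z) z ^+ 2)| <= C * N2 mQ (fun z => -1 * f z + fs n z) * V.
    apply: bsupp_int.
    - by apply: measurable_funX; exact: (proj1 (proj1 Lc)).
    - by move=> z zM; rewrite (proj2 Lc z zM) expr0n.
    - by move=> z; rewrite ger0_norm ?sqr_ge0//; exact: hC.
  exact: le_trans (ler_norm _) h.
rewrite (_ : 0 = C * 0 * V); last by rewrite mulr0 mul0r.
by apply: cvgMl; apply: cvgMr.
Qed.

End convolution_L2.

Section tensor.
Context {R : realType} {d : nat}.
Local Notation E := (R * 'rV[R]_d)%type.
Local Notation mQ := (@lebQ R d).
Local Notation ld := (@leb R d).
Local Notation m1 := (@leb1 R).
Local Notation int1 f := (mQ.-integrable setT (EFin \o f)).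
Local Notation iR f := (ld.-integrable setT (EFin \o f)).

Lemma sub_cts_gen (V : normedModType R) (z : V) : continuous (fun y : V => z - y).
Proof. by move=> y; apply: cvgB; [exact: cvg_cst|exact: cvg_id]. Qed.

Lemma mul_cts (V : normedModType R) (f g : V -> R) : continuous f -> continuous g ->
  continuous (fun x => f x * g x).
Proof. by move=> cf cg x; apply: cvgM; [exact: cf|exact: cg]. Qed.

(** The kernel and the bump are products, and so is their convolution by
    Fubini. *)
Lemma bump_tensor m k (a b : E) : 0 < k -> exists (G : R -> R) (H : 'rV[R]_d -> R),
  J m (bE k a b) = fun z => G z.1 * H z.2.
Proof.
move=> k0; pose e : R := en m; pose c := (\int[mQ]_y kap0 e y)^-1.
have e0 : 0 < e := en_gt0 m.
exists (fun t => c * \int[m1]_s (bt 1 (- e) e (t - s) * bt k a.1 b.1 s)).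
exists (fun x => \int[ld]_y (bx 1 (const_mx (- e)) (const_mx e) (x - y) * bx k a.2 b.2 y)).
apply/funext => z; rewrite /J /conv.
have ib : int1 (bE k a b) by apply: (cs_int1 (M := `|a| + `|b|)); [exact: bE_cts|exact: bE_bsupp].
have [_ _ ->] := Fubini_R (J_int1 m z ib).
pose p s := bt 1 (- e) e (z.1 - s) * bt k a.1 b.1 s.
pose w y := bx 1 (const_mx (- e)) (const_mx e) (z.2 - y) * bx k a.2 b.2 y.
have ip : m1.-integrable setT (EFin \o p).
  apply: (int1_bounded (C := 1) (bt_int1 a.1 b.1 k0)).
    apply: (measurableT_comp (f := bt 1 (- e) e)).
      exact: (continuous_measurable_fun (smooth_cts (bt_smooth 1 (- e) e))).
    exact: measurable_funB.
  by move=> s; rewrite ger0_norm ?bt_ge0// bt_le1.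
have iw : iR w.
  apply: (rV_cs_int1 (M := `|a.2| + `|b.2|)).
    have s1 : smooth (fun y : 'rV[R]_d => bx 1 (const_mx (- e)) (const_mx e) (z.2 - y)).
      apply: (@smooth_affine_comp _ _ _ (fun y => z.2 - y) (fun v => - v) _ _ _ (bx_smooth _ _ _)).1.
        exact: sub_cts_gen.
      by move=> h x v; rewrite opprD scalerN addrA addrC addrA [- _ + z.2]addrC addrC addrA.
    exact: (smooth_cts (smooth_mul s1 (bx_smooth _ _ _))).
  by move=> y yM; rewrite /w (bx_bsupp k0 yM) mulr0.
rewrite -mulrA -[X in _ = c * X]/(\int[m1]_s p s * \int[ld]_y w y).
rewrite [X in _ = c * X]mulrC -(RintZ (\int[ld]_y w y) ip).
have iq : m1.-integrable setT (EFin \o (fun s => \int[ld]_y w y * p s)) by exact: int1Z.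
rewrite -(RintZ c iq); apply: eq_Rintegral => s _.
transitivity (\int[ld]_y ((c * p s) * w y)); last by rewrite (RintZ _ iw) -mulrA [p s * _]mulrC.
apply: eq_Rintegral => y _; rewrite /kap /kap0 /bE /cube /= /p /w -/c.
by rewrite -/e; ring.
Qed.

End tensor.

Section identity.
Context {R : realType} {d : nat}.
Local Notation E := (R * 'rV[R]_d)%type.
Local Notation mQ := (@lebQ R d).
Local Notation ld := (@leb R d).
Local Notation m1 := (@leb1 R).
Local Notation int1 f := (mQ.-integrable setT (EFin \o f)).
Local Notation iR f := (ld.-integrable setT (EFin \o f)).
Local Notation L2T := (L2 mQ setT).
Variables (T alpha : R).
Hypothesis T_gt0 : 0 < T.
Hypothesis alpha_ge0 : 0 <= alpha.
Local Notation r := (@varrho R d alpha).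
Local Notation IT := (`[0, T]%classic : set R).
Local Notation W01a := (@W01d R d T alpha).
Local Notation NWa := (@NW R d T alpha).
Local Notation W1a := (@W1d R d alpha).
Local Notation qV := (@pw R d (alpha * 2)).

Lemma smooth_W1d M (W : 'rV[R]_d -> R) : smooth W -> bsupp M W ->
  W1a W (fun i => 'D_(delta_mx 0 i) W).
Proof.
move=> sW bW.
have L (p : 'rV[R]_d -> R) : continuous p -> bsupp M p -> L2rho r p.
  move=> cp bp; have [sr _] := smooth_slice_x 0 (@pw_smooth R d (- alpha)).
  have er : (fun x => pw (- alpha) ((0, x) : E)) = r by apply/funext => x; rewrite (varrhoE alpha ((0, x) : E)).
  rewrite er in sr; have cr := smooth_cts sr.
  have cpr : continuous (fun x => p x * r x) by exact: mul_cts.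
  apply: L2_of_sq; first exact: cts_measurable_rV.
  apply: (rV_cs_int1 (M := M)); last by move=> x xM; rewrite bp// mul0r expr0n.
  have cpr2 : continuous (fun x => p x * r x * (p x * r x)).
    exact: mul_cts.
  exact: cpr2.
split; [exact: L (smooth_cts sW) bW| |].
- move=> i; split.
  + exact: cts_measurable_rV (smooth_cts (smoothD _ sW)).
  + move=> K cK; have mK := compact_measurable_rV cK.
    apply: integrableS (rV_cs_int1 (smooth_cts (smoothD (delta_mx 0 i) sW)) (bsuppD _ bW)) => //.
  + by move=> psi /test_rV[sp [N bp]]; exact: rV_by_parts sW sp bp.
- by move=> i; apply: L; [exact: smooth_cts (smoothD _ sW)|exact: bsuppD].
Qed.

Lemma rho_smooth : smooth (fun z : E => r z.2).
Proof.
have -> : (fun z : E => r z.2) = pw (- alpha) by apply/funext => z; rewrite varrhoE.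
exact: pw_smooth.
Qed.

Lemma smooth_W01d M (eta : E -> R) : smooth eta -> bsupp M eta ->
  W01a eta (fun i => 'D_(dirx i) eta).
Proof.
move=> se be.
have L (p : E -> R) : smooth p -> bsupp M p -> L2rho_QT T r p.
  move=> sp bp; apply: (L2_sub (@measurable_QT R d T) measurableT) => //.
  apply: (cs_L2 (M := M)); first exact: (smooth_cts (smooth_mul sp rho_smooth)).
  by move=> z zM; rewrite bp// mul0r.
split; [exact: L| |] => i; first exact: wderiv_smooth.
by apply: L; [exact: smoothD|exact: bsuppD].
Qed.

Lemma tr_mul_cvg M (p : E -> R) (gs : nat -> E -> R) (g : E -> R) : continuous p ->
  (forall n, bsupp M (gs n)) -> bsupp M g -> L2cv mQ gs g ->
  L2cv mQ (fun n => tr (QT T) (fun z => p z * gs n z)) (tr (QT T) (fun z => p z * g z)).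
Proof.
move=> cp bs bg cg.
have cB1 : compact [set z : E | `|z| <= M] by exact: E_balls_compact.
pose I : E -> R := \1_(QT T `&` [set z | `|z| <= M]).
have mI : measurable_fun setT I.
  by apply: measurable_indic; apply: measurableI; [exact: measurable_QT|exact: measurable_ballE].
have [C C0 hC] := compact_cts_bounded cB1 (continuous_subspaceT cp).
have E1 (q : E -> R) : bsupp M q -> tr (QT T) (fun z => p z * q z) = (fun z => p z * I z * q z).
  move=> bq; apply/funext => z; rewrite /tr /I !indicE in_setI.
  have [zM|Mz] := leP `|z| M; last by rewrite bq// !mulr0 mul0r.
  have zI : z \in [set z0 : E | `|z0| <= M] by exact: mem_set.
  by rewrite zI andbT mulrAC.
rewrite (E1 _ bg); under eq_fun do rewrite (E1 _ (bs _)).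
apply: (L2cvM (C := C) cg); first by apply: measurable_funM => //; exact: cts_measurable_E.
move=> z; rewrite normrM /I indicE in_setI.
have [zM|Mz] := boolP (z \in [set z | `|z| <= M]).
  rewrite andbT; case: (z \in QT T); rewrite ?normr1 ?normr0 ?mulr1 ?mulr0//.
  by apply: hC; exact: set_mem zM.
by rewrite andbF normr0 mulr0.
Qed.

Lemma NW_cvg (em : nat -> E -> R) (em' : nat -> 'I_d -> E -> R) (e : E -> R) e' :
  L2cv mQ (fun n => tr (QT T) (fun z => em n z * r z.2)) (tr (QT T) (fun z => e z * r z.2)) ->
  (forall i, L2cv mQ (fun n => tr (QT T) (fun z => em' n i z * r z.2)) (tr (QT T) (fun z => e' i z * r z.2))) ->
  NWa (fun z => em n z - e z) (fun i z => em' n i z - e' i z) @[n --> \oo] --> (0 : R).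
Proof.
have H (p : nat -> E -> R) (q : E -> R) :
    L2cv mQ (fun n => tr (QT T) (fun z => p n z * r z.2)) (tr (QT T) (fun z => q z * r z.2)) ->
    N2 mQ (tr (QT T) (fun z => (p n z - q z) * r z.2)) @[n --> \oo] --> (0 : R).
  move=> [_ _ h]; apply: cvg_trans h; apply: near_eq_cvg; near=> n.
  by congr (N2 mQ _); apply/funext => z; rewrite /tr mulrBl mulrBl.
move=> h1 h2; have -> : (0 : R) = 0 + \sum_(i < d) (0 : R) by rewrite big1 ?addr0.
apply: cvgD; first exact: H.
by apply: cvg_big => [|i _]; [exact: add_continuous|exact: H].
Unshelve. all: by end_near. Qed.

Variables (u : E -> R) (Lam : R -> ('rV[R]_d -> R) -> R).
Hypothesis Wu : W01 T r u.
Hypothesis HL : dual_dt T r u Lam.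
Local Notation ell := (@ell R d T Lam).
Local Notation ellok := (@ellok R d T Lam).

Lemma qVr (z : E) : qV z * (r z.2 * r z.2) = 1.
Proof. by rewrite -expr2 varrho_sqr -[X in pw X z * _]opprK; exact: pwV. Qed.

Section fixed_box.
Variable B : set E.
Hypothesis cB : compact B.
Hypothesis BQ : B `<=` oQT T.

Let LuB : L2 mQ B u.
Proof. by case: (W01_facts Wu) => _ Lu _ _; apply: Lu => // z /BQ /oQT_QT. Qed.

(** For [F = G(t) H(x)] this is the definition of the time derivative: [Lam t]
    applied to the slice of [F / rho^2] is a function of time alone times [Lam t
    (H / rho^2)]. The factors themselves need not be smooth, so they are replaced
    by slices of [F], through [F(t, x) = F(t, x0) F(t0, x) / F(t0, x0)]. *)
Lemma tensor_identity (F : E -> R) (G : R -> R) (H : 'rV[R]_d -> R) : smooth F ->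
  (forall z, F z = G z.1 * H z.2) -> (forall z, ~ B z -> F z = 0) ->
  ellok (fun z => F z * qV z) /\
  \int[mQ]_z (tr B u z * 'D_dirt F z) = - ell (fun z => F z * qV z).
Proof.
move=> sF FE F0.
have [z0 z0P] : exists z0, forall z, F z = F (z.1, z0.2) / F z0 * F (z0.1, z.2).
  have [[z0 nz]|h] := pselect (exists z0, F z0 != 0); last first.
    have Fz z : F z = 0 by apply: contrapT => /eqP Fz; apply: h; exists z.
    by exists (0, 0) => z; rewrite !Fz mulr0.
  exists z0 => z; move: nz; rewrite !FE /= => nz.
  have [g0 h0] : G z0.1 != 0 /\ H z0.2 != 0 by move: nz; rewrite mulf_eq0 negb_or => /andP.
  by field; rewrite g0 h0.
pose psi t : R := (F z0)^-1 * F (t, z0.2).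
have [sFq Dq] := smooth_slice_x z0.1 (smooth_mul sF (@pw_smooth R d (alpha * 2))).
pose W x := F (z0.1, x) * qV (z0.1, x).
have [st Dt] := smooth_slice_t z0.2 sF.
have sc : smooth (cst (F z0)^-1 : R -> R) by exact: smooth_cst.
have spsi : smooth psi := smooth_mul sc st.
have qE t x : qV (t, x) = qV (z0.1, x) by [].
have FW t x : F (t, x) * qV (t, x) = psi t * W x.
  by rewrite z0P /psi /W (qE t x) mulrA [(F z0)^-1 * _]mulrC.
have [M bF] := off_bsupp cB F0.
have bW : bsupp M W.
  by move=> x xM; rewrite /W bF ?mul0r// E_normE lt_max xM orbT.
have WW := smooth_W1d sFq bW; have [W1W _] := W1d_W1 WW.
have tpsi : test_fun `]0, T[%classic psi.
  split=> //; exists (fst @` B); split.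
  - apply: continuous_compact => //; apply: continuous_subspaceT; exact: E_fst_cts.
  - by move=> _ [z /BQ /oQTP h <-]; rewrite /= in_itv.
  - move=> t nt; rewrite /psi (F0 (t, z0.2)) ?mulr0// => Bt; apply: nt; by exists (t, z0.2).
have [HW mL _ HD] := HL.
have mLW := mL W W1W.
have eE t : t \in `[0, T] -> Lam t (fun x => F (t, x) * qV (t, x)) = psi t * Lam t W.
  move=> tT; rewrite (_ : (fun x => _) = (fun x => psi t * W x)); last by apply/funext => x; exact: FW.
  exact: (dual_Z (HW t tT) _ WW).
split.
  exists (fun t => psi t * (Lam t W * \1_IT t)).
    apply: measurable_funM; first exact: continuous_measurable_fun (smooth_cts spsi).
    have /(measurable_restrictT _ (measurable_IT T)) := mLW.
    congr (measurable_fun _ _); apply/funext => t; rewrite patchE indicE.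
    by case: ifP => _; rewrite ?mulr1 ?mulr0.
  apply: nearW => t tT; rewrite eE// indicE mem_set ?mulr1//.
have -> : ell (fun z => F z * qV z) = \int[m1]_(t in IT) (psi t * Lam t W).
  by apply: eq_Rintegral => t /set_mem tT; exact: eE.
rewrite -HD//.
have DF z : 'D_dirt F z = 'D_1 psi z.1 * (W z.2 * r z.2 ^+ 2).
  have [sx Dx] := smooth_slice_t z.2 sF.
  rewrite [z in LHS]surjective_pairing -Dx.
  have -> : (fun t : R => F (t, z.2)) = (fun t => W z.2 * r z.2 ^+ 2 * psi t).
    apply/funext => t; rewrite [RHS]mulrC mulrA -FW -mulrA expr2.
    by rewrite (qVr ((t, z.2) : E)) mulr1.
  have sc2 : smooth (cst (W z.2 * r z.2 ^+ 2) : R -> R) by exact: smooth_cst.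
  rewrite (derive_mul _ _ sc2 spsi) [X in _ + X]mulrC.
  have -> : 'D_1 (cst (W z.2 * r z.2 ^+ 2) : R -> R) z.1 = 0 by exact: derive_cst.
  by rewrite mul0r addr0 mulrC.
have trB : (fun z => tr B u z * 'D_dirt F z) = tr (QT T) (fun z => u z * 'D_dirt F z).
  apply/funext => z; have [Bz|nB] := pselect (B z).
    by rewrite !trE//; apply: oQT_QT; exact: BQ.
  rewrite tr_out// mul0r /tr (deriv_off dirt (compact_closed (@norm_hausdorff _ _) cB) F0 nB).
  by rewrite mulr0 mul0r.
have trBz z : tr B u z * 'D_dirt F z = tr (QT T) (fun z => u z * 'D_dirt F z) z := congr1 (@^~ z) trB.
have iu : int1 (fun z => tr B u z * 'D_dirt F z).
  apply: mul_integrable; first by apply: L2_tr; [exact: compact_measurable_E|].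
  by apply: (cs_L2 (M := M)); [exact: smooth_cts (smoothD _ sF)|exact: bsuppD].
have [_ _ ->] := Fubini_R iu.
rewrite (Rint_mul_indic m1 IT).
apply: Rintegral_ae_ext.
have := W01d_slices (W01_W01d Wu); apply: filterS => t ws _.
rewrite indicE; case: (boolP (t \in IT)) => [tI|tI]; last first.
  rewrite mulr0; apply: Rint_eq0 => x; rewrite trBz tr_section indicE (negbTE tI) mulr0 //.
rewrite mulr1; have [Lut _ _] := ws (set_mem tI).
have iuw : iR (fun x => u (t, x) * W x * r x ^+ 2).
  have [LW _ _] := WW; have := mul_integrable Lut LW.
  by congr (_.-integrable _ (_ \o _)); apply/funext => x; rewrite expr2 mulrACA.
rewrite -(RintZ _ iuw); apply: eq_Rintegral => x _.
rewrite trBz tr_section indicE tI mulr1 DF /=.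
by rewrite mulrCA !mulrA.
Qed.

Variables (m : nat) (a0 b0 : E).
Hypothesis thick : forall z y, box a0 b0 z -> `|z - y| <= en m -> B y.
Let M0 := `|a0| + `|b0|.

Lemma DJE v (g : E -> R) : Lb M0 g -> 'D_v (J m g) = conv ('D_v (kap (en m))) g.
Proof.
move=> Lg; apply/funext => z.
by have [_ ->] := conv_is_derive v z (kap_smooth _) (kap_bsupp (en_gt0 m)) (Lb_int1 Lg).
Qed.

Let JB (g : E -> R) : (forall z, ~ box a0 b0 z -> g z = 0) -> forall z, ~ B z -> J m g z = 0.
Proof.
move=> g0 z nB; apply: (J_supp (A := box a0 b0) g0) => y yb.
by rewrite ltNge; apply/negP => h; apply: nB; apply: (thick yb); rewrite distrC.
Qed.

Let bJ (g : E -> R) : Lb M0 g -> bsupp (M0 + 1) (J m g).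
Proof. by move=> [_ h]; exact: J_bsupp. Qed.

Let sJ (g : E -> R) : Lb M0 g -> smooth (J m g).
Proof. by move=> Lg; apply: J_smooth; exact: Lb_int1 Lg. Qed.

Let bx_off (g : E -> R) : L2T g -> (forall z, ~ box a0 b0 z -> g z = 0) -> Lb M0 g.
Proof.
move=> Lg g0; split => // z zM; apply: g0 => /box_bounded.
by rewrite leNgt zM.
Qed.

Let JV (g : E -> R) z := J m g z * qV z.
Let JV' (g : E -> R) i z := J m g z * 'D_(dirx i) qV z + qV z * 'D_(dirx i) (J m g) z.

Lemma JV_W01 (g : E -> R) : Lb M0 g -> W01a (JV g) (JV' g).
Proof.
move=> Lg; have sq := @pw_smooth R d (alpha * 2).
have := smooth_W01d (smooth_mul (sJ Lg) sq) (_ : bsupp (M0 + 1) _).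
have bq : bsupp (M0 + 1) (fun z => J m g z * qV z) by move=> z zM; rewrite (bJ Lg)// mul0r.
move=> /(_ bq); congr (W01d _ _ _ _); apply/funext => i; apply/funext => z.
exact: (derive_mul _ _ (sJ Lg) sq).
Qed.

Lemma JV_lin c (f g : E -> R) : Lb M0 f -> Lb M0 g ->
  JV (fun z => c * f z + g z) = (fun z => c * JV f z + JV g z).
Proof.
move=> Lf Lg; apply/funext => z; rewrite /JV /J.
rewrite (convD c (smooth_cts (kap_smooth _)) (kap_bsupp (en_gt0 m)) Lf Lg).
by rewrite mulrDl mulrA.
Qed.

Lemma JV_cvg (fs : nat -> E -> R) (f : E -> R) : (forall n, Lb M0 (fs n)) -> Lb M0 f -> L2cv mQ fs f ->
  NWa (fun z => JV (fs n) z - JV f z) (fun i z => JV' (fs n) i z - JV' f i z) @[n --> \oo] --> (0 : R).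
Proof.
move=> Ln L0 cf.
have cK := smooth_cts (kap_smooth (en m) (R := R) (d := d)).
have bK := kap_bsupp (en_gt0 m) (R := R) (d := d).
have cJ : L2cv mQ (fun n => J m (fs n)) (J m f) := conv_L2cv cK bK Ln L0 cf.
have cD v : L2cv mQ (fun n => 'D_v (J m (fs n))) ('D_v (J m f)).
  have := conv_L2cv (smooth_cts (smoothD v (kap_smooth (en m)))) (bsuppD v bK) Ln L0 cf.
  by rewrite -DJE//; under eq_fun do rewrite -DJE//.
have G (p : E -> R) (gs : nat -> E -> R) (g : E -> R) : continuous p ->
    (forall n, bsupp (M0 + 1) (gs n)) -> bsupp (M0 + 1) g -> L2cv mQ gs g ->
    L2cv mQ (fun n => tr (QT T) (fun z => p z * gs n z)) (tr (QT T) (fun z => p z * g z)).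
  exact: tr_mul_cvg.
have sq := @pw_smooth R d (alpha * 2).
apply: NW_cvg.
  have := G _ _ _ (smooth_cts (smooth_mul sq rho_smooth)) (fun n => bJ (Ln n)) (bJ L0) cJ.
  by congr (L2cv _ _ _); [apply/funext => n|]; congr tr; apply/funext => z; rewrite /JV mulrC mulrA.
move=> i.
have h1 := G _ _ _ (smooth_cts (smooth_mul (smoothD (dirx i) sq) rho_smooth)) (fun n => bJ (Ln n)) (bJ L0) cJ.
have h2 := G _ _ _ (smooth_cts (smooth_mul sq rho_smooth)) (fun n => bsuppD (dirx i) (bJ (Ln n))) (bsuppD (dirx i) (bJ L0)) (cD (dirx i)).
have := L2cvD h1 h2.
by congr (L2cv _ _ _); [apply/funext => n|]; apply/funext => z; rewrite /tr /JV'; ring.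
Qed.

(** Both sides are continuous in [g], as [J m] maps square integrable functions
    continuously into the energy space. So [bump_L2_ind] reduces to bumps, whose
    averages are tensor products. *)
Lemma mollified_identity (g : E -> R) : L2T g -> (forall z, ~ box a0 b0 z -> g z = 0) ->
  ellok (fun z => J m g z * qV z) /\
  \int[mQ]_z (tr B u z * 'D_dirt (J m g) z) = - ell (fun z => J m g z * qV z).
Proof.
pose P g := [/\ Lb M0 g, (forall z, ~ box a0 b0 z -> g z = 0), ellok (JV g) &
  \int[mQ]_z (tr B u z * 'D_dirt (J m g) z) = - ell (JV g)].
have LtrB : L2T (tr B u) by apply: L2_tr => //; exact: compact_measurable_E.
have LD v g' : Lb M0 g' -> L2T ('D_v (J m g')).
  by move=> Lg; apply: (cs_L2 (M := M0 + 1)); [exact: smooth_cts (smoothD v (sJ Lg))|exact: bsuppD (bJ Lg)].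
suff H : L2T g -> (forall z, ~ box a0 b0 z -> g z = 0) -> P g.
  by move=> Lg g0; have [_ _ h1 h2] := H Lg g0.
apply: (@bump_L2_ind R d a0 b0 P).
- move=> k a b ab.
  have k0 : 0 < k.+1%:R :> R by rewrite ltr0n.
  have off z : ~ box a0 b0 z -> bE k.+1%:R a b z = 0.
    by move=> nz; apply: bE_out => // /ab.
  have Lb0 : Lb M0 (bE k.+1%:R a b).
    by apply: bx_off => //; apply: (cs_L2 (M := `|a| + `|b|)); [exact: bE_cts|exact: bE_bsupp].
  have [G [H GH]] := bump_tensor m a b k0.
  have [h1 h2] := @tensor_identity (J m (bE k.+1%:R a b)) G H (sJ Lb0) (fun z => congr1 (@^~ z) GH) (JB off).
  by split.
- move=> c f g' [Lf f0 okf ef] [Lg g0 okg eg].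
  have [h1 h2] := ell_lin HL c (JV_W01 Lf) (JV_W01 Lg) okf okg.
  split.
  + by apply: LbD => //; exact: LbZ.
  + by move=> z nz; rewrite f0// g0// mulr0 addr0.
  + by rewrite JV_lin.
  rewrite JV_lin// h2 opprD -mulrN -ef -eg.
  have i1 := mul_integrable LtrB (LD dirt _ Lf); have i2 := mul_integrable LtrB (LD dirt _ Lg).
  rewrite -(RintZ c i1) -(RintD (int1Z c i1) i2); apply: eq_Rintegral => z _.
  have DJz v0 (q : E -> R) (Lq : Lb M0 q) := congr1 (@^~ z) (DJE v0 Lq).
  rewrite (DJz dirt _ (LbD (LbZ c Lf) Lg)) (DJz dirt _ Lf) (DJz dirt _ Lg).
  rewrite (convD c (smooth_cts (smoothD dirt (kap_smooth _))) (bsuppD dirt (kap_bsupp (en_gt0 m))) Lf Lg).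
  by rewrite mulrDr mulrCA.
- move=> fs f Pn _ f0 cf.
  have Ln n : Lb M0 (fs n) by case: (Pn n).
  have L0 : Lb M0 f by apply: bx_off => //; case: cf.
  have [ok cl] := ell_cvg HL (fun n => JV_W01 (Ln n)) (JV_W01 L0) (fun n => let: And4 _ _ o _ := Pn n in o)
     (JV_cvg Ln L0 cf).
  split => //.
  have cD : L2cv mQ (fun n => 'D_dirt (J m (fs n))) ('D_dirt (J m f)).
    have := conv_L2cv (smooth_cts (smoothD dirt (kap_smooth (en m)))) (bsuppD dirt (kap_bsupp (en_gt0 m))) Ln L0 cf.
    by rewrite -DJE//; under eq_fun do rewrite -DJE//.
  have l1 := L2cv_int (L2cv_cst LtrB) cD.
  apply: (cvg_unique _ l1 _) => //.
  rewrite (_ : (fun n => _) = (fun n => - ell (JV (fs n)))); first exact: cvgN.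
  by apply/funext => n; case: (Pn n).
Qed.

End fixed_box.
End identity.

(** * Strong solutions *)

Section limits_of_ell.
Context {R : realType} {d : nat}.
Local Notation E := (R * 'rV[R]_d)%type.
Local Notation mQ := (@lebQ R d).
Local Notation L2T := (L2 mQ setT).
Variables (T alpha : R).
Hypothesis T_gt0 : 0 < T.
Hypothesis alpha_ge0 : 0 <= alpha.
Local Notation r := (@varrho R d alpha).
Local Notation W01a := (@W01d R d T alpha).
Local Notation NWa := (@NW R d T alpha).
Local Notation qV := (@pw R d (alpha * 2)).

Lemma W01d_mul (w : E -> R) w' (q : E -> R) C : W01a w w' -> smooth q ->
  (forall z, `|q z| <= C) -> (forall i z, `|'D_(dirx i) q z| <= C) ->
  W01a (fun z => w z * q z) (fun i z => w' i z * q z + w z * 'D_(dirx i) q z).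
Proof.
move=> [Lw Dw Lw'] sq qC dqC.
have mQT := @measurable_QT R d T.
have Lp (p s : E -> R) : L2rho_QT T r p -> continuous s -> (forall z, `|s z| <= C) ->
    L2T (tr (QT T) (fun z => p z * s z * r z.2)).
  move=> /(L2_tr mQT) Lp cs sC.
  have := L2M Lp (cts_measurable_E cs) sC.
  by congr (L2 _ _ _); apply/funext => z; rewrite /tr; ring.
have Lq (p s : E -> R) : L2rho_QT T r p -> continuous s -> (forall z, `|s z| <= C) ->
    L2rho_QT T r (fun z => p z * s z).
  by move=> h1 h2 h3; apply: L2_trV => //; exact: Lp.
split; first exact: Lq (smooth_cts sq) qC.
  have [mw lw] := rho_L2 Lw.
  by move=> i; apply: wderivM => //; exact: loc1_L2.
move=> i; apply: L2_trV => //.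
have := L2D (Lp _ _ (Lw' i) (smooth_cts sq) qC) (Lp _ _ Lw (smooth_cts (smoothD (dirx i) sq)) (dqC i)).
by congr (L2 _ _ _); apply/funext => z; rewrite /tr; ring.
Qed.

Variables (u : E -> R) (Lam : R -> ('rV[R]_d -> R) -> R).
Hypothesis Wu : W01 T r u.
Hypothesis HL : dual_dt T r u Lam.
Local Notation ell := (@ell R d T Lam).
Local Notation ellok := (@ellok R d T Lam).

Variables (w : E -> R) (w' : 'I_d -> E -> R).
Hypothesis Ww : W01a w w'.

Lemma NW_mul_cvg C (qn : nat -> E -> R) (q : E -> R) :
  (forall n, smooth (qn n)) -> smooth q -> (forall n z, `|qn n z| <= C) -> (forall z, `|q z| <= C) ->
  (forall n i z, `|'D_(dirx i) (qn n) z| <= C) -> (forall i z, `|'D_(dirx i) q z| <= C) ->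
  (forall z, oQT T z -> qn n z @[n --> \oo] --> q z) ->
  (forall i z, oQT T z -> 'D_(dirx i) (qn n) z @[n --> \oo] --> 'D_(dirx i) q z) ->
  NWa (fun z => w z * qn n z - w z * q z) (fun i z => w' i z * qn n z + w z * 'D_(dirx i) (qn n) z -
    (w' i z * q z + w z * 'D_(dirx i) q z)) @[n --> \oo] --> (0 : R).
Proof.
move=> sn s0 bn b0 dn d0 cn cd; have [Lw Dw Lw'] := Ww.
have mQT := @measurable_QT R d T.
have G (p : E -> R) (sm : nat -> E -> R) (s : E -> R) : L2rho_QT T r p ->
   (forall n, continuous (sm n)) -> continuous s -> (forall n z, `|sm n z| <= C) -> (forall z, `|s z| <= C) ->
   (forall z, oQT T z -> sm n z @[n --> \oo] --> s z) ->
   L2cv mQ (fun n => tr (QT T) (fun z => p z * sm n z * r z.2)) (tr (QT T) (fun z => p z * s z * r z.2)).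
  move=> /(L2_tr mQT) Lp c1 c2 b1 b2 c3.
  set P := tr _ _ in Lp.
  have EP (t : E -> R) : tr (QT T) (fun z => p z * t z * r z.2) = (fun z => t z * P z).
    by apply/funext => z; rewrite /P /tr; ring.
  rewrite EP; under eq_fun do rewrite EP.
  have mP : measurable_fun setT P by case: Lp.
  apply: (L2cv_dominated (G := fun z => C * `|P z|)).
  - by move=> n; apply: measurable_funM => //; exact: cts_measurable_E.
  - by apply: measurable_funM => //; exact: cts_measurable_E.
  - by apply: L2Z; exact: L2_abs.
  - by move=> n z; rewrite normrM ler_wpM2r.
  - by move=> z; rewrite normrM ler_wpM2r.
  - apply: filterS (@QT_oQT_ae R d T) => z hz.
    have [Qz|nQ] := pselect (QT T z).
      by apply: cvgM; [apply: c3; exact: hz|exact: cvg_cst].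
    by rewrite /P tr_out// mulr0; under eq_fun do rewrite mulr0; exact: cvg_cst.
apply: NW_cvg; first by apply: G => //; [move=> n; exact: smooth_cts (sn n)|exact: smooth_cts s0].
move=> i.
have h1 := G _ _ _ (Lw' i) (fun n => smooth_cts (sn n)) (smooth_cts s0) bn b0 cn.
have h2 := G _ _ _ Lw (fun n => smooth_cts (smoothD (dirx i) (sn n))) (smooth_cts (smoothD (dirx i) s0))
  (fun n => dn n i) (d0 i) (cd i).
have := L2cvD h1 h2.
by congr (L2cv _ _ _); [apply/funext => n|]; apply/funext => z; rewrite /tr; ring.
Qed.

Lemma ell_mul_cvg C (qn : nat -> E -> R) (q : E -> R) :
  (forall n, smooth (qn n)) -> smooth q -> (forall n z, `|qn n z| <= C) -> (forall z, `|q z| <= C) ->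
  (forall n i z, `|'D_(dirx i) (qn n) z| <= C) -> (forall i z, `|'D_(dirx i) q z| <= C) ->
  (forall z, oQT T z -> qn n z @[n --> \oo] --> q z) ->
  (forall i z, oQT T z -> 'D_(dirx i) (qn n) z @[n --> \oo] --> 'D_(dirx i) q z) ->
  (forall n, ellok (fun z => w z * qn n z)) ->
  ellok (fun z => w z * q z) /\ ell (fun z => w z * qn n z) @[n --> \oo] --> ell (fun z => w z * q z).
Proof.
move=> sn s0 bn b0 dn d0 cn cd ok.
exact: (ell_cvg HL (fun n => W01d_mul Ww (sn n) (bn n) (dn n)) (W01d_mul Ww s0 b0 d0) ok
  (NW_mul_cvg sn s0 bn b0 dn d0 cn cd)).
Qed.

Section mollified.
Variables (s e n : R) (zeta : E -> R).
Hypothesis s0 : 0 < s.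
Hypothesis eT : e < T.
Hypothesis szeta : smooth zeta.
Let B0 : set E := cbox (s, const_mx (- n)) (e, const_mx n).
Hypothesis zeta0 : forall z, ~ B0 z -> zeta z = 0.

(** [mollified_identity] evaluates the left-hand side for each [m], and the test
    functions converge in the energy space, where [ell] is continuous. This is
    what replaces [mol_time] when the time derivative is the one of [u]. *)
Lemma ell_mol (B : set E) N : compact B -> B `<=` oQT T ->
  (forall z y, B0 z -> `|z - y| <= en N -> B y) ->
  ellok (fun z => w z * (zeta z * qV z)) /\
  \int[mQ]_z (tr B u z * 'D_dirt (mol B zeta w (m + N)) z) @[m --> \oo] -->
    - ell (fun z => w z * (zeta z * qV z)).
Proof.
move=> cB BQ thick.
have [Lw Dw Lw'] := Ww.
have [mw lw] := rho_L2 Lw.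
have LBw : L2 mQ B w by apply: lw => // z /BQ /oQT_QT.
have LBw' i : L2 mQ B (w' i) by have [_ l] := rho_L2 (Lw' i); apply: l => // z /BQ /oQT_QT.
have cB0 : compact B0 by exact: compact_cbox.
pose a0 : E := (s / 2, const_mx (- (n + 1))); pose b0 : E := ((e + T) / 2, const_mx (n + 1)).
have s20 : 0 < s / 2 by rewrite divr_gt0.
have eT2 : (e + T) / 2 < T by rewrite ltr_pdivrMr// mulr_natr mulr2n ltrD2r.
have [N' [B' [cB' BQ' thick']]] := @thick_box R d T (s / 2) ((e + T) / 2) (n + 1) s20 eT2.
have thk m : (N' <= m)%N -> forall z y, box a0 b0 z -> `|z - y| <= en m -> B' y.
  move=> Nm z y /box_cbox bz zy; apply: (thick' z) => //.
  exact: le_trans zy (en_le Nm).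
have B0b z : B0 z -> box a0 b0 z.
  move=> [/andP[h1 h2] h3]; split; first by rewrite /=; apply/andP; split; rewrite /= in h1 h2 *; lra.
  by move=> i; have := h3 i; rewrite !mxE /= => /andP[h4 h5]; apply/andP; split; lra.
pose g m z := zeta z * J m (tr B w) z.
have Lg m : L2T (g m).
  have [M Lb1] := Lb_tr cB LBw.
  exact: (Lb_off cB0 (smooth_cts szeta) zeta0 (J_Lb m Lb1)).1.
have g0 m z : ~ box a0 b0 z -> g m z = 0.
  by move=> nb; rewrite /g zeta0 ?mul0r// => /B0b.
pose K := (N' + N)%N.
have sm m : smooth (mol B zeta w m) by exact: (mol_smooth cB0 cB szeta zeta0 LBw).
have offB m : (N <= m)%N -> forall z, ~ B z -> mol B zeta w m z = 0.
  by move=> Nm z; exact: (mol_off thick).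
have offB' m : (N' <= m)%N -> forall z, ~ B' z -> mol B zeta w m z = 0.
  move=> Nm z nB; apply: (J_supp (A := box a0 b0) (g0 m)) => y yb.
  by rewrite ltNge; apply/negP => h; apply: nB; apply: (thk m Nm y) => //; rewrite distrC.
have id m : ellok (fun z => mol B zeta w (m + K) z * qV z) /\
    \int[mQ]_z (tr B u z * 'D_dirt (mol B zeta w (m + K)) z) = - ell (fun z => mol B zeta w (m + K) z * qV z).
  have Nm : (N' <= m + K)%N by rewrite /K addnA -addnA addnCA leq_addr.
  have Nm2 : (N <= m + K)%N by rewrite /K addnA leq_addl.
  have [h1 h2] := mollified_identity Wu HL cB' BQ' (thk _ Nm) (Lg (m + K)%N) (g0 (m + K)%N).
  split => //; rewrite -h2; apply: eq_Rintegral => z _.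
  have [Bz|nB] := pselect (B z); last first.
    by rewrite (deriv_off dirt (compact_closed (@norm_hausdorff _ _) cB) (offB _ Nm2) nB) !mulr0.
  have [Bz'|nB] := pselect (B' z); last first.
    by rewrite (deriv_off dirt (compact_closed (@norm_hausdorff _ _) cB') (offB' _ Nm) nB) !mulr0.
  by rewrite !trE.
have [M hM] := compact_bd cB.
have bm m : bsupp M (mol B zeta w (m + K)).
  move=> z Mz; apply: offB; first by rewrite /K addnA leq_addl.
  by move=> /hM; rewrite leNgt Mz.
have bz (p : E -> R) : (forall z, ~ B0 z -> p z = 0) -> bsupp M p.
  move=> p0 z Mz; apply: p0 => Bz; have /hM : B z by apply: (thick z) => //; rewrite subrr normr0 ltW// en_gt0.
  by rewrite leNgt Mz.
have B0B z : B0 z -> B z by move=> Bz; apply: (thick z) => //; rewrite subrr normr0 ltW// en_gt0.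
have sq := @pw_smooth R d (alpha * 2).
have szq := smooth_mul szeta sq.
have bzq : bsupp M (fun z => zeta z * qV z) by apply: bz => z nB; rewrite zeta0// mul0r.
have [C1 C10 hC1] := cs_bounded E_balls_compact (smooth_cts szq) bzq.
have /choice[C2 hC2] i : exists C2, forall z, `|'D_(dirx i) (fun z => zeta z * qV z) z| <= C2.
  have [C2 _ h] := cs_bounded E_balls_compact (smooth_cts (smoothD (dirx i) szq)) (bsuppD (dirx i) bzq).
  by exists C2.
pose C := C1 + \sum_i `|C2 i|.
have We : W01a (fun z => w z * (zeta z * qV z)) (fun i z => w' i z * (zeta z * qV z) + w z * 'D_(dirx i) (fun z => zeta z * qV z) z).
  apply: (W01d_mul (C := C) Ww szq).
    by move=> z; apply: le_trans (hC1 z) _; rewrite lerDl; apply: sumr_ge0.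
  move=> i z; apply: le_trans (hC2 i z) _; apply: le_trans (ler_norm _) _.
  by rewrite /C (bigD1 i)//= addrCA lerDl addr_ge0//; apply: sumr_ge0.
have Wm m : W01a (fun z => mol B zeta w (m + K) z * qV z) (fun i => 'D_(dirx i) (fun z => mol B zeta w (m + K) z * qV z)).
  apply: (@smooth_W01d R d T alpha M); first exact: (smooth_mul (sm _) sq).
  by move=> z Mz; rewrite (bm m)// mul0r.
have c0 : L2cv mQ (fun m => mol B zeta w (m + K)) (fun z => zeta z * tr B w z).
  have -> : (fun m => mol B zeta w (m + K)) = (fun m => mol B zeta w (m + N' + N)).
    by apply/funext => m; rewrite (addnA m N' N).
  exact: (L2cv_shift N' (mol_cvg N cB0 cB szeta zeta0 LBw)).
have c1 i : L2cv mQ (fun m => 'D_(dirx i) (mol B zeta w (m + K)))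
    (fun z => 'D_(dirx i) zeta z * tr B w z + zeta z * tr B (w' i) z).
  have -> : (fun m => 'D_(dirx i) (mol B zeta w (m + K))) = (fun m => 'D_(dirx i) (mol B zeta w (m + N' + N))).
    by apply/funext => m; rewrite (addnA m N' N).
  exact: (L2cv_shift N' (mol_derive_cvg cB0 cB BQ thick szeta zeta0 LBw (Dw i) (LBw' i))).
have z1 (p : E -> R) (zt : E -> R) : (forall z, ~ B0 z -> zt z = 0) -> forall z, zt z * tr B p z = zt z * p z.
  move=> zt0 z; have [Bz|nB] := pselect (B0 z); first by rewrite trE//; exact: B0B.
  by rewrite zt0// !mul0r.
have dz0 i : forall z, ~ B0 z -> 'D_(dirx i) zeta z = 0.
  exact: (deriv_off _ (compact_closed (@norm_hausdorff _ _) cB0) zeta0).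
have cN : NWa (fun z => mol B zeta w (m + K) z * qV z - w z * (zeta z * qV z))
    (fun i z => 'D_(dirx i) (fun z => mol B zeta w (m + K) z * qV z) z -
      (w' i z * (zeta z * qV z) + w z * 'D_(dirx i) (fun z => zeta z * qV z) z)) @[m --> \oo] --> (0 : R).
  apply: NW_cvg.
    have bb : bsupp M (fun z => zeta z * tr B w z) by apply: bz => z nB; rewrite zeta0// mul0r.
    have := tr_mul_cvg T (smooth_cts (smooth_mul sq (rho_smooth alpha))) bm bb c0.
    congr (L2cv _ _ _); [apply/funext => m|]; apply/funext => z; rewrite /tr; first by ring.
    by rewrite z1//; ring.
  move=> i.
  have bb : bsupp M (fun z => zeta z * tr B w z) by apply: bz => z nB; rewrite zeta0// mul0r.
  have bb1 : bsupp M (fun z => 'D_(dirx i) zeta z * tr B w z + zeta z * tr B (w' i) z).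
    by apply: bz => z nB; rewrite zeta0// dz0// !mul0r addr0.
  have h1 := tr_mul_cvg T (smooth_cts (smooth_mul (smoothD (dirx i) sq) (rho_smooth alpha))) bm bb c0.
  have h2 := tr_mul_cvg T (smooth_cts (smooth_mul sq (rho_smooth alpha))) (fun m => bsuppD (dirx i) (bm m)) bb1 (c1 i).
  have := L2cvD h1 h2.
  congr (L2cv _ _ _); [apply/funext => m|]; apply/funext => z; rewrite /tr.
    by rewrite (derive_mul _ _ (sm _) sq); ring.
  have e1 := z1 w zeta zeta0 z; have e2 := z1 w _ (dz0 i) z; have e3 := z1 (w' i) zeta zeta0 z.
  by rewrite /tr in e1 e2 e3; rewrite (derive_mul _ _ szeta sq) e1 e2 e3; ring.
have [ok cl] := ell_cvg HL Wm We (fun m => (id m).1) cN.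
split => //.
rewrite -(cvg_shiftn N').
have -> : (fun m => \int[mQ]_z (tr B u z * 'D_dirt (mol B zeta w ((m + N') + N)) z)) =
    (fun m => - ell (fun z => mol B zeta w (m + K) z * qV z)).
  by apply/funext => m; rewrite -addnA -/K (id m).2.
exact: cvgN.
Qed.

End mollified.
End limits_of_ell.

Section strong_conclusion.
Context {R : realType} {d : nat}.
Local Notation E := (R * 'rV[R]_d)%type.
Local Notation mQ := (@lebQ R d).
Variables (T alpha : R).
Hypothesis T_gt0 : 0 < T.
Hypothesis alpha_ge0 : 0 <= alpha.
Local Notation r := (@varrho R d alpha).
Local Notation b := (- (alpha * 2)).
Local Notation W01a := (@W01d R d T alpha).
Local Notation qV := (@pw R d (alpha * 2)).

Variables (u : E -> R) (Lam : R -> ('rV[R]_d -> R) -> R).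
Hypothesis Wu : W01 T r u.
Hypothesis HL : dual_dt T r u Lam.
Local Notation ell := (@ell R d T Lam).
Local Notation ellok := (@ellok R d T Lam).

Lemma th_chi_Dx k n i (z : E) : 'D_(dirx i) (fun z => th T k z * chi n z) z = th T k z * 'D_(dirx i) (chi n) z.
Proof. by rewrite (derive_mul _ _ (tc_smooth _ _ _ _) (chi_smooth n)) tc_Dx mulr0 addr0. Qed.

Lemma cwV n (z : E) : cw n b z * qV z = chi n z.
Proof.
have h := pwV alpha z; rewrite opprK in h.
by rewrite /cw -mulrA (mulrC (pw b z)) h mulr1.
Qed.

Lemma norm_gz0 (t : R) : `|gz 0 t| <= 1.
Proof. by rewrite ger0_norm ?gz_ge0// gz0_le1. Qed.

Section multiplier.
Variables (w : E -> R) (w' : 'I_d -> E -> R).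
Hypothesis Ww : W01a w w'.

Lemma ell_zeta k n : ellok (fun z => w z * (th T k z * chi n z)).
Proof.
have [N [B [cB BQ thick]]] := @thick_box R d T (en k) (T - en k) n.+1%:R (en_gt0 k)
  (ltac:(rewrite ltrBlDr ltrDl; exact: en_gt0)).
have [ok _] := ell_mol Wu HL Ww (en_gt0 k) (ltac:(rewrite ltrBlDr ltrDl; exact: en_gt0) : T - en k < T)
  (zeta_smooth T alpha k n) (@zeta_off R d T alpha k n) cB BQ thick.
move: ok; congr (ellok _); apply/funext => z; rewrite /zeta.
by rewrite -mulrA cwV.
Qed.

Lemma ell_th n : ellok (fun z => w z * chi n z) /\
  ell (fun z => w z * (th T k z * chi n z)) @[k --> \oo] --> ell (fun z => w z * chi n z).
Proof.
have th1 k (z : E) : `|th T k z| <= 1 by rewrite ger0_norm ?tc_ge0// tc_le1.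
have c1 (z : E) m : `|chi m z| <= 1 by rewrite ger0_norm ?chi_ge0// chi_le1.
apply: (ell_mul_cvg HL Ww (C := 3)).
- by move=> k; apply: smooth_mul; [exact: tc_smooth|exact: chi_smooth].
- exact: chi_smooth.
- move=> k z; rewrite normrM; apply: (@le_trans _ _ 1); last by rewrite ler1n.
  by rewrite -[leRHS]mul1r; apply: ler_pM.
- by move=> z; apply: le_trans (c1 z n) _; rewrite ler1n.
- move=> k i z; rewrite th_chi_Dx normrM -[leRHS]mul1r; apply: ler_pM => //; exact: chi_Dx_bd.
- by move=> i z; exact: chi_Dx_bd.
- move=> z Qz; rewrite -[X in _ --> X]mul1r; apply: cvgM; [exact: th_cvg|exact: cvg_cst].
- move=> i z Qz; under eq_fun do rewrite th_chi_Dx.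
  have h : th T k z * 'D_(dirx i) (chi n) z @[k --> \oo] --> 1 * 'D_(dirx i) (chi n) z.
    by apply: cvgM; [exact: th_cvg|exact: cvg_cst].
  by rewrite mul1r in h.
- by move=> k; exact: ell_zeta.
Qed.

Lemma ell_chi : ellok w /\ ell (fun z => w z * chi n z) @[n --> \oo] --> ell w.
Proof.
have c1 (z : E) m : `|chi m z| <= 1 by rewrite ger0_norm ?chi_ge0// chi_le1.
have D1 v (z : E) : 'D_v (cst 1 : E -> R) z = 0 by exact: derive_cst.
have [|||||||||ok cl] := ell_mul_cvg HL Ww (C := 3) (qn := fun n => chi n) (q := cst 1).
- by move=> k; exact: chi_smooth.
- exact: smooth_cst.
- by move=> n z; apply: le_trans (c1 z n) _; rewrite ler1n.
- by move=> z; rewrite normr1 ler1n.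
- by move=> k i z; exact: chi_Dx_bd.
- by move=> i z; rewrite D1 normr0.
- by move=> z _; exact: chi_cvg.
- by move=> i z _; rewrite D1; exact: chi_Dx_cvg.
- by move=> n; case: (ell_th n).
have E1 : (fun z => w z * cst 1 z) = w by apply/funext => z; rewrite mulr1.
by rewrite E1 in ok cl.
Qed.

End multiplier.

Variables (ob F : E -> R) (P : E -> 'rV[R]_d) (mu : {measure set E -> \bar R}).
Hypothesis cu : {within oQT T, continuous u}.
Hypothesis ch : {within QT T, continuous ob}.
Hypothesis mh : measurable_fun (QT T) ob.
Hypothesis uh : forall z, QT T z -> ob z <= u z.
Hypothesis radon_mu : radon T mu.
Hypothesis mu_min : forall xi, C0_plus T xi ->
    (\int[mu]_(z in QT T) ((u z - ob z) * xi z)%:E = 0)%E.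
Hypothesis LP : forall i, L2rho_QT T r (fun z => P z 0 i).
Hypothesis mF : measurable_fun (QT T) F.
Hypothesis LF : L2loc_QT T F.
Hypothesis EQ : tested_equation T u F P mu.

Variable v : E -> R.
Hypothesis Wv : W01 T r v.
Hypothesis vh : above_obstacle T ob v.

Let w z := v z - u z.
Let w' i z := wderiv T (dirx i) v z - wderiv T (dirx i) u z.

Lemma Ww : W01a w w'.
Proof.
have [h1 _ _ h2] := W01B Wv Wu; split => // i; have [] := h2 i => //.
Qed.

(** [zeta_ineq] with [ell_mol] as [k] tends to infinity. No derivative of the
    cutoff occurs, hence no boundary term. *)
Lemma strong_n n : ell (fun z => w z * chi n z) - 2^-1 * (\sum_i \int[mQ]_z G2 T alpha u P v n i z)
  + \int[mQ]_z G3 T alpha u F v n z <= 0.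
Proof.
have i2 i := G2_int1 Wu LP Wv n i.
have i3 := G3_int1 Wu LF Wv n alpha_ge0.
have key k : 0 <= - ell (fun z => w z * (th T k z * chi n z))
    + 2^-1 * (\sum_i \int[mQ]_z (th T k z * G2 T alpha u P v n i z)) - \int[mQ]_z (th T k z * G3 T alpha u F v n z).
  apply: (zeta_ineq Wu cu ch mh uh radon_mu mu_min LP LF EQ Wv alpha_ge0 vh (k := k) (n := n)).
  move=> B N cB BQ thick.
  have [_] := ell_mol Wu HL Ww (en_gt0 k) (ltac:(rewrite ltrBlDr ltrDl; exact: en_gt0) : T - en k < T)
    (zeta_smooth T alpha k n) (@zeta_off R d T alpha k n) cB BQ thick.
  have -> // : (fun z => w z * (zeta T alpha k n z * qV z)) = (fun z => w z * (th T k z * chi n z)).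
  by apply/funext => z; rewrite /zeta -[_ * _ * qV z]mulrA cwV.
have L2' i := th_lim (i2 i) (fun z nQ => tr_out _ nQ).
have L3 := th_lim i3 (fun z nQ => tr_out _ nQ).
have [_ L1] := ell_th Ww n.
suff : 0 <= - ell (fun z => w z * chi n z)
    + 2^-1 * (\sum_i \int[mQ]_z G2 T alpha u P v n i z) - \int[mQ]_z G3 T alpha u F v n z by lra.
apply: (lim_ge0 _ key).
apply: cvgB; last exact: L3.
apply: cvgD; first exact: cvgN.
apply: cvgM; first exact: cvg_cst.
by apply: cvg_big => [|i _]; [exact: add_continuous|exact: L2'].
Qed.

Lemma strong_inequality :
  ((ell w - 2^-1 * \sum_i \int[mQ]_(z in QT T) (P z 0 i * wderiv T (dirx i) (fun z => w z * r z.2 ^+ 2) z))%:E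
   + \int[mQ]_(z in QT T) (F z * w z * r z.2 ^+ 2)%:E <= 0)%E.
Proof.
rewrite int_trE.
have [Lw1 _ _ _] := W01B Wv Wu; have [mw _] := rho_L2 Lw1.
have mr2 : measurable_fun (QT T) (fun z : E => r z.2 ^+ 2).
  by apply: measurable_funTS; apply: measurable_funX; apply: cts_measurable_E; exact: rho_cts.
apply: (@cutoff_limit _ _ _ _ _ (fun n => chi n)
  (fun n => ell (fun z => w z * chi n z) - 2^-1 * (\sum_i \int[mQ]_z G2 T alpha u P v n i z))).
- apply: measurable_tr; first exact: measurable_QT.
  by apply: measurable_funM => //; apply: measurable_funM.
- by move=> n; exact: measurable_chi.
- by move=> n z; rewrite chi_ge0 chi_le1.
- by move=> z n k; exact: chi_le.
- exact: chi_cvg.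
- move=> n; have := G3_int1 Wu LF Wv n alpha_ge0; congr (_.-integrable _ (_ \o _)).
  by apply/funext => z; rewrite /G3 /tr cw_rho /w; ring.
- apply: cvgB; first by case: (ell_chi Ww).
  apply: cvgM; first exact: cvg_cst.
  apply: cvg_big => [|i _]; first exact: add_continuous.
  by have [] := G2_lim Wu LP Wv i.
- move=> n; apply: le_trans (strong_n n); rewrite lerD2l le_eqVlt; apply/orP; left; apply/eqP.
  by apply: eq_Rintegral => z _; rewrite /G3 /tr cw_rho /w; ring.
Qed.

End strong_conclusion.

(** * Continuity in time in the weighted space *)

Section arithmetic.
Variable R : realFieldType.

Lemma arith2 (x y e : R) : x <= e -> y <= e -> 2 * x + 2 * y <= 4 * e.
Proof. by move=> *; lra. Qed.

Lemma arith3 (x y z q : R) : 0 <= q -> x <= q / 8 -> y <= q / 8 -> z <= q / 8 -> 2 * (x + y) + 2 * z <= q.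
Proof. by move=> *; lra. Qed.

Lemma arith4 (x y z e : R) : x <= e / 2 -> y <= e / 8 -> z <= e / 8 -> x + (2 * y + 2 * z) <= e.
Proof. by move=> *; lra. Qed.

End arithmetic.

Section Lcont_more.
Context {R : realType} {d : nat}.
Local Notation ld := (@leb R d).

Lemma LcontN T c (g : R -> 'rV[R]_d -> R) : Lcont T c g -> Lcont T c (fun t x => 0 - g t x).
Proof.
move=> h t tT; have [L H] := h t tT; split.
  have := L2N L; congr (L2 _ _ _); apply/funext => x; ring.
move=> e e0; have [del d0 hd] := H e e0; exists del => // s sT st.
apply: le_trans (hd s sT st); rewrite le_eqVlt; apply/orP; left; apply/eqP.
by rewrite -N2N; congr (N2 ld _); apply/funext => x; ring.
Qed.

Lemma Lcont_L2continuous T c (g : R -> 'rV[R]_d -> R) : Lcont T c g -> L2continuous T setT c g.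
Proof.
move=> h t tT; have [L H] := h t tT; split => //.
have cE : (fun s => (\int[ld]_x (((g s x - g t x) * c x) ^+ 2)%:E)%E) @ within `[0, T]%classic (nbhs t) --> (0%R)%:E.
  have c0 : N2 ld (fun x => (g s x - g t x) * c x) @[s --> within `[0, T]%classic (nbhs t)] --> (0 : R).
    apply/cvgr0Pnorm_le => e e0; have [del d0 hd] := H e e0.
    rewrite near_withinE; near=> s => sT; rewrite ger0_norm ?N2_ge0//.
    apply: hd => //; rewrite distrC; near: s; exact: cvgr_dist_lt.
  have c1 : (N2 ld (fun x => (g s x - g t x) * c x))%:E @[s --> within `[0, T]%classic (nbhs t)] --> (0%R)%:E.
    by apply: cvg_EFin; [exact: nearW|exact: c0].
  apply: cvg_trans c1; apply: near_eq_cvg; rewrite near_withinE; apply: nearW => s sT.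
  have [Ls _] := h s sT.
  rewrite /= -L2_N2E//.
  have := L2B Ls L; congr (L2 _ _ _); apply/funext => x; ring.
exact: cE.
Unshelve. all: by end_near. Qed.

End Lcont_more.

Section trace.
Context {R : realType} {d : nat}.
Local Notation E := (R * 'rV[R]_d)%type.
Local Notation mQ := (@lebQ R d).
Local Notation ld := (@leb R d).
Local Notation int1 f := (mQ.-integrable setT (EFin \o f)).
Local Notation m1 := (@leb1 R).
Variables (T alpha : R).
Hypothesis T_gt0 : 0 < T.
Hypothesis alpha_ge0 : 0 <= alpha.
Local Notation r := (@varrho R d alpha).
Local Notation b := (- (alpha * 2)).
Local Notation W01a := (@W01d R d T alpha).
Local Notation NWa := (@NW R d T alpha).
Local Notation qV := (@pw R d (alpha * 2)).

Lemma NW_B (f : E -> R) f' (g : E -> R) g' : W01a f f' -> W01a g g' ->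
  NWa (fun z => f z - g z) (fun i z => f' i z - g' i z) <= 2 * NWa f f' + 2 * NWa g g'.
Proof.
move=> [Lf _ Lf'] [Lg _ Lg'].
have H (p q : E -> R) : L2rho_QT T r p -> L2rho_QT T r q ->
    N2 mQ (tr (QT T) (fun z => (p z - q z) * r z.2)) <=
    2 * N2 mQ (tr (QT T) (fun z => p z * r z.2)) + 2 * N2 mQ (tr (QT T) (fun z => q z * r z.2)).
  move=> /(L2_tr (@measurable_QT R d T)) Lp /(L2_tr (@measurable_QT R d T)) Lq.
  rewrite -[X in _ + 2 * X]N2N; apply: le_trans (N2D Lp (L2N Lq)).
  by rewrite le_eqVlt; apply/orP; left; apply/eqP; congr (N2 mQ _); apply/funext => z; rewrite /tr; ring.
rewrite /NW !mulrDr addrACA; apply: lerD; first exact: H.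
rewrite !mulr_sumr -big_split /=; apply: ler_sum => i _; exact: H.
Qed.

Variables (u : E -> R) (Lam : R -> ('rV[R]_d -> R) -> R).
Hypothesis Wu : W01 T r u.
Hypothesis HL : dual_dt T r u Lam.
Local Notation ell := (@ell R d T Lam).
Local Notation ellok := (@ellok R d T Lam).

Let w z := 0 - u z.
(* [- u] is written as [-2 u + u], to be a combination of functions of the space. *)
Let w' i z := -2 * wderiv T (dirx i) u z + wderiv T (dirx i) u z.

Let Ww : W01a w w'.
Proof.
have := W01d_lin (-2) (W01_W01d Wu) (W01_W01d Wu).
by congr (W01d _ _ _ _); apply/funext => z; rewrite /w; ring.
Qed.

Lemma wderiv0 (v : E) : is_wderiv T v (fun=> 0 : R) (fun=> 0 : R).
Proof.
have s0 : smooth (cst 0 : E -> R) by exact: smooth_cst.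
have := wderiv_smooth T v s0; congr (is_wderiv _ _ _ _).
by apply/funext => z; exact: derive_cst.
Qed.

(** The same integral has two limits: [ell_mol] evaluates it through the time
    derivative of [u], and [mol_time], with [v = 0], through the derivative of the
    cutoff. *)
Lemma energy_identity (s e n : R) (zeta : E -> R) : 0 < s -> e < T -> smooth zeta ->
  (forall z, ~ cbox (s, const_mx (- n)) (e, const_mx n) z -> zeta z = 0) ->
  ellok (fun z => w z * (zeta z * qV z)) /\
  ell (fun z => w z * (zeta z * qV z)) = 2^-1 * \int[mQ]_z ('D_dirt zeta z * w z ^+ 2).
Proof.
move=> s0 eT sz z0.
have [N [B [cB BQ thick]]] := @thick_box R d T s e n s0 eT.
have [ok cl] := ell_mol Wu HL Ww s0 eT sz z0 cB BQ thick.
split => //; have [_ lu _ _] := W01_facts Wu.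
have cB0 : compact (cbox (s, const_mx (- n)) (e, const_mx n) : set E) by exact: compact_cbox.
have L0 : L2 mQ B (fun=> 0 : R).
  by apply: (L2_sub (compact_measurable_E cB) measurableT) => //; exact: L2_0.
have LuB : L2 mQ B u by apply: lu => // z /BQ /oQT_QT.
have := mol_time cB0 cB BQ thick sz z0 LuB L0 L0 (wderiv0 dirt).
move=> /(cvg_unique _ cl) => /(_ (@norm_hausdorff _ _)).
rewrite (_ : \int[mQ]_z (zeta z * 0 * (0 - u z)) = 0); last first.
  transitivity (\int[mQ]_z (0 : R)); last by rewrite /Rintegral integral0.
  by apply: eq_Rintegral => z _; rewrite mulr0 mul0r.
by rewrite oppr0 sub0r => /oppr_inj.
Qed.

Section cutoff.
Variables (m n : nat).
Hypothesis nm : (n <= m)%N.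
Let c (z : E) : R := chi m z - chi n z.

Lemma c_ge0 (z : E) : 0 <= c z.
Proof. by rewrite subr_ge0 chi_le. Qed.

Lemma c_le1 (z : E) : c z <= 1.
Proof. by rewrite lerBlDr ler_wpDr ?chi_ge0 ?chi_le1. Qed.

Lemma c_norm (z : E) : `|c z| <= 1. Proof. by rewrite ger0_norm ?c_ge0 ?c_le1. Qed.

Lemma c_smooth : smooth c.
Proof.
have h := smooth_add (chi_smooth m) (smooth_mul (smooth_cst (-1)) (chi_smooth n)) (V := E).
by move: h; congr smooth; apply/funext => z; rewrite mulN1r.
Qed.

Lemma c_is_derive (z v : E) : is_derive z v c ('D_v (chi m) z - 'D_v (chi n) z).
Proof. by apply: is_deriveB; apply: smooth_is_derive; exact: chi_smooth. Qed.

Lemma c_D (z v : E) : 'D_v c z = 'D_v (chi m) z - 'D_v (chi n) z.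
Proof. by have [_ ->] := c_is_derive z v. Qed.

Lemma c_xsupp : xsupp m.+1%:R c.
Proof.
move=> z mz; rewrite /c (chi_xsupp mz) (chi_xsupp (n := n)) ?subrr//.
by apply: le_lt_trans mz; rewrite ler_nat ltnS.
Qed.

Let Nc := NWa (fun z => w z * c z) (fun i z => w' i z * c z + w z * 'D_(dirx i) c z).
Let C0 := tr (QT T) (fun z => c z * pw b z * w z ^+ 2).

Lemma C0_int1 : int1 C0.
Proof.
have [Lw _ _] := Ww.
have := rho_int1 Lw Lw (cts_measurable_E (smooth_cts c_smooth)) c_norm.
congr (_.-integrable _ (_ \o _)); apply/funext => z; rewrite /C0 /tr -varrho_sqr; ring.
Qed.

Lemma C0_ge0 z : 0 <= C0 z.
Proof. by rewrite /C0 /tr mulr_ge0// mulr_ge0 ?sqr_ge0// mulr_ge0 ?c_ge0// ltW// pw_gt0. Qed.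

Lemma c_Wd : W01a (fun z => w z * c z) (fun i z => w' i z * c z + w z * 'D_(dirx i) c z).
Proof.
apply: (W01d_mul (C := 6) Ww c_smooth).
  by move=> z; apply: le_trans (c_norm z) _; rewrite ler1n.
move=> i z; rewrite c_D; apply: le_trans (ler_normB _ _) _.
have -> : 6 = 3 + 3 :> R by rewrite -natrD.
by apply: lerD; exact: chi_Dx_bd.
Qed.

Section time.
Variables (t0 s : R).
Hypothesis ss : s = 1 /\ T / 2 <= t0 <= T \/ s = -1 /\ 0 <= t0 <= T / 2.

Let A t : R := gz 0 (s * t + (- (s * (T / 2)) + T / 4)).
(** For [s = 1] a cutoff to the times between [T / 4] and [t0], for [s = -1] to
    those between [t0] and [3 T / 4]. In the limit it jumps at [t0]; its smooth
    end is at distance at least [T / 4] from [t0]. *)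
Let theta k : E -> R := tc s (- (s * (T / 2)) + T / 4) (- (s * k.+1%:R)) (s * k.+1%:R * t0 - 1).

Let s2 : s * s = 1. Proof. by case: ss => -[-> _]; ring. Qed.

Lemma theta_supp k (z : E) : ~~ (Num.min (T / 4) (en k) < z.1 < T - Num.min (T / 4) (en k)) ->
  theta k z = 0.
Proof.
set m0 := Num.min _ _ => h; rewrite /theta /tc.
have m4 : m0 <= T / 4 by rewrite ge_min lexx.
have mk : m0 <= en k by rewrite ge_min lexx orbT.
have k0 : 0 < k.+1%:R :> R by rewrite ltr0n.
have g0 (p q : R) : p <= 0 \/ q <= 0 -> gz 0 p * gz 0 q = 0.
  by case=> h0; rewrite (gz_neg 0 h0) ?mul0r ?mulr0.
have kk : en k * k.+1%:R = 1 :> R by rewrite /en mulVf// gt_eqF.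
have h' : z.1 <= m0 \/ T - m0 <= z.1.
  by move: h; rewrite negb_and -!leNgt => /orP.
apply: g0; case: ss => -[-> /andP[t1 t2]]; case: h' => hz.
- by left; lra.
- right; have : k.+1%:R * (t0 - z.1) <= k.+1%:R * en k by rewrite ler_pM2l//; lra.
  by rewrite mulrC [_ * en k]mulrC kk => ?; lra.
- right; have : k.+1%:R * (z.1 - t0) <= k.+1%:R * en k by rewrite ler_pM2l//; lra.
  by rewrite mulrC [_ * en k]mulrC kk => ?; lra.
- by left; lra.
Qed.

Lemma theta_Dt k (z : E) : 'D_dirt (theta k) z =
  s * (gz 2 (s * z.1 + (- (s * (T / 2)) + T / 4)) * gz 0 (k.+1%:R * (s * (t0 - z.1)) - 1))
  - s * (ker s t0 k z.1 * A z.1).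
Proof.
have [_ ->] := tc_is_derive s (- (s * (T / 2)) + T / 4) (- (s * k.+1%:R)) (s * k.+1%:R * t0 - 1) z dirt.
rewrite mulr1 /ker /A.
have -> : - (s * k.+1%:R) * z.1 + (s * k.+1%:R * t0 - 1) = k.+1%:R * (s * (t0 - z.1)) - 1 by ring.
by ring.
Qed.

(** The energy identity for [theta k * c * rho^2]: the jump at [t0] gives the
    left-hand side, the smooth end of the cutoff the integral of [C0], and [ell]
    is bounded uniformly in [k] and [t0] since [theta k] depends on time alone and
    is at most 1. *)
Lemma trace_bound k eps : 0 < eps ->
  \int[mQ]_z (ker s t0 k z.1 * (A z.1 * C0 z)) <=
  2 * (eps * CL T alpha Lam + eps^-1 * Nc) + 2 * \int[mQ]_z C0 z.
Proof.
move=> eps0.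
pose m0 := Num.min (T / 4) (en k).
have m00 : 0 < m0 by rewrite lt_min divr_gt0// en_gt0.
have mT : T - m0 < T by rewrite ltrBlDr ltrDl.
pose zeta z := theta k z * (c z * pw b z).
have st : smooth (theta k) by exact: tc_smooth.
have sc : smooth (fun z => c z * pw b z) := smooth_mul c_smooth (pw_smooth b).
have sz : smooth zeta := smooth_mul st sc.
have xs : xsupp m.+1%:R (fun z => c z * pw b z) by move=> z mz; rewrite c_xsupp// mul0r.
have z0 := xsupp_cbox (@theta_supp k) xs.
have [ok E1] := energy_identity m00 mT sz z0.
have qb z : pw b z * qV z = 1 by have := pwV alpha z; rewrite opprK mulrC.
have WE : (fun z => w z * (zeta z * qV z)) = (fun z => w z * (theta k z * c z)).
  by apply/funext => z; rewrite /zeta -!mulrA qb mulr1.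
rewrite WE in ok E1.
have t1 z : `|theta k z| <= 1 by rewrite ger0_norm ?tc_ge0// tc_le1.
have tD i (z : E) : 'D_(dirx i) (fun z => theta k z * c z) z = theta k z * 'D_(dirx i) c z.
  by rewrite (derive_mul _ _ st c_smooth) tc_Dx mulr0 addr0.
have Wt : W01a (fun z => w z * (theta k z * c z)) (fun i z => w' i z * (theta k z * c z) +
    w z * 'D_(dirx i) (fun z => theta k z * c z) z).
  apply: (W01d_mul (C := 6) Ww (smooth_mul st c_smooth)).
    move=> z; rewrite normrM; apply: (@le_trans _ _ 1); last by rewrite ler1n.
    by rewrite -[leRHS]mul1r; apply: ler_pM => //; exact: c_norm.
  move=> i z; rewrite tD c_D normrM -[leRHS]mul1r; apply: ler_pM => //.
  apply: le_trans (ler_normB _ _) _; have -> : 6 = 3 + 3 :> R by rewrite -natrD.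
  by apply: lerD; exact: chi_Dx_bd.
have NWle : NWa (fun z => w z * (theta k z * c z)) (fun i z => w' i z * (theta k z * c z) +
    w z * 'D_(dirx i) (fun z => theta k z * c z) z) <= Nc.
  have H (p q : E -> R) : L2rho_QT T r p -> L2rho_QT T r q -> (forall z, q z = theta k z * p z) ->
      N2 mQ (tr (QT T) (fun z => q z * r z.2)) <= N2 mQ (tr (QT T) (fun z => p z * r z.2)).
    move=> /(L2_tr (@measurable_QT R d T)) Lp /(L2_tr (@measurable_QT R d T)) [mq _] qp.
    apply: (N2_le mq Lp) => z.
    have -> : tr (QT T) (fun z => q z * r z.2) z = theta k z * tr (QT T) (fun z => p z * r z.2) z.
      by rewrite /tr qp; ring.
    by rewrite normrM ler_piMl.
  have [La _ La'] := c_Wd; have [Lb _ Lb'] := Wt.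
  apply: lerD; first by apply: H => // z; ring.
  by apply: ler_sum => i _; apply: H => // z; rewrite tD; ring.
have := ell_bd HL eps0 Wt ok => h.
have {}h : `|ell (fun z => w z * (theta k z * c z))| <= eps * CL T alpha Lam + eps^-1 * Nc.
  by apply: le_trans h _; rewrite lerD2l ler_pM2l// invr_gt0.
have DE z : 'D_dirt zeta z * w z ^+ 2 = 'D_dirt (theta k) z * C0 z.
  have cD : 'D_dirt (fun z => c z * pw b z) z = 0.
    by rewrite (derive_mul _ _ c_smooth (pw_smooth b)) pw_Dt c_D !chi_Dt subrr !mulr0 addr0.
  have Dz : 'D_dirt zeta z = c z * pw b z * 'D_dirt (theta k) z.
    by rewrite (derive_mul _ _ st sc) cD mulr0 add0r.
  rewrite /C0; have [Qz|nQ] := pselect (QT T z); first by rewrite trE// Dz; ring.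
  rewrite tr_out// mulr0.
  have cB0 : compact (cbox (m0, const_mx (- m.+1%:R)) (T - m0, const_mx m.+1%:R) : set E) by exact: compact_cbox.
  rewrite (Dzeta0 cB0 z0) ?mul0r// => -[/andP[/= h1 h2] _]; apply: nQ.
  by apply/QTP; apply/andP; split; lra.
have {}E1 : ell (fun z => w z * (theta k z * c z)) = 2^-1 * \int[mQ]_z ('D_dirt (theta k) z * C0 z).
  by rewrite E1; congr (_ * _); apply: eq_Rintegral => z _; exact: DE.
have iC := C0_int1.
pose g1 (z : E) := gz 2 (s * z.1 + (- (s * (T / 2)) + T / 4)) * gz 0 (k.+1%:R * (s * (t0 - z.1)) - 1).
have mgz j p q : measurable_fun setT (fun z : E => gz j (p * z.1 + q)).
  apply: cts_measurable_E; apply: smooth_cts; apply: smooth_gz; exact: affine_smooth.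
have mg1 : measurable_fun setT g1.
  apply: measurable_funM; first exact: mgz.
  have := mgz 0%N (- (s * k.+1%:R)) (s * k.+1%:R * t0 - 1); congr (measurable_fun _ _).
  by apply/funext => z; congr (gz 0 _); ring.
have g1b z : `|g1 z| <= 2.
  rewrite normrM -[leRHS]mulr1; apply: ler_pM => //; last exact: norm_gz0.
  by rewrite ger0_norm ?gz_ge0//; exact: gz_le.
have i1 := int1_bounded iC mg1 g1b.
have mk : measurable_fun setT (fun z : E => ker s t0 k z.1).
  by apply: measurableT_comp => //; apply: continuous_measurable_fun; exact: ker_cts.
have mA : measurable_fun setT (fun z : E => A z.1) by exact: mgz.
have i2 : int1 (fun z => ker s t0 k z.1 * (A z.1 * C0 z)).
  apply: (int1_bounded (C := k.+1%:R * 2) _ mk).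
    by apply: (int1_bounded (C := 1) iC mA) => z; exact: norm_gz0.
  by move=> z; rewrite ger0_norm ?ker_ge0// ler_wpM2l//; exact: gz_le.
have split1 : \int[mQ]_z ('D_dirt (theta k) z * C0 z) =
    s * (\int[mQ]_z (g1 z * C0 z) - \int[mQ]_z (ker s t0 k z.1 * (A z.1 * C0 z))).
  rewrite -(RintB i1 i2) -(RintZ s (int1B i1 i2)); apply: eq_Rintegral => z _.
  by rewrite theta_Dt /g1; ring.
have key : \int[mQ]_z (ker s t0 k z.1 * (A z.1 * C0 z)) =
    - 2 * s * ell (fun z => w z * (theta k z * c z)) + \int[mQ]_z (g1 z * C0 z).
  rewrite E1 split1; set I1 := \int[mQ]_z _; set I2 := \int[mQ]_z _.
  have -> : - 2 * s * (2^-1 * (s * (I2 - I1))) = - (s * s) * (I2 - I1) by field.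
  by rewrite s2; ring.
rewrite key; apply: lerD.
  apply: le_trans (ler_norm _) _; rewrite normrM normrM normrN (ger0_norm (ler0n _ 2)).
  have -> : `|s| = 1 by case: ss => -[-> _]; rewrite ?normrN normr1.
  by rewrite mulr1 ler_wpM2l.
rewrite -(RintZ 2 iC); apply: le_Rint => //; first exact: int1Z.
by move=> z; apply: ler_wpM2r; [exact: C0_ge0|exact: le_trans (ler_norm _) (g1b z)].
Qed.

End time.
End cutoff.

Variable ub : R -> 'rV[R]_d -> R.
Hypothesis us : slice_version T u ub.
Hypothesis uC : forall K, compact K -> L2continuous T K (cst 1) ub.

Let wb t x := 0 - ub t x.

Let ws : {ae m1, forall t, t \in `[0, T] -> {ae ld, forall x, w (t, x) = wb t x}}.
Proof.
by apply: filterS us => t h tT; apply: filterS (h tT) => x; rewrite /w /wb => ->.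
Qed.

Let Lcont_wb n : Lcont T (rK alpha n) wb.
Proof. by apply: LcontN; exact: (Lcont_loc alpha_ge0 n uC). Qed.

Let ch n (x : 'rV[R]_d) : R := chi n ((0, x) : E).

Let mch n : measurable_fun setT (ch n).
Proof.
have [sc _] := smooth_slice_x 0 (@chi_smooth R d n).
exact: cts_measurable_rV (smooth_cts sc).
Qed.

Lemma trace_cutoff m n t eps : (n <= m)%N -> t \in `[0, T] -> 0 < eps ->
  gz 0 (T / 4) * Wb alpha wb (fun x => ch m x - ch n x) m t <=
  2 * (eps * CL T alpha Lam + eps^-1 * NWa (fun z => w z * (chi m z - chi n z))
     (fun i z => w' i z * (chi m z - chi n z) + w z * 'D_(dirx i) (fun z => chi m z - chi n z) z))
  + 2 * \int[mQ]_z (tr (QT T) (fun z => (chi m z - chi n z) * pw b z * w z ^+ 2) z).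
Proof.
move=> nm tT eps0; have tT' := tT; rewrite in_itv /= in tT'; move/andP: tT' => [t0 t1].
have [s ss] : exists s : R, s = 1 /\ T / 2 <= t <= T \/ s = -1 /\ 0 <= t <= T / 2.
  have [h|h] := leP (T / 2) t; [exists 1; left|exists (-1); right]; split => //; apply/andP; split => //.
  exact: ltW.
have s2 : s * s = 1 by case: ss => -[-> _]; ring.
pose A t : R := gz 0 (s * t + (- (s * (T / 2)) + T / 4)).
have cA : continuous A.
  apply: smooth_cts; apply: smooth_gz.
  have sid : smooth (fun t : R => t).
    have [h _] := smooth_slice_t (0 : 'rV[R]_d) (@fst_smooth R d); exact: h.
  exact: smooth_add (smooth_mul (smooth_cst s) sid) (smooth_cst _).
have W0 : 0 <= Wb alpha wb (fun x => ch m x - ch n x) m t.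
  by apply: Rintegral_ge0 => x _; rewrite mulr_ge0 ?sqr_ge0// /ch subr_ge0 chi_le.
apply: (@le_trans _ _ (A t * Wb alpha wb (fun x => ch m x - ch n x) m t)).
  apply: ler_wpM2r => //; apply: gz0_homo.
  by case: ss => -[-> /andP[h1 h2]]; lra.
have lim : \int[mQ]_z (ker s t k z.1 * (A z.1 * tr (QT T) (fun z => (chi m z - chi n z) * pw b z * w z ^+ 2) z))
    @[k --> \oo] --> A t * Wb alpha wb (fun x => ch m x - ch n x) m t.
  apply: (ker_slices T_gt0 ws (A := A) (p := fun z => (chi m z - chi n z) * pw b z)) => //.
  - by move=> t'; exact: norm_gz0.
  - by have T0 := T_gt0; case: ss => -[-> /andP[h1 h2]]; lra.
  - by apply: measurable_funB; exact: mch.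
  - by move=> x; apply: c_norm.
  - move=> x nK; apply: (c_xsupp nm); rewrite /= ltNge; apply/negP; exact: nK.
  - move=> z; rewrite -expr2 varrho_sqr; congr (_ * _).
  - exact: C0_int1.
rewrite -subr_ge0.
set K := (X in X - _).
have lim2 : K - \int[mQ]_z (ker s t k z.1 * (A z.1 * tr (QT T) (fun z => (chi m z - chi n z) * pw b z * w z ^+ 2) z))
    @[k --> \oo] --> K - A t * Wb alpha wb (fun x => ch m x - ch n x) m t.
  by apply: cvgB lim; exact: cvg_cst.
by apply: (lim_ge0 lim2) => k; rewrite subr_ge0; exact: trace_bound.
Qed.

(** Let [k] tend to infinity in [trace_bound]. The bound does not depend on the
    time; choose first [eps] small, then [n] large, as [w * chi n] tends to [w] in
    the energy space. *)
Lemma trace_tail eta : 0 < eta -> exists n0, forall m n t, (n0 <= n)%N -> (n <= m)%N -> t \in `[0, T] ->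
  Wb alpha wb (fun x => ch m x - ch n x) m t <= eta.
Proof.
move=> eta0; set a := gz 0 (T / 4).
have a0 : 0 < a by apply: gz0_gt0; rewrite divr_gt0.
have C0 := CL_ge0 T alpha Lam.
pose eps := a * eta / (8 * (CL T alpha Lam + 1)).
have ae0 : 0 < a * eta by exact: mulr_gt0.
have eps0 : 0 < eps by rewrite divr_gt0// mulr_gt0// ltr_wpDl.
have c1 (z : E) m : `|chi m z| <= 1 by rewrite ger0_norm ?chi_ge0// chi_le1.
have D1 v (z : E) : 'D_v (cst 1 : E -> R) z = 0 by exact: derive_cst.
have Wn n : W01a (fun z => w z * chi n z) (fun i z => w' i z * chi n z + w z * 'D_(dirx i) (chi n) z).
  apply: (W01d_mul (C := 3) Ww (chi_smooth n)); first by move=> z; apply: le_trans (c1 z n) _; rewrite ler1n.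
  by move=> i z; exact: chi_Dx_bd.
have W1' : W01a (fun z => w z * cst 1 z) (fun i z => w' i z * cst 1 z + w z * 'D_(dirx i) (cst 1 : E -> R) z).
  apply: (W01d_mul (C := 3) Ww (smooth_cst 1)); first by move=> z; rewrite normr1 ler1n.
  by move=> i z; rewrite D1 normr0.
have WB k : W01a (fun z => w z * chi k z - w z * cst 1 z) (fun i z => w' i z * chi k z + w z * 'D_(dirx i) (chi k) z
    - (w' i z * cst 1 z + w z * 'D_(dirx i) (cst 1 : E -> R) z)).
  have := W01d_lin (-1) W1' (Wn k).
  by congr (W01d _ _ _ _); [apply/funext => z|apply/funext => i; apply/funext => z]; ring.
pose NN k := NWa (fun z => w z * chi k z - w z * cst 1 z) (fun i z => w' i z * chi k z + w z * 'D_(dirx i) (chi k) z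
    - (w' i z * cst 1 z + w z * 'D_(dirx i) (cst 1 : E -> R) z)).
have cN : NN k @[k --> \oo] --> (0 : R).
  apply: (NW_mul_cvg Ww (C := 3)).
  - by move=> k; exact: chi_smooth.
  - exact: smooth_cst.
  - by move=> k z; apply: le_trans (c1 z k) _; rewrite ler1n.
  - by move=> z; rewrite normr1 ler1n.
  - by move=> k i z; exact: chi_Dx_bd.
  - by move=> i z; rewrite D1 normr0.
  - by move=> z _; exact: chi_cvg.
  - by move=> i z _; rewrite D1; exact: chi_Dx_cvg.
have [Lw _ _] := Ww.
pose G := tr (QT T) (fun z => cst 1 z * (w z * r z.2 * (w z * r z.2))).
have iG : int1 G.
  by apply: (rho_int1 Lw Lw (C := 1)) => // z; rewrite normr1.
have iGn n : int1 (fun z => chi n z * G z) by apply: (int1_bounded (C := 1) iG (measurable_chi n)) => z.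
have cG : \int[mQ]_z (chi n z * G z) @[n --> \oo] --> \int[mQ]_z G z.
  apply: (Rint_dominated (G := fun z => `|G z|) _ _ _ _ _).2.
  + by move=> n; exact: int1_measurable (iGn n).
  + exact: int1_measurable iG.
  + exact: int1_norm.
  + by move=> n z; rewrite normrM ler_piMl.
  + apply: nearW => z; rewrite -[X in _ --> X]mul1r.
    by apply: cvgM; [exact: chi_cvg|exact: cvg_cst].
have G0 z : 0 <= G z.
  by rewrite /G /tr mul1r -expr2 mulr_ge0 ?sqr_ge0.
have HN : \forall n \near \oo, NN n < eps * (a * eta / 32).
  by apply: (cvgr_lt _ cN); rewrite mulr_gt0// divr_gt0.
have HG : \forall n \near \oo, \int[mQ]_z G z - a * eta / 8 < \int[mQ]_z (chi n z * G z).
  by apply: (cvgr_gt _ cG); rewrite ltrBlDr ltrDl divr_gt0.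
have [n0 _ H0] := filterI HN HG.
exists n0 => m n t n0n nm tT.
have [hn gn] := H0 n n0n; have [hm gm] := H0 m (leq_trans n0n nm).
rewrite -(ler_pM2l a0); apply: le_trans (trace_cutoff nm tT eps0) _.
set N1 := NWa _ _; set I1 := \int[mQ]_z _.
have N1b : N1 <= 2 * NN m + 2 * NN n.
  apply: le_trans (NW_B (WB m) (WB n)); rewrite le_eqVlt; apply/orP; left; apply/eqP.
  congr (NW _ _ _ _); first by apply/funext => z; ring.
  by apply/funext => i; apply/funext => z; rewrite c_D; ring.
have I1b : I1 <= a * eta / 8.
  have -> : I1 = \int[mQ]_z (chi m z * G z) - \int[mQ]_z (chi n z * G z).
    rewrite -(RintB (iGn m) (iGn n)); apply: eq_Rintegral => z _.
    by rewrite /G /tr mul1r -varrho_sqr; ring.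
  have : \int[mQ]_z (chi m z * G z) <= \int[mQ]_z G z.
    by apply: le_Rint => // z; rewrite ler_piMl ?chi_le1.
  by move=> h; rewrite lerBlDr; apply: le_trans h _; rewrite -lerBlDl ltW.
have e1 : eps * CL T alpha Lam <= a * eta / 8.
  have -> : eps * CL T alpha Lam = a * eta / 8 * (CL T alpha Lam / (CL T alpha Lam + 1)).
    by rewrite /eps; field; rewrite gt_eqF// ltr_wpDl.
  by rewrite ler_piMr ?divr_ge0 ?(ltW ae0)// ler_pdivrMr ?mul1r ?lerDl// ltr_wpDl.
have e2 : eps^-1 * N1 <= a * eta / 8.
  rewrite mulrC ler_pdivrMr// mulrC; apply: le_trans N1b _.
  have -> : eps * (a * eta / 8) = 4 * (eps * (a * eta / 32)) by field.
  exact: arith2 (ltW hm) (ltW hn).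
exact: arith3 (ltW ae0) e1 e2 I1b.
Qed.

Let G t x := (wb t x * r x) ^+ 2.

Let ch_out n (x : 'rV[R]_d) : ~ Kball n x -> ch n x = 0.
Proof. by move=> nK; apply: chi_xsupp; rewrite /= ltNge; apply/negP. Qed.

Let chK n m (p : 'rV[R]_d -> R) x : (n <= m)%N -> ch n x * (p x * rK alpha m x) ^+ 2 = ch n x * (p x * r x) ^+ 2.
Proof.
move=> nm; have [Kx|nK] := pselect (Kball n x); last by rewrite ch_out// !mul0r.
rewrite /rK indicE mem_set ?mulr1//; apply: le_trans Kx _.
by rewrite ler_nat ltnS.
Qed.

Let ch01 n (x : 'rV[R]_d) : 0 <= ch n x <= 1. Proof. by rewrite chi_ge0 chi_le1. Qed.

Let ich n t : t \in `[0, T] -> ld.-integrable setT (EFin \o (fun x => ch n x * G t x)).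
Proof.
move=> tT; have [Lt _] := Lcont_wb n tT.
have := int1_bounded (sqr_integrable Lt) (mch n) (fun x => (ltac:(by case/andP: (ch01 n x) => h0 h1; rewrite ger0_norm) : `|ch n x| <= 1)).
by congr (_.-integrable _ (_ \o _)); apply/funext => x; rewrite chK.
Qed.

Let mwb t : t \in `[0, T] -> measurable_fun setT (fun x => wb t x * r x).
Proof.
move=> tT; apply: (@measurable_fun_cvg _ _ _ setT (fun n x => wb t x * rK alpha n x)).
  by move=> n; have [[+ _] _] := Lcont_wb n tT.
move=> x _; have [n0 xn] := truncn_gt_norm `|x|.
apply: cvg_near_cst; near=> n; rewrite /rK indicE mem_set ?mulr1//.
apply: le_trans (ltW xn) _; rewrite ler_nat; apply: leq_trans (leqnSn n); near: n; exact: nbhs_infty_ge.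
Unshelve. all: by end_near. Qed.

(** [trace_tail] as [m] tends to infinity; that the slice is square integrable at
    every time is part of the conclusion. *)
Lemma trace_tail_int eta : 0 < eta -> exists n, forall t, t \in `[0, T] ->
  L2 ld setT (fun x => wb t x * r x) /\
  \int[ld]_x G t x - \int[ld]_x (ch n x * G t x) <= eta.
Proof.
move=> eta0; have [n hn] := trace_tail eta0; exists n => t tT.
have mG : measurable_fun setT (G t) by apply: measurable_funX; exact: mwb.
have H : ((- (\int[ld]_x (ch n x * G t x)))%R%:E + \int[ld]_x (G t x)%:E <= eta%:E)%E.
  apply: (@cutoff_limit _ _ _ _ _ ch (fun=> - (\int[ld]_x (ch n x * G t x)))) => //.
  - by move=> x i j ij; exact: chi_le.
  - by move=> x; exact: chi_cvg.
  - by move=> k; exact: ich.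
  - exact: cvg_cst.
  - move=> k; rewrite addrC; have [nk|kn] := leqP n k.
      apply: le_trans (hn k n t (leqnn _) nk tT).
      rewrite -(RintB (ich k tT) (ich n tT)) le_eqVlt; apply/orP; left; apply/eqP.
      apply: eq_Rintegral => x _; rewrite mulrBl chK// chK//.
    apply: le_trans (ltW eta0); rewrite subr_le0; apply: le_Rint; [exact: ich|exact: ich|].
    by move=> x; apply: ler_wpM2r; [exact: sqr_ge0|apply: chi_le; exact: ltnW].
have LG : L2 ld setT (fun x => wb t x * r x).
  split; first exact: mwb.
  have -> : (fun x => ((wb t x * r x) ^+ 2)%:E) = (fun x => (G t x)%:E) by [].
  rewrite ltey; apply/negP => /eqP GE; move: H.
  by rewrite GE addey// leye_eq.
split => //; move: H; rewrite (_ : \int[ld]_x (G t x)%:E = (\int[ld]_x G t x)%:E)%E; last exact: L2_N2E.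
by rewrite -EFinD lee_fin addrC.
Qed.

(** Continuity on balls is known for [u], and the tails are small uniformly in
    time. *)
Lemma trace_continuous : L2continuous T setT r ub.
Proof.
apply: Lcont_L2continuous.
have -> : ub = (fun t x => 0 - wb t x) by apply/funext => t; apply/funext => x; rewrite /wb; ring.
apply: LcontN => t tT.
have [n1 h1] := trace_tail_int ltr01; have [Lt _] := h1 t tT.
split => // e e0.
have e8 : 0 < e / 8 by rewrite divr_gt0.
have [n hn] := trace_tail_int e8.
have e2 : 0 < e / 2 by rewrite divr_gt0.
have [_ H] := Lcont_wb n tT; have [del d0 hd] := H _ e2.
exists del => // s sT st.
have [Ls is'] := hn s sT; have [_ it'] := hn t tT.
have hs := hd s sT st.
have [Lsn _] := Lcont_wb n sT; have [Ltn _] := Lcont_wb n tT.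
have Ld : L2 ld setT (fun x => (wb s x - wb t x) * rK alpha n x).
  by have := L2B Lsn Ltn; congr (L2 _ _ _); apply/funext => x; ring.
have LD : L2 ld setT (fun x => (wb s x - wb t x) * r x).
  by have := L2B Ls Lt; congr (L2 _ _ _); apply/funext => x; ring.
have iGs := sqr_integrable Ls; have iGt := sqr_integrable Lt.
have ib1 := int1Z 2 (int1B iGs (ich n sT)); have ib2 := int1Z 2 (int1B iGt (ich n tT)).
have ib := int1D (sqr_integrable Ld) (int1D ib1 ib2).
have : N2 ld (fun x => (wb s x - wb t x) * r x) <=
   \int[ld]_x (((wb s x - wb t x) * rK alpha n x) ^+ 2 + (2 * (G s x - ch n x * G s x) + 2 * (G t x - ch n x * G t x))).
  apply: le_Rint => //; first exact: sqr_integrable.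
  move=> x; have /andP[c0 c1] := ch01 n x.
  set D := (wb s x - wb t x) * r x.
  have -> : D ^+ 2 = ch n x * D ^+ 2 + (1 - ch n x) * D ^+ 2 by ring.
  apply: lerD.
    rewrite -(chK (fun x => wb s x - wb t x) x (leqnn n)).
    by rewrite ler_piMl ?sqr_ge0.
  have DD : D ^+ 2 <= 2 * G s x + 2 * G t x.
    have -> : D = wb s x * r x + - (wb t x * r x) by rewrite /D; ring.
    by have := sqrD_le (wb s x * r x) (- (wb t x * r x)); rewrite sqrrN.
  have -> : 2 * (G s x - ch n x * G s x) + 2 * (G t x - ch n x * G t x) = (1 - ch n x) * (2 * G s x + 2 * G t x) by ring.
  by apply: ler_wpM2l => //; rewrite subr_ge0.
move=> h; apply: le_trans h _.
rewrite (RintD (sqr_integrable Ld) (int1D ib1 ib2)) (RintD ib1 ib2).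
rewrite (RintZ 2 (int1B iGs (ich n sT))) (RintZ 2 (int1B iGt (ich n tT))).
rewrite (RintB iGs (ich n sT)) (RintB iGt (ich n tT)).
exact: arith4 hs is' it'.
Qed.

End trace.

(** * Weak and strong solutions of the obstacle problem *)

Section assembly.
Context {R : realType} {d : nat}.
Local Notation E := (R * 'rV[R]_d)%type.
Local Notation mQ := (@lebQ R d).

Lemma L2loc_measurable T (p : E -> R) : L2loc_QT T p -> measurable_fun (QT T) p.
Proof.
move=> Lp; pose D n : set E := cbox (0, const_mx (- n%:R)) (T, const_mx n%:R).
have cD n : compact (D n) by exact: compact_cbox.
have DQ n : D n `<=` QT T by move=> z [h _]; apply/QTP.
have -> : QT T = \bigcup_n D n.
  apply/seteqP; split => [z Qz|z [n _]]; last exact: DQ.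
  have [n zn] := truncn_gt_norm `|z.2|; exists n => //; split; first exact/QTP.
  by move=> i; rewrite !mxE -ler_norml; apply: le_trans (rV_coord_le _ _) (ltW zn).
apply/measurable_fun_bigcup => n; first exact: (compact_measurable_E (cD n)).
by case: (Lp _ (cD n) (@DQ n)).
Qed.

Lemma A_pairing_sum T alpha (a : E -> 'M[R]_d) (u v : E -> R) : W01 T (varrho alpha) u -> W01 T (varrho alpha) v ->
  (forall i, L2rho_QT T (varrho alpha) (fun z => (grad T u z *m (a z)^T) 0 i)) ->
  A_pairing T a (varrho alpha) u (v \- u) = - (2^-1 * \sum_i \int[mQ]_(z in QT T)
    ((grad T u z *m (a z)^T) 0 i * wderiv T (dirx i) (fun z => (v z - u z) * varrho alpha z.2 ^+ 2) z)).
Proof.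
move=> Wu Wv LP; rewrite /A_pairing mulNr; congr (- (_ * _)).
have H i := (G2_lim Wu LP Wv i).2.
rewrite Rint_tr.
under [in RHS]eq_bigr do rewrite Rint_tr.
rewrite -(Rint_sum H); apply: eq_Rintegral => z _.
rewrite /tr /dot mulr_suml; apply: eq_bigr => i _.
by congr (_ * _ * _); rewrite /grad mxE.
Qed.

End assembly.

Theorem proposition2p10 (R : realType) (d : nat) (d_ge1 : (1 <= d)%N)
  (T : R) (T_gt0 : 0 < T)
  (lambda Lambda : R) (lambda_gt0 : 0 < lambda) (le_lL : lambda <= Lambda)
  (a sigma : R * 'rV[R]_d -> 'M[R]_d)
  (ma : measurable_fun (QT T) a)
  (a_sym : forall z, QT T z -> (a z)^T = a z)
  (a_elliptic : forall z (xi : 'rV[R]_d), QT T z ->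
     lambda * enorm xi ^+ 2 <= \sum_i \sum_j a z i j * xi 0 i * xi 0 j
       <= Lambda * enorm xi ^+ 2)
  (msigma : measurable_fun (QT T) sigma)
  (sigmaE : forall z, QT T z -> sigma z *m (sigma z)^T = a z)
  (alpha : R) (alpha_ge0 : 0 <= alpha)
  (phi : 'rV[R]_d -> R) (phi_L2loc : L2loc_Rd phi)
  (h : R * 'rV[R]_d -> R) (h_L2loc : L2loc_QT T h)
  (h_cont : {within QT T, continuous h})
  (phi_ge_h : forall x, h (T, x) <= phi x)
  (f : R * 'rV[R]_d -> R -> 'rV[R]_d -> R)
  (mf : measurable_fun (QT T `*` setT `*` setT)
          (fun p : (R * 'rV[R]_d) * R * 'rV[R]_d => f p.1.1 p.1.2 p.2))
  (L M : R) (L_gt0 : 0 < L) (M_gt0 : 0 < M)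
  (g : R * 'rV[R]_d -> R) (g_L2loc : L2loc_QT T g)
  (f_lip : forall z y1 y2 z1 z2, QT T z ->
     `|f z y1 z1 - f z y2 z2| <= L * (`|y1 - y2| + enorm (z1 - z2)))
  (f_growth : forall z y z1, QT T z ->
     `|f z y z1| <= g z + M * (`|y| + enorm z1))
  (u : R * 'rV[R]_d -> R) (mu : {measure set (R * 'rV[R]_d) -> \bar R}) :
  OP_solution T a sigma phi f h u mu ->
  W01 T (varrho alpha) u ->
  {within oQT T, continuous u} ->
  weak_variational T a sigma phi f h (varrho alpha) u /\
  (calW T (varrho alpha) u ->
   strong_variational T a sigma phi f h (varrho alpha) u).
Proof.
move=> [radon_mu mu_ _ [ub [[us uC] OPeq]] uh mu_min slices] Wu cu.
have [_ Lu _ Du] := W01_facts Wu.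
have gradm i : measurable_fun (QT T) (wderiv T (dirx i) u) by case: (Du i) => -[].
have a_upper z (xi : 'rV[R]_d) : QT T z ->
    \sum_i \sum_j a z i j * xi 0 i * xi 0 j <= Lambda * enorm xi ^+ 2.
  by move=> Qz; case/andP: (a_elliptic z xi Qz).
pose P z := grad T u z *m (a z)^T; pose F := fu T sigma f u.
have LP i : L2rho_QT T (varrho alpha) (fun z => P z 0 i).
  apply: (flux_L2 ma a_upper sigmaE i (@measurable_QT R d T)) => // j.
  by case: (Du j).
have mh := L2loc_measurable h_L2loc.
have mF : measurable_fun (QT T) F by exact: fu_measurable.
have LF : L2loc_QT T F.
  move=> K cK KQ.
  apply: (fu_L2 a_upper msigma sigmaE gradm M_gt0 mf f_growth mu_ (compact_measurable_E cK) KQ).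
  - exact: g_L2loc.
  - exact: Lu.
  - by move=> i; case: (Du i) => _ _; apply.
have EQ : tested_equation T u F P mu.
  move=> B eta cB BQ; apply: (OP_compact T_gt0 OPeq cB BQ) => i.
  by have [_] := rho_L2 (LP i); apply => // z /BQ /oQT_QT.
have uphi : {ae leb d, forall x, ub T x = phi x}.
  apply: (OP_final T_gt0 OPeq) => //; apply: slices.
  by rewrite in_itv /= lexx ltW.
split.
  split => // v vb Wv vh vC.
  have [Wv0 _ _] := Wv.
  have := weak_inequality T_gt0 alpha_ge0 Wu cu h_cont mh uh radon_mu mu_min LP mF LF EQ us uC uphi Wv vh vC.
  by rewrite EFinB (A_pairing_sum Wu Wv0 LP) EFinN.
move=> cW; have [_ [Lam HL]] := cW; split => //.
  exists ub; split => //; split => //.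
  exact: (trace_continuous T_gt0 alpha_ge0 Wu HL us uC).
move=> {}Lam v {}HL Wv vh.
have := strong_inequality alpha_ge0 Wu HL cu h_cont mh uh radon_mu mu_min LP mF LF EQ Wv vh.
by rewrite EFinB (A_pairing_sum Wu Wv LP) EFinN.
Qed.
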